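(* Let $X$ be a Polish space with Borel probability measure $\mu$. (a) Every Borel graph on $X$ all of whose vertices have (finite) even degree and that admits a connected toast also admits a Borel balanced orientation. (b) For every one-ended Borel graph $G$ on $X$ all of whose vertices have (finite) even degree, there is a $G$-invariant comeagre Borel set $X'\subseteq X$ such that $G|_{X'}$ admits a Borel balanced orientation. (c) Let $\Gamma$ be a finitely generated amenable group of superlinear growth with finite generating set $S$, acting freely and in a Borel way on $X$, and let $G$ be the Schreier graph of the action with respect to $S$, with all degrees even. Then there is a $G$-invariant $\mu$-conull Borel set $X'\subseteq X$ such that $G|_{X'}$ admits a Borel balanced orientation. (d) Let $\Gamma$ be a finitely generated group of polynomial growth and superlinear growth with finite generating set $S$, acting freely and in a Borel way on $X$, and let $G$ be the Schreier graph of the action with respect to $S$, with all degrees even. Then $G$ admits a Borel balanced orientation.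
   Context: A Borel graph $G$ on a Polish space $X$ is a (simple, undirected) graph with vertex set $X$ whose edge set is a Borel subset of $X^2$. A connected graph is one-ended if for every finite set $F$ of vertices the induced subgraph on the complement of $F$ has exactly one infinite connected component; a non-connected graph is one-ended if each of its connected components is. A set is $G$-invariant if it is a union of connected components of $G$. A Borel balanced orientation is a Borel orientation of the edges of the graph such that the in-degree of each vertex equals its out-degree. In the Schreier graph of an action with respect to $S$, vertices $x\neq y$ are adjacent iff $y=s\cdot x$ or $x=s\cdot y$ for some $s\in S$. Toasts. $X^{<\omega}$ is the (standard Borel) space of finite subsets of $X$. For $K\subseteq X$, $E(K)$ is the set of edges of the subgraph induced on $K$, and $B_1(K)$ is the set of vertices at graph distance at most $1$ from $K$. A Borel collection $\mathcal{T}\subset X^{<\omega}$ is a toast for $G$ if (T1) $\bigcup_{K\in\mathcal{T}}E(K)=E(G)$, and (T2) for every pair of distinct $K,L\in\mathcal{T}$, either $B_1(K)\cap L=\emptyset$, or $B_1(K)\subseteq L$, or $B_1(L)\subseteq K$. The toast is connected if (T3) for every $K\in\mathcal{T}$ the induced subgraph on $K\setminus\bigcup_{K\supsetneq L\in\mathcal{T}}L$ is connected. $G$ admits a connected toast if such a $\mathcal{T}$ exists. *)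

(* Defs.v *)
From HB Require Import structures.
From Stdlib Require Import Relation_Operators.
From mathcomp Require Import all_boot all_order all_algebra finmap.
From mathcomp Require Import all_classical all_reals all_analysis.

Set Implicit Arguments.
Unset Strict Implicit.
Unset Printing Implicit Defensive.

Import Order.TTheory GRing.Theory Num.Theory.

Local Open Scope classical_set_scope.
Local Open Scope ring_scope.
Local Open Scope card_scope.

(** * Polish spaces, Borel sets, Baire category *)

Definition is_metric (R : realType) (X : Type) (d : X -> X -> R) : Prop :=
  [/\ forall x y, 0 <= d x y,
      forall x y, d x y = 0 <-> x = y,
      forall x y, d x y = d y x
    & forall x y z, d x z <= d x y + d y z].

Definition metrizes (R : realType) (X : topologicalType) (d : X -> X -> R) :
    Prop :=
  forall (x : X) (A : set X),
    nbhs x A <-> exists2 e : R, 0 < e & [set y | d x y < e] `<=` A.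

Definition metric_complete (R : realType) (X : topologicalType)
    (d : X -> X -> R) : Prop :=
  forall u : nat -> X,
    (forall e : R, 0 < e ->
       exists N : nat, forall m n, (N <= m)%N -> (N <= n)%N ->
         d (u m) (u n) < e) ->
    exists l : X, u @ \oo --> l.

Definition polish (R : realType) (X : topologicalType) : Prop :=
  (exists2 D : set X, countable D & dense D) /\
  (exists d : X -> X -> R, [/\ is_metric d, metrizes d & metric_complete d]).

Definition borel (T : topologicalType) : set (set T) := <<s @open T >>.

Definition nowhere_dense (X : topologicalType) (A : set X) : Prop :=
  interior (closure A) = set0.

Definition meagre (X : topologicalType) (A : set X) : Prop :=
  exists2 F : nat -> set X, (forall n, nowhere_dense (F n)) & A = \bigcup_n F n.

Definition comeagre (X : topologicalType) (A : set X) : Prop := meagre (~` A).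

(** * Graphs

    A graph with vertex set [X] is given by its edge set [E], seen as a set of
    ordered pairs. *)

Definition simple_graph (X : Type) (E : set (X * X)) : Prop :=
  (forall x y, E (x, y) -> E (y, x)) /\ (forall x, ~ E (x, x)).

Definition borel_graph (X : topologicalType) (E : set (X * X)) : Prop :=
  simple_graph E /\ borel E.

Definition nbrs (X : Type) (E : set (X * X)) (x : X) : set X :=
  [set y | E (x, y)].

Definition even_degrees (X : Type) (E : set (X * X)) : Prop :=
  forall x, exists n : nat, nbrs E x #= `I_(n.*2).

(* The subgraph induced on [A], also used as a graph on the whole of [X] in
   which the points outside [A] are isolated. *)
Definition induced_graph (X : Type) (E : set (X * X)) (A : set X) : set (X * X) :=
  E `&` (A `*` A).

Definition reachable (X : Type) (E : set (X * X)) : X -> X -> Prop :=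
  clos_refl_trans X (fun x y => E (x, y)).

Definition component (X : Type) (E : set (X * X)) (x : X) : set X :=
  [set y | reachable E x y].

(* The empty graph counts as connected. *)
Definition connected_on (X : Type) (E : set (X * X)) (A : set X) : Prop :=
  forall x y, A x -> A y -> reachable (induced_graph E A) x y.

Definition component_of_induced (X : Type) (E : set (X * X)) (A D : set X) :
    Prop :=
  exists2 x, A x & D = component (induced_graph E A) x.

Definition one_ended_on (X : Type) (E : set (X * X)) (C : set X) : Prop :=
  forall F : set X, F `<=` C -> finite_set F ->
    exists! D : set X, component_of_induced E (C `\` F) D /\ infinite_set D.

Definition one_ended (X : Type) (E : set (X * X)) : Prop :=
  forall x, one_ended_on E (component E x).

Definition graph_invariant (X : Type) (E : set (X * X)) (A : set X) : Prop :=
  exists I : set X, A = \bigcup_(x in I) component E x.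

(** * Balanced orientations

    [O (x, y)] means that the edge between [x] and [y] is directed from [x] to
    [y]. *)

Definition orientation (X : Type) (E O : set (X * X)) : Prop :=
  O `<=` E /\
  forall x y, E (x, y) -> (O (x, y) /\ ~ O (y, x)) \/ (O (y, x) /\ ~ O (x, y)).

Definition balanced (X : Type) (O : set (X * X)) : Prop :=
  forall x, [set y | O (y, x)] #= [set y | O (x, y)].

Definition admits_borel_balanced_orientation (X : topologicalType)
    (E : set (X * X)) : Prop :=
  exists O : set (X * X), [/\ borel O, orientation E O & balanced O].

(** * Toasts *)

(* The Borel sets of the space of finite subsets of [X]: those of the Vietoris
   topology, which are generated by the hit sets of the open sets. *)
Definition borel_finsub (X : topologicalType) : set (set {fset X}) :=
  <<s [set [set K : {fset X} | [set` K] `&` U !=set0] | U in @open X] >>.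

Definition B1 (X : Type) (E : set (X * X)) (A : set X) : set X :=
  A `|` [set y | exists2 x, A x & E (x, y)].

Definition toast (X : topologicalType) (E : set (X * X)) (T : set {fset X}) :
    Prop :=
  [/\ borel_finsub T,
      \bigcup_(K in T) induced_graph E [set` K] = E
    & forall K L : {fset X}, T K -> T L -> K <> L ->
        [\/ B1 E [set` K] `&` [set` L] = set0,
            B1 E [set` K] `<=` [set` L]
          | B1 E [set` L] `<=` [set` K]]].

Definition connected_toast (X : topologicalType) (E : set (X * X))
    (T : set {fset X}) : Prop :=
  toast E T /\
  forall K : {fset X}, T K ->
    connected_on E
      ([set` K] `\` \bigcup_(L in [set L | T L /\ (L `<` K)%fset]) [set` L]).

Definition admits_connected_toast (X : topologicalType) (E : set (X * X)) :
    Prop :=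
  exists T : set {fset X}, connected_toast E T.

(** * Groups and actions *)

(* The elements that are products of at most [n] elements of [S] and their
   inverses. *)
Fixpoint word_ball (G : groupType) (S : set G) (n : nat) : set G :=
  if n is m.+1 then
    word_ball S m `|`
    [set (s * g)%g | s in S `|` [set (t^-1)%g | t in S] & g in word_ball S m]
  else [set 1%g].

Definition generates (G : groupType) (S : set G) : Prop :=
  \bigcup_n word_ball S n = [set: G].

Definition polynomial_growth (G : groupType) (S : set G) : Prop :=
  exists C d : nat, forall n : nat, (0 < n)%N ->
    word_ball S n #<= `I_(C * n ^ d).

(* The growth function divided by [n] tends to infinity. *)
Definition superlinear_growth (G : groupType) (S : set G) : Prop :=
  forall C : nat, \forall n \near \oo, `I_(C * n) #<= word_ball S n.

(* Amenability of a discrete group: a left-invariant finitely additive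
   probability measure defined on all subsets. *)
Definition amenable (R : realType) (G : groupType) : Prop :=
  exists m : set G -> R,
    [/\ forall A, 0 <= m A,
        m [set: G] = 1,
        forall A B, A `&` B = set0 -> m (A `|` B) = m A + m B
      & forall (g : G) A, m [set (g * x)%g | x in A] = m A].

Definition is_action (G : groupType) (X : Type) (a : G -> X -> X) : Prop :=
  (forall x, a 1%g x = x) /\ (forall g h x, a (g * h)%g x = a g (a h x)).

Definition free_action (G : groupType) (X : Type) (a : G -> X -> X) : Prop :=
  forall g x, a g x = x -> g = 1%g.

(* For a countable discrete group this is Borel measurability of the action
   map on the product. *)
Definition borel_action (G : groupType) (X : topologicalType)
    (a : G -> X -> X) : Prop :=
  forall (g : G) (B : set X), borel B -> borel (a g @^-1` B).

Definition schreier_graph (G : groupType) (X : Type) (a : G -> X -> X)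
    (S : set G) : set (X * X) :=
  [set p | p.1 <> p.2 /\
     exists2 s, S s & p.2 = a s p.1 \/ p.1 = a s p.2].

(* Main.v *)
(* Call a set of edges a piece if it is Borel, every degree in it is even and its
   components are finite.  A component of a piece has Eulerian balanced
   orientations, one of which can be chosen in a Borel way by Lusin-Novikov
   uniformization, and the union of balanced orientations of disjoint pieces is
   balanced.  So it suffices to write the graph, or its restriction to a large
   invariant set, as a disjoint union of countably many pieces.

   The pieces are removed one after the other.  Given a Borel family of disjoint
   finite tiles, each with a core, the edges at the core are completed to an even
   subgraph of the tile by adding, modulo 2, paths avoiding the core: this works
   because each connected part of the tile outside the core receives an even
   number of edges.  Removing the piece isolates the core and keeps all degrees
   even.  What varies is the source of the tiles.

   (a) The members of a connected toast are the tiles, and the core of a member is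
   the union of the smaller ones.
   (b) By one-endedness every point lies in the core of a finite tile outside of
   which the rest of the component can still be joined, and this property is not
   lost when edges are removed.  At each stage a Borel family of disjoint tiles is
   chosen whose cores are non-meagre in the next translate of the next basic open
   set, so that almost every point, in the sense of category, is isolated at the end.
   (d) The annuli of a vertex-transitive graph of superlinear and subexponential
   growth are connected up to a bounded multiple of their width: otherwise three
   far apart ends would grow a binary tree, and two ends force linear growth.  At
   doubling scales boundedly many separated families of balls cover the space.
   (c) Almost invariant Følner sets with thin connected walls give Borel sets [Y m]
   of summably small measure which are connected along each orbit and whose
   complements have finite components.  By Borel-Cantelli almost every point
   is in [A n], the complement of the union of the [Y m] with [n <= m], for large [n].
   The components of [A n] are the cores and those of [A n'], for a sparse
   sequence of [n], the tiles. *)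
From HB Require Import structures.
From Stdlib Require Import Relation_Operators Operators_Properties.
Require Import Defs.
From mathcomp Require Import all_boot all_order all_algebra finmap.
From mathcomp Require Import all_classical all_reals all_analysis.
From mathcomp Require Import zify lra.

Set Implicit Arguments.
Unset Strict Implicit.
Unset Printing Implicit Defensive.

Import Order.TTheory GRing.Theory Num.Theory.

Local Open Scope classical_set_scope.
Local Open Scope nat_scope.

(** Points are coded by sequences of naturals, and uniformization is derived from one separation
    argument for closed sets of sequences. Afterwards a graph is handled through countably many
    Borel maps that enumerate each component, so that a condition on finite configurations becomes a
    countable combination of Borel conditions. The obstacle is that a removed piece may destroy the
    connectivity needed for the next one. In (a) and (c) the joining paths run where no edge has
    been removed yet. In (b) and (d) a tile must also allow detours: any two of its touched vertices
    that keep an edge remain joined inside the tile. As the tiles of one stage are disjoint, an old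
    path is replaced tile by tile by a surviving one that stays near it, in the tiles it meets. In
    (b) this preserves a form of one-endedness that speaks of non-isolated vertices only; in (d) it
    costs a displacement by the tile diameter, and each scale is therefore chosen after the
    displacement accumulated so far is known. What survives all stages is one more piece, even
    because degrees are finite. *)

Notation pickle := choice.pickle.
Notation unpickle := choice.unpickle.
Notation pickleK := choice.pickleK.

(** * Borel predicates *)

(* A wrapper, because [<<s G >>] unfolds to a product. *)
Variant Bor T (G : set (set T)) (P : T -> Prop) : Prop := MkBor of <<s G >> [set x | P x].

Lemma BorP T (G : set (set T)) (P : T -> Prop) : Bor G P <-> <<s G >> [set x | P x].
Proof. by split=> [[]|]. Qed.

Section BorTheory.
Variables (T : Type) (G : set (set T)).
Implicit Types P Q : T -> Prop.

Lemma Bor_gen (A : set T) : G A -> Bor G A.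
Proof. by move=> GA; split; apply: sub_sigma_algebra. Qed.

Lemma Bor_ext P Q : (forall x, P x <-> Q x) -> Bor G P -> Bor G Q.
Proof. by move=> PQ [BP]; split; rewrite (_ : [set x | Q x] = [set x | P x])//; apply/seteqP; split=> x /PQ. Qed.

Lemma Bor_eqv P Q : Bor G P -> (forall x, P x <-> Q x) -> Bor G Q.
Proof. by move=> BP PQ; exact: (Bor_ext PQ BP). Qed.

Lemma BorN P : Bor G P -> Bor G (fun x => ~ P x).
Proof.
move=> [BP]; split; have [_ + _] := smallest_sigma_algebra setT G.
by move=> /(_ _ BP); rewrite setTD.
Qed.

Lemma Bor_bigcup (P : nat -> T -> Prop) :
  (forall n, Bor G (P n)) -> Bor G (fun x => exists n, P n x).
Proof.
move=> BP; have [_ _] := smallest_sigma_algebra setT G.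
move=> /(_ (fun n => [set x | P n x]) (fun n => (BorP _ _).1 (BP n))) B.
by apply: (@Bor_ext (\bigcup_n [set x | P n x])) => // x; split=> [[n _ ?]|[n ?]]; exists n.
Qed.

Lemma Bor_cst (P : Prop) : Bor G (fun=> P).
Proof.
have B0 : Bor G (fun=> False) by split; have [] := smallest_sigma_algebra setT G.
have [p|np] := pselect P; last by apply: (Bor_eqv B0).
apply: (Bor_eqv (BorN B0)) => x; split=> [_|_ []]; exact: p.
Qed.

Lemma BorEx (I : countType) (P : I -> T -> Prop) :
  (forall i, Bor G (P i)) -> Bor G (fun x => exists i, P i x).
Proof.
move=> BP.
apply: (@Bor_ext (fun x => exists n : nat, exists2 i : I, (unpickle n : option I) = Some i & P i x)).
  move=> x; split=> [[n [i _ ?]]|[i Pi]]; first by exists i.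
  by exists (pickle i), i => //; rewrite pickleK.
apply: Bor_bigcup => n; case: (@unpickle I n) => [i|].
  by apply: (Bor_eqv (BP i)) => x; split=> [|[j [->]]]//; exists i.
by apply: (Bor_eqv (Bor_cst False)) => x; split=> // -[].
Qed.

Lemma BorAll (I : countType) (P : I -> T -> Prop) :
  (forall i, Bor G (P i)) -> Bor G (fun x => forall i, P i x).
Proof.
move=> BP; apply: (@Bor_ext (fun x => ~ exists i, ~ P i x)).
  move=> x; split=> [nP i|Pi [i]//]; have [//|nPi] := pselect (P i x).
  by case: nP; exists i.
by apply: BorN; apply: BorEx => i; apply: BorN.
Qed.

Lemma BorO P Q : Bor G P -> Bor G Q -> Bor G (fun x => P x \/ Q x).
Proof.
move=> BP BQ; apply: (@Bor_ext (fun x => exists b : bool, if b then P x else Q x)).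
  by move=> x; split=> [[[] ?]|[?|?]]; [left|right|exists true|exists false].
by apply: BorEx => -[].
Qed.

Lemma BorA P Q : Bor G P -> Bor G Q -> Bor G (fun x => P x /\ Q x).
Proof.
move=> BP BQ; apply: (@Bor_ext (fun x => forall b : bool, if b then P x else Q x)).
  by move=> x; split=> [H|[? ?] []//]; split; [apply: (H true)|apply: (H false)].
by apply: BorAll => -[].
Qed.

Lemma BorI P Q : Bor G P -> Bor G Q -> Bor G (fun x => P x -> Q x).
Proof.
move=> BP BQ; apply: (@Bor_ext (fun x => ~ P x \/ Q x)); last first.
  by apply: BorO => //; apply: BorN.
move=> x; split=> [[]//|PQ].
by have [p|np] := pselect (P x); [right; apply: PQ|left].
Qed.

Lemma BorEq P Q : Bor G P -> Bor G Q -> Bor G (fun x => P x <-> Q x).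
Proof. by move=> BP BQ; apply: BorA; apply: BorI. Qed.

Lemma BorIc (A : Prop) Q : (A -> Bor G Q) -> Bor G (fun x => A -> Q x).
Proof.
move=> BQ; have [a|na] := pselect A.
  by apply: (Bor_eqv (BQ a)) => x; split=> // /(_ a).
by apply: (Bor_eqv (Bor_cst True)) => x; split.
Qed.

Lemma BorAc (A : Prop) Q : (A -> Bor G Q) -> Bor G (fun x => A /\ Q x).
Proof.
move=> BQ; have [a|na] := pselect A.
  by apply: (Bor_eqv (BQ a)) => x; split=> // -[].
by apply: (Bor_eqv (Bor_cst False)) => x; split=> // -[].
Qed.

End BorTheory.

Lemma Bor_ind T (G : set (set T)) (Q : (T -> Prop) -> Prop) :
  (forall A, G A -> Q A) -> (forall A, Q A -> Q (fun x => ~ A x)) ->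
  (forall F : nat -> T -> Prop, (forall n, Q (F n)) -> Q (fun x => exists n, F n x)) ->
  Q (fun=> False) ->
  forall P, Bor G P -> Q P.
Proof.
move=> QG QN QU Q0 P [BP]; apply: (BP [set A | Q A]); split=> //; split=> //.
  by move=> A QA; rewrite setTD; apply: QN.
move=> F QF; rewrite (_ : \bigcup_n F n = (fun x => exists n, F n x)); first exact: QU.
by apply/seteqP; split=> x; [move=> [n _ ?]; exists n|move=> [n ?]; exists n].
Qed.

Definition mea T T' (G : set (set T)) (G' : set (set T')) (f : T -> T') :=
  forall P, Bor G' P -> Bor G (fun x => P (f x)).

Lemma mea_gen T T' (G : set (set T)) (G' : set (set T')) (f : T -> T') :
  (forall A, G' A -> Bor G (fun x => A (f x))) -> mea G G' f.
Proof.
move=> fG; apply: Bor_ind => //.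
- by move=> A; apply: BorN.
- by move=> F; apply: Bor_bigcup.
- exact: Bor_cst.
Qed.

Lemma mea_comp T T' T'' (G : set (set T)) (G' : set (set T')) (G'' : set (set T''))
  (f : T -> T') (g : T' -> T'') : mea G G' f -> mea G' G'' g -> mea G G'' (g \o f).
Proof. by move=> mf mg P /mg /mf. Qed.

Lemma mea_id T (G : set (set T)) : mea G G id.
Proof. by []. Qed.

(* The sigma-algebra generated by the coordinates of a coding of the points
   of [T] by points of the product [J -> nat]. *)
Definition cyl T J (g : T -> J -> nat) : set (set T) :=
  [set A | exists j v, A = [set x | g x j = v]].

Lemma Bor_cyl T (J : countType) (g : T -> J -> nat) j v : Bor (cyl g) (fun x => g x j = v).
Proof. by apply: Bor_gen; exists j, v. Qed.

Lemma mea_cyl T T' (J : countType) (G : set (set T)) (g : T' -> J -> nat) (f : T -> T') :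
  (forall j v, Bor G (fun x => g (f x) j = v)) -> mea G (cyl g) f.
Proof. by move=> H; apply: mea_gen => _ [j [v ->]]; apply: H. Qed.

Lemma mea_if T T' (G : set (set T)) (G' : set (set T')) (P : T -> Prop) (f g : T -> T') :
  Bor G P -> mea G G' f -> mea G G' g ->
  mea G G' (fun x => if pselect (P x) then f x else g x).
Proof.
move=> BP mf mg Q BQ.
apply: (@Bor_ext _ _ (fun x => (P x /\ Q (f x)) \/ (~ P x /\ Q (g x)))).
  move=> x; case: pselect => px; split.
  + by case=> -[].
  + by left.
  + by case=> -[].
  + by right.
apply: BorO; apply: BorA => //; [exact: mf|exact: BorN|exact: mg].
Qed.

(** * Borel subsets of products of copies of [nat] *)

(** Borel sets of the Baire space when [J] is countable. The index type stays arbitrary so that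
    products and projections become reindexings of coordinates. *)
Definition bair (J : Type) : set (set (J -> nat)) := cyl (@id (J -> nat)).
Arguments bair : clear implicits.

Lemma Bor_bair (J : countType) j v : Bor (bair J) (fun s => s j = v).
Proof. exact: (@Bor_cyl _ _ id). Qed.

(** Closedness in the product topology, basic neighbourhoods being given by finite lists of
    coordinates. *)
Definition clos (J : eqType) (C : (J -> nat) -> Prop) :=
  forall s, (forall l : seq J, exists2 t, C t & forall j, j \in l -> s j = t j) -> C s.

Definition inj_on (J K : Type) (i : J -> K) (P : (K -> nat) -> Prop) :=
  forall w w', P w -> P w' -> (forall j, w (i j) = w' (i j)) -> w = w'.

Definition proj (J K : Type) (i : J -> K) (P : (K -> nat) -> Prop) (s : J -> nat) :=
  exists2 w, P w & forall j, w (i j) = s j.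

(** Representation as an injective projection of a closed set. Uniqueness of the witness in the
    extra coordinates is what later makes projections Borel rather than merely analytic. *)
Definition sus (J : countType) (P : (J -> nat) -> Prop) :=
  exists C : (J + nat -> nat) -> Prop,
    [/\ clos C, inj_on inl C & forall s, P s <-> proj inl C s].

Lemma sus_ext (J : countType) (P Q : (J -> nat) -> Prop) :
  (forall s, P s <-> Q s) -> sus P -> sus Q.
Proof. by move=> PQ [C [cC iC PC]]; exists C; split=> // s; rewrite -PQ. Qed.

Lemma sus_clopen (J : countType) (P : (J -> nat) -> Prop) (l : seq J) :
  (forall s t, (forall j, j \in l -> s j = t j) -> P s -> P t) -> sus P.
Proof.
move=> Pl; exists (fun w => P (w \o inl) /\ forall k, w (inr k) = 0%N); split.
- move=> s H; split.
    have [t [Pt _] st] := H (map inl l).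
    by apply: Pl Pt => j jl /=; rewrite st// map_f.
  by move=> k; have [t [_ t0] ->] := H [:: inr k]; rewrite ?mem_head.
- move=> w w' [_ w0] [_ w'0] ww'; apply: funext => -[j|k]; first exact: ww'.
  by rewrite w0 w'0.
- move=> s; split=> [Ps|[w [Pw _] ws]].
    by exists (fun z => if z is inl j then s j else 0%N).
  by apply: Pl Pw => j _ /=.
Qed.

(** The witnesses for the single sets are interleaved in one sequence along the pairing [pickle];
    positions that code no pair are frozen at [0] for uniqueness. *)
Lemma sus_bigcap (J : countType) (P : nat -> (J -> nat) -> Prop) :
  (forall n, sus (P n)) -> sus (fun s => forall n, P n s).
Proof.
move=> /choice[C HC].
pose part (n : nat) (w : J + nat -> nat) : J + nat -> nat := fun z =>
  match z with inl j => w (inl j) | inr k => w (inr (pickle (n, k))) end.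
exists (fun w => (forall n, C n (part n w)) /\
  forall m, (forall n k : nat, m <> pickle (n, k) :> nat) -> w (inr m) = 0%N); split.
- move=> s H; split.
    move=> n; have [cC _ _] := HC n; apply: cC => l.
    pose emb (z : J + nat) : J + nat := match z with inl j => inl j | inr k => inr (pickle (n, k)) end.
    have [t [Ct _] st] := H (map emb l).
    exists (part n t) => // z zl; have := st (emb z) (map_f _ zl).
    by case: z {zl}.
  move=> m mN; have [t [_ t0] ->] := H [:: inr m]; last by rewrite mem_head.
  exact: t0.
- move=> w w' [Cw w0] [Cw' w'0] ww'; apply: funext => -[j|m]; first exact: ww'.
  have [[n [k ->]]|mN] := pselect (exists n k : nat, m = pickle (n, k) :> nat); last first.
    by rewrite w0 ?w'0// => n k mE; apply: mN; exists n, k.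
  have [_ iC _] := HC n.
  by have /(congr1 (fun f => f (inr k))) := iC _ _ (Cw n) (Cw' n) (fun j => ww' j).
- move=> s; split=> [Ps|[w [Cw _] ws] n]; last first.
    by have [_ _ ->] := HC n; exists (part n w).
  have /choice[w Hw] : forall n, exists w, C n w /\ forall j, w (inl j) = s j.
    by move=> n; have [_ _ /(_ s)[/(_ (Ps n))[w]]] := HC n; exists w.
  exists (fun z => match z with inl j => s j | inr m =>
     if unpickle m is Some (n, k) then if pickle (n, k) == m then w n (inr k) else 0%N else 0%N end) => //.
  split=> [n|m mN].
    rewrite (_ : part _ _ = w n); first by case: (Hw n).
    apply: funext => -[j|k] /=; first by rewrite (Hw n).2.
    by rewrite pickleK eqxx.
  case E: unpickle => [[n k]|//]; case: eqP => // nkm.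
  by case: (mN n k).
Qed.

(** Extra coordinate [0] announces which set of the union is meant; disjointness makes the
    announcement unique. *)
Lemma sus_bigcup (J : countType) (P : nat -> (J -> nat) -> Prop) :
  (forall n, sus (P n)) -> (forall n m s, P n s -> P m s -> n = m) ->
  sus (fun s => exists n, P n s).
Proof.
move=> /choice[C HC] dP.
pose tail (w : J + nat -> nat) : J + nat -> nat := fun z =>
  match z with inl j => w (inl j) | inr k => w (inr k.+1) end.
exists (fun w => C (w (inr 0%N)) (tail w)); split.
- move=> s H; have [cC _ _] := HC (s (inr 0%N)); apply: cC => l.
  pose emb (z : J + nat) : J + nat := match z with inl j => inl j | inr k => inr k.+1 end.
  have [t Ct st] := H (inr 0%N :: map emb l).
  exists (tail t); first by rewrite (st (inr 0%N)) ?mem_head.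
  move=> z zl; have zl' : emb z \in inr 0%N :: map emb l by rewrite inE map_f ?orbT.
  by have := st (emb z) zl'; case: z {zl zl'}.
- move=> w w' Cw Cw' ww'.
  have E : w (inr 0%N) = w' (inr 0%N).
    apply: (dP _ _ (w \o inl)).
      by have [_ _ ->] := HC (w (inr 0%N)); exists (tail w).
    by have [_ _ ->] := HC (w' (inr 0%N)); exists (tail w') => // j /=; rewrite ww'.
  rewrite -E in Cw'; have [_ iC _] := HC (w (inr 0%N)).
  have e := iC _ _ Cw Cw' (fun j => ww' j).
  apply: funext => -[j|[|k]]; [exact: ww'|exact: E|].
  by have /(congr1 (fun f => f (inr k))) := e.
- move=> s; split=> [[n]|[w Cw ws]]; last first.
    by exists (w (inr 0%N)); have [_ _ ->] := HC (w (inr 0%N)); exists (tail w).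
  have [_ _ ->] := HC n => -[w Cw ws].
  exists (fun z => match z with inl j => s j | inr 0 => n | inr k.+1 => w (inr k) end) => //=.
  by rewrite (_ : tail _ = w)//; apply: funext => -[j|k] /=; rewrite ?ws.
Qed.

Lemma Bor_sus (J : countType) (P : (J -> nat) -> Prop) : Bor (bair J) P -> sus P.
Proof.
move=> BP; suff [] : sus P /\ sus (fun s => ~ P s) by [].
apply: (Bor_ind (Q := fun P => sus P /\ sus (fun s => ~ P s))) BP => {P}.
- move=> A [j [v ->]]; split; apply: (@sus_clopen _ _ [:: j]) => s t /= st.
    by rewrite -st ?mem_head.
  by rewrite -st ?mem_head.
- move=> A [sA sN]; split=> //; apply: sus_ext sA => s; split=> [? //|nn].
  by have [|/nn] := pselect (A s).
- move=> F sF; split; last first.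
    apply: (@sus_ext _ (fun s => forall n, ~ F n s)).
      by move=> s; split=> [nF [n] /nF//|nF n Fn]; apply: nF; exists n.
    by apply: sus_bigcap => n; case: (sF n).
  (* A union is made disjoint by taking the least index, which calls for the complements of the
     earlier sets; hence the induction carries [P] together with its negation. *)
  apply: (@sus_ext _ (fun s => exists n, forall k, if k < n then ~ F k s else F n s)).
    move=> s; split=> [[n /(_ n)]|[n Fn]]; first by rewrite ltnn => ?; exists n.
    have ex : exists n, `[< F n s >] by exists n; apply/asboolP.
    exists (ex_minn ex) => k; case: ex_minnP => m /asboolP Fm mmin.
    case: ltnP => // km Fk; have /mmin : `[< F k s >] by apply/asboolP.
    by rewrite leqNgt km.
  apply: sus_bigcup => [n|n m s Hn Hm].
    by apply: sus_bigcap => k; case: ltnP => _; case: (sF k); case: (sF n).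
  case: (ltngtP n m) => // lt.
    by have := Hn n; have := Hm n; rewrite lt ltnn.
  by have := Hn m; have := Hm m; rewrite lt ltnn.
- by split; apply: (@sus_clopen _ _ [::]).
Qed.

(** * Novikov separation for countably many closed sets *)

Section Novikov.
Variables (J K : countType) (i : J -> K) (C : nat -> (K -> nat) -> Prop).
Hypothesis cC : forall n, clos (C n).

Let sat (u : seq (K * nat)) (w : K -> nat) := forall p, p \in u -> w p.1 = p.2.

(** [U n] prescribes values at finitely many coordinates and cuts a clopen part out of [C n]. This
    relative form lets a failure of separation be traced to smaller and smaller parts. *)
Definition separable (U : nat -> seq (K * nat)) :=
  exists B : nat -> (J -> nat) -> Prop,
  [/\ forall n, Bor (bair J) (B n),
      forall n w, C n w -> sat (U n) w -> B n (w \o i)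
    & forall s, ~ forall n, B n s].

Let upd (U : nat -> seq (K * nat)) n p := fun m => if m == n then p :: U m else U m.

(** Otherwise there are separating families for all values [v]: the union over [v] of their [n]th
    sets, together with the intersections of the others, separates [U] itself. *)
Lemma separable_refine U n k : ~ separable U -> exists v, ~ separable (upd U n (k, v)).
Proof.
move=> nU; apply/not_existsP => H.
have {}H v : separable (upd U n (k, v)) by have [//|/H] := pselect (separable (upd U n (k, v))).
have [B HB] := choice H.
apply: nU; exists (fun m s => if m == n then exists v, B v m s else forall v, B v m s); split.
- by move=> m; case: eqP => _; [apply: BorEx|apply: BorAll] => v; have [] := HB v.
- move=> m w Cw sw; case: eqP => [mn|/eqP mn].
    exists (w k); have [_ + _] := HB (w k); apply=> //.
    by rewrite /upd mn eqxx => p; rewrite inE => /predU1P[->//|]; rewrite -mn; apply: sw.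
  by move=> v; have [_ + _] := HB v; apply=> //; rewrite /upd (negbTE mn).
- move=> s Hs; have := Hs n; rewrite eqxx => -[v Bv].
  have [_ _ /(_ s)] := HB v; apply=> m; have := Hs m.
  by case: eqP => [->//|_]; apply.
Qed.

Let state := {U : nat -> seq (K * nat) | ~ separable U}.
(** Stage [m] decodes to an index [n] and a coordinate [k] and prescribes one more value there, so
    that in the limit every coordinate of every point is prescribed. *)
Let step (m : nat) (U : state) : state :=
  if (unpickle m : option (nat * nat)) is Some (n, a) then
    if (unpickle a : option K) is Some k then
      let v := cid (separable_refine n k (svalP U)) in
      exist _ (upd (sval U) n (k, sval v)) (svalP v)
    else U
  else U.

(** If separation failed, the prescribed values would define points [w n], which are in [C n]
    because these sets are closed. Their projections are not all equal, so some [w n] differs from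
    [w 0] at a coordinate [i j]; but fixing the two values of that coordinate separates a late
    stage, a contradiction. *)
Lemma novikov :
  (forall s, ~ forall n, proj i (C n) s) -> separable (fun=> [::]).
Proof.
move=> C0; have [//|nsep] := pselect (separable (fun=> [::])); exfalso.
pose st := fix st m : state := if m is m'.+1 then step m' (st m') else exist (fun U => ~ separable U) _ nsep.
pose U m := sval (st m).
have nU m : ~ separable (U m) := svalP (st m).
have sub m m' n : m <= m' -> {subset U m n <= U m' n}.
  move=> /subnK <-; elim: (m' - m) => [//|d IH] p /IH.
  rewrite addSn /U /= /step; case: unpickle => [[n' a]|//]; case: unpickle => [k|//] /=.
  by rewrite /upd; case: eqP => // _; rewrite inE => ->; rewrite orbT.
pose stage (n : nat) (k : K) := (pickle (n, pickle k)).+1.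
have decided n k : exists v, (k, v) \in U (stage n k) n.
  rewrite /U /= /step pickleK /= pickleK /= /upd eqxx.
  by exists (sval (cid (separable_refine n k (svalP (st (pickle (n, pickle k))))))); rewrite mem_head.
have [w Hw] := choice (fun p : nat * K => decided p.1 p.2).
have big n (l : seq K) : exists m, forall m', m <= m' -> forall k, k \in l -> (k, w (n, k)) \in U m' n.
  elim: l => [|k l [m Hm]]; first by exists 0%N.
  exists (maxn m (stage n k)) => m'; rewrite geq_max => /andP[mm' km'] k'.
  rewrite inE => /predU1P[->|/(Hm _ mm')//].
  by apply: sub km' _ (Hw (n, k)).
have real m n : exists2 w', C n w' & sat (U m n) w'.
  apply: contrapT => H; apply: (nU m); exists (fun n' => if n' == n then fun=> False else fun=> True); split.
  + by move=> n'; case: eqP => _; apply: Bor_cst.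
  + by move=> n' w' Cw' sw'; case: eqP => // e; apply: H; exists w'; rewrite -e.
  + by move=> s /(_ n); rewrite eqxx.
have Cw n : C n (fun k => w (n, k)).
  apply: cC => l; have [m Hm] := big n l; have [w' Cw' sw'] := real m n.
  by exists w' => // k /(Hm _ (leqnn m)) /sw'.
apply: (C0 (fun j => w (0%N, i j))) => n; exists (fun k => w (n, k)) => // j.
have [//|/eqP ne] := eqVneq (w (n, i j)) (w (0%N, i j)); exfalso.
have n0 : n <> 0%N by move=> e; rewrite e in ne.
have [m1 H1] := big n [:: i j]; have [m2 H2] := big 0%N [:: i j].
have {}H1 := H1 _ (leq_maxl m1 m2) _ (mem_head _ _).
have {}H2 := H2 _ (leq_maxr m1 m2) _ (mem_head _ _).
apply: (nU (maxn m1 m2)); exists (fun n' s => if n' == n then s j = w (n, i j)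
  else if n' == 0%N then s j = w (0%N, i j) else True); split.
- move=> n'; case: eqP => _; first exact: Bor_bair.
  by case: eqP => _; [exact: Bor_bair|exact: Bor_cst].
- move=> n' w' _ sw'; case: eqP => [e|_].
    by rewrite e in sw'; apply: sw' H1.
  by case: eqP => // e; rewrite e in sw'; apply: sw' H2.
- move=> s Hs; have := Hs n; have := Hs 0%N; rewrite !eqxx.
  by case: eqP => [/esym//|_ -> /esym].
Qed.

End Novikov.

(** * Injective projections of closed sets are Borel (Lusin and Souslin) *)

Section LusinSouslin.
Variables (J K : countType) (i : J -> K) (C : (K -> nat) -> Prop).
Hypotheses (cC : clos C) (iC : inj_on i C).

Let val (w : K -> nat) (n : nat) := if (unpickle n : option K) is Some k then w k else 0%N.
Let pre n w := mkseq (val w) n.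
Let A u s := proj i (fun w => C w /\ pre (size u) w = u) s.

Let clos_pre u : clos (fun w => C w /\ pre (size u) w = u).
Proof.
move=> s H; split; first by apply: cC => l; have [t []] := H l; exists t.
have [t [_ tu] st] := H (pmap (@unpickle K) (iota 0 (size u))).
rewrite -[RHS]tu; apply/eq_in_map => n nI; rewrite /val; case E: unpickle => [k|//].
by rewrite st// mem_pmap; apply/mapP; exists n.
Qed.

(** Witnesses are unique, so [A u] and [A v] are disjoint. [novikov] is applied to the sequence that
    starts with the closed set of [u] and continues with that of [v]. *)
Let lusin u v : u <> v -> size u = size v ->
  exists2 S, Bor (bair J) S & (forall s, A u s -> S s) /\ (forall s, A v s -> ~ S s).
Proof.
move=> uv suv.
pose D n w := C w /\ pre (size u) w = if n == 0%N then u else v.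
have cD n : clos (D n) by rewrite /D; case: eqP => _; [|rewrite suv]; apply: clos_pre.
have [s H|B [BB DB B0]] := @novikov J K i D cD.
  have [w [Cw wu] ws] := H 0%N; have [w' [Cw' w'v] w's] := H 1%N.
  move: wu w'v => /= wu w'v.
  by apply: uv; rewrite -wu -w'v; congr pre; apply: iC => // j; rewrite ws w's.
exists (B 0%N) => //; split=> s [w [Cw wu] ws].
  by rewrite (_ : s = w \o i); [apply: DB|apply/funext => j; rewrite /= ws].
move=> B0s; apply: (B0 s) => -[//|n].
by rewrite (_ : s = w \o i); [apply: DB => //; rewrite /D suv|apply/funext => j; rewrite /= ws].
Qed.

Lemma Bor_proj_closed : Bor (bair J) (proj i C).
Proof.
have /choice[S HS] : forall uv : seq nat * seq nat, exists S, uv.1 <> uv.2 -> size uv.1 = size uv.2 ->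
    Bor (bair J) S /\ (forall s, A uv.1 s -> S s) /\ (forall s, A uv.2 s -> ~ S s).
  move=> [u v] /=; have [->|/eqP uv] := eqVneq u v; first by exists (fun=> True).
  have [e|ne] := eqVneq (size u) (size v); last by exists (fun=> True) => _ /eqP; rewrite (negbTE ne).
  by have [S ? ?] := lusin uv e; exists S.
(* [T u] is a Borel set containing [A u], and the [T u] with [u] of a fixed length are disjoint. The
   first clause keeps [u] extendible to a point of [C], so that a branch through the sets [T]
   converges to a point of the closed set [C]. *)
pose T u s := (exists s', A u s') /\
  forall v, u <> v -> size u = size v -> S (u, v) s /\ ~ S (v, u) s.
have AT u s : A u s -> T u s.
  move=> Au; split; first by exists s.
  move=> v uv suv; have /= [//|//|_ [+ _]] := HS (u, v); move=> /(_ s Au) ?; split=> //.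
  by have /= [||_ [_]] := HS (v, u); [exact: nesym|by []|move=> /(_ s Au)].
have Tdis u v s : size u = size v -> T u s -> T v s -> u = v.
  move=> suv [_ Tu] [_ Tv]; have [//|/eqP ne] := eqVneq u v.
  by have [] := Tu v ne suv; have [_] := Tv u (nesym ne) (esym suv).
apply: (@Bor_ext _ _ (fun s => forall n, exists u, size u = n /\
   ((forall m, m <= n -> T (take m u) s) /\ forall j, pickle (i j) < n -> nth 0%N u (pickle (i j)) = s j))).
  move=> s; split=> [H|[w Cw ws] n]; last first.
    exists (pre n w); split; first by rewrite size_mkseq.
    split=> [m mn|j jn]; last by rewrite nth_mkseq// /val pickleK ws.
    rewrite /pre -map_take take_iota (minn_idPl mn) -/(mkseq _ m) -/(pre m w); apply: AT; exists w => //; split=> //.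
    by rewrite /pre size_mkseq.
  have /choice[u Hu] := H.
  have tu m n : m <= n -> take m (u n) = u m.
    move=> mn; have [sm [Tm _]] := Hu m; have [sn [Tn _]] := Hu n.
    apply: (Tdis _ _ s); first by rewrite size_take sn sm; case: ltngtP mn.
      exact: Tn.
    by have := Tm m (leqnn m); rewrite -{1}sm take_size.
  pose w (k : K) := nth 0%N (u (pickle k).+1) (pickle k).
  have nu n m : m < n -> nth 0%N (u n) m = nth 0%N (u m.+1) m.
    by move=> mn; rewrite -(tu m.+1 n)// nth_take.
  exists w; last first.
    by move=> j; have [_ [_]] := Hu (pickle (i j)).+1; apply.
  apply: cC => l; pose n := \max_(k <- l) (pickle k).+1.
  have [sn [Tn _]] := Hu n; have [[s' [w' [Cw' w'u] _]] _] := Tn n (leqnn n).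
  have tk : take n (u n) = u n by rewrite -{1}sn take_size.
  rewrite tk sn in w'u.
  exists w' => // k kl; have kn : pickle k < n by apply: (leq_bigmax_seq (F := fun k => (pickle k).+1)).
  by rewrite /w -(nu n)// -w'u nth_mkseq// /val pickleK.
apply: BorAll => n; apply: BorEx => u; apply: BorAc => su; apply: BorA.
  apply: BorAll => m; apply: BorIc => mn; apply: BorAc => _; apply: BorAll => v.
  apply: BorIc => uv; apply: BorIc => suv.
  have /= [//|//|B1 _] := HS (take m u, v).
  have /= [||B2 _] := HS (v, take m u); [exact: nesym|by []|].
  by apply: BorA => //; apply: BorN.
apply: BorAll => j; apply: BorIc => _.
by apply: (Bor_eqv (Bor_bair j (nth 0%N u (pickle (i j))))) => s; split=> ->.
Qed.

End LusinSouslin.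

Lemma Bor_proj (J K : countType) (i : J -> K) (P : (K -> nat) -> Prop) :
  Bor (bair K) P -> inj_on i P -> Bor (bair J) (proj i P).
Proof.
move=> /Bor_sus[C [cC iC PC]] iP.
apply: (@Bor_ext _ _ (proj (inl \o i : J -> (K + nat)%type) C)).
  move=> s; split=> [[w Cw ws]|[w /PC[w' Cw' w'w] ws]].
    by exists (w \o inl) => //; apply/PC; exists w.
  by exists w' => // j /=; rewrite w'w ws.
apply: Bor_proj_closed => // w w' Cw Cw' ww'; apply: iC => // k.
have Pw : P (w \o inl) by apply/PC; exists w.
have Pw' : P (w' \o inl) by apply/PC; exists w'.
by have /(congr1 (fun f => f k)) := iP _ _ Pw Pw' ww'.
Qed.

(* Novikov separation cuts a set with discrete sections into countably many
   Borel sets on which the projection is injective. *)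
Lemma uniformize (J L : countType) (P : (J + L -> nat) -> Prop) :
  Bor (bair (J + L)%type) P ->
  (forall w, P w -> exists l : seq L, forall w', P w' -> (forall j, w' (inl j) = w (inl j)) ->
     (forall k, k \in l -> w' (inr k) = w (inr k)) -> w' = w) ->
  exists Q : nat -> (J + L -> nat) -> Prop,
  [/\ forall n, Bor (bair (J + L)%type) (Q n), forall n, inj_on inl (Q n)
    & forall w, P w <-> exists n, Q n w].
Proof.
move=> BP iso.
pose K := ((J + L) + L)%type.
pose z1 (z : K -> nat) : J + L -> nat := z \o inl.
pose z2 (z : K -> nat) : J + L -> nat := fun p => match p with inl j => z (inl (inl j)) | inr k => z (inr k) end.
(* [z] codes two points of [P] over the same base that are distinct but agree on the first [n] fibre
   coordinates. As sections are discrete, no point of [P] is the first component of such a pair for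
   every [n]. *)
pose A n z := [/\ P (z1 z), P (z2 z), exists k : L, z1 z (inr k) <> z2 z (inr k)
  & forall k : L, pickle k < n -> z1 z (inr k) = z2 z (inr k)].
have m1 : mea (bair K) (bair (J + L)%type) z1 by apply: mea_cyl => j v; apply: Bor_bair.
have m2 : mea (bair K) (bair (J + L)%type) z2 by apply: mea_cyl => -[j|k] v; apply: Bor_bair.
have Beq k : Bor (bair K) (fun z => z1 z (inr k) = z2 z (inr k)).
  apply: (@Bor_ext _ _ (fun z => exists v, z1 z (inr k) = v /\ z2 z (inr k) = v)).
    by move=> z; split=> [[v [-> ->]]//|->]; eexists.
  by apply: BorEx => v; apply: BorA; exact: Bor_bair.
have BA n : Bor (bair K) (A n).
  apply: (@Bor_ext _ _ (fun z => (P (z1 z) /\ P (z2 z)) /\ ((exists k : L, ~ z1 z (inr k) = z2 z (inr k))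
     /\ forall k : L, pickle k < n -> z1 z (inr k) = z2 z (inr k)))).
    by move=> z; split=> [[[? ?] [? ?]]|[? ? ? ?]].
  apply: BorA; first by apply: BorA; [apply: m1|apply: m2].
  apply: BorA; first by apply: BorEx => k; apply: BorN.
  by apply: BorAll => k; apply: BorIc.
have /choice[C HC] := fun n => Bor_sus (BA n).
pose i := inl \o inl : J + L -> (K + nat)%type.
have CA n s : proj i (C n) s <-> exists2 z, A n z & z1 z = s.
  have [_ _ AC] := HC n; split=> [[w Cw ws]|[z /AC[w Cw wz] zs]].
    exists (w \o inl); first by apply/AC; exists w.
    by apply/funext => p /=; rewrite -ws.
  by exists w => // p; rewrite -zs /i /= wz.
have [|s H|B [BB AB B0]] := @novikov _ _ i C.
- by move=> n; have [] := HC n.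
- have /CA[z [Pz _ _ _] zs] := H 0%N.
  rewrite zs in Pz; have [l Hl] := iso s Pz.
  have /CA[z' [_ Pz2 [k nk] zn] z's] := H (\max_(k <- l) (pickle k).+1).
  apply: nk; rewrite z's (Hl (z2 z'))//.
  + by move=> j; rewrite -z's.
  + by move=> k' k'l; rewrite -zn ?z's//; apply: (leq_bigmax_seq (F := fun k => (pickle k).+1)).
(* Outside [B p.1] no point of [P] has a distinct companion in its section with the same first [p.1]
   fibre coordinates, so prescribing these leaves at most one point in each section. *)
pose Q (p : nat * seq nat) w := P w /\ (~ B p.1 w /\ forall k : L, pickle k < p.1 -> w (inr k) = nth 0%N p.2 (pickle k)).
have BQ p : Bor (bair (J + L)%type) (Q p).
  apply: BorA => //; apply: BorA; first by apply: BorN.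
  by apply: BorAll => k; apply: BorIc => _; apply: Bor_bair.
exists (fun n s => if (unpickle n : option (nat * seq nat)) is Some p then Q p s else False); split.
- by move=> n; case: unpickle => [p|]; [exact: BQ|exact: Bor_cst].
- move=> n; case: unpickle => [[m u]|w w' //] w w' [Pw [nB wu]] [Pw' [_ w'u]] ww'.
  apply: funext => -[j|k]; first exact: ww'.
  apply: contrapT => ne; apply: nB.
  have /CA[v Cv vw] : exists2 z, A m z & z1 z = w.
    exists (fun p => match p with inl q => w q | inr k => w' (inr k) end) => //.
    have e1 : z2 (fun p : K => match p with inl q => w q | inr k => w' (inr k) end) = w'.
      by apply/funext => -[j'|k'] //=; rewrite ww'.
    split=> //; rewrite ?e1//; first by exists k.
    by move=> k' k'm; rewrite /z1 /= wu// w'u.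
  by rewrite (_ : w = v \o i); [apply: AB|apply/funext => p; rewrite /= vw].
- move=> w; split=> [Pw|[n]]; last by case: unpickle => [p [//]|//].
  have [m nB] : exists m, ~ B m w.
    by apply: contrapT => H; apply: (B0 w) => n; apply: contrapT => ?; apply: H; exists n.
  pose val n := if (unpickle n : option L) is Some k then w (inr k) else 0%N.
  exists (pickle (m, mkseq val m)); rewrite pickleK; split=> //; split=> //= k km.
  by rewrite nth_mkseq// /val pickleK.
Qed.

(** * Standard Borel spaces *)

(** A standard Borel structure on [T]: an isomorphism with a Borel set of sequences. *)
Definition coded T (J : countType) (g : T -> J -> nat) :=
  injective g /\ Bor (bair J) (fun s => exists x, g x = s).

Lemma Bor_image T (J : countType) (g : T -> J -> nat) (A : T -> Prop) :
  coded g -> Bor (cyl g) A -> Bor (bair J) (fun s => exists2 x, A x & g x = s).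
Proof.
move=> [gI gR]; apply: (Bor_ind (Q := fun A => Bor (bair J) (fun s => exists2 x, A x & g x = s))).
- move=> _ [j [v ->]]; apply: (@Bor_ext _ _ (fun s => (exists x, g x = s) /\ s j = v)).
    by move=> s; split=> [[[x <-] xv]|[x xv <-]]; [exists x|split=> //; exists x].
  by apply: BorA => //; exact: Bor_bair.
- move=> B BB; apply: (@Bor_ext _ _ (fun s => (exists x, g x = s) /\ ~ exists2 x, B x & g x = s)).
    move=> s; split=> [[[x xs] nB]|[x nB xs]].
      by exists x => // Bx; apply: nB; exists x.
    by split=> [|[y By ys]]; [exists x|apply: nB; rewrite (gI x y)// ys].
  by apply: BorA => //; apply: BorN.
- move=> F BF; apply: (@Bor_ext _ _ (fun s => exists n, exists2 x, F n x & g x = s)).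
    by move=> s; split=> [[n [x Fx xs]]|[x [n Fx] xs]]; [exists x => //; exists n|exists n, x].
  exact: BorEx.
- by apply: (@Bor_ext _ _ (fun=> False)) => [s|]; [split=> // -[]|exact: Bor_cst].
Qed.

Lemma mea_code T (J : countType) (g : T -> J -> nat) : mea (cyl g) (bair J) g.
Proof. by apply: mea_cyl => j v; exact: Bor_cyl. Qed.

Definition pcode T1 T2 J1 J2 (g1 : T1 -> J1 -> nat) (g2 : T2 -> J2 -> nat)
    (p : T1 * T2) (z : J1 + J2) : nat :=
  match z with inl j => g1 p.1 j | inr k => g2 p.2 k end.

Definition icode I T J (g : T -> J -> nat) (f : I -> T) (z : I * J) : nat := g (f z.1) z.2.

Lemma coded_icode (I J : countType) T (g : T -> J -> nat) : coded g -> coded (@icode I T J g).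
Proof.
move=> [gI gR]; split.
  move=> f f' e; apply: funext => i; apply: gI; apply: funext => j.
  by have /(congr1 (fun h => h (i, j))) := e.
apply: (@Bor_ext _ _ (fun s : I * J -> nat => forall i, exists x, g x = fun j => s (i, j))).
  move=> s; split=> [/choice[f Hf]|[f <-] i]; last by exists (f i).
  by exists f; apply: funext => -[i j]; rewrite /icode /= Hf.
apply: BorAll => i.
by apply: (mea_cyl (f := fun (s : I * J -> nat) j => s (i, j)) _ gR) => j v; exact: Bor_bair.
Qed.

(** * Uniformization of Borel relations with finite sections *)

Section LusinNovikov.
Variables (T1 T2 : Type) (J1 J2 : countType) (g1 : T1 -> J1 -> nat) (g2 : T2 -> J2 -> nat).
Hypotheses (c1 : coded g1) (c2 : coded g2).
Variables (P : T1 -> T2 -> Prop) (y0 : T2).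
Hypothesis BP : Bor (cyl (pcode g1 g2)) (fun p => P p.1 p.2).
Hypothesis finP : forall x, finite_set (P x).

Lemma coded_pcode : coded (pcode g1 g2).
Proof.
case: c1 c2 => [gI1 gR1] [gI2 gR2]; split.
  move=> [x y] [x' y'] e; congr (_, _); [apply: gI1|apply: gI2]; apply: funext => j.
    by have /(congr1 (fun h => h (inl j))) := e.
  by have /(congr1 (fun h => h (inr j))) := e.
apply: (@Bor_ext _ _ (fun s : (J1 + J2)%type -> nat => (exists x, g1 x = s \o inl) /\ exists y, g2 y = s \o inr)).
  move=> s; split=> [[[x xs] [y ys]]|[[x y] <-]]; last by split; [exists x|exists y].
  by exists (x, y); apply: funext => -[j|k] /=; [rewrite xs|rewrite ys].
apply: BorA.
  by apply: (mea_cyl (f := fun s : (J1 + J2)%type -> nat => s \o inl) _ gR1) => j v; exact: Bor_bair.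
by apply: (mea_cyl (f := fun s : (J1 + J2)%type -> nat => s \o inr) _ gR2) => j v; exact: Bor_bair.
Qed.

Lemma discrete_section x y : P x y ->
  exists l : seq J2, forall y', P x y' -> (forall k, k \in l -> g2 y' k = g2 y k) -> y' = y.
Proof.
move=> Pxy.
pose f y' : option J2 := if pselect (exists j, g2 y' j <> g2 y j) is left e then Some (sval (cid e)) else None.
have /(finite_image f)/finite_seqP[l lE] := finP x.
exists (pmap id l) => y' Py' H; apply: contrapT => ne.
have ex : exists j, g2 y' j <> g2 y j.
  by apply/not_existsP => E; apply: ne; apply: c2.1; apply: funext => j; have := E j => /contrapT.
have : f y' \in l by have : [set f z | z in P x] (f y') by [exists y']; rewrite lE.
rewrite /f; case: pselect => // e; case: cid => j /= nj jl; apply: nj; apply: H.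
by rewrite mem_pmap map_id.
Qed.

(** Each piece [Q n] given by [uniformize] is the graph of a partial function. Its domain and the
    sets where a coordinate takes a given value are injective projections, hence Borel; [y0] is the
    value outside the domain. *)
Theorem lusin_novikov : exists (D : nat -> T1 -> Prop) (f : nat -> T1 -> T2),
  [/\ forall n, Bor (cyl g1) (D n), forall n, mea (cyl g1) (cyl g2) (f n)
    & forall x y, P x y <-> exists n, D n x /\ f n x = y].
Proof.
have [|Q [BQ iQ PQ]] := uniformize (Bor_image coded_pcode BP).
  move=> _ [[x y] /= Pxy <-]; have [l Hl] := discrete_section Pxy.
  exists l => _ [[x' y'] /= Pxy' <-] e1 e2.
  have xx' : x' = x by apply: c1.1; apply: funext => j; have := e1 j.
  rewrite xx' in Pxy' *; congr (pcode _ _ (_, _)).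
  by apply: Hl => // k /e2.
pose G n x y := Q n (pcode g1 g2 (x, y)).
have Gfun n x y y' : G n x y -> G n x y' -> y = y'.
  move=> Gy Gy'; apply: c2.1; apply: funext => k.
  by have /(congr1 (fun h => h (inr k))) := iQ n _ _ Gy Gy' (fun=> erefl).
have GP x y : P x y <-> exists n, G n x y.
  split=> [Pxy|[n Gxy]]; first by apply/PQ; exists (x, y).
  have /PQ[[x' y'] /= Pxy' e] : exists n, Q n (pcode g1 g2 (x, y)) by exists n.
  by have [<- <-] := coded_pcode.1 _ _ e.
pose f n x := if pselect (exists y, G n x y) is left e then sval (cid e) else y0.
have fG n x y : G n x y -> f n x = y.
  by rewrite /f => Gy; case: pselect => [e|[]]; [case: cid => z /= /Gfun; apply|exists y].
have QG n w : Q n w -> exists x y, w = pcode g1 g2 (x, y) /\ G n x y.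
  move=> Qw; have /PQ[[x y] /= _ e] : exists n, Q n w by exists n.
  by exists x, y; rewrite /G e.
have BG n (A : (J1 + J2 -> nat) -> Prop) : Bor (bair (J1 + J2)%type) A ->
    Bor (cyl g1) (fun x => exists y, G n x y /\ A (pcode g1 g2 (x, y))).
  move=> BA.
  have BQA : Bor (bair (J1 + J2)%type) (fun w => Q n w /\ A w) by apply: BorA.
  have /(mea_code g1) : Bor (bair J1) (proj inl (fun w => Q n w /\ A w)).
    by apply: Bor_proj => // w w' [Qw _] [Qw' _]; apply: iQ Qw Qw'.
  apply: Bor_ext => x; split=> [[w [Qw Aw] wx]|[y [Gy Ay]]]; last by exists (pcode g1 g2 (x, y)).
  have [x' [y [e Gy]]] := QG _ _ Qw; subst w; exists y.
  suff -> : x = x' by [].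
  by apply: c1.1; apply: funext => j; rewrite -wx.
exists (fun n x => exists y, G n x y), f; split.
- by move=> n; apply: (Bor_eqv (BG n _ (Bor_cst _ True))) => x; split=> [[y []]|[y]]; exists y.
- move=> n; apply: mea_cyl => k v.
  apply: (@Bor_ext _ _ (fun x => (exists y, G n x y /\ g2 y k = v) \/ (~ (exists y, G n x y /\ True)) /\ g2 y0 k = v)).
    move=> x; split=> [[[y [Gy <-]]|[nG <-]]|<-].
    + by rewrite (fG _ _ _ Gy).
    + by rewrite /f; case: pselect => // -[y Gy]; case: nG; exists y.
    + rewrite /f; case: pselect => [e|nG]; first by left; exists (sval (cid e)); split=> //; case: cid.
      by right; split=> // -[y [Gy _]]; apply: nG; exists y.
  apply: BorO; last by apply: BorA; [exact: (BorN (BG n (fun=> True) (Bor_cst _ True)))|exact: Bor_cst].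
  exact: (BG n (fun w => w (inr k) = v) (Bor_bair _ _)).
- move=> x y; rewrite GP; split=> [[n Gy]|[n [[y' Gy'] fy]]].
    by exists n; split; [exists y|exact: fG].
  by exists n; rewrite -fy (fG _ _ _ Gy').
Qed.

End LusinNovikov.

Lemma openP (T : topologicalType) (A : set T) :
  open A <-> forall x, A x -> nbhs x A.
Proof. by rewrite openE. Qed.

Section Polish.
Variables (R : realType) (X : ptopologicalType).
Hypothesis polishX : polish R X.

(** [c x n] is the least index of a point of a dense sequence within [1/(n+1)] of [x], so its level
    sets are differences of open sets. The range of [c] is Borel because, by completeness, a
    sequence is a code as soon as it satisfies countably many inequalities between distances in the
    dense sequence. *)
Lemma polish_code : exists c : X -> nat -> nat,
  [/\ coded c, forall n i, exists A B : set X, [/\ open A, open B & [set x | c x n = i] = A `\` B]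
    & forall x (A : set X), nbhs x A -> exists n, [set y | c y n = c x n] `<=` A].
Proof.
have [[D /pcard_injP[h hI] dD] [d [[d0 dE dC dT] dm dc]]] := polishX.
pose e n : X := if pselect (exists2 x, D x & h x = n) is left w then sval (cid2 w) else point.
have de x (eps : R) : (0 < eps)%R -> exists n, (d x (e n) < eps)%R.
  move=> eps0; have ox : nbhs x [set y | (d x y < eps)%R] by apply/dm; exists eps.
  have [y [/interior_subset xy Dy]] : ([set y | (d x y < eps)%R]°)%classic `&` D !=set0.
    by apply: dD; [exists x|exact: open_interior].
  exists (h y); rewrite /e; case: pselect => [w|[]]; last by exists y.
  by case: cid2 => z /= Dz /hI-> //; rewrite inE.
pose q n : R := (n.+1%:R^-1)%R.
have q0 n : (0 < q n)%R by rewrite invr_gt0 ltr0n.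
have qlt (x y : R) : (x < y)%R -> exists n, (x + q n + q n < y)%R.
  move=> xy; have xy2 : (0 < (y - x) / 2)%R by rewrite divr_gt0// ?subr_gt0// ltr0n.
  have [n] := ltr_add_invr xy2; rewrite add0r -/(q n) => qn; exists n.
  have -> : y = (x + (y - x) / 2 + (y - x) / 2)%R.
    by rewrite -addrA -mulr2n -[(_ *+ 2)%R]mulr_natr divfK ?pnatr_eq0// addrC subrK.
  by rewrite ltrD// ltrD2l.
pose c x n := ex_minn (de x (q n) (q0 n)).
have c1 x n : (d x (e (c x n)) < q n)%R by rewrite /c; case: ex_minnP.
have c2 x n i : (i < c x n) -> ~~ (d x (e i) < q n)%R.
  rewrite /c; case: ex_minnP => m _ mmin im; apply/negP => /mmin.
  by rewrite leqNgt im.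
have cE x n i : c x n = i <-> (d x (e i) < q n)%R /\ forall j, (j < i) -> ~~ (d x (e j) < q n)%R.
  split=> [<-|[di Hi]]; first by split=> // j; apply: c2.
  case: (ltngtP (c x n) i) => // lt; first by have := Hi _ lt; rewrite c1.
  by have := c2 x n i lt; rewrite di.
have cnear x (A : set X) : nbhs x A -> exists n, [set y | c y n = c x n] `<=` A.
  move=> /dm[eps eps0 epsA]; have [n qn] := qlt 0%R eps eps0; exists n => y /= yx; apply: epsA => /=.
  apply: le_lt_trans (dT x (e (c x n)) y) _; apply: lt_trans qn.
  by rewrite add0r ltrD// dC -yx.
have op i (r : R) : open [set x | (d x (e i) < r)%R].
  apply/openP => x /= xr; apply/dm; exists (r - d x (e i))%R; first by rewrite subr_gt0.
  move=> y /= xy; apply: le_lt_trans (dT y x (e i)) _; rewrite dC.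
  by rewrite -ltrBrDr.
exists c; split=> //; last first.
  move=> n i; exists [set x | (d x (e i) < q n)%R], (\bigcup_(j in [set j | j < i]) [set x | (d x (e j) < q n)%R]).
  split=> //; first by apply: bigcup_open => j _.
  apply/seteqP; split=> x /=; rewrite cE => -[di].
    by move=> Hi; split=> // -[j /= ji]; have := Hi j ji => /negP.
  by move=> Hi; split=> // j ji; apply/negP => dj; apply: Hi; exists j.
split.
  move=> x y xy; apply/dE; apply/eqP; rewrite eq_le d0 andbT leNgt; apply/negP => dxy.
  have [n qn] := qlt 0%R _ dxy; rewrite add0r in qn.
  have := dT x (e (c x n)) y; rewrite leNgt (lt_trans _ qn)// ltrD//.
  by rewrite dC xy.
(* If [s] codes [x], this says that [d x (e i) < q n], expressed by the sequence alone: [e (s k)] is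
   within [q k] of [x], and the slack [q k] keeps the inequality strict. *)
pose near (s : nat -> nat) n i := exists k, (d (e (s k)) (e i) + q k < q n)%R.
apply: (@Bor_ext _ _ (fun s => (forall m n, (d (e (s m)) (e (s n)) < q m + q n)%R) /\
   forall n i, (i = s n -> near s n i) /\ (i < s n -> ~ near s n i))).
  move=> s; split=> [[sC sN]|[x <-]]; last first.
    split=> [m n|n i].
      by apply: le_lt_trans (dT _ x _) _; rewrite dC ltrD.
    have nearE : near (c x) n i <-> (d x (e i) < q n)%R.
      split=> [[k]|].
        apply: lt_trans; apply: le_lt_trans (dT x (e (c x k)) _) _.
        by rewrite addrC ltrD2l.
      move=> /qlt[k qk]; exists k; apply: lt_trans qk; rewrite ltrD2r.
      apply: le_lt_trans (dT _ x _) _; rewrite dC addrC ltrD2l; exact: c1.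
    split=> [e_|ilt]; first by apply/nearE; rewrite e_.
    by move=> /nearE; apply/negP; apply: c2.
  have [eps eps0|x xl] := dc (e \o s).
    have [N qN] := qlt 0%R eps eps0; exists N => m n Nm Nn; apply: lt_trans (sC _ _) _.
    have qle k : N <= k -> (q k <= q N)%R by move=> Nk; rewrite lef_pV2 ?posrE ?ltr0n// ler_nat.
    by apply: le_lt_trans qN; rewrite add0r lerD// qle.
  have dx k : (d x (e (s k)) <= q k)%R.
    rewrite leNgt; apply/negP => /qlt[n qn].
    have /xl[N _ HN] : nbhs x [set y | (d x y < q n)%R] by apply/dm; exists (q n).
    pose m := maxn N n; have qm : (q m <= q n)%R by rewrite lef_pV2 ?posrE ?ltr0n// ler_nat ltnS leq_maxr.
    have := HN m (leq_maxl _ _) => /= dm'.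
    have := dT x (e (s m)) (e (s k)); rewrite leNgt => /negP; apply.
    apply: lt_le_trans (ltrD dm' (sC m k)) _; apply: ltW; apply: le_lt_trans qn.
    by move: qm; move: (q n) (q m) (q k) => ? ? ?; lra.
  exists x; apply: funext => n; apply/cE.
  have nearE i : near s n i <-> (d x (e i) < q n)%R.
    split=> [[k]|].
      apply: le_lt_trans; apply: le_trans (dT x (e (s k)) _) _.
      by rewrite addrC lerD2l.
    move=> /qlt[k qk]; exists k; apply: le_lt_trans qk; rewrite lerD2r.
    by apply: le_trans (dT _ x _) _; rewrite dC addrC lerD2l.
  split; first by apply/nearE; apply: (sN n (s n)).1.
  by move=> j jn; apply/negP => /nearE; apply: (sN n j).2.
have BP2 m n (A : nat -> nat -> Prop) : Bor (bair nat) (fun s => A (s m) (s n)).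
  apply: (@Bor_ext _ _ (fun s => exists u v, A u v /\ (s m = u /\ s n = v))).
    by move=> s; split=> [[u [v [? [-> ->]]]]//|?]; exists (s m), (s n).
  by do 2 apply: BorEx => ?; apply: BorAc => _; apply: BorA; exact: Bor_bair.
have BP1 m (A : nat -> Prop) : Bor (bair nat) (fun s => A (s m)) by exact: (BP2 m m (fun u _ => A u)).
have Bnear n i : Bor (bair nat) (fun s => near s n i).
  by apply: BorEx => k; exact: (BP1 k (fun u => (d (e u) (e i) + q k < q n)%R)).
apply: BorA; first by do 2 apply: BorAll => ?; exact: (BP2 _ _ (fun u v => (d (e u) (e v) < _)%R)).
apply: BorAll => n; apply: BorAll => i; apply: BorA; apply: BorI.
- exact: (BP1 n (fun u => i = u)).
- exact: Bnear.
- exact: (BP1 n (fun u => i < u)).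
- exact: BorN.
Qed.

End Polish.

Section BorelCode.
Variables (X : topologicalType) (c : X -> nat -> nat).
Hypothesis c_Bor : forall n i, exists A B : set X,
  [/\ open A, open B & [set x | c x n = i] = A `\` B].
Hypothesis c_nbhs : forall x (A : set X), nbhs x A -> exists n, [set y | c y n = c x n] `<=` A.

Lemma Bor_code n i : Bor open (fun x => c x n = i).
Proof.
have [A [B [oA oB e]]] := c_Bor n i.
apply: (@Bor_ext _ _ (fun x => A x /\ ~ B x)); last by apply: BorA; [|apply: BorN]; apply: Bor_gen.
by move=> x; have /(congr1 (fun S => S x)) /= := e; rewrite /setD /= => ->.
Qed.

Lemma borel_cyl (P : X -> Prop) : Bor open P <-> Bor (cyl c) P.
Proof.
split=> BP.
  apply: (mea_gen (f := id) _ BP) => A oA.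
  apply: (@Bor_ext _ _ (fun x => exists n i, [set y | c y n = i] `<=` A /\ c x n = i)).
    move=> x; split=> [[n [i [iA xi]]]|Ax]; first exact: iA.
    have [n nA] := c_nbhs ((openP A).1 oA x Ax); by exists n, (c x n).
  by do 2 apply: BorEx => ?; apply: BorAc => _; exact: Bor_cyl.
by apply: (mea_cyl (f := id) _ BP); exact: Bor_code.
Qed.

Lemma borel_pcyl (P : X * X -> Prop) : Bor open P <-> Bor (cyl (pcode c c)) P.
Proof.
split=> BP.
  apply: (mea_gen (f := id) _ BP) => A oA.
  apply: (@Bor_ext _ _ (fun p => exists q : (nat * nat) * (nat * nat),
      [set y | c y q.1.1 = q.1.2] `*` [set y | c y q.2.1 = q.2.2] `<=` A /\
      (pcode c c p (inl q.1.1) = q.1.2 /\ pcode c c p (inr q.2.1) = q.2.2))).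
    move=> [x y]; split=> [[q [qA [xq yq]]]|Axy]; first by apply: qA.
    have [[U V] /= [nU nV] UVA] := (openP A).1 oA _ Axy.
    have [n nU'] := c_nbhs nU; have [m mV'] := c_nbhs nV.
    exists ((n, c x n), (m, c y m)); split=> // -[x' y'] /= [xx' yy'].
    by apply: UVA; split; [apply: nU'|apply: mV'].
  by apply: BorEx => q; apply: BorAc => _; apply: BorA; exact: Bor_cyl.
have mfst : mea open open (@fst X X).
  apply: mea_gen => A oA; apply: Bor_gen; apply/openP => -[x y] /= Ax.
  by exists (A, setT) => //=; [split; [exact/(openP A).1|exact: filterT]|move=> [? ?] []].
have msnd : mea open open (@snd X X).
  apply: mea_gen => A oA; apply: Bor_gen; apply/openP => -[x y] /= Ay.
  by exists (setT, A) => //=; [split; [exact: filterT|exact/(openP A).1]|move=> [? ?] []].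
apply: (mea_cyl (f := id) _ BP) => -[n|n] i; [exact: (mfst _ (Bor_code n i))|exact: (msnd _ (Bor_code n i))].
Qed.

End BorelCode.

(** * Borel relations on a Polish space *)

Definition std (X : topologicalType) (c : X -> nat -> nat) :=
  [/\ coded c,
      forall n i, exists A B : set X, [/\ open A, open B & [set x | c x n = i] = A `\` B]
    & forall x (A : set X), nbhs x A -> exists n, [set y | c y n = c x n] `<=` A].

Notation BX := (Bor open).
Notation mX := (mea open open).
Definition BR (X : topologicalType) (F : X -> X -> Prop) := Bor (@open (X * X)%type) (fun p => F p.1 p.2).

Lemma borelP (X : topologicalType) (A : set X) : borel A <-> BX A.
Proof. by rewrite BorP. Qed.

Lemma borel_BR (X : topologicalType) (E : set (X * X)) : borel E <-> BR (fun x y => E (x, y)).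
Proof.
rewrite borelP; split; apply: Bor_ext => -[x y] //.
Qed.

Section Relations.
Variables (X : ptopologicalType) (c : X -> nat -> nat).
Hypothesis Hc : std c.

Lemma BX_code n i : BX (fun x => c x n = i).
Proof. by case: Hc => _ h1 h2; exact: Bor_code. Qed.

Lemma BX_eq (T : topologicalType) (f g : T -> X) : mea open open f -> mea open open g ->
  BX (fun x => f x = g x).
Proof.
move=> mf mg; apply: (@Bor_ext _ _ (fun x => forall n, exists i, c (f x) n = i /\ c (g x) n = i)).
  move=> x; split=> [H|-> n]; last by exists (c (g x) n).
  by case: Hc => -[cI _] _ _; apply: cI; apply: funext => n; have [i [-> ->]] := H n.
apply: BorAll => n; apply: BorEx => i; apply: BorA.
  exact: (mf _ (BX_code n i)).
exact: (mg _ (BX_code n i)).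
Qed.

Lemma BR_mX (F : X -> X -> Prop) (f g : X -> X) : BR F -> mX f -> mX g -> BX (fun x => F (f x) (g x)).
Proof.
case: Hc => cc h1 h2 /(borel_pcyl h1 h2) BF mf mg.
apply: (@mea_cyl _ _ _ _ (pcode c c) (fun x => (f x, g x)) _ _ BF) => -[n|n] i.
  exact: (mf _ (BX_code n i)).
exact: (mg _ (BX_code n i)).
Qed.

Lemma mfst : mea open open (@fst X X).
Proof.
case: Hc => cc h1 h2; move=> P /(borel_cyl h1 h2) BP; apply/(borel_pcyl h1 h2).
by apply: (mea_cyl _ BP) => j v; exact: (@Bor_cyl _ _ (pcode c c) (inl j)).
Qed.

Lemma msnd : mea open open (@snd X X).
Proof.
case: Hc => cc h1 h2; move=> P /(borel_cyl h1 h2) BP; apply/(borel_pcyl h1 h2).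
by apply: (mea_cyl _ BP) => j v; exact: (@Bor_cyl _ _ (pcode c c) (inr j)).
Qed.

Definition covers (I : Type) (f : I -> X -> X) (F : X -> X -> Prop) :=
  forall x y, F x y -> exists i, f i x = y.

(** The pattern behind most Borel proofs about relations below: a relation whose sections are
    enumerated by [f] is tested at the points [f i x], so that only sets of points have to be shown
    Borel. *)
Lemma BR_covers (I : countType) (f : I -> X -> X) (F : X -> X -> Prop) :
  (forall i, mX (f i)) -> covers f F -> (forall i, BX (fun x => F x (f i x))) -> BR F.
Proof.
move=> mf cF BF; apply: (@Bor_ext _ _ (fun p => exists i, f i p.1 = p.2 /\ F p.1 (f i p.1))).
  move=> [x y] /=; split=> [[i [<-]]//|Fxy].
  by have [i xy] := cF _ _ Fxy; exists i; rewrite xy.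
apply: BorEx => i; apply: BorA.
  by apply: BX_eq; [exact: mea_comp mfst (mf i)|exact: msnd].
exact: (mfst (BF i)).
Qed.

End Relations.

Definition rtc (X : Type) (F : X -> X -> Prop) := clos_refl_trans X F.

Lemma rtc_step (X : Type) (F : X -> X -> Prop) x y : F x y -> rtc F x y.
Proof. exact: rt_step. Qed.
Lemma rtc_refl (X : Type) (F : X -> X -> Prop) x : rtc F x x.
Proof. exact: rt_refl. Qed.
Lemma rtc_trans (X : Type) (F : X -> X -> Prop) y x z : rtc F x y -> rtc F y z -> rtc F x z.
Proof. exact: rt_trans. Qed.
Lemma rtc_sym (X : Type) (F : X -> X -> Prop) :
  (forall x y, F x y -> F y x) -> forall x y, rtc F x y -> rtc F y x.
Proof.
move=> sF x y; elim=> [u v /sF|u|u v w _ vu _ wv]; first exact: rtc_step.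
  exact: rtc_refl.
exact: rtc_trans wv vu.
Qed.
Lemma rtc_mono (X : Type) (F F' : X -> X -> Prop) :
  (forall x y, F x y -> F' x y) -> forall x y, rtc F x y -> rtc F' x y.
Proof.
move=> FF' x y; elim=> [u v /FF'|u|u v w _ uv _ vw]; first exact: rtc_step.
  exact: rtc_refl.
exact: rtc_trans uv vw.
Qed.

(* The four hypotheses on a family of Borel maps that enumerates, together
   with each point, its whole component. *)
Definition moves (X : topologicalType) (I : Type) (f : I -> X -> X) :=
  [/\ forall i, mX (f i), exists i, forall x, f i x = x
    & forall i j, exists k, forall x, f k x = f i (f j x)].

Section Reach.
Variables (X : ptopologicalType) (c : X -> nat -> nat).
Hypothesis Hc : std c.
Variables (I : countType) (f : I -> X -> X) (F : X -> X -> Prop).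
Hypotheses (mf : moves f) (cF : covers f F) (BF : BR F).

Lemma covers_rtc : covers f (rtc F).
Proof.
case: mf => _ [i0 fi0] fc x y; elim=> [u v /cF//|u|u v w _ [i <-] _ [j <-]]; first by exists i0.
by have [k fk] := fc j i; exists k.
Qed.

Lemma BR_rtc : BR (rtc F).
Proof.
have [mfi _ _] := mf.
pose Rn := fix Rn n x y := if n is n'.+1 then exists i, F x (f i x) /\ Rn n' (f i x) y else x = y.
have RnE x y : rtc F x y <-> exists n, Rn n x y.
  split=> [/clos_rt_rt1n_iff|[n]].
    elim=> [u|u v w Fuv _ [n Hn]]; first by exists 0%N.
    by have [i e] := cF Fuv; exists n.+1, i; rewrite e.
  elim: n x => [|n IH] x /= => [->|[i [Fi /IH]]]; first exact: rtc_refl.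
  by apply: rtc_trans; exact: rtc_step.
apply: (BR_covers Hc mfi covers_rtc) => i.
apply: (@Bor_ext _ _ (fun x => exists n, Rn n x (f i x))); first by move=> x; rewrite RnE.
apply: BorEx => n.
(* Arbitrary Borel maps appear as arguments because each step of the path composes the first one
   with another [f j]. *)
suff H (g h : X -> X) : mX g -> mX h -> BX (fun x => Rn n (g x) (h x)) by apply: H.
elim: n g => [|n IH] g mg mh /=; first exact: (BX_eq Hc).
apply: BorEx => j; apply: BorA.
  by apply: (BR_mX Hc BF) => //; exact: mea_comp mg (mfi j).
by apply: IH => //; exact: mea_comp mg (mfi j).
Qed.

End Reach.

(** * Borel choice in the classes of a finite equivalence relation *)

Section Selector.
Variables (X : ptopologicalType) (c : X -> nat -> nat).
Hypothesis Hc : std c.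
Variables (I : countType) (f : I -> X -> X) (Q : X -> X -> Prop).
Hypotheses (mf : moves f) (cQ : covers f Q) (BQ : BR Q).
Hypotheses (Qrefl : forall x, Q x x) (Qsym : forall x y, Q x y -> Q y x)
  (Qtrans : forall x y z, Q x y -> Q y z -> Q x z) (Qfin : forall x, finite_set (Q x)).

Definition prefix (w : seq nat) (x : X) := forall i, (i < size w)%N -> c x i = nth 0%N w i.

Lemma BX_prefix w : BX (prefix w).
Proof. by apply: BorAll => i; apply: BorIc => _; exact: (BX_code Hc). Qed.

Lemma prefix_sep (A : set X) x : finite_set A -> exists w, prefix w x /\
  forall y, A y -> prefix w y -> y = x.
Proof.
move=> /finite_seqP[s ->]; elim: s => [|y s [w [wx Hw]]]; first by exists [::].
have ext v : size w <= v -> exists w', size w' = v /\ prefix w' x.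
  by move=> _; exists (mkseq (c x) v); rewrite size_mkseq; split=> // i; rewrite size_mkseq => iv; rewrite nth_mkseq.
have ref w' z : size w <= size w' -> prefix w' x -> prefix w' z -> prefix w z.
  by move=> ww' w'x w'z i iw; rewrite w'z -?w'x ?wx//; apply: leq_trans ww'.
have [yx|nyx] := pselect (y = x).
  by exists w; split=> // z; rewrite /= inE => /predU1P[->//|]; apply: Hw.
have [n cn] : exists n, c y n <> c x n.
  apply/not_existsP => H; apply: nyx; case: Hc => -[cI _] _ _; apply: cI; apply: funext => n.
  by have := H n => /contrapT.
have [w' [sw' w'x]] := ext (maxn (size w) n.+1) (leq_maxl _ _).
exists w'; split=> // z; rewrite /= inE => /predU1P[-> w'y|zs w'z].
  by case: cn; rewrite w'y ?w'x// sw' leq_maxr.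
by apply: Hw => //; apply: ref w'z => //; rewrite sw' leq_maxl.
Qed.

(** Each class takes the least code of a prefix and a label such that the prefix isolates in the
    class a single point carrying that label. The condition [W] depends only on the class, so all
    its points agree on the choice. *)
Lemma selector (K : countType) (V : K -> X -> Prop) :
  (forall k, BX (V k)) -> (forall x, exists y, Q x y /\ exists k, V k y) ->
  exists L : K -> X -> Prop,
  [/\ forall k, BX (L k), forall k x, L k x -> V k x,
      forall x, exists k y, Q x y /\ L k y
    & forall k k' x y, Q x y -> L k x -> L k' y -> k = k' /\ x = y].
Proof.
move=> BV exV; have [mfi _ _] := mf.
pose W (p : seq nat * K) x := exists y, [/\ Q x y, prefix p.1 y, V p.2 y & forall z, Q x z -> prefix p.1 z -> z = y].
have BW p : BX (W p).
  apply: (@Bor_ext _ _ (fun x => exists i, Q x (f i x) /\ (prefix p.1 (f i x) /\ (V p.2 (f i x) /\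
     forall j, Q x (f j x) -> prefix p.1 (f j x) -> f j x = f i x)))).
    move=> x; split=> [[i [? [? [? H]]]]|[y [Qxy py Vy H]]].
      by exists (f i x); split=> // z Qxz; have [j e] := cQ Qxz; rewrite -e in Qxz *; apply: H.
    by have [i iy] := cQ Qxy; exists i; rewrite iy; split=> //; split=> //; split=> // j; apply: H.
  apply: BorEx => i; apply: BorA; first by apply: (BR_mX Hc BQ) => //; exact: mea_id.
  apply: BorA; first exact: (mfi i _ (BX_prefix _)).
  apply: BorA; first exact: (mfi i _ (BV _)).
  apply: BorAll => j; apply: BorI; first by apply: (BR_mX Hc BQ) => //; exact: mea_id.
  by apply: BorI; [exact: (mfi j _ (BX_prefix _))|exact: (BX_eq Hc)].
have Winv p x y : Q x y -> W p x -> W p y.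
  move=> Qxy [z [Qxz pz Vz H]]; exists z; split=> //; first exact: Qtrans (Qsym Qxy) Qxz.
  by move=> t Qyt; apply: H; exact: Qtrans Qyt.
have Wex x : exists p, W p x.
  have [y [Qxy [k Vy]]] := exV x; have [w [wy Hw]] := prefix_sep y (Qfin x).
  by exists (w, k), y; split.
pose L k x := exists w, (W (w, k) x /\ forall q, (pickle q < pickle (w, k))%N -> ~ W q x) /\ prefix w x.
exists L; split.
- move=> k; apply: BorEx => w; apply: BorA; last exact: BX_prefix.
  by apply: BorA => //; apply: BorAll => q; apply: BorIc => _; apply: BorN.
- move=> k x [w [[[y [Qxy wy Vy H]] _] wx]].
  by rewrite (H x).
- move=> x; have [p0 Wp0] := Wex x.
  have ex : exists n, `[< exists2 p, pickle p = n & W p x >] by exists (pickle p0); apply/asboolP; exists p0.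
  have [n /asboolP[[w k] pn Wp] nmin] := ex_minnP ex.
  have [y [Qxy wy Vy H]] := Wp; exists k, y; split=> //; exists w; split=> //; split.
    exact: Winv Qxy Wp.
  move=> q qlt Wq; have /nmin : `[< exists2 p, pickle p = pickle q & W p x >].
    by apply/asboolP; exists q => //; exact: Winv (Qsym Qxy) Wq.
  by rewrite leqNgt -pn qlt.
- move=> k k' x y Qxy [w [[Wx mx] wx]] [w' [[Wy my] w'y]].
  have e : (w, k) = (w', k').
    apply: (pcan_inj pickleK); case: (ltngtP (pickle (w, k)) (pickle (w', k'))) => // lt.
      by case: (my _ lt); exact: Winv Wx.
    by case: (mx _ lt); exact: Winv (Qsym Qxy) Wy.
  case: e => e1 e2; subst w' k'; split=> //.
  have [z [Qxz _ _ H]] := Wx; rewrite (H x)//; apply/esym; exact: H.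
Qed.

End Selector.

(** * Finite even graphs as lists of edges *)

Section EdgeLists.
Variable V : eqType.
Implicit Types (r d : seq (V * V)) (u v w : V).

Definition deg r v := count (fun e => e.1 == v) r + count (fun e => e.2 == v) r.

Lemma deg_cons e r v : deg (e :: r) v = (e.1 == v) + (e.2 == v) + deg r v.
Proof. by rewrite /deg /=; lia. Qed.

Lemma deg_cat r r' v : deg (r ++ r') v = deg r v + deg r' v.
Proof. by rewrite /deg !count_cat; lia. Qed.

Lemma deg_perm r r' v : perm_eq r r' -> deg r v = deg r' v.
Proof. by move=> /permP p; rewrite /deg !p. Qed.

Definition fl (b : V * V -> bool) (e : V * V) := if b e then (e.2, e.1) else e.

(* Following edges from [v] until the walk is stuck can only end at [u]. *)
Lemma euler_trail r u v : uniq r -> (forall w, odd (deg r w) = (w == u) (+) (w == v)) ->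
  exists b, forall w, count (fun e => (fl b e).1 == w) r + (w == u) =
                      count (fun e => (fl b e).2 == w) r + (w == v).
Proof.
move: {2}(size r) (leqnn (size r)) => n; elim: n r u v => [|n IH] r u v.
  case: r => // _ _ H; exists (fun=> false) => w /=; have := H w; rewrite /deg /=.
  by case: eqP; case: eqP.
move=> sr ur H.
(* One edge is oriented from [a] to [b'], and the rest is left to the induction with endpoints [u'],
   [v'] that restore the parity condition. *)
have step e b0 a b' : e \in r -> (a, b') = fl b0 e ->
    (forall w, odd (deg (rem e r) w) = (w == u) (+) (w == v) (+) (w == a) (+) (w == b')) ->
    forall u' v', (forall w, (w == u) (+) (w == v) (+) (w == a) (+) (w == b') = (w == u') (+) (w == v')) ->
    exists b, forall w, exists c1 c2, [/\ count (fun e => (fl b e).1 == w) r = (a == w) + c1,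
       count (fun e => (fl b e).2 == w) r = (b' == w) + c2 & c1 + (w == u') = c2 + (w == v')].
  move=> er ab par u' v' Huv.
  have [||b Hb] := IH (rem e r) u' v' _ (rem_uniq _ ur).
  + by rewrite size_rem//; case: (r) er sr.
  + by move=> w; rewrite par Huv.
  exists (fun e' => if e' == e then b0 e else b e') => w; exists (count (fun e => (fl b e).1 == w) (rem e r)).
  exists (count (fun e => (fl b e).2 == w) (rem e r)).
  have fle : fl (fun e' => if e' == e then b0 e else b e') e = (a, b') by rewrite ab /fl eqxx.
  have ner e' : e' \in rem e r -> fl (fun e' => if e' == e then b0 e else b e') e' = fl b e'.
    by rewrite mem_rem_uniq// inE => /andP[/negbTE ne _]; rewrite /fl ne.
  split; last exact: Hb.
    rewrite (permP (perm_to_rem er)) /= fle; congr (_ + _); apply: eq_in_count => e' /ner -> //.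
  rewrite (permP (perm_to_rem er)) /= fle; congr (_ + _); apply: eq_in_count => e' /ner -> //.
have par e b0 a b' : e \in r -> (a, b') = fl b0 e ->
    forall w, odd (deg (rem e r) w) = (w == u) (+) (w == v) (+) (w == a) (+) (w == b').
  move=> er ab w; have := H w; rewrite (deg_perm w (perm_to_rem er)) deg_cons !oddD.
  have -> : odd (e.1 == w) (+) odd (e.2 == w) = (w == a) (+) (w == b').
    case: e {er} ab => x y; rewrite /fl /=; case: (b0 _) => -[-> ->];
    by rewrite ![w == _]eq_sym !oddb // addbC.
  by move=> <-; case: (w == a); case: (w == b'); case: (odd _); case: (odd _).
(* When the endpoints agree the walk is closed, and any remaining edge starts the next closed
   walk. *)
have [uv|nuv] := eqVneq u v.
  case: r sr ur H step par => [|e r] sr ur H step par; first by exists (fun=> false) => w; rewrite uv.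
  have e0 : (e.1, e.2) = fl (fun=> false) e by case: (e).
  have [||b Hb] := step e (fun=> false) e.1 e.2 (mem_head _ _) e0 _ e.1 e.2.
  + exact: (par e (fun=> false) e.1 e.2 (mem_head _ _) e0).
  + by move=> w; rewrite uv addbb.
  exists b => w; have [c1 [c2 [-> -> +]]] := Hb w.
  by rewrite uv ![_ == w]eq_sym; lia.
have : odd (deg r v) by rewrite H eqxx eq_sym (negbTE nuv).
case: (boolP (has (fun e => (e.1 == v) || (e.2 == v)) r)) => [/hasP[e er ev] _|/hasPn nr]; last first.
  have z (p : pred (V * V)) : {in r, forall e, ~~ p e} -> count p r = 0.
    by move=> np; apply/eqP; rewrite -leqn0 leqNgt -has_count; apply/hasPn.
  by rewrite /deg !z// => e /nr; rewrite negb_or => /andP[].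
(* The next edge leaves [v], and its other end takes the place of [v]. *)
pose b0 := fun e : V * V => e.1 != v.
have e0 : (v, (fl b0 e).2) = fl b0 e.
  by move: ev; rewrite /fl /b0; case: (e) => x y /=; have [->//|_ /= /eqP ->] := eqVneq x v.
have [||b Hb] := step e b0 v (fl b0 e).2 er e0 _ u (fl b0 e).2.
+ exact: (par e b0 v (fl b0 e).2 er e0).
+ by move=> w; case: (w == u); case: (w == v); case: (w == _).
exists b => w; have [c1 [c2 [-> -> +]]] := Hb w.
by rewrite ![_ == w]eq_sym; lia.
Qed.

Definition simple_list r := uniq r /\ forall e, e \in r -> (e.2, e.1) \notin r.

Lemma graph_list (P : V -> V -> Prop) (s : seq V) :
  (forall u v, P u v -> P v u) -> (forall u, ~ P u u) -> (forall u v, P u v -> u \in s) ->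
  exists r, simple_list r /\ forall u v, P u v <-> (u, v) \in r \/ (v, u) \in r.
Proof.
move=> Psym Pirr Ps.
exists [seq e <- [seq (u, v) | u <- undup s, v <- undup s] | `[< P e.1 e.2 >] && (index e.1 s < index e.2 s)].
split.
  split=> [|e].
    by rewrite filter_uniq// allpairs_uniq ?undup_uniq// => -[? ?] [? ?].
  by rewrite !mem_filter /= => /andP[/andP[_ lt] _]; rewrite ltnNge (ltnW lt) andbF.
move=> u v; split=> [Puv|[]]; last 2 first.
- by rewrite mem_filter => /andP[/andP[/asboolP]].
- by rewrite mem_filter => /andP[/andP[/asboolP/Psym]].
have us := Ps _ _ Puv; have vs := Ps _ _ (Psym _ _ Puv).
have [lt|lt|e] := ltngtP (index u s) (index v s).
- left; rewrite mem_filter /= lt andbT; apply/andP; split; first exact/asboolP.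
  by apply/allpairsP; exists (u, v); rewrite /= !mem_undup.
- right; rewrite mem_filter /= lt andbT; apply/andP; split; first exact/asboolP/Psym.
  by apply/allpairsP; exists (v, u); rewrite /= !mem_undup.
- have uv : u = v by rewrite -(nth_index u us) e nth_index.
  by case: (Pirr u); rewrite {2}uv.
Qed.

Lemma deg_nbrs r v (N : seq V) : simple_list r -> uniq N ->
  (forall y, (y \in N) = ((v, y) \in r) || ((y, v) \in r)) -> deg r v = size N.
Proof.
move=> [ur ar] uN HN.
suff /perm_size -> : perm_eq N (map snd [seq e <- r | e.1 == v] ++ map fst [seq e <- r | e.2 == v]).
  by rewrite size_cat !size_map !size_filter.
apply: uniq_perm => //.
  rewrite cat_uniq !map_inj_in_uniq ?filter_uniq//; last 2 first.
  - move=> [a b] [a' b']; rewrite !mem_filter /= => /andP[/eqP -> _] /andP[/eqP -> _] -> //.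
  - move=> [a b] [a' b']; rewrite !mem_filter /= => /andP[/eqP -> _] /andP[/eqP -> _] -> //.
  rewrite andbT /=; apply/hasPn => y /mapP[[a b]]; rewrite mem_filter /= => /andP[/eqP -> abr] ->.
  apply/negP => /mapP[[a' b']]; rewrite mem_filter /= => /andP[/eqP -> abr'] e.
  by subst b'; have /= := ar _ abr; rewrite abr'.
move=> y; rewrite HN mem_cat; congr (_ || _).
  by apply/idP/mapP => [yr|[[a b]]]; [exists (v, y); rewrite ?mem_filter /= ?eqxx|rewrite mem_filter /= => /andP[/eqP -> ?] ->].
by apply/idP/mapP => [yr|[[a b]]]; [exists (y, v); rewrite ?mem_filter /= ?eqxx|rewrite mem_filter /= => /andP[/eqP -> ?] ->].
Qed.

End EdgeLists.

Lemma card_seq (T : choiceType) (A : set T) (s : seq T) :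
  uniq s -> (forall x, A x <-> x \in s) -> (A #= `I_(size s))%card.
Proof.
move=> us As; have -> : A = [set` [fset x in s]%fset].
  by apply/seteqP; split=> x /=; rewrite inE As.
by apply/card_eq_fsetP; rewrite card_fseq undup_id.
Qed.

Lemma card_seq_size (T : choiceType) (A : set T) (s : seq T) n :
  uniq s -> (forall x, A x <-> x \in s) -> (A #= `I_n)%card -> size s = n.
Proof.
move=> us As An; apply/card_eq_II; apply: card_eq_trans An.
by rewrite card_eq_sym; exact: card_seq.
Qed.

(** Adds up in-degrees and out-degrees over the countably many pieces: a finite union of disjoint
    sets has finitely many nonempty terms, so a finite sum of sizes computes both sides. *)
Lemma card_bigcup (T : choiceType) (A B : nat -> set T) :
  (forall n m x, A n x -> A m x -> n = m) -> (forall n m x, B n x -> B m x -> n = m) ->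
  (forall n, (A n #= B n)%card) -> finite_set (\bigcup_n A n) -> finite_set (\bigcup_n B n) ->
  (\bigcup_n A n #= \bigcup_n B n)%card.
Proof.
move=> dA dB AB /finite_seqP[s As] /finite_seqP[t Bt].
have lst (C : nat -> set T) (l : seq T) n : \bigcup_n C n = [set` l] -> (C n #= `I_(size [seq x <- undup l | `[< C n x >]]))%card.
  move=> Cl; apply: card_seq; first by rewrite filter_uniq// undup_uniq.
  move=> x; rewrite mem_filter mem_undup; split=> [Cx|/andP[/asboolP]//].
  by apply/andP; split; [exact/asboolP|have : (\bigcup_n C n) x by [exists n]; rewrite Cl].
have sz (C : nat -> set T) (l : seq T) : (forall n m x, C n x -> C m x -> n = m) -> \bigcup_n C n = [set` l] ->
    exists N0, forall N, (N0 <= N)%N -> size (undup l) = \sum_(n < N) size [seq x <- undup l | `[< C n x >]].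
  move=> dC Cl.
  have /choice[g Hg] : forall x, exists n, x \in l -> C n x.
    move=> x; case: (boolP (x \in l)) => [xl|_]; last by exists 0%N.
    by have [n _ Cx] : (\bigcup_n C n) x by [rewrite Cl]; exists n.
  exists (\max_(x <- undup l) (g x).+1) => N NN0.
  rewrite -sum1_size (eq_bigr (fun n : 'I_N => \sum_(x <- undup l | `[< C n x >]) 1)%N); last first.
    by move=> n _; rewrite -big_filter sum1_size.
  rewrite (exchange_big_dep predT)//=; apply: eq_big_seq => x xl.
  have gx : (g x < N)%N by apply: leq_trans NN0; apply: (leq_bigmax_seq (F := fun x => (g x).+1)).
  rewrite (bigD1 (Ordinal gx)) /=; last by apply/asboolP; apply: Hg; rewrite -mem_undup.
  rewrite big1// => n /andP[/asboolP Cx /eqP]; case; apply/val_inj => /=.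
  by apply: dC Cx _; apply: Hg; rewrite -mem_undup.
have [N1 H1] := sz _ _ dA As; have [N2 H2] := sz _ _ dB Bt.
have e : size (undup s) = size (undup t).
  rewrite (H1 (maxn N1 N2)) ?leq_maxl// (H2 (maxn N1 N2)) ?leq_maxr//; apply: eq_bigr => n _.
  apply/card_eq_II; apply: card_eq_trans (lst _ _ n Bt).
  by apply: card_eq_trans (AB n); rewrite card_eq_sym; exact: lst As.
apply: (@card_eq_trans _ _ _ _ `I_(size (undup s))); first by apply: card_seq; rewrite ?undup_uniq// As => x; rewrite mem_undup.
by rewrite card_eq_sym e; apply: card_seq; rewrite ?undup_uniq// Bt => x; rewrite mem_undup.
Qed.

(** * Borel balanced orientations of graphs with finite components *)

Definition even_rel (X : Type) (F : X -> X -> Prop) :=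
  forall x, exists n, ([set y | F x y] #= `I_n.*2)%card.

Definition orients (X : Type) (F O : X -> X -> Prop) :=
  (forall x y, O x y -> F x y) /\
  (forall x y, F x y -> (O x y /\ ~ O y x) \/ (O y x /\ ~ O x y)).

Definition balanced_rel (X : Type) (O : X -> X -> Prop) :=
  forall x, ([set y | O y x] #= [set y | O x y])%card.

Section FiniteComponents.
Variables (X : ptopologicalType) (c : X -> nat -> nat).
Hypothesis Hc : std c.
Variables (I : countType) (f : I -> X -> X) (F : X -> X -> Prop).
Hypotheses (mf : moves f) (cF : covers f F) (BF : BR F).
Hypotheses (Fsym : forall x y, F x y -> F y x) (Firr : forall x, ~ F x x)
  (Ffin : forall x, finite_set (rtc F x)) (Feven : even_rel F).

Let supp (d : seq (I * I)) := map fst d ++ map snd d.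

(* [d] codes a balanced orientation of the component of [x] by directed edges
   from [f a x] to [f b x]. *)
Let V (d : seq (I * I)) (x : X) :=
  ((uniq d /\ (forall p, p \in d -> (p.2, p.1) \notin d) /\
    forall a, count (fun p => p.1 == a) d = count (fun p => p.2 == a) d) /\
   (forall i j, i \in supp d -> j \in supp d -> f i x = f j x -> i = j)) /\
  ((forall p, p \in d -> F (f p.1 x) (f p.2 x)) /\
   (forall i j, rtc F x (f i x) -> F (f i x) (f j x) ->
     exists p, p \in d /\ ((f p.1 x = f i x /\ f p.2 x = f j x) \/ (f p.2 x = f i x /\ f p.1 x = f j x)))).

Let BV d : BX (V d).
Proof.
have [mfi _ _] := mf.
apply: BorA; first (apply: BorAc => _; do 2 (apply: BorAll => ?)).
  by apply: BorIc => _; apply: BorIc => _; apply: BorI; [exact: (BX_eq Hc)|exact: Bor_cst].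
apply: BorA; first by apply: BorAll => p; apply: BorIc => _; exact: (BR_mX Hc BF).
do 2 (apply: BorAll => ?); apply: BorI.
  by apply: (BR_mX Hc (BR_rtc Hc mf cF BF)) => //; exact: mea_id.
apply: BorI; first exact: (BR_mX Hc BF).
apply: BorEx => p; apply: BorAc => _.
by apply: BorO; apply: BorA; exact: (BX_eq Hc).
Qed.

(** The component of [x] is a finite graph with even degrees, so [euler_trail] with equal endpoints
    gives a balanced orientation; a choice of one index for every vertex turns it into a code. *)
Let exV x : exists d, V d x.
Proof.
have [s Hs] := (finite_seqP _).1 (Ffin x).
have Ps y : rtc F x y <-> y \in s by split; [move=> h; have : [set` s] y by rewrite -Hs|move=> ys; have : [set` s] y by []; rewrite -Hs].
pose P y z := rtc F x y /\ F y z.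
have Psym y z : P y z -> P z y.
  by move=> [xy yz]; split; [apply: rtc_trans xy (rtc_step yz)|exact: Fsym].
have [r [[ur ar] rP]] : exists r, simple_list r /\ forall u v, P u v <-> (u, v) \in r \/ (v, u) \in r.
  by apply: (@graph_list _ P s) => // [u [_ /Firr]|u v [/Ps]].
have [b Hb] : exists b, forall w, count (fun e => (fl b e).1 == w) r + (w == x) = count (fun e => (fl b e).2 == w) r + (w == x).
  apply: euler_trail => // w; rewrite addbb.
  have [ws|nws] := boolP (w \in s); last first.
    have nr e : e \in r -> e.1 != w /\ e.2 != w.
      case: e => u v /= er; have [uw _] : P u v by apply/rP; left.
      have [vw _] : P v u by apply/rP; right.
      by split; apply/negP => /eqP e; move: nws => /negP; apply; rewrite -e; apply/Ps.
    have z (p : pred (X * X)) : {in r, forall e, ~~ p e} -> count p r = 0.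
      by move=> np; apply/eqP; rewrite -leqn0 leqNgt -has_count; apply/hasPn.
    by rewrite /deg !z// => e /nr[].
  have [n Fn] := Feven w.
  have [N uN HN] : exists2 N, uniq N & forall y, F w y <-> y \in N.
    exists [seq y <- undup s | `[< F w y >]]; first by rewrite filter_uniq// undup_uniq.
    move=> y; rewrite mem_filter mem_undup; split=> [Fwy|/andP[/asboolP]//].
    apply/andP; split; first exact/asboolP.
    by apply/Ps; apply: rtc_trans (rtc_step Fwy); apply/Ps.
  rewrite (deg_nbrs (N := N))//; last first.
    move=> y; apply/idP/orP => [/HN Fwy|/rP[_ /HN]//].
    by apply/rP; split=> //; apply/Ps.
  by rewrite (card_seq_size uN HN Fn) odd_double.
have /choice[idx Hidx] : forall y, exists i, y \in s -> f i x = y.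
  move=> y; have [ys|_] := boolP (y \in s); last by have [_ [i _] _] := mf; exists i.
  by have [i e] := covers_rtc mf cF ((Ps y).2 ys); exists i.
have rs e : e \in r -> e.1 \in s /\ e.2 \in s.
  case: e => u v er; have [/Ps us _] : P u v by apply/rP; left.
  by have [/Ps vs _] : P v u by apply/rP; right.
have fls e : e \in r -> (fl b e).1 \in s /\ (fl b e).2 \in s.
  by move=> /rs; rewrite /fl; case: (b e) => -[].
have flP e : e \in r -> F (fl b e).1 (fl b e).2.
  case: e => u v er; have [_ Fuv] : P u v by apply/rP; left.
  by rewrite /fl; case: (b _) => //=; exact: Fsym.
have idxI : {in s &, injective idx} by move=> y z ys zs e; rewrite -(Hidx y ys) e Hidx.
pose g e := (idx (fl b e).1, idx (fl b e).2).
have cnt (h : X * X -> X) (p : I * I -> I) : (forall e, p (g e) = idx (h (fl b e))) -> (forall e, e \in r -> h (fl b e) \in s) ->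
    forall y, y \in s -> count (fun q => p q == idx y) (map g r) = count (fun e => h (fl b e) == y) r.
  move=> pg hs y ys; rewrite count_map; apply: eq_in_count => e er /=; rewrite pg.
  by apply/eqP/eqP => [/idxI|->//]; apply=> //; exact: hs.
have cnt0 (p : I * I -> I) a : (forall y, y \in s -> a <> idx y) -> (forall e, e \in r -> exists2 y, y \in s & p (g e) = idx y) ->
    count (fun q => p q == a) (map g r) = 0.
  move=> na pg; apply/eqP; rewrite -leqn0 leqNgt -has_count; apply/hasPn => _ /mapP[e er ->].
  by have [y ys ->] := pg e er; apply/negP => /eqP/esym; exact: na.
have flI : {in r &, injective g}.
  move=> e e' er er'; have [s1 s2] := fls _ er; have [s1' s2'] := fls _ er'.
  move=> [/idxI e1 /idxI e2]; have {e1} e1 := e1 s1 s1'; have {e2} e2 := e2 s2 s2'.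
  move: e1 e2; rewrite /fl; case: (b e); case: (b e') => /=.
  - by case: (e); case: (e') => ? ? ? ? /= -> ->.
  - move=> e1 e2; have := ar _ er; rewrite e1 e2; case: (e') er' => ? ? /= -> //.
  - move=> e1 e2; have := ar _ er'; rewrite -e1 -e2; case: (e) er => ? ? /= -> //.
  - by case: (e); case: (e') => ? ? ? ? /= -> ->.
exists (map g r); split; split; first split.
- by rewrite map_inj_in_uniq.
- split=> [_ /mapP[e er ->]|a].
    apply/negP => /mapP[e' er' [/idxI e1 /idxI e2]].
    have [s1 s2] := fls _ er; have [s1' s2'] := fls _ er'.
    have {e1} e1 := e1 s2 s1'; have {e2} e2 := e2 s1 s2'.
    move: e1 e2; rewrite /fl; case be: (b e); case be': (b e') => /=.
    + by move=> e1 e2; have := ar _ er'; rewrite -e1 -e2; case: (e) er => ? ? /= ->.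
    + move=> e1 e2; have ee : e = e' by move: e1 e2; case: (e); case: (e') => ? ? ? ? /= -> ->.
      by rewrite ee be' in be.
    + move=> e1 e2; have ee : e = e' by move: e1 e2; case: (e); case: (e') => ? ? ? ? /= -> ->.
      by rewrite ee be' in be.
    + by move=> e1 e2; have := ar _ er'; rewrite -e1 -e2; case: (e) er => ? ? /= ->.
  have [[y [ys ->]]|na] := pselect (exists y, y \in s /\ a = idx y).
    rewrite (cnt fst fst)// ?(cnt snd snd)//; [|by move=> e /fls[]|by move=> e /fls[]].
    by apply/eqP; rewrite -(eqn_add2r (y == x)) Hb.
  have na' y : y \in s -> a <> idx y by move=> ys e; apply: na; exists y.
  by rewrite !cnt0// => e /fls[s1 s2]; [exists (fl b e).2|exists (fl b e).1].
- have hs i : i \in supp (map g r) -> exists2 y, y \in s & i = idx y.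
    rewrite mem_cat => /orP[] /mapP[_ /mapP[e er ->]] ->; have [s1 s2] := fls _ er.
      by exists (fl b e).1.
    by exists (fl b e).2.
  by move=> i j /hs[y ys ->] /hs[z zs ->]; rewrite !Hidx// => ->.
- by move=> _ /mapP[e er ->] /=; have [s1 s2] := fls _ er; rewrite !Hidx//; exact: flP.
- move=> i j xi Fij; have Pij : P (f i x) (f j x) by [].
  have is_ : f i x \in s by apply/Ps.
  have js : f j x \in s by apply/Ps; exact: rtc_trans xi (rtc_step Fij).
  have [er|er] := (rP _ _).1 Pij.
    exists (g (f i x, f j x)); split; first exact: map_f.
    by rewrite /g /fl; case: (b _) => /=; rewrite !Hidx//; [right|left].
  exists (g (f j x, f i x)); split; first exact: map_f.
  by rewrite /g /fl; case: (b _) => /=; rewrite !Hidx//; [left|right].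
Qed.

(** [selector] picks one base point and one code in each component, and all edges of the component
    follow that code. As [V] makes the coding injective on the indices that occur, the balance of
    counts in [d] passes from indices to vertices. *)
Lemma finite_components_orientation :
  exists O : X -> X -> Prop, [/\ BR O, orients F O & balanced_rel O].
Proof.
have [mfi [i0 fi0] fc] := mf.
have BQ := BR_rtc Hc mf cF BF; have cQ := covers_rtc mf cF.
have Qsym := rtc_sym Fsym.
have [L [BL LV exL uL]] : exists L : seq (I * I) -> X -> Prop, [/\ forall k, BX (L k), forall k x, L k x -> V k x,
      forall x, exists k y, rtc F x y /\ L k y
    & forall k k' x y, rtc F x y -> L k x -> L k' y -> k = k' /\ x = y].
  apply: (@selector _ c Hc _ f (rtc F)) => //; [exact: rtc_refl|by move=> x y z; exact: rtc_trans|].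
  by move=> x; exists x; split; [exact: rtc_refl|exact: exV].
pose O x y := exists d l, (rtc F x l /\ L d l) /\ exists p, p \in d /\ (f p.1 l = x /\ f p.2 l = y).
have OF x y : O x y -> F x y.
  by move=> [d [l [[_ /LV[_ [dF _]]] [p [pd [<- <-]]]]]]; exact: dF.
have HO d l : L d l -> forall x y, rtc F x l -> O x y <-> exists p, p \in d /\ (f p.1 l = x /\ f p.2 l = y).
  move=> Ll x y xl; split=> [[d' [l' [[xl' Ll'] H]]]|H]; last by exists d, l.
  by have [-> ->] := uL _ _ _ _ (rtc_trans (Qsym _ _ xl) xl') Ll Ll'.
exists O; split.
- apply: (BR_covers Hc mfi) => [x y /OF/cF//|i].
  apply: (@Bor_ext _ _ (fun x => exists d j, (rtc F x (f j x) /\ L d (f j x)) /\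
      exists p, p \in d /\ (f p.1 (f j x) = x /\ f p.2 (f j x) = f i x))).
    move=> x; split=> [[d [j H]]|[d [l [[xl Ll] H]]]]; first by exists d, (f j x).
    by have [j jl] := cQ _ _ xl; exists d, j; rewrite jl.
  have mc j k : mX (fun x => f j (f k x)) by exact: mea_comp (mfi k) (mfi j).
  do 2 (apply: BorEx => ?); apply: BorA.
    apply: BorA; last exact: (mfi _ _ (BL _)).
    by apply: (BR_mX Hc BQ) => //; exact: mea_id.
  apply: BorEx => p; apply: BorAc => _; apply: BorA; apply: (BX_eq Hc) => //; exact: mea_id.
- split=> // x y Fxy; have [d [l [xl Ll]]] := exL x.
  have [[[ud [ad cd]] injd] [dF dC]] := LV _ _ Ll.
  have lx := Qsym _ _ xl; have ly := rtc_trans lx (rtc_step Fxy).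
  have [i ix] := cQ _ _ lx; have [j jy] := cQ _ _ ly.
  have sup p : p \in d -> (p.1 \in supp d) /\ (p.2 \in supp d) by move=> pd; rewrite !mem_cat !map_f ?orbT.
  have OE := HO _ _ Ll.
  have nrev p q : p \in d -> q \in d -> f p.1 l = f q.2 l -> f p.2 l = f q.1 l -> False.
    move=> pd qd /(injd _ _ (sup _ pd).1 (sup _ qd).2) e1 /(injd _ _ (sup _ pd).2 (sup _ qd).1) e2.
    by have := ad _ pd; rewrite e1 e2 -surjective_pairing qd.
  have [p [pd]] : exists p, p \in d /\ ((f p.1 l = x /\ f p.2 l = y) \/ (f p.2 l = x /\ f p.1 l = y)).
    by rewrite -ix -jy; apply: dC; rewrite ?ix ?jy.
  have yl := Qsym _ _ ly.
  case=> -[p1 p2]; [left|right]; split.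
  + by apply/(OE _ _ xl); exists p.
  + by move=> /(OE _ _ yl)[q [qd [q1 q2]]]; apply: (nrev p q); rewrite ?p1 ?p2.
  + by apply/(OE _ _ yl); exists p.
  + by move=> /(OE _ _ xl)[q [qd [q1 q2]]]; apply: (nrev p q); rewrite ?p1 ?p2.
- move=> x; have [d [l [xl Ll]]] := exL x.
  have [[[ud [ad cd]] injd] [dF dC]] := LV _ _ Ll; have OE := HO _ _ Ll.
  have lx := Qsym _ _ xl.
  have Oi y : O y x <-> exists p, p \in d /\ (f p.1 l = y /\ f p.2 l = x).
    have yl : F y x -> rtc F y l by move=> Fyx; apply: rtc_trans (rtc_step Fyx) xl.
    split=> [Oyx|H]; first exact/(OE _ _ (yl (OF _ _ Oyx))).
    have [p [pd [py px]]] := H; apply/OE => //; apply: yl.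
    by rewrite -py -px; exact: dF.
  have [[a [ad' ax]]|na] := pselect (exists a, a \in supp d /\ f a l = x); last first.
    have n1 p : p \in d -> f p.1 l <> x by move=> pd e; apply: na; exists p.1; rewrite mem_cat map_f.
    have n2 p : p \in d -> f p.2 l <> x by move=> pd e; apply: na; exists p.2; rewrite mem_cat map_f ?orbT.
    apply: (@card_eq_trans _ _ _ _ `I_(size ([::] : seq X))).
      by apply: card_seq => // y; split=> // /Oi[p [/n2 h [_ /h]]].
    by rewrite card_eq_sym; apply: card_seq => // y; split=> // /(OE _ _ xl)[p [/n1 h [/h]]].
  have sup p : p \in d -> (p.1 \in supp d) /\ (p.2 \in supp d) by move=> pd; rewrite !mem_cat !map_f ?orbT.
  have inj2 p q : p \in d -> q \in d -> f p.1 l = f q.1 l -> f p.2 l = f q.2 l -> p = q.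
    move=> pd qd /(injd _ _ (sup _ pd).1 (sup _ qd).1) e1 /(injd _ _ (sup _ pd).2 (sup _ qd).2) e2.
    by rewrite [p]surjective_pairing e1 e2 -surjective_pairing.
  have ain p : p \in d -> (f p.1 l = x <-> p.1 = a) /\ (f p.2 l = x <-> p.2 = a).
    move=> pd; have [s1 s2] := sup _ pd; rewrite -ax.
    by split; split=> [/injd|->//]; exact.
  apply: (@card_eq_trans _ _ _ _ `I_(size [seq f p.1 l | p <- d & p.2 == a])).
    apply: card_seq.
      rewrite map_inj_in_uniq ?filter_uniq// => p q; rewrite !mem_filter => /andP[/eqP p2 pd] /andP[/eqP q2 qd] e.
      by apply: inj2 => //; rewrite p2 q2.
    move=> y /=; rewrite Oi; split=> [[p [pd [<- px]]]|/mapP[p]].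
      by apply: map_f; rewrite mem_filter pd andbT; apply/eqP; apply: (ain p pd).2.1.
    by rewrite mem_filter => /andP[/eqP p2 pd] ->; exists p; split=> //; split=> //; apply: (ain p pd).2.2.
  rewrite size_map size_filter -cd -size_filter -(size_map (fun p => f p.2 l)) card_eq_sym.
  apply: card_seq.
    rewrite map_inj_in_uniq ?filter_uniq// => p q; rewrite !mem_filter => /andP[/eqP p2 pd] /andP[/eqP q2 qd] e.
    by apply: inj2 => //; rewrite p2 q2.
  move=> y /=; rewrite (OE _ _ xl); split=> [[p [pd [px <-]]]|/mapP[p]].
    by apply: (map_f (fun p => f p.2 l)); rewrite mem_filter pd andbT; apply/eqP; apply: (ain p pd).1.1.
  by rewrite mem_filter => /andP[/eqP p2 pd] ->; exists p; split=> //; split=> //; apply: (ain p pd).1.2.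
Qed.

End FiniteComponents.

(** * Decomposition into finite even graphs *)

Section Decomposition.
Variables (X : ptopologicalType) (c : X -> nat -> nat).
Hypothesis Hc : std c.
Variables (I : countType) (f : I -> X -> X).
Hypothesis mf : moves f.

Definition piece (F : X -> X -> Prop) :=
  [/\ covers f F, BR F, forall x y, F x y -> F y x, forall x, finite_set (rtc F x) & even_rel F].

Lemma decomposition (E : X -> X -> Prop) (F : nat -> X -> X -> Prop) :
  (forall x, ~ E x x) -> (forall x, finite_set (E x)) ->
  (forall n, piece (F n)) -> (forall n m x y, F n x y -> F m x y -> n = m) ->
  (forall x y, E x y <-> exists n, F n x y) ->
  exists O : X -> X -> Prop, [/\ BR O, orients E O & balanced_rel O].
Proof.
move=> Eirr Efin pF dF EF.
have /choice [Or HO] : forall n, exists O : X -> X -> Prop, [/\ BR O, orients (F n) O & balanced_rel O].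
  move=> n; have [h1 h2 h3 h4 h5] := pF n; apply: (finite_components_orientation Hc mf h1 h2 h3) => //.
  by move=> x Fx; apply: (Eirr x); apply/EF; exists n.
have OF n x y : Or n x y -> F n x y by have [_ [h _] _] := HO n; exact: h.
have Fs n x y : F n x y -> F n y x by have [_ _ h _ _] := pF n; exact: h.
have EO x y : (exists n, Or n x y) -> E x y by move=> [n /OF h]; apply/EF; exists n.
have Es x y : E x y -> E y x by move=> /EF[n /Fs h]; apply/EF; exists n.
exists (fun x y => exists n, Or n x y); split.
- by apply: BorEx => n; have [] := HO n.
- split=> // x y /EF[n Fxy]; have [_ [_ /(_ _ _ Fxy) ori] _] := HO n.
  have u m u v : Or m u v -> (F n u v \/ F n v u) -> m = n.
    by move=> /OF h [h'|/Fs h']; exact: dF h h'.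
  by case: ori => -[h nh]; [left|right]; split; try (by exists n); move=> [m Om];
    have mn := u m _ _ Om; rewrite mn in Om => //; auto.
- move=> x.
  rewrite (_ : [set y | exists n, Or n y x] = \bigcup_n [set y | Or n y x]); last first.
    by apply/seteqP; split=> y; [move=> [n ?]; exists n|move=> [n _ ?]; exists n].
  rewrite (_ : [set y | exists n, Or n x y] = \bigcup_n [set y | Or n x y]); last first.
    by apply/seteqP; split=> y; [move=> [n ?]; exists n|move=> [n _ ?]; exists n].
  apply: card_bigcup.
  + by move=> n m y /= /OF h /OF h'; exact: dF h h'.
  + by move=> n m y /= /OF h /OF h'; exact: dF h h'.
  + by move=> n; have [_ _] := HO n.
  + by apply: sub_finite_set (Efin x) => y [n _ /= h]; apply: Es; apply: EO; exists n.
  + by apply: sub_finite_set (Efin x) => y [n _ /= h]; apply: EO; exists n.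
Qed.

End Decomposition.

(** * Mod 2 chains and rerouting *)

Definition isolated (X : Type) (E : X -> X -> Prop) x := forall y, ~ E x y.

Lemma nisolated (X : Type) (E : X -> X -> Prop) x : ~ isolated E x -> exists y, E x y.
Proof. by move=> /existsNP[y /contrapT]; exists y. Qed.

Definition within (X : Type) (E : X -> X -> Prop) (A : X -> Prop) (x y : X) := E x y /\ (A x /\ A y).

Lemma within_sym (X : Type) (E : X -> X -> Prop) A : (forall x y, E x y -> E y x) ->
  forall x y, within E A x y -> within E A y x.
Proof. by move=> sE x y [/sE ? [? ?]]. Qed.

Section Chains.
Variable X : choiceType.
Implicit Types (d : seq (X * X)) (E F G : X -> X -> Prop).

(** A list of edges stands for a chain modulo 2 and [par d] for its support; directions are ignored
    and concatenation is addition. *)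
Definition par d (u v : X) := odd (count (fun e => (e == (u, v)) || (e == (v, u))) d).

Lemma par_sym d u v : par d u v = par d v u.
Proof. by rewrite /par; congr odd; apply: eq_count => e; rewrite orbC. Qed.

Lemma par_cat d d' u v : par (d ++ d') u v = par d u v (+) par d' u v.
Proof. by rewrite /par count_cat oddD. Qed.

Lemma par_mem d u v : par d u v -> (u, v) \in d \/ (v, u) \in d.
Proof.
move=> p; have : has (fun e => (e == (u, v)) || (e == (v, u))) d.
  by rewrite has_count; move: p; rewrite /par; case: count.
by move=> /hasP[e ed /orP[]/eqP <-]; [left|right].
Qed.

Lemma par_simple r u v : simple_list r -> u <> v -> par r u v <-> (u, v) \in r \/ (v, u) \in r.
Proof.
move=> [ur ar] uv; split=> [/par_mem//|H].
wlog uvr : u v uv {H} / (u, v) \in r.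
  by move=> W; case: H => h; [exact: W|rewrite par_sym; apply: W h; exact: nesym].
have vur : (v, u) \notin r by have := ar _ uvr.
rewrite /par (eq_in_count (a2 := pred1 (u, v))) ?count_uniq_mem// ?uvr// => e er /=.
by case: (e =P (v, u)) er => [->|_] er; rewrite ?orbF//; move: vur; rewrite er.
Qed.

(** Edges of even multiplicity cancel without changing the parity of a degree. Both sides are
    additive modulo 2 in [d], so it is enough to add the edges one at a time. *)
Lemma par_nbrs d u (N : seq X) : (forall e, e \in d -> e.1 != e.2) ->
  uniq N -> (forall y, (y \in N) = par d u y) -> odd (size N) = odd (deg d u).
Proof.
move=> nl uN HN.
pose S d' (W : seq X) := \big[addb/false]_(y <- W) par d' u y.
have sz : odd (size N) = S d (undup (N ++ map fst d ++ map snd d)).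
  rewrite /S -(big_rmcond_in (fun y => y \in N)); last by move=> y _; rewrite HN => /negbTE.
  rewrite -big_filter (perm_big N); last first.
    by apply: uniq_perm => //; rewrite ?filter_uniq ?undup_uniq// => y; rewrite mem_filter mem_undup mem_cat; case: (y \in N).
  rewrite big_seq (eq_bigr (fun=> true)); last by move=> y; rewrite HN.
  rewrite -big_seq; elim: (N) => [|y N' IH]; first by rewrite big_nil.
  by rewrite big_cons /= IH.
rewrite sz {sz}; move: (undup _) (undup_uniq (N ++ map fst d ++ map snd d)) (mem_undup (N ++ map fst d ++ map snd d)) => W uW HW.
have {HW} : forall e, e \in d -> e.1 \in W /\ e.2 \in W.
  by move=> e ed; rewrite !HW !mem_cat !map_f ?orbT.
elim: d nl {HN} => [|e d IH] nl HW.
  by rewrite /S big1.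
have -> : S (e :: d) W = ((e.1 == u) (+) (e.2 == u)) (+) S d W.
  have [e1W e2W] := HW e (mem_head _ _); have ne := nl e (mem_head _ _).
  rewrite /S (eq_bigr (fun y => ((e == (u, y)) || (e == (y, u))) (+) par d u y)); last first.
    by move=> y _; rewrite /par /= oddD oddb.
  rewrite big_split /=; congr (_ (+) _).
  case: e e1W e2W ne {nl HW} => a b /= aW bW ab.
  have one z : z \in W -> \big[addb/false]_(y <- W) (z == y) = true.
    move=> zW; rewrite (bigD1_seq z)//= eqxx big1// => y /negbTE; by rewrite eq_sym.
  have [au|au] := eqVneq a u.
    rewrite -au [b == a]eq_sym (negbTE ab) /=; apply: etrans (one b bW); apply: eq_bigr => y _.
    rewrite !xpair_eqE eqxx /=; case: (b =P a) => [e|_]; first by rewrite e eqxx in ab.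
    by rewrite andbF orbF.
  have [bu|bu] := eqVneq b u.
    rewrite -bu /=; apply: etrans (one a aW); apply: eq_bigr => y _.
    by rewrite !xpair_eqE eqxx (negbTE ab) /= andbT.
  by rewrite big1// => y _; rewrite !xpair_eqE (negbTE au) (negbTE bu) andbF.
rewrite IH; last 2 first.
- by move=> e' e'd; apply: nl; rewrite inE e'd orbT.
- by move=> e' e'd; apply: HW; rewrite inE e'd orbT.
by rewrite deg_cons !oddD !oddb.
Qed.

Lemma path_chain G x y : rtc G x y ->
  exists d, (forall e, e \in d -> G e.1 e.2) /\ forall w, odd (deg d w) = (w == x) (+) (w == y).
Proof.
elim=> [u v Guv|u|u v w _ [d [dG Hd]] _ [d' [d'G Hd']]].
- exists [:: (u, v)]; split=> [e|w]; first by rewrite inE => /eqP ->.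
  by rewrite deg_cons /= /deg /= ![_ == w]eq_sym; case: (w == u); case: (w == v).
- by exists [::]; split=> // w; rewrite addbb.
- exists (d ++ d'); split=> [e|z]; first by rewrite mem_cat => /orP[/dG|/d'G].
  by rewrite deg_cat oddD Hd Hd'; case: (z == u); case: (z == v); case: (z == w).
Qed.

(** A [T]-join: the members of [T] are paired, each pair is joined by a path, and overlaps cancel
    modulo 2. *)
Lemma tjoin G (T : seq X) : uniq T -> ~~ odd (size T) ->
  (forall t t', t \in T -> t' \in T -> rtc G t t') ->
  exists d, (forall e, e \in d -> G e.1 e.2) /\ forall w, odd (deg d w) = (w \in T).
Proof.
move: {2}(size T) (leqnn (size T)) => n; elim: n T => [|n IH] T.
  by case: T => // _ _ _ _; exists [::].
case: T => [|a [|b T]]//; first by exists [::].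
move=> sT /= /andP[]; rewrite inE negb_or => /andP[ab aT] /andP[bT uT] oT GT.
have [d [dG Hd]] := path_chain (GT a b (mem_head _ _) (mem_behead (s := [:: a, b & T]) (mem_head _ _))).
have [||||d' [d'G Hd']] := IH T.
- by move: sT => /=; lia.
- by [].
- by move: oT; rewrite negbK.
- by move=> t t' tT t'T; apply: GT; rewrite !inE ?tT ?t'T !orbT.
exists (d ++ d'); split=> [e|w]; first by rewrite mem_cat => /orP[/dG|/d'G].
rewrite deg_cat oddD Hd Hd' !inE.
have [->|wa] := eqVneq w a; first by rewrite (negbTE ab) (negbTE aT).
by have [->|wb] := eqVneq w b; rewrite ?(negbTE bT).
Qed.

Lemma deg_sum r (W : seq X) : uniq W -> (forall e, e \in r -> e.1 \in W /\ e.2 \in W) ->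
  \sum_(w <- W) deg r w = (size r).*2.
Proof.
move=> uW; elim: r => [|e r IH] HW; first by rewrite big1.
rewrite (eq_bigr (fun w => (e.1 == w) + (e.2 == w) + deg r w)%N); last by move=> w _; rewrite deg_cons.
have {IH} IH : \sum_(w <- W) deg r w = (size r).*2.
  by apply: IH => e' e'r; apply: HW; rewrite inE e'r orbT.
rewrite big_split [X in _ + X = _]IH big_split.
have [e1 e2] := HW e (mem_head _ _).
have one z : z \in W -> \sum_(w <- W) (z == w) = 1.
  move=> zW; rewrite (bigD1_seq z)//= eqxx big1// => y; by rewrite eq_sym => /negbTE ->.
by rewrite /= !one// doubleS.
Qed.

Lemma handshake r (W : seq X) : uniq W -> (forall e, e \in r -> e.1 \in W /\ e.2 \in W) ->
  ~~ odd (size [seq w <- W | odd (deg r w)]).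
Proof.
move=> uW HW; have := congr1 odd (deg_sum uW HW); rewrite odd_double.
have -> : odd (\sum_(w <- W) deg r w) = odd (size [seq w <- W | odd (deg r w)]).
  elim: (W) => [|w W' IH]; first by rewrite big_nil.
  by rewrite big_cons oddD IH /=; case: (odd (deg r w)).
by move=> ->.
Qed.

Lemma nbrs_list E x : finite_set (E x) -> exists2 N, uniq N & forall y, E x y <-> y \in N.
Proof.
move=> /finite_seqP[s Es]; exists (undup s); first exact: undup_uniq.
by move=> y; rewrite mem_undup; have -> : E x y = [set` s] y by rewrite -Es.
Qed.

Lemma nbrs_list_all E (s : seq X) : (forall x, finite_set (E x)) ->
  exists N : seq X, forall x y, x \in s -> E x y -> y \in N.
Proof.
move=> fE; elim: s => [|x s [N HN]]; first by exists [::].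
have [N' _ HN'] := nbrs_list (fE x); exists (N' ++ N) => z y.
by rewrite inE mem_cat => /predU1P[->/HN' ->//|zs /(HN _ _ zs) ->]; rewrite orbT.
Qed.

Lemma even_list E x (N : seq X) : even_rel E -> uniq N -> (forall y, E x y <-> y \in N) -> ~~ odd (size N).
Proof. by move=> eE uN HN; have [n En] := eE x; rewrite (card_seq_size uN HN En) odd_double. Qed.

Lemma even_relI E : (forall x, finite_set (E x)) ->
  (forall x N, uniq N -> (forall y, E x y <-> y \in N) -> ~~ odd (size N)) -> even_rel E.
Proof.
move=> fE eE x; have [N uN HN] := nbrs_list (fE x); exists (size N)./2.
have e : (size N)./2.*2 = size N by rewrite even_halfK// (eE _ _ uN HN).
by rewrite e; exact: card_seq.
Qed.

Lemma even_diff E F : (forall x, finite_set (E x)) -> (forall x y, F x y -> E x y) ->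
  even_rel E -> even_rel F -> even_rel (fun x y => E x y /\ ~ F x y).
Proof.
move=> fE FE eE eF; apply: even_relI => [x|x N uN HN].
  by apply: sub_finite_set (fE x) => y [].
have fF z : finite_set (F z) by apply: sub_finite_set (fE z) => y; exact: FE.
have [N' uN' HN'] := nbrs_list (fF x).
have : ~~ odd (size (N ++ N')).
  apply: (even_list (E := E) (x := x)) => //.
    rewrite cat_uniq uN uN' andbT /=; apply/hasPn => y /HN' Fy; apply/negP => /HN[_ //].
  move=> y; rewrite mem_cat; split=> [Ey|/orP[/HN[]//|/HN'/FE//]].
  by apply/orP; have [Fy|nF] := pselect (F x y); [right; apply/HN'|left; apply/HN].
by rewrite size_cat oddD (negbTE (even_list eF uN' HN')) addbF.
Qed.

Section CoverChain.
Variable E : X -> X -> Prop.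
Hypotheses (Esym : forall x y, E x y -> E y x) (Eirr : forall x, ~ E x x)
  (Efin : forall x, finite_set (E x)) (Eeven : even_rel E).

(* The edges at [S0] are made even by joining their odd outer endpoints along [G]. *)
Lemma cover_chain (S0 S : seq X) G :
  {subset S <= S0} -> (forall u v, G u v -> E u v) -> (forall u v, G u v -> u \notin S /\ v \notin S) ->
  (forall w w', w \notin S0 -> w' \notin S0 -> (exists2 s, s \in S0 & E w s) ->
     (exists2 s, s \in S0 & E w' s) -> rtc G w w') ->
  exists d, [/\ forall e, e \in d -> E e.1 e.2 /\ ((e.1 \in S0 \/ e.2 \in S0) \/ G e.1 e.2),
    forall w, ~~ odd (deg d w) & forall x y, x \in S -> E x y -> par d x y].
Proof.
move=> SS0 GE GS Gc.
pose P u v := E u v /\ (u \in S0 \/ v \in S0).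
have [N HN] := nbrs_list_all S0 Efin.
have [r [sr rP]] : exists r, simple_list r /\ forall u v, P u v <-> (u, v) \in r \/ (v, u) \in r.
  apply: (@graph_list _ P (S0 ++ N)).
  - by move=> u v [/Esym ? [?|?]]; split=> //; [right|left].
  - by move=> u [/Eirr].
  - by move=> u v [Euv [uS|vS]]; rewrite mem_cat ?uS// (HN v)// ?orbT//; exact: Esym.
pose W := undup (map fst r ++ map snd r).
have rW e : e \in r -> e.1 \in W /\ e.2 \in W by move=> er; rewrite !mem_undup !mem_cat !map_f ?orbT.
pose T := [seq w <- W | odd (deg r w)].
have rE e : e \in r -> P e.1 e.2 by move=> er; apply/rP; left; rewrite -surjective_pairing.
have dS0 s : s \in S0 -> ~~ odd (deg r s).
  move=> sS; have [N' uN' HN'] := nbrs_list (Efin s).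
  rewrite (deg_nbrs (N := N'))//; first exact: even_list HN'.
  move=> y; apply/idP/orP => [/HN' Esy|/rP[/HN'//]].
  by apply/rP; split=> //; left.
have HT t : t \in T -> t \notin S0 /\ exists2 s, s \in S0 & E t s.
  rewrite mem_filter => /andP[ot tW]; have nt : t \notin S0 by apply: contraL ot; exact: dS0.
  split=> //; move: tW; rewrite mem_undup mem_cat => /orP[]/mapP[e /rE[Ee eS] te]; rewrite te.
    by exists e.2 => //; case: eS => //; rewrite -te (negbTE nt).
  by exists e.1; [case: eS => //; rewrite -te (negbTE nt)|exact: Esym].
have [||t t' /HT[h1 h2] /HT[h3 h4]|J [JG HJ]] := @tjoin G T.
- by rewrite filter_uniq// undup_uniq.
- by apply: handshake => //; exact: undup_uniq.
- exact: Gc.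
exists (r ++ J); split=> [e|w|x y xS Exy].
- rewrite mem_cat => /orP[/rE[]|/JG h]; first by move=> h1 h2; split=> //; left.
  by split; [exact: GE|right].
- rewrite deg_cat oddD HJ mem_filter; case o: (odd (deg r w)) => //=.
  have : has (fun e => (e.1 == w) || (e.2 == w)) r.
    by rewrite has_predU !has_count -addn_gt0 lt0n; move: o; rewrite /deg; case: (_ + _).
  by move=> /hasP[e /rW[h1 h2] /orP[]/eqP <-]; rewrite ?h1 ?h2.
- have xy : x <> y by move=> e; rewrite e in Exy; exact: (Eirr Exy).
  rewrite par_cat.
  have -> : par J x y = false.
    apply/negP => /par_mem[]/JG/GS[] /=; first by rewrite xS.
    by move=> _; rewrite xS.
  by rewrite addbF; apply/par_simple => //; apply/rP; split=> //; left; exact: SS0.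
Qed.

(** [P] is what is removed in the tile [K]. The last clause, active when [b] is true, is the detour
    property. Vertices that lose all their edges are exempt from it, since no later path can pass
    through them. *)
Definition valid (b : bool) (K : seq X) (P : X -> X -> Prop) :=
  [/\ forall u v, P u v -> E u v /\ u \in K,
      forall u v, P u v -> P v u,
      even_rel P
    & b -> forall u v, (exists w, P u w) -> (exists w, P v w) ->
        ~ isolated (fun a b => E a b /\ ~ P a b) u -> ~ isolated (fun a b => E a b /\ ~ P a b) v ->
        rtc (within (fun a b => E a b /\ ~ P a b) (fun a => a \in K)) u v].

(** The edges at [S] are completed to an even chain inside [B] by [cover_chain]. This may cut off
    some parts of [M] from [Out]; they are removed altogether. A touched vertex that keeps an edge
    can then reach [Out] inside [M], and points of [Out] are joined outside [B], where the chain has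
    no edge; this gives the detours. *)
Lemma plan (S0 S B M K : seq X) (Out : X -> Prop) :
  {subset S <= S0} -> {subset S0 <= B} -> {subset B <= M} -> {subset M <= K} ->
  (forall u v, u \in S0 -> E u v -> v \in B) ->
  (forall w w', w \notin S0 -> w' \notin S0 -> (exists2 s, s \in S0 & E w s) ->
     (exists2 s, s \in S0 & E w' s) -> rtc (within E (fun a => a \notin S /\ a \in B)) w w') ->
  (forall u v, u \in M -> ~ Out u -> E u v -> v \in M) ->
  (forall o o', Out o -> Out o' -> o \in M -> o' \in M -> ~ isolated E o -> ~ isolated E o' ->
     rtc (within E (fun a => a \notin B /\ a \in K)) o o') ->
  exists P, valid true K P /\ forall x y, x \in S -> E x y -> P x y.
Proof.
move=> SS0 S0B BM MK S0N Tc Mcl Oc.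
have [d [dE de dS]] := @cover_chain S0 S (within E (fun a => a \notin S /\ a \in B)) SS0 (fun u v h => h.1) (fun u v h => conj h.2.1.1 h.2.2.1) Tc.
have dB e : e \in d -> e.1 \in B /\ e.2 \in B.
  move=> /dE[Ee [[h|h]|h]]; last by case: h => _ [[_ ?] [_ ?]].
    by split; [exact: S0B|exact: S0N Ee].
  by split; [exact: S0N (Esym Ee)|exact: S0B].
have dpE u v : par d u v -> E u v by move=> /par_mem[]/dE[]//= /Esym.
have dpB u v : par d u v -> u \in B /\ v \in B by move=> /par_mem[]/dB[].
pose E2 u v := E u v /\ ~ par d u v.
have E2s u v : E2 u v -> E2 v u by move=> [/Esym ? ?]; split=> //; rewrite par_sym.
pose WM := within E2 (fun a => a \in M).
(* [D] collects the vertices of [M] that can no longer reach [Out]. Removing every edge at [D] keeps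
   degrees even: at a vertex of [D] all edges go, at any other vertex only those of the chain. *)
pose D u := u \in M /\ forall o, rtc WM u o -> ~ Out o.
have Dcl u v : D u -> E2 u v -> D v.
  move=> [uM Du] Euv; have vM : v \in M by apply: Mcl Euv.1 => //; apply: Du; exact: rtc_refl.
  by split=> // o vo; apply: Du; apply: rtc_trans vo; apply: rtc_step.
pose P u v := par d u v \/ (E2 u v /\ D u).
have Ps u v : P u v -> P v u.
  move=> [p|[h Du]]; first by left; rewrite par_sym.
  by right; split; [exact: E2s|exact: Dcl h].
have PE u v : P u v -> E u v by move=> [/dpE//|[[]]].
have PM u v : P u v -> u \in M by move=> [/dpB[/BM]//|[_ []]].
exists P; split; last by move=> x y xS Exy; left; exact: dS.
split=> //.
- by move=> u v h; split; [exact: PE|exact/MK/(PM _ _ h)].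
- apply: even_relI => [x|x N uN HN]; first by apply: sub_finite_set (Efin x) => y; exact: PE.
  have [Dx|nD] := pselect (D x).
    apply: (even_list (E := E) (x := x) Eeven uN) => y; rewrite -HN; split=> [Exy|/PE//].
    by have [p|np] := pselect (par d x y); [left|right; split].
  rewrite (@par_nbrs d x)//; first by move=> e /dE[+ _]; apply: contraPneq => <-; exact: Eirr.
  by move=> y; apply/idP/idP => [/HN[//|[_ /nD]]|p]; [|apply/HN; left].
- move=> _ u v [wu Pu] [wv Pv] nu nv.
  have toOut z w : P z w -> ~ isolated (fun a b => E a b /\ ~ P a b) z ->
      exists o, [/\ Out o, o \in M, ~ isolated E o, ~ D o & rtc (within (fun a b => E a b /\ ~ P a b) (fun a => a \in K)) z o].
    move=> Pzw nz; have [y [Ezy nP]] := nisolated nz; have zM := PM _ _ Pzw.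
    have nDz : ~ D z by move=> Dz; apply: nP; have [p|np] := pselect (par d z y); [left|right].
    have [ o [zo Oo]] : exists o, rtc WM z o /\ Out o.
      by apply: contrapT => H; apply: nDz; split=> // o zo Oo; apply: H; exists o.
    have ind t : rtc WM z t -> ~ D t /\ (t \in M /\ ~ isolated E t) /\ rtc (within (fun a b => E a b /\ ~ P a b) (fun a => a \in K)) z t.
      move=> /clos_rt_rtn1_iff; elim=> [|a b [Eab [aM bM]] _ [nDa [[_ _] za]]].
        by split=> //; split; [split=> // /(_ y)|exact: rtc_refl].
      have nDb : ~ D b by move=> /Dcl/(_ (E2s _ _ Eab)).
      split=> //; split; first by split=> // /(_ a); apply; exact: Esym Eab.1.
      apply: rtc_trans za (rtc_step _); split; last by split; exact: MK.
      by split; [exact: Eab.1|move=> [/Eab.2|[_ /nDa]]].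
    by have [? [[? ?] ?]] := ind o zo; exists o.
  have [ o [Oo oM io nDo uo]] := toOut _ _ Pu nu; have [ o' [Oo' o'M io' _ vo']] := toOut _ _ Pv nv.
  apply: rtc_trans uo _; apply: (rtc_trans (y := o')); last first.
    apply: rtc_sym vo' => a b; apply: within_sym => {}a {}b [Eab nP].
    by split; [exact: Esym|move=> /Ps].
  have := Oc _ _ Oo Oo' oM o'M io io' => /clos_rt_rtn1_iff H.
  suff : ~ D o' /\ rtc (within (fun a b => E a b /\ ~ P a b) (fun a => a \in K)) o o' by case.
  elim: H => [|a b [Eab [[aB aK] [bB bK]]] _ [nDa oa]]; first by split=> //; exact: rtc_refl.
  have np : ~ par d a b by move=> /dpB[]; rewrite (negbTE aB).
  split; first by move=> /Dcl/(_ (E2s a b (conj Eab np))).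
  apply: rtc_trans oa (rtc_step _); split=> //.
  by split=> // -[|[_ /nDa]].
Qed.

End CoverChain.

(** * Rerouting paths around the edges removed in one stage *)

Section Reroute.
Variables (byp : bool) (E : X -> X -> Prop) (L : Type) (K : L -> seq X) (P : L -> X -> X -> Prop).
Hypotheses (Esym : forall x y, E x y -> E y x) (Efin : forall x, finite_set (E x)).
Hypotheses (PV : forall l, valid E byp (K l) (P l)).
Hypothesis Kdis : forall l l' u, u \in K l -> u \in K l' -> l = l'.

Let F u v := exists l, P l u v.
Let E2 u v := E u v /\ ~ F u v.

Lemma stage_sym u v : F u v -> F v u.
Proof. by move=> [l Pl]; exists l; have [_ h _ _] := PV l; exact: h. Qed.

Lemma stage_sub u v : F u v -> E u v.
Proof. by move=> [l Pl]; have [h _ _ _] := PV l; exact: (h _ _ Pl).1. Qed.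

Lemma stage_rtc u v : rtc F u v -> u = v \/ exists l, u \in K l /\ v \in K l.
Proof.
have PK l a b : P l a b -> a \in K l by move=> h; have [hh _ _ _] := PV l; exact: (hh _ _ h).2.
have Psym l a b : P l a b -> P l b a by have [_ h _ _] := PV l; exact: h.
elim=> [a b [l Pl]|a|a b d _ [->//|[l [al bl]]] _ [<-|[l' [bl' dl']]]].
- by right; exists l; split; [exact: PK Pl|exact: PK (Psym _ _ _ Pl)].
- by left.
- by right; exists l.
- by right; exists l; split=> //; rewrite (Kdis bl bl').
Qed.

Lemma stage_fin u : finite_set (rtc F u).
Proof.
have [[l ul]|nl] := pselect (exists l, u \in K l).
  apply/(finite_seqP _).2; exists [seq v <- K l | `[< rtc F u v >]].
  apply/seteqP; split=> v /=; rewrite mem_filter; last by move=> /andP[/asboolP].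
  move=> uv; apply/andP; split; first exact/asboolP.
  by have [<-//|[l' [ul' vl']]] := stage_rtc uv; rewrite (Kdis ul ul').
apply/(finite_seqP _).2; exists [:: u]; apply/seteqP; split=> v /=; rewrite inE; last first.
  by move=> /eqP ->; exact: rtc_refl.
by move=> /stage_rtc[->//|[l [ul _]]]; case: nl; exists l.
Qed.

Lemma stage_at l u v : u \in K l -> F u v <-> P l u v.
Proof.
move=> ul; split=> [[l' Pl']|?]; last by exists l.
by have [h _ _ _] := PV l'; rewrite (Kdis ul (h _ _ Pl').2).
Qed.

Lemma stage_even : even_rel F.
Proof.
move=> u; have [[l ul]|nl] := pselect (exists l, u \in K l).
  have [_ _ h _] := PV l; have [n hn] := h u; exists n.
  by rewrite (_ : [set y | F u y] = [set y | P l u y])//; apply/seteqP; split=> y /(stage_at y ul).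
exists 0%N; apply: (@card_seq _ _ [::]) => // y; split=> // -[l Pl].
by case: nl; exists l; have [h _ _ _] := PV l; exact: (h _ _ Pl).2.
Qed.

(* A path of [E] that enters a tile and leaves it again can bypass the edges
   removed in that tile, because tiles are disjoint. *)
Lemma reroute (bT : byp) (A A' : X -> Prop) u v :
  (forall x, A x -> A' x) -> (forall l x y, A x -> x \in K l -> y \in K l -> A' y) ->
  rtc (within E A) u v -> ~ isolated E2 u -> ~ isolated E2 v -> rtc (within E2 A') u v.
Proof.
move=> AA' AK uv nu nv.
(* Invariant along the path: while the current vertex has lost all its edges, the walk waits at a
   vertex [q] of the same tile that is touched and keeps an edge, until the path reaches a vertex
   with a surviving edge. *)
suff H : (~ isolated E2 v /\ rtc (within E2 A') u v) \/
    (isolated E2 v /\ exists l q, [/\ v \in K l, exists w, P l q w, ~ isolated E2 q & rtc (within E2 A') u q]).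
  by case: H => -[].
have iso l q : q \in K l -> ~ isolated E2 q -> ~ isolated (fun a b => E a b /\ ~ P l a b) q.
  by move=> ql nq; have [y [Ey nF]] := nisolated nq; move=> /(_ y); apply; split=> // /(stage_at y ql).
elim/(clos_refl_trans_ind_left _ (within E A) u): uv {nv} => [|a e _ IH [Eae [Aa Ae]]].
  by left; split=> //; exact: rtc_refl.
have [[l Pae]|nF] := pselect (F a e); last first.
  case: IH => [[_ ua]|[ia]]; last by case: (ia e).
  left; split=> [/(_ a)|]; first by apply; split; [exact: Esym|move=> /stage_sym].
  by apply: rtc_trans ua (rtc_step _); split=> //; split; exact: AA'.
have [hE hs _ hby] := PV l.
have aK := (hE _ _ Pae).2; have eK := (hE _ _ (hs _ _ Pae)).2.
have [q [qw nq uq]] : exists q, [/\ exists w, P l q w, ~ isolated E2 q & rtc (within E2 A') u q].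
  case: IH => [[na ua]|[_ [l' [q [aK' qw nq uq]]]]]; first by exists a; split=> //; exists e.
  by rewrite (Kdis aK aK'); exists q.
have [ib|nb] := pselect (isolated E2 e); first by right; split=> //; exists l, q.
left; split=> //; apply: rtc_trans uq _.
have qK : q \in K l by have [w /hE[]] := qw.
have := hby bT q e qw (ex_intro _ _ (hs _ _ Pae)) (iso _ _ qK nq) (iso _ _ eK nb).
apply: rtc_mono => x y [[Exy nP] [xK yK]]; split.
  by split=> // /(stage_at y xK).
by split; exact: AK Aa aK _.
Qed.

End Reroute.
End Chains.

(** * Borel selection of tiles *)

Section Stage.
Variables (X : ptopologicalType) (c : X -> nat -> nat).
Hypothesis Hc : std c.
Variables (I : countType) (f : I -> X -> X).
Hypothesis mf : moves f.
Implicit Types d : seq (I * I).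

(* A list of pairs of indices describes, at each point, a list of edges. *)
Definition at_pt d z := [seq (f e.1 z, f e.2 z) | e <- d].

Lemma BX_addb (p q : X -> bool) : BX p -> BX q -> BX (fun x => p x (+) q x).
Proof.
move=> Bp Bq; apply: (@Bor_ext _ _ (fun x => ~ (p x <-> q x))); last by apply: BorN; apply: BorEq.
move=> x; have -> : p x (+) q x = (p x != q x) by case: (p x); case: (q x).
split=> [h|/eqP ne [h1 h2]]; last by apply: ne; apply/idP/idP.
by apply/eqP => e; apply: h; rewrite e.
Qed.

Lemma BX_eqb (g h : X -> X) : mX g -> mX h -> BX (fun x => g x == h x).
Proof. by move=> mg mh; apply: (Bor_ext _ (BX_eq Hc mg mh)) => x; split=> /eqP. Qed.

Lemma par_cons (e : X * X) r u v : par (e :: r) u v = ((e == (u, v)) || (e == (v, u))) (+) par r u v.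
Proof. by rewrite /par /= oddD oddb. Qed.

Lemma BX_par d (g h k : X -> X) : mX g -> mX h -> mX k -> BX (fun x => par (at_pt d (k x)) (g x) (h x)).
Proof.
move=> mg mh mk; have [mfi _ _] := mf; elim: d => [|e d IH] /=.
  by apply: (@Bor_ext _ _ (fun=> False)); [|exact: Bor_cst].
apply: (@Bor_ext _ _ (fun x => (((f e.1 (k x), f e.2 (k x)) == (g x, h x)) || ((f e.1 (k x), f e.2 (k x)) == (h x, g x))) (+) par (at_pt d (k x)) (g x) (h x))).
  by move=> x; rewrite par_cons.
apply: BX_addb => //.
have mm i : mX (fun x => f i (k x)) by exact: mea_comp mk (mfi i).
apply: (@Bor_ext _ _ (fun x => (f e.1 (k x) == g x /\ f e.2 (k x) == h x) \/ (f e.1 (k x) == h x /\ f e.2 (k x) == g x))).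
  by move=> x; rewrite !xpair_eqE; split=> [[[-> ->]//|[-> ->]]|/orP[]/andP[]]; rewrite ?orbT//; [left|right].
by apply: BorO; apply: BorA; exact: BX_eqb.
Qed.

Lemma BX_odd_deg d (g k : X -> X) : mX g -> mX k -> BX (fun x => odd (deg (at_pt d (k x)) (g x))).
Proof.
move=> mg mk; have [mfi _ _] := mf; elim: d => [|e d IH] /=.
  by apply: (@Bor_ext _ _ (fun=> False)); [|exact: Bor_cst].
have mm i : mX (fun x => f i (k x)) by exact: mea_comp mk (mfi i).
apply: (@Bor_ext _ _ (fun x => ((f e.1 (k x) == g x) (+) (f e.2 (k x) == g x)) (+) odd (deg (at_pt d (k x)) (g x)))).
  by move=> x; rewrite deg_cons !oddD !oddb.
by apply: BX_addb => //; apply: BX_addb; exact: BX_eqb.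
Qed.

Variables (E R : X -> X -> Prop) (core : X -> Prop) (b : bool).
Hypotheses (BE : BR E) (cE : covers f E) (Eirr : forall x, ~ E x x)
  (Efin : forall x, finite_set (E x)).
Hypotheses (BR_R : BR R) (cR : covers f R) (Rsym : forall x y, R x y -> R y x)
  (Rtrans : forall x y z, R x y -> R y z -> R x z) (Rfin : forall x, finite_set (R x)).
Hypothesis Bcore : BX core.

Let G z d u v := (E u v /\ ~ par (at_pt d z) u v) /\ (R z u /\ R z v).

Lemma BX_rtcG d i j : BX (fun z => rtc (G z d) (f i z) (f j z)).
Proof.
have [mfi _ _] := mf.
pose ch := fix ch (w : seq I) z i := if w is m :: w' then G z d (f i z) (f m z) /\ ch w' z m else f i z = f j z.
apply: (@Bor_ext _ _ (fun z => exists w, ch w z i)).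
  move=> z; split=> [[w]|].
    elim: w i => [|m w IH] i' /=; first by move=> ->; exact: rtc_refl.
    by move=> [h /IH]; apply: rtc_trans; exact: rtc_step.
  move=> /clos_rt_rt1n_iff; move e1 : (f i z) => u; move e2 : (f j z) => v H.
  elim: H i e1 e2 => [x i' e1 e2|x y w Gxy _ IH i' e1 e2]; first by exists [::] => /=; rewrite e1.
  have [m my] := cR Gxy.2.2; have [w' Hw'] := IH m my e2.
  by exists (m :: w') => /=; rewrite e1 my.
apply: BorEx => w; elim: w i => [|m w IH] i /=; first exact: (BX_eq Hc).
apply: BorA => //; apply: BorA; apply: BorA.
- exact: (BR_mX Hc BE).
- by apply: BorN; apply: BX_par => //; exact: mea_id.
- by apply: (BR_mX Hc BR_R) => //; exact: mea_id.
- by apply: (BR_mX Hc BR_R) => //; exact: mea_id.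
Qed.

Let niso z d x := ~ isolated (fun a b => E a b /\ ~ par (at_pt d z) a b) x.

(** The conditions of [valid] and the covering of the core for the class of [z] and the chain coded
    by [d]. They quantify over indices instead of points, which makes them Borel in [z]. *)
Let tile d z := [/\ forall e, e \in d -> f e.1 z <> f e.2 z,
  forall i, ~~ odd (deg (at_pt d z) (f i z)),
  forall i j, par (at_pt d z) (f i z) (f j z) -> E (f i z) (f j z) /\ R z (f i z),
  b -> forall i j, (exists m, par (at_pt d z) (f i z) (f m z)) -> (exists m, par (at_pt d z) (f j z) (f m z)) ->
    niso z d (f i z) -> niso z d (f j z) -> rtc (G z d) (f i z) (f j z)
  & forall i j, R z (f i z) -> core (f i z) -> E (f i z) (f j z) -> par (at_pt d z) (f i z) (f j z)].

Lemma BX_tile d : BX (tile d).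
Proof.
have [mfi _ fc] := mf.
apply: (@Bor_ext _ _ (fun z => (forall e, e \in d -> f e.1 z <> f e.2 z) /\
  ((forall i, ~ odd (deg (at_pt d z) (f i z))) /\
  ((forall i j, par (at_pt d z) (f i z) (f j z) -> E (f i z) (f j z) /\ R z (f i z)) /\
  ((b -> forall i j, (exists m, par (at_pt d z) (f i z) (f m z)) -> (exists m, par (at_pt d z) (f j z) (f m z)) ->
    (exists m, E (f i z) (f m (f i z)) /\ ~ par (at_pt d z) (f i z) (f m (f i z))) ->
    (exists m, E (f j z) (f m (f j z)) /\ ~ par (at_pt d z) (f j z) (f m (f j z))) -> rtc (G z d) (f i z) (f j z)) /\
  (forall i j, R z (f i z) -> core (f i z) -> E (f i z) (f j z) -> par (at_pt d z) (f i z) (f j z))))))).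
  have nE z x : niso z d x <-> exists m, E x (f m x) /\ ~ par (at_pt d z) x (f m x).
    split=> [h|[m h] /(_ (f m x))//]; have [y [Exy np]] := nisolated h.
    by have [m e] := cE Exy; exists m; rewrite e.
  move=> z; split=> [[? [h1 [? [h2 ?]]]]|[? h1 ? h2 ?]].
    by split=> // [i|bT i j hi hj /nE ni /nE nj]; [exact/negP|exact: h2].
  by do 3?split=> //; [move=> i; exact/negP|split=> // bT i j hi hj /nE ni /nE nj; exact: h2].
have mm i j : mX (fun z => f i (f j z)) by exact: mea_comp (mfi j) (mfi i).
apply: BorA; first by apply: BorAll => e; apply: BorIc => _; apply: BorN; exact: (BX_eq Hc).
apply: BorA; first by apply: BorAll => i; apply: BorN; exact: BX_odd_deg.
apply: BorA.
  by do 2 (apply: BorAll => ?); apply: BorI; [exact: BX_par|apply: BorA; [exact: (BR_mX Hc BE)|exact: (BR_mX Hc BR_R)]].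
apply: BorA.
  apply: BorIc => _; do 2 (apply: BorAll => ?).
  apply: BorI; first by apply: BorEx => m; exact: BX_par.
  apply: BorI; first by apply: BorEx => m; exact: BX_par.
  apply: BorI; first by apply: BorEx => m; apply: BorA; [exact: (BR_mX Hc BE)|apply: BorN; exact: BX_par].
  apply: BorI; last exact: BX_rtcG.
  by apply: BorEx => m; apply: BorA; [exact: (BR_mX Hc BE)|apply: BorN; exact: BX_par].
do 2 (apply: BorAll => ?); apply: BorI; first exact: (BR_mX Hc BR_R).
apply: BorI; first exact: (mfi _ _ Bcore).
by apply: BorI; [exact: (BR_mX Hc BE)|exact: BX_par].
Qed.

Let cov (K : seq X) (P : X -> X -> Prop) := forall u v, u \in K -> core u -> E u v -> P u v.

Lemma par_at d z u v : par (at_pt d z) u v -> exists i j, f i z = u /\ f j z = v.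
Proof. by move=> /par_mem[]/mapP[e _ [-> ->]]; [exists e.1, e.2|exists e.2, e.1]. Qed.

Lemma tile_valid d z K : (forall v, R z v <-> v \in K) -> tile d z ->
  valid E b K (par (at_pt d z)) /\ cov K (par (at_pt d z)).
Proof.
have [mfi _ fc] := mf.
move=> HK [h1 h2 h3 h4 h5]; split; [split|].
- by move=> u v p; have [i [j [iu jv]]] := par_at p; rewrite -HK -iu -jv; apply: h3; rewrite iu jv.
- by move=> u v; rewrite par_sym.
- apply: even_relI => [x|x N uN HN].
    apply: (@sub_finite_set _ _ [set` K]) => // y; rewrite par_sym => p /=.
    by have [i [j [iu jv]]] := par_at p; rewrite -HK -iu; apply: (h3 i j _).2; rewrite iu jv.
  rewrite (@par_nbrs _ (at_pt d z) x)//.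
  + have [[i <-]|nx] := pselect (exists i, f i z = x); first exact: h2.
    rewrite /deg; rewrite (eq_in_count (a2 := pred0)); last first.
      by move=> e /mapP[e' _ ->] /=; apply/negP => /eqP e1; apply: nx; exists e'.1.
    rewrite [X in _ + X](eq_in_count (a2 := pred0)) ?count_pred0//.
    by move=> e /mapP[e' _ ->] /=; apply/negP => /eqP e1; apply: nx; exists e'.2.
  + by move=> e /mapP[e' /h1 e'd ->] /=; exact/eqP.
  + by move=> y; apply/idP/idP => /HN.
- move=> bT u v [w puw] [w' pvw'] nu nv.
  have [i [m [iu mw]]] := par_at puw; have [j [m' [jv mw']]] := par_at pvw'.
  have := h4 bT i j; rewrite iu jv => /(_ _ _ nu nv) H.
  have {}H : rtc (G z d) u v by apply: H; [exists m; rewrite mw|exists m'; rewrite mw'].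
  by apply: rtc_mono H => x y [h [/HK ? /HK ?]].
- move=> u v /HK zu cu Euv; have [i iu] := cR zu; have [j jv] := cE Euv.
  by have [k fk] := fc j i; rewrite -jv -iu -fk; apply: h5; rewrite ?fk iu // jv.
Qed.

Lemma valid_tile z K P : (forall v, R z v <-> v \in K) -> valid E b K P -> cov K P -> exists d, tile d z.
Proof.
have [mfi _ fc] := mf.
move=> HK [p1 p2 p3 p4] p5.
have PE u v : P u v -> E u v by move=> /p1[].
have PK u v : P u v -> u \in K by move=> /p1[].
have [r [sr rP]] : exists r, simple_list r /\ forall u v, P u v <-> (u, v) \in r \/ (v, u) \in r.
  by apply: (@graph_list _ P K) => // u; move=> /PE; exact: Eirr.
have idx e : e \in r -> exists i, f i.1 z = e.1 /\ f i.2 z = e.2.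
  move=> er; have Pe : P e.1 e.2 by apply/rP; left; rewrite -surjective_pairing.
  have [i ie] := cR ((HK _).2 (PK _ _ Pe)); have [j je] := cR ((HK _).2 (PK _ _ (p2 _ _ Pe))).
  by exists (i, j).
have [d Hd] : exists d, at_pt d z = r.
  elim: (r) idx => [|e r' IH] idx; first by exists [::].
  have [i [i1 i2]] := idx e (mem_head _ _).
  have [|d Hd] := IH; first by move=> e' e'r; apply: idx; rewrite inE e'r orbT.
  by exists (i :: d); rewrite /at_pt /= -/(at_pt d z) Hd i1 i2 -surjective_pairing.
have pP u v : par r u v <-> P u v.
  have [<-|uv] := pselect (u = v); last by rewrite par_simple// rP.
  split=> [|/PE/Eirr//] /par_mem[] uu; by have /PE/Eirr : P u u by apply/rP; left.
have rE : (fun a b => E a b /\ ~ par r a b) = (fun a b => E a b /\ ~ P a b).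
  by apply: funext => x; apply: funext => y; apply: propext; split=> -[? h]; split=> // /pP.
exists d; rewrite /tile /niso /G Hd rE; split.
- move=> e ed e12; have : (f e.1 z, f e.2 z) \in r by rewrite -Hd; exact: (map_f (fun e => (f e.1 z, f e.2 z))).
  by rewrite e12 => h; have /PE/Eirr : P (f e.2 z) (f e.2 z) by apply/rP; left.
- move=> i; have fP : finite_set (P (f i z)) by apply: sub_finite_set (Efin (f i z)) => y /PE.
  have [N uN HN] := nbrs_list fP; rewrite (deg_nbrs (N := N))//.
    by apply: (even_list (E := P)) => //; exact: HN.
  by move=> y; apply/idP/orP => [/HN/rP//|/rP/HN].
- by move=> i j /pP/p1[? /HK].
- move=> bT i j [m /pP hi] [m' /pP hj] ni nj.
  have := p4 bT _ _ (ex_intro _ _ hi) (ex_intro _ _ hj) ni nj.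
  by apply: rtc_mono => x y [[h1 h2] [/HK ? /HK ?]]; split=> //; split=> // /pP.
- by move=> i j /HK zi ci Eij; apply/pP; exact: p5.
Qed.

(** [selector] chooses in each class of [R] a base point and the code of a chain that is valid for
    the class. A label in [L] is such a code with its base point, provided that the chain is
    valid. *)
Theorem stage : exists (L : Type) (K : L -> seq X) (P : L -> X -> X -> Prop),
  [/\ forall l, valid E b (K l) (P l), forall l l' u, u \in K l -> u \in K l' -> l = l',
      forall l u v, u \in K l -> (R u v <-> v \in K l), BR (fun u v => exists l, P l u v)
    & forall x, core x -> R x x ->
      (exists Kx Px, [/\ forall v, R x v <-> v \in Kx, valid E b Kx Px
         & forall u v, u \in Kx -> core u -> E u v -> Px u v]) ->
      forall y, E x y -> exists l, P l x y].
Proof.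
have [mfi [i0 fi0] fc] := mf.
have /choice[Kc HKc] : forall z, exists K : seq X, forall v, R z v <-> v \in K.
  by move=> z; have [K _ HK] := nbrs_list (Rfin z); exists K.
(* [R] is reflexive only on its own field; [Q] adds singleton classes to become an equivalence
   relation on the whole space. *)
pose Q x y := x = y \/ R x y.
(* Where no valid chain exists the default code [[::]] is used, because [selector] wants a label in
   every class. *)
pose V d z := tile d z \/ (d = [::] /\ forall d', ~ tile d' z).
have [C [BC CV exC uC]] : exists L : seq (I * I) -> X -> Prop,
  [/\ forall k, BX (L k), forall k x, L k x -> V k x,
      forall x, exists k y, Q x y /\ L k y
    & forall k k' x y, Q x y -> L k x -> L k' y -> k = k' /\ x = y].
  apply: (@selector _ c Hc _ f Q).
  - by [].
  - by move=> x y [->|/cR//]; exists i0.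
  - by apply: BorO => //; exact: (BX_eq Hc (mfst Hc) (msnd Hc)).
  - by left.
  - by move=> x y [->|/Rsym]; [left|right].
  - by move=> x y z [->//|xy] [<-|yz]; right=> //; exact: Rtrans yz.
  - move=> x; apply: (@sub_finite_set _ _ ([set x] `|` R x)); first by move=> y [->|?]; [left|right].
    by rewrite finite_setU; split.
  - by move=> d; apply: BorO; [exact: BX_tile|apply: BorAc => _; apply: BorAll => d'; apply: BorN; exact: BX_tile].
  - move=> x; exists x; split; first by left.
    have [[d td]|nt] := pselect (exists d, tile d x); first by exists d; left.
    by exists [::]; right; split=> // d td; apply: nt; exists d.
pose L := {p : seq (I * I) * X | C p.1 p.2 /\ (tile p.1 p.2 /\ R p.2 p.2)}.
exists L, (fun l => Kc (sval l).2), (fun l => par (at_pt (sval l).1 (sval l).2)); split.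
- by move=> [[d z] /= [Cz [tz _]]]; exact: (tile_valid (HKc z) tz).1.
- move=> [[d z] /= [Cz [tz zz]]] [[d' z'] /= [Cz' [tz' zz']]] u /HKc zu /HKc zu'.
  have [e1 e2] := uC _ _ _ _ (or_intror (Rtrans zu (Rsym zu'))) Cz Cz'.
  by subst d' z'; congr (exist _ _ _); exact: Prop_irrelevance.
- move=> [[d z] /= _] u v /HKc zu; rewrite -HKc; split=> [uv|zv]; first exact: Rtrans uv.
  exact: Rtrans (Rsym zu) zv.
- have tE d z u v : C d z -> tile d z -> par (at_pt d z) u v -> E u v /\ R z u.
    move=> Cz tz puv; have [[h _ _ _] _] := tile_valid (HKc z) tz.
    by have [? /HKc] := h _ _ puv.
  apply: (BR_covers Hc mfi).
    by move=> x y [[[d z] /= [Cz [tz _]]] /(tE _ _ _ _ Cz tz)[/cE]].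
  move=> i; apply: (@Bor_ext _ _ (fun x => exists d j, (C d (f j x) /\ (tile d (f j x) /\ R (f j x) (f j x))) /\ par (at_pt d (f j x)) x (f i x))).
    move=> x; split=> [[d [j [h p]]]|[[[d z] /= h] p]]; first by exists (exist _ (d, f j x) h).
    have [_ zx] := tE _ _ _ _ h.1 h.2.1 p; have [j jz] := cR (Rsym zx).
    by exists d, j; rewrite jz.
  do 2 (apply: BorEx => ?); apply: BorA; last exact: BX_par.
  apply: BorA; first exact: (mfi _ _ (BC _)).
  by apply: BorA; [exact: (mfi _ _ (BX_tile _))|exact: (BR_mX Hc BR_R)].
- move=> x cx xx [Kx [Px [HK vP cP]]] y Exy.
  have [d [z [xz Cz]]] := exC x.
  have xz' : R x z by case: xz => [<-|].
  have HKz v : R z v <-> v \in Kx.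
    by rewrite -HK; split; [exact: Rtrans|apply: Rtrans; exact: Rsym].
  have tz : tile d z.
    have [d' td'] := valid_tile HKz vP cP.
    by case: (CV _ _ Cz) => [//|[_ /(_ d')]].
  have zz : R z z by exact: Rtrans (Rsym xz') xz'.
  exists (exist _ (d, z) (conj Cz (conj tz zz))) => /=.
  by apply: (tile_valid HKz tz).2 => //; exact/HK.
Qed.

End Stage.

(** * Successive removal of finite even pieces *)

Lemma words_moves (X : topologicalType) (J : Type) (g : J -> X -> X) :
  (forall j, mX (g j)) -> moves (fun w x => foldr g x w).
Proof.
move=> mg; split; last 2 first.
- by exists [::].
- by move=> v w; exists (v ++ w) => x; rewrite foldr_cat.
- by elim=> [|j w IH] /=; [exact: mea_id|exact: mea_comp IH (mg j)].
Qed.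

Lemma finite_stab (X : Type) (Es : nat -> X -> Prop) (A : set X) : finite_set A ->
  (forall n y, Es n.+1 y -> Es n y) -> (forall y, Es 0 y -> A y) ->
  exists N, forall y, (forall n, Es n y) <-> Es N y.
Proof.
move=> fA dec E0A.
have le n m y : n <= m -> Es m y -> Es n y.
  by move=> /subnK <-; elim: (m - n) => // k IH /dec.
have /choice[g Hg] : forall y, exists n, (forall k, Es k y) \/ ~ Es n y.
  move=> y; have [h|/existsNP[n hn]] := pselect (forall k, Es k y); first by exists 0; left.
  by exists n; right.
have [B HB] : exists B, forall y, A y -> g y <= B.
  have /finite_seqP[s sE] := finite_image g fA.
  exists (\max_(i <- s) i) => y Ay; apply: (leq_bigmax_seq (F := id)) => //.
  by have : [set g y | y in A] (g y) by [exists y]; rewrite sE.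
exists B => y; split=> // EB; have Ay : A y by apply: E0A; exact: le EB.
by case: (Hg y) => // h; case: h; apply: le EB; exact: HB.
Qed.

Section Towers.
Variables (X : ptopologicalType) (c : X -> nat -> nat).
Hypothesis Hc : std c.
Variables (I : countType) (f : I -> X -> X).
Hypothesis mf : moves f.
Implicit Types E F R : X -> X -> Prop.

Definition egraph E := [/\ BR E /\ covers f E, forall x y, E x y -> E y x,
  forall x, ~ E x x, forall x, finite_set (E x) & even_rel E].

Definition remove E F x y := E x y /\ ~ F x y.

Definition even_part E F := [/\ BR F, forall x y, F x y -> E x y, forall x y, F x y -> F y x,
  even_rel F & forall x, finite_set (rtc F x)].

Lemma egraph_remove E F : egraph E -> even_part E F -> egraph (remove E F).
Proof.
move=> [[BE cE] sE iE fE eE] [BF FE sF eF _]; split=> //.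
- by split; [apply: BorA => //; exact: BorN|move=> x y [/cE]].
- by move=> x y [/sE ? h]; split=> // /sF.
- by move=> x [/iE].
- by move=> x; apply: sub_finite_set (fE x) => y [].
- exact: even_diff.
Qed.

Lemma tower (Inv : nat -> (X -> X -> Prop) -> Prop) E :
  egraph E -> Inv 0 E ->
  (forall n E', egraph E' -> Inv n E' -> exists F, even_part E' F /\ Inv n.+1 (remove E' F)) ->
  exists Es : nat -> X -> X -> Prop, [/\ Es 0 = E, forall n, egraph (Es n), forall n, Inv n (Es n)
    & forall n, exists2 F, even_part (Es n) F & Es n.+1 = remove (Es n) F].
Proof.
move=> gE I0 step.
pose St := {p : nat * (X -> X -> Prop) | egraph p.2 /\ Inv p.1 p.2}.
have /choice[nx Hnx] : forall s : St, exists t : St, (sval t).1 = (sval s).1.+1 /\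
    exists2 F, even_part (sval s).2 F & (sval t).2 = remove (sval s).2 F.
  move=> [[n E'] /= [gE' IE']]; have [F [eF IF]] := step n E' gE' IE'.
  exists (exist _ (n.+1, remove E' F) (conj (egraph_remove gE' eF) IF)) => /=; split=> //.
  by exists F.
pose s0 : St := exist _ (0, E) (conj gE I0).
have num n : (sval (iter n nx s0)).1 = n by elim: n => //= n IH; rewrite (Hnx _).1 IH.
exists (fun n => (sval (iter n nx s0)).2); split=> // n.
- by case: (svalP (iter n nx s0)).
- by have [_] := svalP (iter n nx s0); rewrite num.
- by have [_] := Hnx (iter n nx s0).
Qed.

(** What is left after all stages, the intersection of the [Es n], becomes piece number [0]. Its
    degrees are even because the finitely many edges at a vertex stabilize; its components in [X']
    are finite by hypothesis. *)
Lemma tower_orientation (Es : nat -> X -> X -> Prop) (X' : X -> Prop) :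
  (forall n, egraph (Es n)) ->
  (forall n, exists2 F, even_part (Es n) F & Es n.+1 = remove (Es n) F) ->
  BX X' -> (forall x y, Es 0 x y -> X' x -> X' y) ->
  (forall x, X' x -> finite_set (rtc (fun x y => forall n, Es n x y) x)) ->
  exists O, [/\ BR O, orients (fun x y => Es 0 x y /\ (X' x /\ X' y)) O & balanced_rel O].
Proof.
move=> gE sE BX' invX finX.
have /choice[F HF] : forall n, exists F, even_part (Es n) F /\ Es n.+1 = remove (Es n) F.
  by move=> n; have [F] := sE n; exists F.
have dec n x y : Es n.+1 x y -> Es n x y by rewrite (HF n).2 => -[].
have le n m x y : n <= m -> Es m x y -> Es n x y.
  by move=> /subnK <-; elim: (m - n) => // k IH /dec.
have [[BE cE] sE0 iE fE eE] := gE 0.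
pose P n x y := if n is m.+1 then F m x y else forall k, Es k x y.
have PE n x y : P n x y -> Es 0 x y.
  case: n => [|m] /=; first exact.
  by have [[_ h _ _ _] _] := HF m; move=> /h; exact: le.
have Psym n x y : P n x y -> P n y x.
  case: n => [h k|m] /=; first by have [_ s _ _ _] := gE k; exact: s.
  by have [[_ _ h _ _] _] := HF m; exact: h.
have Peven n : even_rel (P n).
  case: n => [|m] /=; last by have [[_ _ _ h _] _] := HF m.
  move=> x; have [N HN] := @finite_stab _ (fun n => Es n x) _ (fE x) (fun n => dec n x) (fun y h => h).
  have [_ _ _ _ /(_ x)[k hk]] := gE N; exists k.
  by rewrite (_ : [set y | P 0 x y] = [set y | Es N x y])//; apply/seteqP; split=> y /HN.
have BP n : BR (P n).
  case: n => [|m] /=; last by have [[h _ _ _ _] _] := HF m.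
  by apply: BorAll => n; have [[] ] := gE n.
apply: (@decomposition _ c Hc _ f mf _ (fun n x y => P n x y /\ (X' x /\ X' y))).
- by move=> x [/iE].
- by move=> x; apply: sub_finite_set (fE x) => y [].
- move=> n; split.
  + by move=> x y [/PE/cE].
  + by apply: (BorA (BP n)); apply: BorA; [exact: (mfst Hc BX')|exact: (msnd Hc BX')].
  + by move=> x y [/Psym ? []].
  + move=> x; have [Xx|nX] := pselect (X' x); last first.
      apply: (@sub_finite_set _ _ [set x]) => // y /clos_rt_rt1n_iff H; case: H nX => // u v [_ [? _]].
      by [].
    case: n => [|m].
      by apply: sub_finite_set (finX x Xx) => y; apply: rtc_mono => u v [].
    have [[_ _ _ _ h] _] := HF m.
    by apply: sub_finite_set (h x) => y; apply: rtc_mono => u v [].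
  + move=> x; have [Xx|nX] := pselect (X' x).
      have [k hk] := Peven n x; exists k.
      rewrite (_ : [set y | P n x y /\ (X' x /\ X' y)] = [set y | P n x y])//.
      apply/seteqP; split=> y /=; first by case.
      by move=> h; split=> //; split=> //; apply: (invX x) => //; exact: PE h.
    by exists 0; apply: (@card_seq _ _ [::]) => // y; split=> // -[_ [/nX]].
- move=> n m x y [Pn _] [Pm _].
  wlog nm : n m Pn Pm / n < m.
    by move=> W; case: (ltngtP n m) => // h; [exact: W|apply/esym; exact: W].
  case: n m nm Pn Pm => [|n] [|m]// nm /= Pn Pm.
    have := Pn m.+1; rewrite (HF m).2 => -[] //.
  have [[_ h _ _ _] _] := HF m; have := le n.+1 m x y nm (h _ _ Pm).
  by rewrite (HF n).2 => -[].
- move=> x y; split=> [[Exy XX]|[n [/PE]]//].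
  have [h|/existsNP H] := pselect (forall k, Es k x y); first by exists 0.
  have ex : exists n, `[< ~ Es n x y >] by have [n h] := H; exists n; exact/asboolP.
  case: (ex_minnP ex) => -[/asboolP//|n] /asboolP nE nmin.
  exists n.+1; split=> //=; apply: contrapT => nF; apply: nE; rewrite (HF n).2; split=> //.
  apply: contrapT => nEn; have /nmin : `[< ~ Es n x y >] by exact/asboolP.
  by rewrite ltnn.
Qed.

(* Edges at the core of each class are closed up to an even graph by paths in
   the rest of the class. *)
Lemma core_stage E R (core : X -> Prop) : egraph E -> BR R -> covers f R ->
  (forall x y, R x y -> R y x) -> (forall x y z, R x y -> R y z -> R x z) ->
  (forall x, finite_set (R x)) -> BX core -> (forall x y, core x -> E x y -> R x y) ->
  (forall w w' s s', ~ core w -> ~ core w' -> R w w' -> core s -> core s' -> E w s -> E w' s' ->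
     rtc (within E (fun a => R w a /\ ~ core a)) w w') ->
  exists F, [/\ even_part E F, forall x y, F x y -> R x y & forall x y, core x -> E x y -> F x y].
Proof.
move=> [[BE cE] sE iE fE eE] BRR cR sR tR fR Bc cER conn.
have [L [K [P [PV Kd KR BF cov]]]] := stage Hc mf false BE cE iE fE BRR cR sR tR fR Bc.
exists (fun u v => exists l, P l u v); split.
- split=> //.
  + exact: (stage_sub PV).
  + exact: (stage_sym PV).
  + exact: (stage_even PV).
  + exact: (stage_fin PV).
- move=> x y [l Pl]; have [h1 h2 _ _] := PV l; apply/(KR l).
    by have [] := h1 _ _ Pl.
  by have [] := h1 _ _ (h2 _ _ Pl).
move=> x y cx Exy; have xx : R x x by have Rxy := cER _ _ cx Exy; exact: tR (sR _ _ Rxy).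
apply: cov => //.
have [Kx uK HK] := nbrs_list (fR x).
pose S := [seq u <- Kx | `[< core u >]].
have SP u : u \in S <-> core u /\ R x u.
  by rewrite mem_filter; split=> [/andP[/asboolP ? /HK]|[? /HK ->]]//; rewrite andbT; exact/asboolP.
pose G := within E (fun a => R x a /\ ~ core a).
have [|||d [dE de dS]] := @cover_chain X E sE iE fE eE S S G (fun _ h => h).
- by move=> u v [].
- by move=> u v [_ [[_ nu] [_ nv]]]; split; apply/negP => /SP[].
- move=> w w' nw nw' [s /SP[cs xs] Ews] [s' /SP[cs' xs'] Ews'].
  have xw : R x w by apply: tR xs _; apply: cER => //; exact: sE.
  have xw' : R x w' by apply: tR xs' _; apply: cER => //; exact: sE.
  have ncw : ~ core w by move=> cw; move/negP: nw; apply; exact/SP.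
  have ncw' : ~ core w' by move=> cw; move/negP: nw'; apply; exact/SP.
  apply: rtc_mono (conn w w' s s' ncw ncw' (tR _ _ _ (sR _ _ xw) xw') cs cs' Ews Ews').
  by move=> a b [Eab [[wa na] [wb nb]]]; split=> //; split; split=> //; exact: tR xw _.
have dpE u v : par d u v -> E u v /\ u \in Kx.
  have dG e : e \in d -> E e.1 e.2 /\ (R x e.1 /\ R x e.2).
    move=> /dE[Ee [[/SP[ce xe]|/SP[ce xe]]|[_ [[? _] [? _]]]]]; split=> //; split=> //.
    - by apply: tR xe _; exact: cER.
    - by apply: tR xe _; apply: cER => //; exact: sE.
  by move=> /par_mem[]/dG[/= Ee [/HK ? /HK ?]]; split=> //; exact: sE.
exists Kx, (par d); split=> //; last by move=> u v uKx cu Euv; apply: dS => //; apply/SP; split=> //; exact/HK.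
split=> //; first by move=> u v; rewrite par_sym.
apply: even_relI => [u|u N uN HN]; first by apply: sub_finite_set (fE u) => v /dpE[].
rewrite (@par_nbrs _ d u)//; first by move=> e /dE[+ _]; apply: contraPneq => <-; exact: iE.
by move=> v; apply/idP/idP => /HN.
Qed.

End Towers.

(** * Toasts *)

Lemma orientation_of_rel (X : topologicalType) (E : set (X * X)) (F O : X -> X -> Prop) :
  (forall x y, F x y <-> E (x, y)) -> BR O -> orients F O -> balanced_rel O ->
  admits_borel_balanced_orientation E.
Proof.
move=> FE BO [OF oO] bO; exists [set p | O p.1 p.2]; split.
- by apply/borel_BR.
- split=> [[x y] /OF/FE//|x y /FE/oO].
  by [].
- exact: bO.
Qed.

Section EvenGraphs.
Variables (X : ptopologicalType) (c : X -> nat -> nat).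
Hypothesis Hc : std c.
Variables (I : countType) (f : I -> X -> X).

Lemma egraph_of (E : set (X * X)) : borel_graph E -> even_degrees E ->
  covers f (fun x y => E (x, y)) -> egraph f (fun x y => E (x, y)).
Proof.
move=> [[sE iE] /borel_BR BE] eE cE; split=> // x.
by have [n nn] := eE x; exists n.*2.
Qed.

End EvenGraphs.

Section Toast.
Variables (X : ptopologicalType) (c : X -> nat -> nat).
Hypothesis Hc : std c.
Variables (E : set (X * X)) (T : set {fset X}).
Hypotheses (bE : borel_graph E) (eE : even_degrees E) (cT : connected_toast E T).

Let img n (t : 'I_n -> X) : {fset X} := [fset x in codom t]%fset.

Lemma mem_img n (t : 'I_n -> X) x : x \in img t <-> exists i, t i = x.
Proof. by rewrite /img in_fset; split=> [/codomP[i ->]|[i <-]]; [exists i|exact: codom_f]. Qed.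

Lemma B_img n : Bor (cyl (@icode 'I_n X nat c)) (fun t => T (img t)).
Proof.
have [cc h1 h2] := Hc.
have [[BT _ _] _] := cT.
suff : mea (cyl (@icode 'I_n X nat c)) [set [set K : {fset X} | [set` K] `&` U !=set0] | U in @open X] (@img n).
  by apply.
apply: mea_gen => _ [U oU <-].
apply: (@Bor_ext _ _ (fun t : 'I_n -> X => exists i, U (t i))).
  move=> t; split=> [[i Ui]|[x /= [/mem_img[i <-] Ui]]]; last by exists i.
  by exists (t i); split=> //=; apply/mem_img; exists i.
apply: BorEx => i.
have mi : mea (cyl (@icode 'I_n X nat c)) (cyl c) (fun t => t i).
  by apply: mea_cyl => j v; exact: (@Bor_cyl _ _ (@icode 'I_n X nat c) (i, j)).
by apply: mi; apply/(borel_cyl h1 h2); exact: Bor_gen.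
Qed.

(** Members with [n] elements through [x], presented by injective enumerations: this replaces the
    space of finite sets by a power of [X], where uniformization applies. *)
Let P n (x : X) (t : 'I_n -> X) := T (img t) /\ (injective t /\ exists i, t i = x).

Lemma B_P n : Bor (cyl (pcode c (@icode 'I_n X nat c))) (fun p => @P n p.1 p.2).
Proof.
have [cc h1 h2] := Hc.
have ms : mea (cyl (pcode c (@icode 'I_n X nat c))) (cyl (@icode 'I_n X nat c)) snd.
  by apply: mea_cyl => j v; exact: (@Bor_cyl _ _ (pcode c (@icode 'I_n X nat c)) (inr j)).
apply: BorA; first exact: (ms _ (@B_img n)).
apply: BorA.
  apply: (@Bor_ext _ _ (fun p => forall i j, (forall k m, pcode c (@icode 'I_n X nat c) p (inr (i, k)) = m <-> pcode c (@icode 'I_n X nat c) p (inr (j, k)) = m) -> i = j)).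
    move=> p; split=> [H i j tij|H i j tij]; first by apply: H => k m; rewrite /= /icode /= tij.
    by apply: H; apply: cc.1; apply: funext => k; apply/(tij k).
  do 2 (apply: BorAll => ?); apply: BorI; last exact: Bor_cst.
  by do 2 (apply: BorAll => ?); apply: BorEq; exact: Bor_cyl.
apply: BorEx => i.
apply: (@Bor_ext _ _ (fun p => forall k m, pcode c (@icode 'I_n X nat c) p (inr (i, k)) = m <-> pcode c (@icode 'I_n X nat c) p (inl k) = m)).
  move=> p; split=> [H|H k m]; last by rewrite /= /icode /= H.
  by apply: cc.1; apply: funext => k; apply/(H k).
by do 2 (apply: BorAll => ?); apply: BorEq; exact: Bor_cyl.
Qed.

(** By (T2) two members of the same size are equal or disjoint, so the members of size [n] are the
    classes of [R n]. *)
Let R n x y := exists K, (T K /\ #|` K|%fset = n) /\ (x \in K /\ y \in K).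

Lemma toast_sub K L x : T K -> T L -> x \in K -> x \in L -> (#|` L| <= #|` K|)%fset -> K <> L ->
  forall u, u \in L -> u \in K /\ forall v, E (u, v) -> v \in K.
Proof.
move=> TK TL xK xL LK KL.
have [[_ _ T2] _] := cT; case: (T2 _ _ TK TL KL) => [D|S|S].
- have : (B1 E [set` K] `&` [set` L]) x by split=> //; left.
  by rewrite D.
- case: KL; apply/eqP; rewrite eqEfcard LK andbT; apply/fsubsetP => u uK.
  by apply: S; left.
- by move=> u uL; split=> [|v uv]; apply: S; [left|right; exists u].
Qed.

Lemma R_trans n x y z : R n x y -> R n y z -> R n x z.
Proof.
move=> [K [[TK Kn] [xK yK]]] [L [[TL Ln] [yL zL]]].
have [e|ne] := pselect (K = L); first by subst L; exists K.
by exists K; split=> //; split=> //; apply: (toast_sub TK TL yK yL _ ne zL).1; rewrite Kn Ln.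
Qed.

Lemma R_finite n x : finite_set (R n x).
Proof.
have [[K [[TK Kn] [xK _]]]|nx] := pselect (R n x x); last first.
  by apply: (@sub_finite_set _ _ set0) => // y [K [? [? _]]]; apply: nx; exists K.
apply: (@sub_finite_set _ _ [set` K]) => // y [L [[TL Ln] [xL yL]]] /=.
have [->//|ne] := pselect (K = L).
by apply: (toast_sub TK TL xK xL _ ne yL).1; rewrite Kn Ln.
Qed.

Lemma P_finite n x : finite_set (@P n x).
Proof.
have /finite_seqP[s Rs] := R_finite n x.
apply: (@sub_finite_set _ _ [set (fun i => nth point s (g i)) | g in [set: {ffun 'I_n -> 'I_(size s)}]]); last first.
  by apply: finite_image; exact: finite_finset.
move=> t [Tt [it [i0 ti0]]].
have ts i : t i \in s.
  have : R n x (t i).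
    exists (img t); split; last by split; apply/mem_img; [exists i0|exists i].
    by split=> //; rewrite /img card_fseq undup_id ?size_codom ?card_ord//; exact/injectiveP.
  by rewrite -[R n x]/([set y | R n x y]) Rs.
have si i : index (t i) s < size s by rewrite index_mem.
exists [ffun i => Ordinal (si i)] => //; apply: funext => i.
by rewrite ffunE /= nth_index.
Qed.

Lemma R_P n x y : R n x y <-> exists t, @P n x t /\ exists i, t i = y.
Proof.
split=> [[K [[TK Kn] [xK yK]]]|[t [[Tt [it [i ti]]] [j tj]]]]; last first.
  exists (img t); split; last by split; apply/mem_img; [exists i|exists j].
  by split=> //; rewrite /img card_fseq undup_id ?size_codom ?card_ord//; exact/injectiveP.
pose t (i : 'I_n) := nth point (enum_fset K) i.
have sz : size (enum_fset K) = n by [].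
have tK z : z \in K -> exists i, t i = z.
  move=> zK; have zi : index z (enum_fset K) < n by rewrite -[X in _ < X]sz index_mem.
  by exists (Ordinal zi); rewrite /t /= nth_index.
have KE : img t = K.
  apply/fsetP => z; apply/idP/idP => [/mem_img[i <-]|/tK h]; last exact/mem_img.
  by rewrite /t; apply: mem_nth; rewrite sz.
exists t; split; last exact: tK.
split; first by rewrite KE.
split; last exact: tK.
move=> i j /eqP; rewrite /t nth_uniq ?sz ?fset_uniq// => /eqP h; exact: val_inj.
Qed.

Lemma toast_moves : exists (J : countType) (g : J -> X -> X), [/\ forall j, mX (g j),
  forall n, covers g (R n) & forall n, BR (R n)].
Proof.
have [cc h1 h2] := Hc.
have HH n : {Dh : (nat -> X -> Prop) * (nat -> X -> ('I_n -> X)) |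
    [/\ forall k, Bor (cyl c) (Dh.1 k), forall k, mea (cyl c) (cyl (@icode 'I_n X nat c)) (Dh.2 k)
    & forall x t, @P n x t <-> exists k, Dh.1 k x /\ Dh.2 k x = t]}.
  by apply: cid; have [D [h H]] := lusin_novikov cc (coded_icode _ cc) (fun=> point) (@B_P n) (@P_finite n); exists (D, h).
pose D n := (sval (HH n)).1; pose h n := (sval (HH n)).2.
have Dh n : [/\ forall k, Bor (cyl c) (D n k), forall k, mea (cyl c) (cyl (@icode 'I_n X nat c)) (h n k)
    & forall x t, @P n x t <-> exists k, D n k x /\ h n k x = t] := svalP (HH n).
pose J : countType := {n : nat & (nat * 'I_n)%type}.
pose g (j : J) x := if pselect (D (tag j) (tagged j).1 x) then h (tag j) (tagged j).1 x (tagged j).2 else x.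
have mg j : mX (g j).
  apply: mea_if; last exact: mea_id.
    by apply/(borel_cyl h1 h2); have [] := Dh (tag j).
  have [_ mh _] := Dh (tag j).
  move=> A /(borel_cyl h1 h2) BA; apply/(borel_cyl h1 h2).
  have mi : mea (cyl (@icode 'I_(tag j) X nat c)) (cyl c) (fun t => t (tagged j).2).
    by apply: mea_cyl => k v; exact: (@Bor_cyl _ _ (@icode 'I_(tag j) X nat c) ((tagged j).2, k)).
  exact: (mh _ _ (mi _ BA)).
have PD n x t : @P n x t <-> exists k, D n k x /\ h n k x = t by have [_ _] := Dh n; apply.
have gD n k i x : D n k x -> g (existT _ n (k, i)) x = h n k x i.
  by move=> Dk; rewrite /g /=; case: (pselect (D n k x)).
have RE n x y : R n x y <-> exists k i, D n k x /\ g (existT _ n (k, i)) x = y.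
  rewrite R_P; split=> [[t [/PD[k [Dk ht]] [i ti]]]|[k [i [Dk +]]]].
    by exists k, i; split=> //; rewrite gD// ht.
  rewrite gD// => <-; exists (h n k x); split; last by exists i.
  by apply/PD; exists k.
exists J, g; split=> //.
  by move=> n x y /RE[k [i [_ e]]]; exists (existT _ n (k, i)).
move=> n; apply: (@Bor_ext _ _ (fun p => exists k i, D n k p.1 /\ g (existT _ n (k, i)) p.1 = p.2)).
  by move=> p; rewrite RE.
do 2 (apply: BorEx => ?); apply: BorA.
  by apply: (mfst Hc); apply/(borel_cyl h1 h2); have [] := Dh n.
by apply: (BX_eq Hc); [exact: mea_comp (mfst Hc) (mg _)|exact: msnd Hc].
Qed.

(** Stage [n] treats the members with [n] elements. By then edges have been removed only inside
    smaller members, so (T3) provides paths of surviving edges outside the core. A point in two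
    members lies in the core of the larger one and ends up isolated; hence each final component with
    an edge lies in a single member. *)
Theorem toast_orientation : admits_borel_balanced_orientation E.
Proof.
have [J [g [mg cg BRn]]] := toast_moves.
have mf := words_moves mg; set f := fun w x => foldr g x w in mf.
have cR n : covers f (R n) by move=> x y /cg[j <-]; exists [:: j].
have [[_ T1 _] T3] := cT.
have [[sE iE] BE] := bE.
have ET x y : E (x, y) -> exists K, T K /\ (x \in K /\ y \in K).
  by rewrite -T1 => -[K TK [_ [/= xK yK]]]; exists K.
have ER x y : E (x, y) -> exists n, R n x y by move=> /ET[K [TK xy]]; exists #|` K|%fset, K.
have cE : covers f (fun x y => E (x, y)) by move=> x y /ER[n]; exact: cR.
have gE := egraph_of bE eE cE.
pose core n x := R n x x /\ exists m, m < n /\ R m x x.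
have Rsym n x y : R n x y -> R n y x by move=> [K [? [? ?]]]; exists K.
have Rrefl n x y : R n x y -> R n x x by move=> [K [? [? ?]]]; exists K.
have coreE n x y : core n x -> E (x, y) -> R n x y.
  move=> [[K [[TK Kn] [xK _]]] [m [mn [L [[TL Lm] [xL _]]]]]] Exy; exists K; split=> //; split=> //.
  have KL : K <> L by move=> e; move: mn; rewrite -Kn -Lm e ltnn.
  by apply: (toast_sub TK TL xK xL _ KL xL).2; rewrite // Kn Lm ltnW.
pose Inv n E' := (forall x y, E' x y -> E (x, y)) /\
  ((forall x y, E (x, y) -> ~ E' x y -> exists m, m < n /\ R m x y) /\
   forall m x y, m < n -> core m x -> ~ E' x y).
have BXd n : BX (fun x => R n x x) by apply: (BR_mX Hc (BRn n)); exact: mea_id.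
have [||Es [Es0 gEs IEs sEs]] := @tower X _ f Inv _ gE.
- by split=> //; split=> // x y _ h; case: h.
- move=> n E' gE' [E'E [used cored]].
  have [|||||F [eF FR cF]] := @core_stage X c Hc _ f mf E' (R n) (core n) gE' (BRn n) (cR n) (Rsym n).
  + exact: R_trans.
  + exact: R_finite.
  + by apply: BorA => //; apply: BorEx => m; apply: BorAc.
  + by move=> x y cx /E'E; exact: coreE.
  + move=> w w' _ _ nw nw' [K [[TK Kn] [wK w'K]]] _ _ _ _.
    have out a : a \in K -> ~ core n a ->
        ([set` K] `\` \bigcup_(L in [set L | T L /\ (L `<` K)%fset]) [set` L]) a.
      move=> aK na; split=> // -[L [TL LK] aL]; apply: na; split; first by exists K.
      by exists #|` L|%fset; split; [rewrite -Kn; exact: fproper_ltn_card|exists L].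
    have ncore a : ([set` K] `\` \bigcup_(L in [set L | T L /\ (L `<` K)%fset]) [set` L]) a ->
        ~ exists m, m < n /\ R m a a.
      move=> [aK na] [m [mn [L [[TL Lm] [aL _]]]]]; apply: na; exists L => //; split=> //.
      have KL : K <> L by move=> e; move: mn; rewrite -Kn -Lm e ltnn.
      rewrite fproperEcard Kn Lm mn andbT; apply/fsubsetP => u uL.
      by apply: (toast_sub TK TL aK aL _ KL uL).1; rewrite Kn Lm ltnW.
    apply: rtc_mono (T3 _ TK _ _ (out _ wK nw) (out _ w'K nw')) => a b [Eab [/= ha hb]].
    split; last by split; split; [exists K; split=> //; split=> //; case: ha|move=> [_ /(ncore _ ha)]
      |exists K; split=> //; split=> //; case: hb|move=> [_ /(ncore _ hb)]].
    apply: contrapT => nE'; have [m [mn Rm]] := used _ _ Eab nE'.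
    by apply: (ncore _ ha); exists m; split=> //; exact: Rrefl Rm.
  + exists F; split=> //; split; first by move=> x y [/E'E].
    split=> [x y Exy nr|m x y].
      have [E'xy|nE'] := pselect (E' x y); last first.
        by have [m [mn Rm]] := used _ _ Exy nE'; exists m; split=> //; exact: ltnW.
      exists n; split=> //; apply: FR; apply: contrapT => nF; exact: nr.
    rewrite ltnS leq_eqVlt => /predU1P[->|mn] cx [E'xy nF]; last exact: cored mn cx E'xy.
    by apply: nF; exact: cF.
have [||O [BO oO bO]] := @tower_orientation X c Hc _ f mf Es (fun=> True) gEs sEs (Bor_cst _ _).
- by [].
- move=> x _.
  have fin K : T K -> (forall L, T L -> x \in L -> L = K) -> x \in K -> forall y,
      rtc (fun x y => forall n, Es n x y) x y -> y \in K.
    move=> TK uK xK y /clos_rt_rtn1_iff H.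
    suff : y \in K /\ forall L, T L -> y \in L -> L = K by case.
    elim: H => [//|u v Huv _ [uK' uniq_u]].
    have Euv : E (u, v) by have := Huv 0; rewrite Es0.
    have [K' [TK' [uK'' vK']]] := ET _ _ Euv.
    have eK := uniq_u _ TK' uK''; subst K'; split=> // L TL vL; apply: contrapT => LK.
    have nc n : ~ core n v by move=> cv; apply: ((IEs n.+1).2.2 n v u (ltnSn n) cv); have [_ s _ _ _] := gEs n.+1; exact: s.
    case: (ltngtP #|` L|%fset #|` K|%fset) => lt.
    + apply: (nc #|` K|%fset); split; first by exists K.
      by exists #|` L|%fset; split=> //; exists L.
    + apply: (nc #|` L|%fset); split; first by exists L.
      by exists #|` K|%fset; split=> //; exists K.
    + have le : (#|` K| <= #|` L|)%fset by rewrite lt.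
      by have [uL _] := toast_sub TL TK vL vK' le LK uK'; apply: LK; exact: uniq_u.
  have [[y Hy]|ny] := pselect (exists y, forall n, Es n x y); last first.
    apply: (@sub_finite_set _ _ [set x]) => // y /clos_rt_rt1n_iff H; case: H ny => // u v Huv _ [].
    by exists u.
  have Exy : E (x, y) by have := Hy 0; rewrite Es0.
  have [K [TK [xK yK]]] := ET _ _ Exy.
  have nc n : ~ core n x by move=> cx; exact: ((IEs n.+1).2.2 n x y (ltnSn n) cx).
  have uK L : T L -> x \in L -> L = K.
    move=> TL xL; apply: contrapT => LK.
    case: (ltngtP #|` L|%fset #|` K|%fset) => lt.
    + apply: (nc #|` K|%fset); split; first by exists K.
      by exists #|` L|%fset; split=> //; exists L.
    + apply: (nc #|` L|%fset); split; first by exists L.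
      by exists #|` K|%fset; split=> //; exists K.
    + have le : (#|` K| <= #|` L|)%fset by rewrite lt.
      have le' : (#|` L| <= #|` K|)%fset by rewrite lt.
      have LK' := LK; apply: LK; apply/fsetP => u; apply/idP/idP => h.
        by apply: (toast_sub TK TL xK xL le' (nesym LK') h).1.
      by apply: (toast_sub TL TK xL xK le LK' h).1.
  apply: (@sub_finite_set _ _ [set` K]) => // z /=; exact: fin.
apply: orientation_of_rel BO oO bO => x y; rewrite Es0; split=> [[]|]//.
Qed.

End Toast.

(** * Baire category *)

Section Category.
Variable X : topologicalType.
Implicit Types A B U V W : set X.

Lemma nowhere_denseP A U : nowhere_dense A -> open U -> U !=set0 ->
  exists V, [/\ open V, V !=set0, V `<=` U & V `&` A = set0].
Proof.
move=> nA oU [x Ux]; exists (U `&` ~` closure A); split.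
- by apply: openI => //; rewrite openC; exact: closed_closure.
- apply: contrapT => nV; have : (interior (closure A)) x.
    rewrite /interior /=; apply: (@filterS _ (nbhs x) _ U); last exact: open_nbhs_nbhs.
    by move=> y Uy; apply: contrapT => ny; apply: nV; exists y.
  by rewrite (nA : interior (closure A) = set0).
- by move=> y [].
- by apply/seteqP; split=> y // [[_ ny] Ay]; apply: ny; exact: subset_closure.
Qed.

Lemma nowhere_denseI A : (forall U, open U -> U !=set0 ->
    exists V, [/\ open V, V !=set0, V `<=` U & V `&` A = set0]) -> nowhere_dense A.
Proof.
move=> H; apply/seteqP; split=> x // xi.
have [V [oV [y Vy] VU VA]] := H _ (open_interior (closure A)) (ex_intro _ x xi).
have cy : closure A y by exact: interior_subset (VU _ Vy).
have [z [Az Vz]] := cy V (open_nbhs_nbhs (conj oV Vy)).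
by have : (V `&` A) z by []; rewrite VA.
Qed.

Lemma meagre_sub A B : B `<=` A -> meagre A -> meagre B.
Proof.
move=> BA [F nF FA]; exists (fun n => F n `&` B).
  move=> n; apply/seteqP; split=> // x xi.
  have : interior (closure (F n)) x by apply: interiorS xi; apply: closureS => y [].
  by rewrite (nF n : interior _ = set0).
apply/seteqP; split=> [x Bx|x [n _ []]//].
by have := BA _ Bx; rewrite FA => -[n _ Fx]; exists n.
Qed.

Lemma meagre_nowhere_dense A : nowhere_dense A -> meagre A.
Proof. by move=> nA; exists (fun=> A) => //; apply/seteqP; split=> [x Ax|x []//]; exists 0. Qed.

Lemma meagre_bigcup (A : nat -> set X) : (forall n, meagre (A n)) -> meagre (\bigcup_n A n).
Proof.
move=> mA; have /choice[F HF] : forall n, exists F : nat -> set X, (forall k, nowhere_dense (F k)) /\ A n = \bigcup_k F k.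
  by move=> n; have [F] := mA n; exists F.
pose dec (n : nat) : nat * nat := if unpickle n is Some p then p else (0, 0).
exists (fun n => F (dec n).1 (dec n).2).
  by move=> n; exact: (HF _).1.
apply/seteqP; split=> [x [n _]|x [k _ Fx]].
  by rewrite (HF n).2 => -[k _ Fx]; exists (pickle (n, k)) => //; rewrite /dec pickleK.
by exists (dec k).1 => //; rewrite (HF _).2; exists (dec k).2.
Qed.

Lemma meagreU A B : meagre A -> meagre B -> meagre (A `|` B).
Proof.
move=> mA mB; apply: (@meagre_sub (\bigcup_n (fun n => if n is 0 then A else B) n)).
  by move=> x [?|?]; [exists 0|exists 1].
by apply: meagre_bigcup => -[].
Qed.

Lemma meagre0 : meagre (set0 : set X).
Proof.
apply: meagre_nowhere_dense; apply: nowhere_denseI => U oU U0; exists U; split=> //.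
exact: setI0.
Qed.

Lemma meagre_count (I : countType) (A : I -> set X) : (forall i, meagre (A i)) -> meagre [set x | exists i, A i x].
Proof.
move=> mA; pose F (n : nat) := if @choice.unpickle I n is Some i then A i else set0.
apply: (@meagre_sub (\bigcup_n F n)).
  by move=> x [i Aix]; exists (pickle i) => //; rewrite /F pickleK.
by apply: meagre_bigcup => n; rewrite /F; case: (@choice.unpickle I n) => [i|]; [exact: mA|exact: meagre0].
Qed.

(** For a complement the open set is the exterior of [W], since the boundary of an open set is
    nowhere dense. *)
Lemma baire_property A : BX A -> exists2 W, open W & meagre ((A `\` W) `|` (W `\` A)).
Proof.
apply: (Bor_ind (Q := fun A : set X => exists2 W, open W & meagre ((A `\` W) `|` (W `\` A)))).
- by move=> U oU; exists U => //; rewrite setDv setU0; exact: meagre0.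
- move=> {}A [W oW mW]; exists (~` closure W); first by rewrite openC; exact: closed_closure.
  apply: (meagre_sub (A := ((A `\` W) `|` (W `\` A)) `|` (closure W `\` W))).
    move=> x [[nA /contrapT cW]|[nW nnA]].
      by have [Wx|nWx] := pselect (W x); [left; right|right].
    by left; left; split; [exact: contrapT|move=> /subset_closure].
  apply: meagreU => //; apply: meagre_nowhere_dense; apply: nowhere_denseI => U oU [x Ux].
  have [[y [Wy Uy]]|nU] := pselect (exists y, W y /\ U y).
    exists (U `&` W); split; [exact: openI|by exists y|by move=> z []|].
    by apply/seteqP; split=> z // [[_ Wz] [_]].
  exists U; split=> //; first by exists x.
  apply/seteqP; split=> z // [Uz [cz _]]; apply: nU.
  by have [y [Wy Uy]] := cz _ (open_nbhs_nbhs (conj oU Uz)); exists y.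
- move=> F H; have /choice[W HW] : forall n, exists W, open W /\ meagre ((F n `\` W) `|` (W `\` F n)).
    by move=> n; have [W] := H n; exists W.
  exists (\bigcup_n W n).
    by apply: bigcup_open => n _; case: (HW n).
  apply: (meagre_sub (A := \bigcup_n ((F n `\` W n) `|` (W n `\` F n)))).
    move=> x [[[n Fx] nW]|[[n _ Wx] nF]]; exists n => //.
      by left; split=> // Wx; apply: nW; exists n.
    by right; split=> // Fx; apply: nF; exists n.
  by apply: meagre_bigcup => n; case: (HW n).
- exists set0; first exact: open0.
  apply: (meagre_sub (A := set0)); [by move=> x [[]|[]]|exact: meagre0].
Qed.

Lemma borel_nonmeagre A : BX A -> ~ meagre A -> exists W, [/\ open W, W !=set0 & meagre (W `\` A)].
Proof.
move=> /baire_property[W oW mW] nA; exists W; split=> //; last by apply: meagre_sub mW; right.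
apply: contrapT => nW; apply: nA; apply: meagre_sub mW => x Ax; left; split=> // Wx.
by apply: nW; exists x.
Qed.

End Category.

Section PolishCategory.
Variables (R : realType) (X : ptopologicalType).
Hypothesis polishX : polish R X.

Lemma polish_basis : exists U : nat -> set X, (forall n, open (U n)) /\
  forall x A, nbhs x A -> exists n, U n x /\ U n `<=` A.
Proof.
have [[D /pcard_injP[h hI] dD] [d [[d0 dE dC dT] dm dc]]] := polishX.
pose e n : X := if pselect (exists2 x, D x & h x = n) is left w then sval (cid2 w) else point.
have ballo x (r : R) : open [set y | (d x y < r)%R].
  rewrite openE => y /= xy; apply/dm; exists (r - d x y)%R; first by rewrite subr_gt0.
  by move=> z /= yz; apply: le_lt_trans (dT x y z) _; rewrite addrC -ltrBrDr.
have de x (eps : R) : (0 < eps)%R -> exists n, (d x (e n) < eps)%R.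
  move=> eps0; have [y [xy Dy]] : [set y | (d x y < eps)%R] `&` D !=set0.
    by apply: dD => //; exists x => /=; rewrite (dE x x).2.
  exists (h y); rewrite /e; case: pselect => [w|[]]; last by exists y.
  by case: cid2 => z /= Dz /hI-> //; rewrite inE.
pose q n : R := (n.+1%:R^-1)%R.
pose B (p : nat * nat) : set X := [set y | (d (e p.1) y < q p.2)%R].
exists (fun n => if unpickle n is Some p then B p else setT); split.
  by move=> n; case: unpickle => [p|]; [exact: ballo|exact: openT].
move=> x A /dm[eps eps0 epsA].
have [k qk] : exists k, (q k + q k < eps)%R.
  have e2 : (0 < eps / 2)%R by rewrite divr_gt0// ltr0n.
  have [k] := ltr_add_invr e2; rewrite add0r -/(q k) => qk; exists k.
  have -> : eps = (eps / 2 + eps / 2)%R by rewrite -mulr2n -[(_ *+ 2)%R]mulr_natr divfK ?pnatr_eq0.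
  exact: ltrD.
have [n en] := de x (q k) ltac:(by rewrite invr_gt0 ltr0n).
exists (pickle (n, k)); rewrite pickleK; split; first by rewrite /B /= dC.
move=> y; rewrite /B /= => ey; apply: epsA => /=; apply: le_lt_trans (dT x (e n) y) _.
by apply: lt_trans qk; exact: ltrD.
Qed.

Theorem baire (U : set X) : open U -> U !=set0 -> ~ meagre U.
Proof.
move=> oU [x0 Ux0] [F nF UF].
have [_ [d [[d0 dE dC dT] dm dc]]] := polishX.
have dxx x : d x x = 0%R by apply/dE.
have ballo x (r : R) : open [set y | (d x y < r)%R].
  rewrite openE => y /= xy; apply/dm; exists (r - d x y)%R; first by rewrite subr_gt0.
  by move=> z /= yz; apply: le_lt_trans (dT x y z) _; rewrite addrC -ltrBrDr.
pose q n : R := (n.+1%:R^-1)%R.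
have q0 n : (0 < q n)%R by rewrite invr_gt0 ltr0n.
have half (r : R) : (0 < r)%R -> (0 < r / 2)%R /\ (r / 2 < r)%R by move=> r0; lra.
(* The next closed ball lies in the previous open one, misses [F n] and has radius at most [q n];
   completeness then gives a point common to all the balls. *)
have /choice[nx Hnx] : forall s : nat * (X * R), exists t : X * R, (0 < s.2.2)%R ->
    [/\ (0 < t.2)%R, (t.2 <= q s.1)%R & forall y, (d t.1 y <= t.2)%R -> (d s.2.1 y < s.2.2)%R /\ ~ F s.1 y].
  move=> [n [x r]] /=; have [r0|nr] := boolP (0 < r)%R; last by exists (x, r).
  have [V [oV [y Vy] VU VF]] := nowhere_denseP (nF n) (ballo x r) ltac:(by exists x; rewrite /= dxx).
  have [eps eps0 epsV] := (dm _ _).1 (open_nbhs_nbhs (conj oV Vy)).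
  exists (y, Num.min (eps / 2)%R (q n)) => _ /=; split.
  - by rewrite lt_min q0 (half _ eps0).1.
  - by rewrite ge_min lexx orbT.
  - move=> z; rewrite le_min => /andP[yz _].
    have Vz : V z by apply: epsV => /=; apply: le_lt_trans yz (half _ eps0).2.
    by split=> [|Fz]; [exact: VU|have : (V `&` F n) z by []; rewrite VF].
have [r0 r00 r0U] := (dm _ _).1 (open_nbhs_nbhs (conj oU Ux0)).
pose s := fix s n := if n is m.+1 then nx (m, s m) else (x0, (r0 / 2)%R).
have spos n : (0 < (s n).2)%R by elim: n => [|n IH] /=; [exact: (half _ r00).1|case: (Hnx (n, s n) IH)].
have sle n : ((s n.+1).2 <= q n)%R by case: (Hnx (n, s n) (spos n)).
have snest n y : (d (s n.+1).1 y <= (s n.+1).2)%R -> (d (s n).1 y < (s n).2)%R /\ ~ F n y.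
  by case: (Hnx (n, s n) (spos n)) => _ _; apply.
have nest n k y : (d (s (k + n)).1 y <= (s (k + n)).2)%R -> (d (s n).1 y <= (s n).2)%R.
  by elim: k => // k IH /snest[/ltW/IH].
have sin n m : n <= m -> (d (s n).1 (s m).1 <= (s n).2)%R.
  by move=> /subnK <-; apply: (nest n (m - n)); rewrite dxx ltW.
have [|l lim] := dc (fun n => (s n).1).
  move=> eps eps0.
  have [k] := ltr_add_invr (half _ eps0).1; rewrite add0r -/(q k) => qk.
  exists k.+1 => m n km kn; apply: le_lt_trans (dT _ (s k.+1).1 _) _; rewrite dC.
  have := sin _ _ km; have := sin _ _ kn; have := sle k; lra.
have lin n : (d (s n).1 l <= (s n).2)%R.
  rewrite leNgt; apply/negP => H.
  have nb : nbhs l [set y | (d l y < d (s n).1 l - (s n).2)%R].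
    by apply/dm; exists (d (s n).1 l - (s n).2)%R => //; rewrite subr_gt0.
  have [N _ HN] := lim _ nb; have := HN (maxn N n) (leq_maxl _ _) => /=.
  have := sin n (maxn N n) (leq_maxr _ _); have := dT (s n).1 (s (maxn N n)).1 l.
  by rewrite [d (s (maxn N n)).1 l]dC; lra.
have Ul : U l by apply: r0U => /=; apply: le_lt_trans (lin 0) (half _ r00).2.
by have := Ul; rewrite UF => -[n _ Fl]; have [_] := snest n l (lin n.+1).
Qed.

End PolishCategory.

(** * One-ended graphs *)

Section Avoiding.
Variable X : choiceType.
Implicit Types (E F G : X -> X -> Prop) (S : seq X).

Lemma rtc_closed G (C : X -> Prop) x y : (forall a b, C a -> G a b -> C b) -> C x -> rtc G x y -> C y.
Proof. by move=> GC Cx /clos_rt_rtn1_iff; elim=> // a b Gab _ Ca; exact: GC Ca Gab. Qed.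

Lemma path_support G (C : X -> Prop) x y : (forall a b, C a -> G a b -> C b) -> C x -> rtc G x y ->
  exists N : seq X, (forall a, a \in N -> C a) /\ rtc (within G (fun a => a \in N)) x y.
Proof.
move=> GC Cx /clos_rt_rt1n_iff H; elim: H Cx => [u Cu|u v w Guv _ IH Cu].
  by exists [::]; split=> //; exact: rtc_refl.
have Cv := GC _ _ Cu Guv; have [N [NC vw]] := IH Cv.
exists [:: u, v & N]; split.
  by move=> a; rewrite !inE => /or3P[/eqP ->|/eqP ->|/NC].
apply: rtc_trans (rtc_step _) _; first by split; [exact: Guv|rewrite !inE !eqxx orbT].
by apply: rtc_mono vw => a b [? [aN bN]]; split=> //; rewrite !inE aN bN !orbT.
Qed.

Lemma path_supports (Q : X -> X -> Prop) G (C : X -> Prop) (T : seq X) :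
  (forall a b, C a -> G a b -> C b) -> (forall t, t \in T -> C t) ->
  (forall t t', t \in T -> t' \in T -> Q t t' -> rtc G t t') ->
  exists N : seq X, (forall a, a \in N -> C a) /\
    forall t t', t \in T -> t' \in T -> Q t t' -> rtc (within G (fun a => a \in N)) t t'.
Proof.
move=> GC CT H.
have [N [NC HN]] : exists N : seq X, (forall a, a \in N -> C a) /\
    forall p, p \in [seq (t, t') | t <- T, t' <- T] -> Q p.1 p.2 -> rtc (within G (fun a => a \in N)) p.1 p.2.
  have : forall p, p \in [seq (t, t') | t <- T, t' <- T] -> p.1 \in T /\ p.2 \in T.
    by move=> p /allpairsP[q [? ? ->]].
  elim: [seq (t, t') | t <- T, t' <- T] => [|[t t'] l IH] lT; first by exists [::].
  have [|N [NC HN]] := IH; first by move=> p pl; apply: lT; rewrite inE pl orbT.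
  have [/= tT t'T] := lT _ (mem_head _ _).
  have [q|nq] := pselect (Q t t'); last first.
    by exists N; split=> // p; rewrite inE => /predU1P[-> /nq|/HN].
  have [N' [N'C HN']] := path_support GC (CT _ tT) (H _ _ tT t'T q).
  exists (N' ++ N); split; first by move=> a; rewrite mem_cat => /orP[/N'C|/NC].
  move=> p; rewrite inE => /predU1P[->|/HN h] qp; [move: HN'|move: (h qp)];
    by apply: rtc_mono => a b [? [aN bN]]; split=> //; rewrite !mem_cat aN bN ?orbT.
exists N; split=> // t t' tT t'T; apply: (HN (t, t')).
by apply/allpairsP; exists (t, t').
Qed.

(* The form of one-endedness that survives the removal of the edges in a tile. *)
Definition endlike (E0 E : X -> X -> Prop) := forall x0 S, (forall s, s \in S -> rtc E0 x0 s) ->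
  exists S', [/\ {subset S <= S'}, forall s, s \in S' -> rtc E0 x0 s
    & forall x y, rtc E0 x0 x -> rtc E0 x0 y -> x \notin S' -> y \notin S' ->
        ~ isolated E x -> ~ isolated E y -> rtc (within E (fun a => a \notin S)) x y].

(** [S'] adds to [S] the finite components of the complement of [S] that contain a neighbour of [S].
    A vertex outside [S'] lies either in an infinite component, which is unique, or in a finite one
    without neighbours of [S], which is then the whole component of the graph. *)
Lemma one_ended_endlike (E : set (X * X)) : (forall x y, E (x, y) -> E (y, x)) ->
  (forall x, finite_set (fun y => E (x, y))) -> one_ended E ->
  endlike (fun x y => E (x, y)) (fun x y => E (x, y)).
Proof.
move=> sE fE oE x0 S Sx0.
pose E' x y := E (x, y); pose C := component E x0; pose F := [set` S].
have FC : F `<=` C by move=> s /= /Sx0.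
have CP a : C a <-> rtc E' x0 a by [].
pose W := within E' (fun a => C a /\ a \notin S).
have [N HN] := nbrs_list_all (E := E') S fE.
pose cmp y : set X := [set z | rtc W y z].
have cmpE y : cmp y = component (induced_graph E (C `\` F)) y.
  apply/seteqP; split=> z; apply: rtc_mono => a b.
    by move=> [Eab [[Ca na] [Cb nb]]]; split=> //; split; split=> //; exact/negP.
  by move=> [Eab [[Ca na] [Cb nb]]]; split=> //; split; split=> //; apply/negP.
have Wsym y z : cmp y z -> cmp z y by apply: rtc_sym => a b; apply: within_sym => u v; exact: sE.
have /choice[l Hl] : forall n, exists l : seq X, finite_set (cmp n) -> C n -> forall y, cmp n y <-> y \in l.
  move=> n; have [/finite_seqP[l e]|nf] := pselect (finite_set (cmp n)); last by exists [::].
  by exists l => _ _ y; have -> : cmp n y = [set` l] y by rewrite -e.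
have whole y : C y -> (forall n, cmp y n -> n \notin N) -> y \notin S -> forall z, C z -> rtc (within E' (fun a => a \notin S)) y z.
  move=> Cy ny yS z Cz.
  have yz : rtc E' y z by apply: rtc_trans ((CP _).1 Cz); apply: rtc_sym Cy => a b; exact: sE.
  have : (C z /\ z \notin S) /\ cmp y z; last first.
    by move=> [_]; apply: rtc_mono => a b [? [[? ?] [? ?]]].
  move: yz => /clos_rt_rtn1_iff; elim=> [|a b Eab _ [[Ca na] ya]]; first by split=> //; exact: rtc_refl.
  have Cb : C b by apply: rtc_trans Ca (rtc_step _).
  have nb : b \notin S.
    by apply/negP => bS; have := ny _ ya; rewrite (HN b)//; exact: sE.
  by split=> //; apply: rtc_trans ya (rtc_step _).
have cmpC y z : C y -> cmp y z -> C z.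
  by move=> Cy; apply: rtc_closed Cy => a b _ [_ [_ []]].
exists (S ++ flatten [seq [seq z <- l n | `[< C n /\ finite_set (cmp n) >]] | n <- N]); split.
- by move=> s sS; rewrite mem_cat sS.
- move=> s; rewrite mem_cat => /orP[/Sx0//|/flatten_mapP[n nN]].
  rewrite mem_filter => /andP[/asboolP[Cn fn]] /(Hl n fn Cn); exact: cmpC.
move=> x y Cx Cy; rewrite !mem_cat !negb_or => /andP[xS xl] /andP[yS yl] _ _.
have big z : C z -> z \notin S -> z \notin flatten [seq [seq z <- l n | `[< C n /\ finite_set (cmp n) >]] | n <- N] ->
    finite_set (cmp z) -> forall n, cmp z n -> n \notin N.
  move=> Cz zS zl fz n zn; apply/negP => nN; move/negP: zl; apply; apply/flatten_mapP; exists n => //.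
  have e : cmp n = cmp z.
    by apply/seteqP; split=> t; [exact: rtc_trans|apply: rtc_trans; exact: Wsym].
  have Cn := cmpC _ _ Cz zn.
  by rewrite mem_filter; apply/andP; split; [apply/asboolP; rewrite e|apply/Hl; rewrite ?e//; exact: rtc_refl].
have [fx|ix] := pselect (finite_set (cmp x)); first by apply: whole => //; exact: big.
have [fy|iy] := pselect (finite_set (cmp y)).
  apply: (@rtc_sym _ (within E' (fun a => a \notin S))); last by apply: whole => //; exact: big.
  by move=> a b; apply: within_sym => u v; exact: sE.
have [D [_ uD]] := oE x0 F FC (finite_seq S).
have ex : D = cmp x by apply: uD; split=> //; exists x => //; split=> //; exact/negP.
have ey : D = cmp y by apply: uD; split=> //; exists y => //; split=> //; exact/negP.
have : cmp x y by rewrite -ex ey; exact: rtc_refl.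
by apply: rtc_mono => a b [? [[? ?] [? ?]]].
Qed.

(** The hypothesis is applied to [S] enlarged by the tiles that meet it, so that detours through the
    other tiles stay outside [S]. *)
Lemma endlike_remove E0 E (L : Type) (K : L -> seq X) (P : L -> X -> X -> Prop) :
  (forall x y, E x y -> E y x) -> endlike E0 E -> (forall l, valid E true (K l) (P l)) ->
  (forall l l' u, u \in K l -> u \in K l' -> l = l') ->
  (forall l u v, u \in K l -> v \in K l -> rtc E0 u v) ->
  endlike E0 (fun u v => E u v /\ ~ exists l, P l u v).
Proof.
move=> sE eE PV Kd KE x0 S Sx0.
have /choice[t Ht] : forall s, exists t : seq X, (forall l, s \in K l -> {subset K l <= t}) /\
    forall u, u \in t -> rtc E0 s u.
  move=> s; have [[l sl]|ns] := pselect (exists l, s \in K l); last by exists [::]; split=> // l sl; case: ns; exists l.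
  by exists (K l); split=> [l' sl'|u]; [rewrite (Kd _ _ _ sl sl')|exact: KE].
have [|S' [S1S' S'x0 HS']] := eE x0 (S ++ flatten (map t S)).
  move=> s; rewrite mem_cat => /orP[/Sx0//|/flatten_mapP[s' s'S /(Ht s').2]].
  exact: rtc_trans (Sx0 _ s'S).
exists S'; split=> //; first by move=> s sS; apply: S1S'; rewrite mem_cat sS.
move=> x y x0x x0y xS yS nx ny.
have niso z : ~ isolated (fun u v => E u v /\ ~ exists l, P l u v) z -> ~ isolated E z.
  by move=> h i; apply: h => w [/i].
apply: (@reroute _ true E L K P sE PV Kd isT (fun a => a \notin S ++ flatten (map t S))) => //.
- by move=> z; rewrite mem_cat negb_or => /andP[].
- move=> l u v uS ul vl; apply/negP => vS; move/negP: uS; apply.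
  rewrite mem_cat; apply/orP; right; apply/flatten_mapP; exists v => //.
  exact: (Ht v).1 ul.
- by apply: HS' => //; exact: niso.
Qed.

(** [endlike] is used twice: around [x], to join the outer neighbours of [S1] away from [x], and
    around the resulting set [B], to join the vertices outside [S2] away from [B]. Adding the
    supports of finitely many such paths keeps the tile finite. *)
Lemma endlike_tile E0 E x : (forall x y, E x y -> E y x) -> (forall x, ~ E x x) ->
  (forall x, finite_set (E x)) -> even_rel E -> (forall x y, E x y -> E0 x y) -> endlike E0 E ->
  exists K P, [/\ x \in K, forall u, u \in K -> rtc E0 x u, valid E true K P & forall y, E x y -> P x y].
Proof.
move=> sE iE fE eE EE0 oE; pose C := rtc E0 x.
have Ccl a b : C a -> E a b -> C b by move=> Ca /EE0 h; apply: rtc_trans Ca (rtc_step _).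
have grow (S : seq X) : (forall s, s \in S -> C s) -> exists N : seq X, (forall a, a \in N -> C a) /\
    forall u v, u \in S -> E u v -> v \in N.
  move=> SC; have [N HN] := nbrs_list_all S fE.
  exists [seq a <- N | `[< C a >]]; split=> [a|u v uS Euv]; rewrite mem_filter; first by case/andP => /asboolP.
  by rewrite (HN _ _ uS Euv) andbT; apply/asboolP; apply: Ccl Euv; exact: SC.
have [|S1 [SS1 CS1 HS1]] := oE x [:: x]; first by move=> s; rewrite inE => /eqP ->; exact: rtc_refl.
have [N1 [CN1 HN1]] := grow _ CS1.
have [|||B1' [CB1 HB1]] := @path_supports (fun w w' => [/\ w \notin S1, w' \notin S1, ~ isolated E w & ~ isolated E w'])
    (within E (fun a => a \notin [:: x])) C N1.
- by move=> a b Ca [Eab _]; exact: Ccl Eab.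
- exact: CN1.
- by move=> w w' /CN1 wC /CN1 w'C [? ? ? ?]; exact: HS1.
pose B := S1 ++ N1 ++ B1'.
have CB s : s \in B -> C s by rewrite !mem_cat => /or3P[/CS1|/CN1|/CB1].
have [S2 [BS2 CS2 HS2]] := oE x B CB.
have [N2 [CN2 HN2]] := grow _ CS2.
pose M := S2 ++ N2.
have CM s : s \in M -> C s by rewrite !mem_cat => /orP[/CS2|/CN2].
have [|||K1 [CK1 HK1]] := @path_supports (fun w w' => [/\ w \notin S2, w' \notin S2, ~ isolated E w & ~ isolated E w'])
    (within E (fun a => a \notin B)) C M.
- by move=> a b Ca [Eab _]; exact: Ccl Eab.
- exact: CM.
- by move=> w w' /CM wC /CM w'C [? ? ? ?]; exact: HS2.
have niso a b : E a b -> ~ isolated E a by move=> h /(_ b).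
have [||||||||P [VP cP]] := @plan X E sE iE fE eE S1 [:: x] B M (M ++ K1) (fun a => a \notin S2).
- by [].
- by move=> s sS; rewrite !mem_cat sS.
- by move=> s sB; rewrite !mem_cat BS2.
- by move=> s sM; rewrite mem_cat sM.
- by move=> u v uS Euv; rewrite !mem_cat (HN1 u v)// orbT.
- move=> w w' wS w'S [s sS Ews] [s' s'S Ews'].
  have wN : w \in N1 by apply: HN1 (sE _ _ Ews).
  have w'N : w' \in N1 by apply: HN1 (sE _ _ Ews').
  have := HB1 w w' wN w'N (And4 wS w'S (niso _ _ Ews) (niso _ _ Ews')).
  by apply: rtc_mono => a b [[Eab [na nb]] [aB bB]]; split=> //; split; split=> //; rewrite !mem_cat ?aB ?bB !orbT.
- move=> u v uM /negP; rewrite negbK => uS Euv.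
  by rewrite mem_cat (HN2 u v)// orbT.
- move=> w w' wS w'S wM w'M nw nw'.
  have := HK1 w w' wM w'M (And4 wS w'S nw nw').
  by apply: rtc_mono => a b [[Eab [na nb]] [aB bB]]; split=> //; split; split=> //; rewrite [_ \in M ++ K1]mem_cat ?aB ?bB orbT.
exists (M ++ K1), P; split=> //.
- by rewrite !mem_cat BS2// !mem_cat SS1// mem_head.
- by move=> u; rewrite mem_cat => /orP[/CM|/CK1].
- by move=> y; apply: cP; rewrite mem_head.
Qed.

End Avoiding.

(** * Balanced orientations on a comeagre set *)

Lemma words_inverse (X : Type) (J : Type) (g : J -> X -> X) :
  (forall j x, exists i, g i (g j x) = x) ->
  forall w x, exists v, foldr g (foldr g x w) v = x.
Proof.
move=> ginv; elim=> [|j w IH] x /=; first by exists [::].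
have [v Hv] := IH x; have [i Hi] := ginv j (foldr g x w).
by exists (v ++ [:: i]); rewrite foldr_cat /= Hi.
Qed.

(** Uniformization enumerates the neighbours by Borel maps. Words in these maps enumerate the
    component, and the symmetry of [E] provides a way back from every point. *)
Lemma graph_moves (X : ptopologicalType) (c : X -> nat -> nat) (E : X -> X -> Prop) :
  std c -> BR E -> (forall x y, E x y -> E y x) -> (forall x, finite_set (E x)) ->
  exists f : seq nat -> X -> X, [/\ moves f, covers f E, forall w x, exists v, f v (f w x) = x
    & forall w x, rtc E x (f w x)].
Proof.
move=> Hc BE sE fE; have [cc h1 h2] := Hc.
have [D [h [BD mh DE]]] := lusin_novikov cc cc point ((borel_pcyl h1 h2 _).1 BE) fE.
pose g n x := if pselect (D n x) then h n x else x.
have mg n : mX (g n).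
  apply: mea_if; last exact: mea_id; first by apply/(borel_cyl h1 h2).
  by move=> A /(borel_cyl h1 h2) BA; apply/(borel_cyl h1 h2); exact: mh.
have gE n x : g n x = x \/ E x (g n x).
  by rewrite /g; case: (pselect (D n x)) => [Dx|nD] /=; [right; apply/DE; exists n|left].
have Eg x y : E x y -> exists n, g n x = y.
  by move=> /DE[n [Dn <-]]; exists n; rewrite /g; case: (pselect (D n x)).
exists (fun w x => foldr g x w); split.
- exact: words_moves.
- by move=> x y /Eg[n <-]; exists [:: n].
- apply: words_inverse => n x; case: (gE n x) => [e|/sE/Eg//].
  by exists n; rewrite !e.
- elim=> [|n w IH] x /=; first exact: rtc_refl.
  by case: (gE n (foldr g x w)) => [->//|h']; apply: rtc_trans (IH x) (rtc_step _).
Qed.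

(** * Borel families of disjoint tiles described by countably many labels *)

Section Labels.
Variables (X : ptopologicalType) (c : X -> nat -> nat).
Hypothesis Hc : std c.
Variables (I : countType) (f : I -> X -> X).
Hypotheses (mf : moves f) (inv : forall i x, exists j, f j (f i x) = x).

(* A label lists maps together with pairwise incompatible neighbourhoods of
   their values and maps leading back: a point of the tile then determines its
   position in the tile, hence the center. *)
Definition label := seq (I * (seq nat * I)).
Implicit Types l : label.

Definition center l z := forall e, e \in l -> [/\ prefix c e.2.1 (f e.1 z), f e.2.2 (f e.1 z) = z
  & forall e', e' \in l -> prefix c e.2.1 (f e'.1 z) -> e = e'].

Definition tile_rel l x y := exists z, center l z /\ exists e e', (e \in l /\ e' \in l) /\ (f e.1 z = x /\ f e'.1 z = y).

Lemma BX_center l : BX (center l).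
Proof.
have [mfi _ _] := mf.
apply: (@Bor_ext _ _ (fun z => forall e, e \in l -> prefix c e.2.1 (f e.1 z) /\ (f e.2.2 (f e.1 z) = z /\
  forall e', e' \in l -> prefix c e.2.1 (f e'.1 z) -> e = e'))).
  by move=> z; split=> H e /H; [move=> [? [? ?]]|move=> [? ? ?]].
apply: BorAll => e; apply: BorIc => _; apply: BorA; first exact: (mfi _ _ (BX_prefix Hc _)).
apply: BorA; first by apply: (BX_eq Hc); [exact: mea_comp (mfi _) (mfi _)|exact: mea_id].
apply: BorAll => e'; apply: BorIc => _; apply: BorI; last exact: Bor_cst.
exact: (mfi _ _ (BX_prefix Hc _)).
Qed.

Lemma center_uniq l z z' e e' : center l z -> center l z' -> e \in l -> e' \in l -> f e.1 z = f e'.1 z' ->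
  e = e' /\ z = z'.
Proof.
move=> cz cz' el e'l ee; have [pe fe _] := cz _ el; have [_ fe' _] := cz' _ e'l.
have [_ _ H] := cz' _ el; have e1 : e = e' by apply: H => //; rewrite -ee.
by split=> //; rewrite -[LHS]fe ee e1.
Qed.

Lemma tile_rel_sym l x y : tile_rel l x y -> tile_rel l y x.
Proof. by move=> [z [cz [e [e' [[? ?] [? ?]]]]]]; exists z; split=> //; exists e', e. Qed.

Lemma tile_rel_trans l x y z : tile_rel l x y -> tile_rel l y z -> tile_rel l x z.
Proof.
move=> [u [cu [e [e' [[el e'l] [ex e'y]]]]]] [v [cv [d [d' [[dl d'l] [dy d'z]]]]]].
have [_ uv] : e' = d /\ u = v by apply: (center_uniq cu cv e'l dl); rewrite e'y dy.
by subst v; exists u; split=> //; exists e, d'.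
Qed.

Lemma tile_rel_fin l x : finite_set (tile_rel l x).
Proof.
apply: (@sub_finite_set _ _ [set` [seq f e'.1 (f e.2.2 x) | e <- l, e' <- l]]) => // y.
move=> [z [cz [e [e' [[el e'l] [ex e'y]]]]]]; apply/allpairsP; exists (e, e') => /=; split=> //.
by have [_ fe _] := cz _ el; rewrite -ex fe e'y.
Qed.

Lemma tile_rel_E l x y : tile_rel l x y <-> exists p, (p.1 \in l /\ p.2 \in l) /\
  (center l (f p.1.2.2 x) /\ (f p.1.1 (f p.1.2.2 x) = x /\ f p.2.1 (f p.1.2.2 x) = y)).
Proof.
split=> [[z [cz [e [e' [[el e'l] [ex e'y]]]]]]|[[e e'] /= [? [? ?]]]]; last first.
  by exists (f e.2.2 x); split=> //; exists e, e'.
by exists (e, e') => /=; have [_ fe _] := cz _ el; rewrite -ex fe.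
Qed.

Lemma tile_rel_covers l : covers f (tile_rel l).
Proof.
have [_ _ fc] := mf.
move=> x y /tile_rel_E[[e e'] /= [_ [_ [_ <-]]]].
by have [k fk] := fc e'.1 e.2.2; exists k; rewrite fk.
Qed.

Lemma BR_tile_rel l : BR (tile_rel l).
Proof.
have [mfi _ _] := mf.
apply: (@Bor_ext _ _ (fun q => exists p, (p.1 \in l /\ p.2 \in l) /\
  (center l (f p.1.2.2 q.1) /\ (f p.1.1 (f p.1.2.2 q.1) = q.1 /\ f p.2.1 (f p.1.2.2 q.1) = q.2)))).
  by move=> q; rewrite tile_rel_E.
apply: BorEx => p; apply: BorAc => _; apply: BorA.
  exact: (mfst Hc (mfi _ _ (BX_center _))).
have m2 i j : mea open open (fun q : X * X => f i (f j q.1)).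
  exact: mea_comp (mea_comp (mfst Hc) (mfi j)) (mfi i).
by apply: BorA; apply: (BX_eq Hc) => //; [exact: mfst Hc|exact: msnd Hc].
Qed.

(** The label consists of prefixes that separate the finitely many points of [K] and of maps leading
    from them back to [x]. *)
Lemma label_at x (K : seq X) : x \in K -> (forall u, u \in K -> exists i, f i x = u) ->
  exists l, [/\ center l x, exists e, e \in l /\ f e.1 x = x & forall v, tile_rel l x v <-> v \in K].
Proof.
move=> xK HK.
have /choice[e He] : forall u, exists e : I * (seq nat * I), u \in K ->
    f e.1 x = u /\ (f e.2.2 u = x /\ (prefix c e.2.1 u /\ forall v, v \in K -> prefix c e.2.1 v -> v = u)).
  move=> u; case: (boolP (u \in K)) => [uK|_]; last by have [_ [i _] _] := mf; exists (i, ([::], i)).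
  have [i iu] := HK _ uK; have [j ju] := inv i x; have [w [wu Hw]] := prefix_sep Hc u (finite_seq K).
  by exists (i, (w, j)); rewrite /= -iu ju iu.
have cx : center (map e K) x.
  move=> _ /mapP[u uK ->]; have [eu [ju [wu Hw]]] := He u uK; rewrite eu; split=> // _ /mapP[v vK ->].
  by have [-> _] := He v vK; move=> /(Hw _ vK) ->.
have xx v : v \in K -> tile_rel (map e K) x v.
  move=> vK; exists x; split=> //; exists (e x), (e v); rewrite !map_f//; split=> //.
  by rewrite (He _ xK).1 (He _ vK).1.
exists (map e K); split=> //; first by exists (e x); rewrite map_f// (He _ xK).1.
move=> v; split=> [|/xx//] [z [cz [d [d' [[dl d'l] [dx d'v]]]]]].
have [_ zx] : d = e x /\ z = x.
  by apply: (center_uniq cz cx dl); rewrite ?map_f// (He _ xK).1.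
by subst z; move: d'l d'v => /mapP[u uK ->]; rewrite (He u uK).1 => <-.
Qed.

End Labels.

Section Generic.
Variables (R : realType) (X : ptopologicalType).
Hypothesis polishX : polish R X.
Variable c : X -> nat -> nat.
Hypothesis Hc : std c.
Variables (I : countType) (f : I -> X -> X) (E0 : X -> X -> Prop).
Hypotheses (mf : moves f) (inv : forall i x, exists j, f j (f i x) = x) (fE0 : forall i x, rtc E0 x (f i x))
  (cE0 : covers f E0) (sE0 : forall x y, E0 x y -> E0 y x).

(** For a fixed label the tiles around its different centers are disjoint and contain one center
    each, so a single stage treats them all. The tile of [endlike_tile] around [x] is described by
    some label; as there are countably many labels, a category argument can later pick one. *)
Lemma generic_step (E : X -> X -> Prop) : egraph f E -> (forall x y, E x y -> E0 x y) -> endlike E0 E ->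
  exists F : label I -> X -> X -> Prop, (forall l, even_part E (F l) /\ endlike E0 (remove E (F l))) /\
    forall x, exists l, isolated (remove E (F l)) x.
Proof.
move=> gE EE0 eE; have [[BE cE] sE iE fE evE] := gE; have [mfi _ _] := mf.
pose core l x := center c f l x /\ exists e, e \in l /\ f e.1 x = x.
have Bcore l : BX (core l).
  apply: BorA; first exact: BX_center.
  by apply: BorEx => e; apply: BorAc => _; apply: (BX_eq Hc) => //; exact: mea_id.
have st l := stage Hc mf true BE cE iE fE (BR_tile_rel Hc mf l) (tile_rel_covers mf (l := l))
  (@tile_rel_sym _ _ _ _ l) (@tile_rel_trans _ _ _ _ l) (tile_rel_fin c f l) (Bcore l).
have /choice[F HF] : forall l, exists F : X -> X -> Prop,
    (even_part E F /\ endlike E0 (remove E F)) /\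
    forall x, core l x -> tile_rel c f l x x -> (exists Kx Px, [/\ forall v, tile_rel c f l x v <-> v \in Kx,
       valid E true Kx Px & forall u v, u \in Kx -> core l u -> E u v -> Px u v]) -> forall y, E x y -> F x y.
  move=> l; have [L [K [P [PV Kd KR BF cov]]]] := st l.
  exists (fun u v => exists l, P l u v); split=> //; split.
    split=> //.
    - exact: (stage_sub PV).
    - exact: (stage_sym PV).
    - exact: (stage_even PV).
    - exact: (stage_fin PV).
  apply: (endlike_remove sE eE PV Kd) => l' u v ul vl.
  have : tile_rel c f l u v by apply/(KR l').
  by move=> /(tile_rel_covers mf)[i <-]; exact: fE0.
exists F; split=> [l|x]; first exact: (HF l).1.
have [K [P [xK KC VP cP]]] := endlike_tile x sE iE fE evE EE0 eE.
have [|l [cx xx lK]] := label_at Hc mf inv xK.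
  by move=> u /KC; apply: covers_rtc.
have [e0 [e0l e0x]] := xx.
exists l => y [Exy]; apply; apply: (HF l).2 => //; first exact/lK.
exists K, P; split=> // u v uK [cu [e [el eu]]] Euv.
suff ux : u = x by rewrite ux in Euv *; exact: cP.
have [z [cz [d [d' [[dl d'l] [dx d'u]]]]]] := (lK u).2 uK.
have [_ zx] : d = e0 /\ z = x by apply: (center_uniq cz cx dl e0l); rewrite e0x dx.
have [_ zu] : d' = e /\ z = u by apply: (center_uniq cz cu d'l el); rewrite eu d'u.
by rewrite -zu zx.
Qed.

End Generic.

Lemma BX_isolated (X : ptopologicalType) (c : X -> nat -> nat) (I : countType) (f : I -> X -> X) E :
  std c -> moves f -> egraph f E -> BX (isolated E).
Proof.
move=> Hc [mfi _ _] [[BE cE] _ _ _ _].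
apply: (@Bor_ext _ _ (fun x => forall i, ~ E x (f i x))).
  by move=> x; split=> [H y Exy|H i]; [have [i e] := cE _ _ Exy; apply: (H i); rewrite e|exact: H].
by apply: BorAll => i; apply: BorN; apply: (BR_mX Hc BE) => //; exact: mea_id.
Qed.

Theorem one_ended_orientation (R : realType) (X : ptopologicalType) (polishX : polish R X) (E : set (X * X)) :
  borel_graph E -> one_ended E -> even_degrees E ->
  exists X' : set X, [/\ graph_invariant E X', comeagre X', borel X'
    & admits_borel_balanced_orientation (induced_graph E X')].
Proof.
move=> bE oE eE; have [c Hc] := polish_code polishX.
have [U [oU bU]] := polish_basis polishX; have noM := baire polishX.
pose E0 x y := E (x, y); have [[sE iE] /borel_BR BE] := bE.
have fE x : finite_set (E0 x) by have [n nn] := eE x; exists n.*2.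
have [f [mf cE inv fE0]] := graph_moves Hc BE sE fE.
have gE : egraph f E0 by exact: egraph_of.
have [mfi [i0 fi0] fc] := mf.
(* [p] is a word and the index of a basic open set. Category is measured at [x] while isolation is
   demanded at [f p.1 x], because the maps [f] may fail to preserve meagre sets and [X'] has to be
   invariant. *)
pose Inv n (E' : X -> X -> Prop) := [/\ forall x y, E' x y -> E0 x y, endlike E0 E' &
  forall p : seq nat * nat, pickle p < n -> U p.2 !=set0 ->
    exists V, [/\ open V, V !=set0, V `<=` U p.2 & meagre (V `\` [set x | isolated E' (f p.1 x)])]].
have [||Es [Es0 gEs IEs sEs]] := @tower X _ f Inv _ gE.
- by split=> //; exact: one_ended_endlike.
- move=> n E' gE' [E'E eE' HE'].
  have [F [HF covF]] := generic_step Hc mf inv fE0 cE gE' E'E eE'.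
  have [l Hl] : exists l, forall p : seq nat * nat, pickle p = n -> U p.2 !=set0 ->
      exists V, [/\ open V, V !=set0, V `<=` U p.2 & meagre (V `\` [set x | isolated (remove E' (F l)) (f p.1 x)])].
    have [[p pn]|np] := pselect (exists p : seq nat * nat, pickle p = n); last by exists [::] => p pn; case: np; exists p.
    have [U0|nU] := pselect (U p.2 !=set0); last first.
      by exists [::] => p' p'n; have -> : p' = p by apply: (pcan_inj pickleK); rewrite p'n.
    pose A l : set X := [set x | isolated (remove E' (F l)) (f p.1 x)] `&` U p.2.
    have BA l : BX (A l).
      apply: BorA; last exact: Bor_gen.
      exact: (mfi p.1 _ (BX_isolated Hc mf (egraph_remove gE' (HF l).1))).
    have [l nAl] : exists l, ~ meagre (A l).
      apply: contrapT => H; apply: (noM (U p.2)) => //.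
      apply: (meagre_sub (A := [set x | exists l, A l x])).
        by move=> x Ux; have [l xl] := covF (f p.1 x); exists l.
      apply: meagre_count => l.
      by apply: contrapT => nA; apply: H; exists l.
    have [W [oW W0 mW]] := borel_nonmeagre (BA l) nAl.
    exists l => p' p'n _; have -> : p' = p by apply: (pcan_inj pickleK); rewrite p'n.
    exists (W `&` U p.2); split.
    + exact: openI.
    + apply: contrapT => WU; apply: (noM W) => //; apply: meagre_sub mW => x Wx; split=> // -[_ Ux].
      by apply: WU; exists x.
    + by move=> x [].
    + by apply: meagre_sub mW => x [[Wx Ux] nx]; split=> // -[].
  exists (F l); split; first exact: (HF l).1.
  split; [by move=> x y [/E'E]|exact: (HF l).2|move=> p].
  rewrite ltnS leq_eqVlt => /predU1P[pn|pn]; first exact: Hl.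
  move=> /(HE' p pn)[V [oV V0 VU mV]]; exists V; split=> //.
  apply: meagre_sub mV => x [Vx nx]; split=> // ix; apply: nx => y [/ix].
  by [].
pose X' : set X := [set x | forall i, exists n, isolated (Es n) (f i x)].
have BX' : BX X'.
  apply: BorAll => i; apply: BorEx => n; exact: (mfi i _ (BX_isolated Hc mf (gEs n))).
have invX x y : E0 x y -> X' x -> X' y.
  move=> /cE[j <-] Xx i; have [k fk] := fc i j; have [n Hn] := Xx k.
  by exists n; rewrite -fk.
exists X'; split.
- exists X'; apply/seteqP; split=> [x Xx|y [x Xx]]; first by exists x => //; exact: rtc_refl.
  by apply: rtc_closed Xx => a b Ca Eab; exact: invX Eab Ca.
- apply: (meagre_sub (A := [set x | exists i, ~ exists n, isolated (Es n) (f i x)])).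
    by move=> x /existsNP.
  apply: meagre_count => i.
  apply: contrapT => nM.
  (* A non-meagre Borel set of failures would be comeagre in some nonempty open [W]; a basic set
     [U k] inside [W] contradicts what stage [pickle (i, k)] achieved. *)
  have [W [oW [w Ww] mW]] : exists W, [/\ open W, W !=set0 & meagre (W `\` [set x | ~ exists n, isolated (Es n) (f i x)])].
    apply: borel_nonmeagre nM; apply: BorN; apply: BorEx => n; exact: (mfi i _ (BX_isolated Hc mf (gEs n))).
  have [k [Uw UW]] := bU w W (open_nbhs_nbhs (conj oW Ww)).
  have [_ _ H] := IEs (pickle (i, k)).+1.
  have [V [oV V0 VU mV]] := H (i, k) (ltnSn _) (ex_intro _ w Uw).
  apply: (noM V oV V0); apply: meagre_sub (meagreU mV mW) => x Vx.
  have [ix|nx] := pselect (isolated (Es (pickle (i, k)).+1) (f i x)); last by left.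
  by right; split; [apply/UW/VU|apply; exists (pickle (i, k)).+1].
- exact/borelP.
have [||O [BO oO bO]] := @tower_orientation X c Hc _ f mf Es X' gEs sEs BX'.
- by rewrite Es0.
- move=> x Xx; apply: (@sub_finite_set _ _ [set x]) => // y /clos_rt_rt1n_iff H; case: H Xx => // u v Huv _ /(_ i0)[n].
  by rewrite fi0 => /(_ u); case; exact: Huv.
apply: orientation_of_rel BO oO bO => x y; rewrite Es0.
by split.
Qed.

(** * Annuli in homogeneous graphs *)

Section Homogeneous.
Variables (V : choiceType) (dist : V -> V -> nat).
Hypotheses (dist0 : forall x y, dist x y = 0 <-> x = y) (distC : forall x y, dist x y = dist y x)
  (distT : forall x y z, dist x z <= dist x y + dist y z)
  (distS : forall x y n, dist x y = n.+1 -> exists z, dist x z = n /\ dist z y = 1).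
Hypothesis hom : forall x y, exists phi : V -> V,
  [/\ forall a b, dist (phi a) (phi b) = dist a b, phi x = y & forall b, exists a, phi a = b].
Variable bs : nat -> nat.
Hypothesis ball : forall x n, exists l : seq V, [/\ uniq l, size l = bs n & forall y, (y \in l) = (dist x y <= n)].

Definition adj a b := dist a b = 1.

Lemma adj_sym a b : adj a b -> adj b a.
Proof. by rewrite /adj distC. Qed.

Lemma geodesic x y : rtc (within adj (fun a => dist x a + dist a y = dist x y)) x y.
Proof.
move en : (dist x y) => n; elim: n y en => [|n IH] y en.
  by move/dist0: en => ->; exact: rtc_refl.
have [z [xz zy]] := distS en.
have yy : dist y y = 0 by exact/dist0.
apply: (@rtc_trans _ _ z); last by apply: rtc_step; split; [exact: zy|rewrite xz zy en yy addn1 addn0].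
apply: rtc_mono (IH z xz) => a b [ab [ha hb]]; split=> //.
have := distT a z y; have := distT x a y; have := distT b z y; have := distT x b y.
by rewrite en zy; lia.
Qed.

Definition conn t R x p q := rtc (within adj (fun a => t < dist x a /\ dist x a <= R)) p q.

Lemma conn_sym t R x p q : conn t R x p q -> conn t R x q p.
Proof. by apply: rtc_sym => a b; apply: within_sym; exact: adj_sym. Qed.

Lemma geodesic_conn t R x p q : (forall a, dist p a + dist a q = dist p q -> t < dist x a /\ dist x a <= R) ->
  conn t R x p q.
Proof. by move=> H; apply: rtc_mono (geodesic p q) => a b [ab [/H ha /H hb]]. Qed.

Lemma conn_sub t R t' R' x x' p q :
  (forall a, t < dist x a -> dist x a <= R -> t' < dist x' a /\ dist x' a <= R') ->
  conn t R x p q -> conn t' R' x' p q.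
Proof. by move=> H; apply: rtc_mono => a b [ab [[h1 h2] [h3 h4]]]; split=> //; split; exact: H. Qed.

Lemma conn_map (phi : V -> V) t R x p q : (forall a b, dist (phi a) (phi b) = dist a b) ->
  conn t R x p q -> conn t R (phi x) (phi p) (phi q).
Proof.
move=> iso; elim=> [u v [uv [h1 h2]]|u|u v w _ h1 _ h2]; [|exact: rtc_refl|exact: rtc_trans h2].
by apply: rtc_step; rewrite /within /adj !iso.
Qed.

Section Chain.
Variables (t R T n : nat) (x : nat -> V).
Hypotheses (t0 : 0 < t) (TR : (2 * n) * T <= R).
Hypothesis step : forall i, i < n -> 5 * t <= dist (x i) (x i.+1) /\ dist (x i) (x i.+1) <= T.
Hypothesis turn : forall i, i.+1 < n -> ~ conn t R (x i.+1) (x i) (x i.+2).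

Lemma chain_le i k : i + k <= n -> dist (x i) (x (i + k)) <= k * T.
Proof.
elim: k => [|k IH] ik; first by rewrite addn0 (dist0 _ _).2.
rewrite addnS; apply: leq_trans (distT _ (x (i + k)) _) _.
have [_ h] := step (i := i + k) ltac:(lia); have := IH ltac:(lia); rewrite mulSn; lia.
Qed.

Lemma chain_le2 i j : i <= n -> j <= n -> dist (x i) (x j) <= n * T.
Proof.
wlog ij : i j / i <= j => [W hi hj|hi hj].
  by case/orP: (leq_total i j) => h; [exact: W|rewrite distC; exact: W].
by rewrite -(subnKC ij); apply: leq_trans (chain_le _) _; rewrite ?leq_mul2r; lia.
Qed.

Let sep k := forall i j l, i < j -> j < l -> l <= n -> l - i <= k ->
  ~ conn t R (x j) (x i) (x l) /\ dist (x i) (x j) + dist (x j) (x l) <= dist (x i) (x l) + 2 * t.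
Let far k := forall i l, i < l -> l <= n -> l - i <= k -> 5 * t + 3 * t * (l - i).-1 <= dist (x i) (x l).

Lemma seg_conn k j a b : sep k -> far k -> j <= n -> a <= b -> b <= n ->
  (b < j /\ j - a <= k) \/ (j < a /\ b - j <= k) -> conn t R (x j) (x a) (x b).
Proof.
move=> Hs Hf jn ab; rewrite -(subnKC ab); elim: (b - a) => [|m IH] bn H.
  by rewrite addn0; exact: rtc_refl.
apply: rtc_trans (IH _ _) _; [lia|lia|].
rewrite addnS; set u := a + m; rewrite addnS -/u in bn H.
have [s1 s2] := step (i := u) bn.
apply: geodesic_conn => z hz; split; last first.
  have h1 : dist (x j) (x u) <= n * T by apply: chain_le2; rewrite // /u; lia.
  have h2 : dist (x u) z <= T by lia.
  apply: leq_trans (distT _ (x u) _) (leq_trans _ TR).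
  have : T <= n * T by rewrite leq_pmull//; lia.
  by rewrite -mulnA; lia.
rewrite ltnNge; apply/negP => zt.
have h1 := distT (x j) z (x u); have h2 := distT (x j) z (x u.+1).
rewrite [dist z (x u)]distC in h1.
case: H => [[uj jk]|[ju uk]].
  have [_ h3] := Hs u u.+1 j (ltnSn u) uj jn ltac:(rewrite /u; lia).
  have := Hf u.+1 j uj jn ltac:(rewrite /u; lia).
  by rewrite ![dist _ (x j)]distC in h3 *; lia.
have [_ h3] := Hs j u u.+1 ltac:(rewrite /u; lia) (ltnSn u) bn ltac:(lia).
have := Hf j u ltac:(rewrite /u; lia) ltac:(lia) ltac:(rewrite /u; lia).
by lia.
Qed.

(** Simultaneous induction on the span. Points on one side of [x j] are joined around it, as
    geodesics between successive ones keep away from [x j]. Since the chain turns at [x j], points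
    on opposite sides are not joined, so a geodesic between them comes within [t] of [x j] and
    distances add up to an error [2 * t]. A further step of length at least [5 * t] thus gains
    [3 * t]. *)
Lemma chain_sep k : sep k /\ far k.
Proof.
elim: k => [|k [Hs Hf]].
  by split=> [i j l|i l]; lia.
have Hs' : sep k.+1.
  move=> i j l ij jl ln lik.
  have c1 : conn t R (x j) (x i) (x j.-1) by apply: (seg_conn Hs Hf); lia.
  have c2 : conn t R (x j) (x j.+1) (x l) by apply: (seg_conn Hs Hf); lia.
  have nc : ~ conn t R (x j) (x i) (x l).
    move=> c3; apply: (turn (i := j.-1)); rewrite prednK ?(leq_ltn_trans _ ij)//; first by lia.
    exact: rtc_trans (conn_sym c1) (rtc_trans c3 (conn_sym c2)).
  split=> //.
  have [a [ha at_]] : exists a, dist (x i) a + dist a (x l) = dist (x i) (x l) /\ dist (x j) a <= t.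
    apply: contrapT => H; apply: nc; apply: geodesic_conn => a ha; split.
      by rewrite ltnNge; apply/negP => at_; apply: H; exists a.
    have h1 : dist (x j) (x i) <= n * T by apply: chain_le2; lia.
    have h2 : dist (x i) (x l) <= n * T by apply: chain_le2; lia.
    apply: leq_trans (distT _ (x i) _) (leq_trans _ TR); rewrite -mulnA; lia.
  have h1 := distT (x i) a (x j); have h2 := distT (x j) a (x l).
  by rewrite [dist a (x j)]distC in h1; lia.
split=> // i l il ln lik.
have [l1|l1] := eqVneq l i.+1.
  by rewrite l1 subSnn /= muln0 addn0; apply: (step (i := i) _).1; lia.
have [_ h1] := Hs' i l.-1 l ltac:(lia) ltac:(lia) ln lik.
have h2 := Hf i l.-1 ltac:(lia) ltac:(lia) ltac:(lia).
have [h3 _] := step (i := l.-1) ltac:(lia); rewrite prednK in h3; last by lia.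
have -> : (l - i).-1 = (l.-1 - i).-1.+1 by lia.
by rewrite mulnS; lia.
Qed.

Lemma chain_far i l : i < l -> l <= n -> 5 * t + 3 * t * (l - i).-1 <= dist (x i) (x l).
Proof. by move=> il ln; apply: (chain_sep (l - i)).2. Qed.

Lemma chain_conn j a b : j <= n -> a <= b -> b <= n -> b < j \/ j < a -> conn t R (x j) (x a) (x b).
Proof.
move=> jn ab bn H; apply: (seg_conn (chain_sep n).1 (chain_sep n).2) => //.
by case: H => h; [left|right]; lia.
Qed.

Lemma chain_nconn i j l : i < j -> j < l -> l <= n -> ~ conn t R (x j) (x i) (x l).
Proof. by move=> ij jl ln; apply: ((chain_sep (l - i)).1 i j l _ _ _ _).1. Qed.

End Chain.

Lemma disjoint_balls (U : seq V) t : pairwise (fun u v => 2 * t < dist u v) U ->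
  exists W : seq V, [/\ uniq W, size W = size U * bs t & forall y, y \in W -> exists2 u, u \in U & dist u y <= t].
Proof.
elim: U => [|u U IH] /=; first by exists [::].
move=> /andP[au /IH[W [uW sW HW]]]; have [x0 _] : exists x : V, True by exists u.
have [l' [ul' sl' lu]] := ball u t.
exists (l' ++ W); split; last 2 first.
- by rewrite size_cat sl' sW mulSn.
- move=> y; rewrite mem_cat lu => /orP[h|/HW[v vU h]]; first by exists u; rewrite ?mem_head.
  by exists v; rewrite // inE vU orbT.
rewrite cat_uniq ul' uW andbT /=; apply/hasPn => y /HW[v vU vy]; apply/negP; rewrite lu => uy.
have := allP au v vU; have := distT u y v; rewrite [dist y v]distC; lia.
Qed.

Lemma packing (U : seq V) x r t : pairwise (fun u v => 2 * t < dist u v) U -> (forall u, u \in U -> dist x u <= r) ->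
  size U * bs t <= bs (r + t).
Proof.
move=> pU Ur; have [l [ul sl lx]] := ball x (r + t); have [W [uW sW HW]] := disjoint_balls pU.
rewrite -sW -sl; apply: uniq_leq_size => // y /HW[u /Ur xu uy].
by rewrite lx; have := distT x u y; lia.
Qed.

Lemma covering (U : seq V) x r t : (forall y, dist x y <= r -> exists2 u, u \in U & dist u y <= t) ->
  bs r <= size U * bs t.
Proof.
move=> HU; have [l [ul sl lx]] := ball x r.
have [W [sW HW]] : exists W : seq V, size W = size U * bs t /\ forall u y, u \in U -> dist u y <= t -> y \in W.
  elim: (U) => [|u U' [W [sW HW]]]; first by exists [::].
  have [l' [ul' sl' lu]] := ball u t.
  exists (l' ++ W); split; first by rewrite size_cat sl' sW mulSn.
  by move=> v y; rewrite inE mem_cat => /predU1P[-> h|vU h]; [rewrite lu h|rewrite (HW v y)// orbT].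
rewrite -sW -sl; apply: uniq_leq_size => // y; rewrite lx => /HU[u uU uy]; exact: HW uU uy.
Qed.

Lemma bs_mono (x : V) m n : m <= n -> bs m <= bs n.
Proof.
move=> mn; have [l [ul sl lx]] := ball x m; have [l' [ul' sl' lx']] := ball x n.
by rewrite -sl -sl'; apply: uniq_leq_size => // y; rewrite lx lx' => h; exact: leq_trans mn.
Qed.

Definition bottleneck s R x p q := [/\ dist x p = 5 * s, dist x q = 5 * s & ~ conn s R x p q].

Definition far_triple t R T x a b c := [/\ 5 * t <= dist x a <= T, 5 * t <= dist x b <= T,
  5 * t <= dist x c <= T & [/\ ~ conn t R x a b, ~ conn t R x a c & ~ conn t R x b c]].

Definition ischain t R T n (y : nat -> V) := (forall i, i < n -> 5 * t <= dist (y i) (y i.+1) /\ dist (y i) (y i.+1) <= T) /\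
  (forall i, i.+1 < n -> ~ conn t R (y i.+1) (y i) (y i.+2)).

(* Three far apart ends at every point produce a binary tree of disjoint balls. *)
Lemma tree_growth t R T k : 0 < t -> 2 * (2 * k.+1) * T <= R ->
  (forall x, exists a b c, far_triple t R T x a b c) ->
  forall p x, 5 * t <= dist p x <= T ->
  exists U, [/\ size U = 2 ^ k, pairwise (fun u v => 5 * t <= dist u v) U
    & forall u, u \in U -> exists y, [/\ y 0 = p, y 1 = x, y k.+1 = u & ischain t R T k.+1 y]].
Proof.
move=> t0 TR tri.
(* At most one of the three ends is joined to the incoming point [p]; the other two continue the
   chain. *)
have fork x p : exists q1 q2, [/\ 5 * t <= dist x q1 <= T, 5 * t <= dist x q2 <= T,
    ~ conn t R x p q1, ~ conn t R x p q2 & ~ conn t R x q1 q2].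
  have [a [b [d [ha hb hd [ab ad bd]]]]] := tri x.
  have [pa|na] := pselect (conn t R x p a).
    exists b, d; split=> // h; [apply: ab|apply: ad]; exact: rtc_trans (conn_sym pa) h.
  have [pb|nb] := pselect (conn t R x p b); last by exists a, b.
  by exists a, d; split=> // h; apply: bd; exact: rtc_trans (conn_sym pb) h.
elim: k TR => [|k IH] TR p x px.
  exists [:: x]; split=> // u; rewrite inE => /eqP ->; exists (fun i => if i is 0 then p else x).
  by split=> //; split=> [[|i]|]//; case/andP: px.
have TR' : 2 * (2 * k.+1) * T <= R by apply: leq_trans TR; rewrite leq_mul2r; lia.
have [q1 [q2 [h1 h2 n1 n2 n12]]] := fork x p.
have [U1 [s1 p1 c1]] := IH TR' x q1 h1; have [U2 [s2 p2 c2]] := IH TR' x q2 h2.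
exists (U1 ++ U2); split.
- by rewrite size_cat s1 s2 addnn -mul2n expnS.
- rewrite pairwise_cat p1 p2 !andbT; apply/allrelP => u v /c1[y1 [y10 y11 y1u [st1 tu1]]] /c2[y2 [y20 y21 y2v [st2 tu2]]].
  (* Two branches glued back to back at [x] form one chain, so [chain_far] keeps their leaves at
     distance at least [5 * t]. *)
  pose y i := if i <= k.+1 then y1 (k.+1 - i) else y2 (i - k.+1).
  have yl i : i <= k.+1 -> y i = y1 (k.+1 - i) by rewrite /y => ->.
  have yr i : k.+1 <= i -> y i = y2 (i - k.+1).
    rewrite /y leq_eqVlt => /predU1P[<-|ki]; first by rewrite leqnn subnn y10 y20.
    by rewrite leqNgt ki.
  have := @chain_far t R T (k.+1 + k.+1) y t0 _ _ _ 0 (k.+1 + k.+1).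
  rewrite (yl 0)// subn0 y1u yr ?leq_addr// addnK y2v => H; apply: leq_trans (H _ _ _ _ _) => //.
  + exact: leq_addr.
  + by apply: leq_trans TR; rewrite leq_mul2r; lia.
  + move=> i ik; have [ki|ki] := ltnP i k.+1.
      rewrite !yl ?(ltnW ki)// distC; have -> : k.+1 - i = (k.+1 - i.+1).+1 by lia.
      by apply: st1; lia.
    by rewrite !yr ?(leqW ki)// subSn//; apply: st2; lia.
  + move=> i ik; case: (ltngtP i.+1 k.+1) => ki.
    * rewrite !yl; try lia.
      have -> : k.+1 - i = (k.+1 - i.+2).+2 by lia.
      have -> : k.+1 - i.+1 = (k.+1 - i.+2).+1 by lia.
      by move=> /conn_sym; apply: tu1; lia.
    * rewrite !yr; try lia.
      have -> : i.+2 - k.+1 = (i - k.+1).+2 by lia.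
      have -> : i.+1 - k.+1 = (i - k.+1).+1 by lia.
      by apply: tu2; lia.
    * case: ki => ->; rewrite (yl k)// (yl k.+1)// (yr k.+2)//.
      by rewrite subSnn subnn subSnn y11 y10 y21.
- move=> u; rewrite mem_cat => H.
  have [q [y [hq nq [y0 y1 yu [st tu]]]]] : exists q y, [/\ 5 * t <= dist x q <= T, ~ conn t R x p q
      & [/\ y 0 = x, y 1 = q, y k.+1 = u & ischain t R T k.+1 y]].
    by case/orP: H => [/c1[y h]|/c2[y h]]; [exists q1, y|exists q2, y].
  exists (fun i => if i is j.+1 then y j else p); split=> //; split.
    by case=> [|i] ik; [rewrite y0; case/andP: px|exact: st].
  by case=> [|i] ik; [rewrite y0 y1|exact: tu].
Qed.

(** * Bottlenecks lead to three ends and to exponential growth *)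

Section NoBottleneck.
Variables (k s : nat).
Hypothesis s0 : 0 < s.
(** The factor leaves room for the tree in [bottleneck_growth]: depth [k] with steps up to [160 * s]
    takes [2 * (2 * k.+1) * (160 * s)] in [tree_growth], and [5 * s] is lost in passing to a
    neighbouring centre. *)
Let R := 640 * k.+2 * s.
Hypothesis bottle : forall x, exists p q, bottleneck s R x p q.

Let turning p x : exists q, dist x q = 5 * s /\ ~ conn s R x p q.
Proof.
have [a [b [ha hb nab]]] := bottle x.
have [pa|na] := pselect (conn s R x p a); last by exists a.
by exists b; split=> // pb; apply: nab; exact: rtc_trans (conn_sym pa) pb.
Qed.

Lemma infinite_chain (x0 : V) : exists x : nat -> V,
  (forall i, dist (x i) (x i.+1) = 5 * s) /\ forall i, ~ conn s R (x i.+1) (x i) (x i.+2).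
Proof.
have /choice[nx Hnx] : forall p : V * V, exists q, dist p.2 q = 5 * s /\ ~ conn s R p.2 p.1 q.
  by move=> [p x]; exact: turning.
have [x1 [x01 _]] := turning x0 x0.
pose st := fix st n : V * V := if n is m.+1 then ((st m).2, nx (st m)) else (x0, x1).
exists (fun n => (st n).1); split=> [[|i]|i] //=.
  by have [] := Hnx (st i).
by have [] := Hnx (st i).
Qed.

Lemma window (x : nat -> V) n o : (forall i, dist (x i) (x i.+1) = 5 * s) ->
  (forall i, ~ conn s R (x i.+1) (x i) (x i.+2)) -> n <= 42 ->
  [/\ forall i l, i < l -> l <= n -> 5 * s + 3 * s * (l - i).-1 <= dist (x (o + i)) (x (o + l)),
    forall i l, i <= l -> l <= n -> dist (x (o + i)) (x (o + l)) <= (l - i) * (5 * s),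
    forall j a b, j <= n -> a <= b -> b <= n -> b < j \/ j < a -> conn s R (x (o + j)) (x (o + a)) (x (o + b))
    & forall i j l, i < j -> j < l -> l <= n -> ~ conn s R (x (o + j)) (x (o + i)) (x (o + l))].
Proof.
move=> st tu n42.
have TR : (2 * n) * (5 * s) <= R by rewrite /R mulnA leq_mul2r; apply/orP; right; lia.
have st' i : i < n -> 5 * s <= dist (x (o + i)) (x (o + i.+1)) /\ dist (x (o + i)) (x (o + i.+1)) <= 5 * s.
  by move=> _; rewrite addnS st.
have tu' i : i.+1 < n -> ~ conn s R (x (o + i.+1)) (x (o + i)) (x (o + i.+2)) by move=> _; rewrite !addnS; exact: tu.
split.
- exact: (chain_far s0 TR st' tu').
- move=> i l il ln; have := chain_le s0 TR st' (i := i) (k := l - i).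
  by rewrite subnKC//; apply.
- exact: (chain_conn s0 TR st' tu').
- exact: (chain_nconn s0 TR st' tu').
Qed.

(* Either the graph stays within bounded distance of a chain, hence grows
   linearly, or some point sees three far apart ends. *)
Lemma line_or_branch (x0 : V) :
  (exists C n0, forall n, n0 <= n -> bs n <= C * n) \/
  exists x a b c, far_triple (6 * s) (R - 5 * s) (160 * s) x a b c.
Proof.
have [x [st tu]] := infinite_chain x0.
(* If nothing near the middle of a window strays from the chain, a ball of radius [H + m] is covered
   by balls of radius [H] about [42 * m + 1] points of the chain, so growth is linear. *)
have [line|] := pselect (forall o v, dist (x (o + 21)) v <= 30 * s + 1 ->
    exists2 j, j <= 42 & dist (x (o + j)) v <= 30 * s).
  left; pose H := 30 * s.
  have grow m o v : dist (x (o + 21 * m)) v <= H + m -> exists2 j, j <= 42 * m & dist (x (o + j)) v <= H.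
    elim: m o v => [|m IH] o v h; first by exists 0 => //; rewrite muln0 !addn0 in h *.
    have [z zc zv] : exists2 z, dist (x (o + 21 * m.+1)) z <= H + m & dist z v <= 1.
      have [h'|h'] := leqP (dist (x (o + 21 * m.+1)) v) (H + m); first by exists v => //; rewrite (dist0 _ _).2.
      have [z [h1 h2]] := distS (n := H + m) (x := x (o + 21 * m.+1)) (y := v) ltac:(lia).
      by exists z; rewrite ?h1 ?h2.
    have [|j jm xz] := IH (o + 21) z; first by move: zc; rewrite mulnS addnA.
    have [|j' j'42 h'] := line (o + j) v.
      have -> : o + j + 21 = o + 21 + j by lia.
      by have := distT (x (o + 21 + j)) z v; rewrite -/H; lia.
    by exists (j + j'); [lia|rewrite addnA].
  exists (43 * bs H), H.+1 => n Hn.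
  have := @covering [seq x j | j <- iota 0 (42 * (n - H)).+1] (x (21 * (n - H))) n H.
  move=> h; apply: leq_trans (h _) _.
    move=> y xy; have [|j jm xj] := grow (n - H) 0 y; first by rewrite add0n subnKC// ltnW.
    by exists (x (0 + j)) => //; apply: map_f; rewrite mem_iota add0n; lia.
  rewrite size_map size_iota.
  have hh : (42 * (n - H)).+1 <= 43 * n by lia.
  by rewrite -mulnA [bs H * n]mulnC mulnA leq_mul2r hh orbT.
(* Now [v] is more than [30 * s = 5 * (6 * s)] away from the window. The inner radius is raised from
   [s] to [6 * s] because an annulus of inner radius [6 * s] about one chain point lies in that of
   inner radius [s] about the next, at distance [5 * s]. The bound [160 * s] is the length of [32]
   steps. *)
move=> /existsNP[ o /existsNP[v /not_implyP[xv nv]]]; right.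
have [far le cn nc] := window o st tu (leqnn 42).
have nv' j : j <= 42 -> 30 * s < dist (x (o + j)) v.
  by move=> j42; rewrite ltnNge; apply/negP => h; apply: nv; exists j.
have sub o' o'' : dist o' o'' <= 5 * s -> forall p q, conn (6 * s) (R - 5 * s) o' p q -> conn s R o'' p q.
  move=> oo p q; apply: conn_sub => a h1 h2.
  by have := distT o' o'' a; have := distT o'' o' a; rewrite [dist o'' o']distC; lia.
have dv j : 10 <= j -> j <= 32 -> dist (x (o + j)) v <= 160 * s.
  move=> j1 j2; have := distT (x (o + j)) (x (o + 21)) v.
  have : dist (x (o + j)) (x (o + 21)) <= 55 * s.
    have [h|h] := leqP j 21; first by apply: leq_trans (le j 21 h isT) _; rewrite mulnA leq_mul2r; apply/orP; right; lia.
    rewrite distC; apply: leq_trans (le 21 j (ltnW h) _) _; first by lia.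
    by rewrite mulnA leq_mul2r; apply/orP; right; lia.
  by lia.
have dl j : 10 <= j -> j <= 32 -> 5 * (6 * s) <= dist (x (o + j)) (x (o + 0)) <= 160 * s.
  move=> j1 j2; rewrite distC; apply/andP; split.
    apply: leq_trans (far 0 j _ _); [|lia|lia].
    have : 3 * s * 9 <= 3 * s * (j - 0).-1 by rewrite leq_mul2l; lia.
    by lia.
  by apply: leq_trans (le 0 j _ _) _; [lia|lia|rewrite mulnA leq_mul2r; apply/orP; right; lia].
have dr j : 10 <= j -> j <= 32 -> 5 * (6 * s) <= dist (x (o + j)) (x (o + 42)) <= 160 * s.
  move=> j1 j2; apply/andP; split.
    apply: leq_trans (far j 42 _ _); [|lia|lia].
    have : 3 * s * 9 <= 3 * s * (42 - j).-1 by rewrite leq_mul2l; lia.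
    by lia.
  by apply: leq_trans (le j 42 _ _) _; [lia|lia|rewrite mulnA leq_mul2r; apply/orP; right; lia].
have d5 y : dist y y <= 5 * s by rewrite (dist0 y y).2.
have goal j : 10 <= j -> j <= 32 -> ~ conn (6 * s) (R - 5 * s) (x (o + j)) v (x (o + 0)) ->
    ~ conn (6 * s) (R - 5 * s) (x (o + j)) v (x (o + 42)) ->
    exists x a b c, far_triple (6 * s) (R - 5 * s) (160 * s) x a b c.
  move=> j1 j2 n1 n2; exists (x (o + j)), v, (x (o + 0)), (x (o + 42)); split.
  - by rewrite dv// andbT; have := nv' j ltac:(lia); lia.
  - exact: dl.
  - exact: dr.
  - by split=> // /(sub _ _ (d5 _)); apply: nc; lia.
have near21 j : j = 10 \/ j = 32 -> conn s R (x (o + j)) v (x (o + 21)).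
  move=> hj; apply: conn_sym; apply: geodesic_conn => a ha.
  have h1 := distT (x (o + 21)) a (x (o + j)); have h2 := distT (x (o + j)) (x (o + 21)) a.
  have h3 : 35 * s <= dist (x (o + 21)) (x (o + j)).
    by case: hj => ->; [rewrite distC; apply: leq_trans (far 10 21 isT isT)|apply: leq_trans (far 21 32 isT isT)] => /=; lia.
  have h4 : dist (x (o + 21)) (x (o + j)) <= 55 * s.
    by case: hj => ->; [rewrite distC; apply: leq_trans (le 10 21 isT isT) _|apply: leq_trans (le 21 32 isT isT) _] => /=; lia.
  rewrite [dist a _]distC in h1; rewrite [dist (x (o + j)) (x (o + 21))]distC in h2.
  by lia.
(* Around [x (o + j)] the point [v] is joined to the right end for [j = 10] but not for [j = 32].
   Where this switches, [v] is joined to neither end at the larger inner radius. *)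
pose Rc j := conn s R (x (o + j)) v (x (o + 42)).
have [j [j1 j2 Rj nR]] : exists j, [/\ 10 <= j, j < 32, Rc j & ~ Rc j.+1].
  have R10 : Rc 10 by apply: rtc_trans (near21 10 (or_introl erefl)) (cn 10 21 42 _ _ _ _); lia.
  have R32 : ~ Rc 32.
    move=> h; apply: (nc 0 32 42) => //; apply: rtc_trans h; apply: conn_sym.
    by apply: rtc_trans (near21 32 (or_intror erefl)) (conn_sym (cn 32 0 21 _ _ _ _)); lia.
  have ex : exists i, `[< ~ Rc (11 + i) >] by exists 21; exact/asboolP.
  case: (ex_minnP ex) => i /asboolP ni imin.
  have i21 : i <= 21 by apply: imin; exact/asboolP.
  exists (10 + i); split; [lia|lia| |exact: ni].
  case: i ni imin i21 => [//|i] ni imin i21; apply: contrapT => h.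
  have : `[< ~ Rc (11 + i) >] by apply/asboolP; move: h; rewrite addnS.
  by move=> /imin; rewrite ltnn.
apply: (goal j) => //; first by lia.
  move=> /(sub _ _ (d5 _)) h; apply: (nc 0 j 42); [lia|lia|lia|].
  exact: rtc_trans (conn_sym h) Rj.
have jj : dist (x (o + j)) (x (o + j.+1)) <= 5 * s by rewrite addnS st.
by move=> /(sub _ _ jj).
Qed.

(** Superlinear growth excludes the first alternative of [line_or_branch]. By homogeneity every
    point then sees three far ends, and the tree has [2 ^ k] leaves whose balls of radius [6 * s]
    are disjoint inside a ball of radius [k.+1 * (160 * s) + 6 * s]. *)
Lemma bottleneck_growth (x0 : V) : (forall C, exists n0, forall n, n0 <= n -> C * n < bs n) ->
  2 ^ k * bs s <= bs (160 * k.+2 * s).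
Proof.
move=> sup.
have [[C [n0 h]]|[x [a [b [d tr]]]]] := line_or_branch x0.
  have [n1 h1] := sup C; have := h _ (leq_maxl n0 n1); have := h1 _ (leq_maxr n0 n1).
  by rewrite ltnNge => /negP.
have tri y : exists a b c, far_triple (6 * s) (R - 5 * s) (160 * s) y a b c.
  have [phi [iso py onto]] := hom y x.
  have [a' ea] := onto a; have [b' eb] := onto b; have [d' ed] := onto d.
  exists a', b', d'; move: tr; rewrite -py -ea -eb -ed /far_triple !iso => -[h1 h2 h3 [n1 n2 n3]].
  have cp u v : conn (6 * s) (R - 5 * s) y u v -> conn (6 * s) (R - 5 * s) (phi y) (phi u) (phi v).
    by apply: conn_map.
  by split=> //; split=> /cp.
have [a1 [_ [_ [ha1 _ _ _]]]] := tri x0.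
have [||U [sU pU cU]] := @tree_growth (6 * s) (R - 5 * s) (160 * s) k _ _ tri x0 a1 ha1.
- by lia.
- have : 2 * (2 * k.+1) * (160 * s) + 5 * s <= R.
    by rewrite /R mulnA -mulnDl leq_mul2r; apply/orP; right; lia.
  by lia.
have := @packing U x0 (k.+1 * (160 * s)) (6 * s).
rewrite sU => P; apply: leq_trans (leq_trans (P _ _) _).
- by rewrite leq_mul2l (bs_mono x0) ?orbT// leq_pmull.
- by apply: sub_pairwise pU => u v; lia.
- move=> u /cU[y [y0 _ yu [stp _]]].
  have s6 : 0 < 6 * s by rewrite muln_gt0.
  have := chain_le s6 (leqnn _) stp (i := 0) (k := k.+1); rewrite add0n y0 yu; apply.
  by [].
- apply: (bs_mono x0); rewrite mulnA -mulnDl leq_mul2r; apply/orP; right; lia.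
Qed.

End NoBottleneck.

Theorem no_bottleneck (x0 : V) k s : 0 < s -> (forall C, exists n0, forall n, n0 <= n -> C * n < bs n) ->
  bs (160 * k.+2 * s) < 2 ^ k * bs s ->
  forall x p q, dist x p = 5 * s -> dist x q = 5 * s -> conn s (640 * k.+2 * s) x p q.
Proof.
move=> s0 sup small x p q xp xq; apply: contrapT => npq.
have bot y : exists p q, bottleneck s (640 * k.+2 * s) y p q.
  have [phi [iso py onto]] := hom y x; have [p' ep] := onto p; have [q' eq] := onto q.
  exists p', q'; rewrite -ep -eq -py in xp xq npq; rewrite !iso in xp xq; split=> // h.
  by apply: npq; exact: conn_map.
by have := bottleneck_growth s0 bot x0 sup; rewrite leqNgt small.
Qed.

End Homogeneous.

(** * Word metrics and actions *)

Section WordMetric.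
Variables (G : groupType) (S : set G).
Hypotheses (fS : finite_set S) (gS : generates S).
Local Open Scope group_scope.
Implicit Types g h : G.

Let S' := S `|` [set t^-1 | t in S].

Lemma finite_wb n : finite_set (word_ball S n).
Proof.
elim: n => [|n IH] /=; first exact: finite_set1.
rewrite finite_setU; split=> //; apply: finite_image2 => //.
by rewrite finite_setU; split=> //; exact: finite_image.
Qed.

Lemma wb_mono m n : (m <= n)%N -> word_ball S m `<=` word_ball S n.
Proof. by move=> /subnK <-; elim: (n - m)%N => // k IH g /IH h; left. Qed.

Lemma wbM m n g h : word_ball S m g -> word_ball S n h -> word_ball S (m + n) (g * h).
Proof.
move=> + hn; elim: m g => [|m IH] g; first by move=> ->; rewrite mul1g.
case=> [/IH h'|[s sS [g' g'm <-]]]; first by left.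
by rewrite -mulgA; right; exists s => //; exists (g' * h) => //; exact: IH.
Qed.

Lemma wb_gen s : S' s -> word_ball S 1 s.
Proof. by move=> sS; right; exists s => //; exists 1 => //; rewrite mulg1. Qed.

Lemma S'V s : S' s -> S' s^-1.
Proof. by case=> [sS|[t tS <-]]; [right; exists s|left; rewrite invgK]. Qed.

Lemma wbV n g : word_ball S n g -> word_ball S n g^-1.
Proof.
elim: n g => [|n IH] g /=; first by move=> ->; rewrite invg1.
case=> [/IH h|[s sS [g' g'n <-]]]; first by left.
by rewrite invgM; have := wbM (IH _ g'n) (wb_gen (S'V sS)); rewrite addn1.
Qed.

Lemma wb_ex g : exists n, `[< word_ball S n g >].
Proof.
have : (\bigcup_n word_ball S n) g by rewrite gS.
by move=> [n _ gn]; exists n; exact/asboolP.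
Qed.

Definition len g := ex_minn (wb_ex g).

Lemma lenP n g : word_ball S n g <-> (len g <= n)%N.
Proof.
rewrite /len; case: ex_minnP => m /asboolP gm mmin; split=> [gn|/wb_mono]; last exact.
by apply: mmin; exact/asboolP.
Qed.

Lemma lenM g h : (len (g * h) <= len g + len h)%N.
Proof. by apply/lenP; apply: wbM; exact/lenP. Qed.

Lemma lenV g : len g^-1 = len g.
Proof.
have le x : (len x^-1 <= len x)%N by apply/lenP; apply: wbV; exact/lenP.
by apply/eqP; rewrite eqn_leq le -{1}[g]invgK le.
Qed.

Lemma len0 g : len g = 0%N <-> g = 1.
Proof.
split=> [h|->]; first by have : word_ball S 0 g by apply/lenP; rewrite h.
by apply/eqP; rewrite -leqn0; apply/lenP.
Qed.

Lemma len_step n g : len g = n.+1 -> exists s h, [/\ g = s * h, len h = n & len s = 1%N].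
Proof.
move=> gn; have : word_ball S n.+1 g by apply/lenP; rewrite gn.
case=> [/lenP|[s sS [h hn e]]]; first by rewrite gn ltnn.
exists s, h; have s1 : (len s <= 1)%N by apply/lenP; exact: wb_gen.
have h1 : (len h <= n)%N by exact/lenP.
by have := lenM s h; rewrite e gn; split=> //; lia.
Qed.

(** Right invariant: right multiplications are isometries, and left multiplication by a generator,
    which gives the edges of the Schreier graph, moves by at most one. *)
Definition gdist g h := len (h * g^-1).

Lemma gdist0 g h : gdist g h = 0%N <-> g = h.
Proof.
rewrite /gdist len0; split=> [e|->]; last by rewrite mulgV.
by apply/esym; rewrite -[LHS]mulg1 -(mulVg g) mulgA e mul1g.
Qed.

Lemma gdistC g h : gdist g h = gdist h g.
Proof. by rewrite /gdist -lenV invgM invgK. Qed.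

Lemma gdistT g h k : (gdist g k <= gdist g h + gdist h k)%N.
Proof.
have -> : gdist g k = len ((k * h^-1) * (h * g^-1)) by rewrite /gdist -mulgA mulKg.
by rewrite addnC; exact: lenM.
Qed.

Lemma gdistS g h n : gdist g h = n.+1 -> exists k, gdist g k = n /\ gdist k h = 1%N.
Proof.
move=> /len_step[s [k [e kn s1]]]; exists (k * g); split; first by rewrite /gdist mulgK.
have -> : h = s * (k * g) by rewrite mulgA -e -mulgA mulVg mulg1.
by rewrite /gdist mulgK.
Qed.

Lemma gdistM g h k : gdist (g * k) (h * k) = gdist g h.
Proof. by rewrite /gdist invgM -!mulgA mulVKg. Qed.

Lemma gdist_hom g h : exists phi : G -> G,
  [/\ forall a b, gdist (phi a) (phi b) = gdist a b, phi g = h & forall b, exists a, phi a = b].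
Proof.
exists (fun x => x * (g^-1 * h)); split=> [a b||b]; first exact: gdistM.
  by rewrite mulVKg.
by exists (b * (g^-1 * h)^-1); rewrite mulgVK.
Qed.

Lemma gdist1 g : gdist 1 g = len g.
Proof. by rewrite /gdist invg1 mulg1. Qed.

Lemma wb_list n : exists l : seq G, uniq l /\ forall g, (g \in l) = (len g <= n)%N.
Proof.
have /finite_seqP[l e] := finite_wb n; exists (undup l); split; first exact: undup_uniq.
move=> g; rewrite mem_undup; apply/idP/idP => [gl|/lenP h].
  by apply/lenP; rewrite e.
by have : word_ball S n g := h; rewrite e.
Qed.

Definition bsize n := size (sval (cid (wb_list n))).

Lemma bsize_card n : (word_ball S n #= `I_(bsize n))%card.
Proof.
rewrite /bsize; case: cid => l /= [ul lE]; apply: card_seq => // g.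
by rewrite lE; exact: lenP.
Qed.

Lemma gball g n : exists l : seq G, [/\ uniq l, size l = bsize n & forall h, (h \in l) = (gdist g h <= n)%N].
Proof.
rewrite /bsize; case: cid => l /= [ul lE]; exists (map (fun h => h * g) l); split.
- by rewrite map_inj_uniq// => x y /mulIg.
- by rewrite size_map.
- move=> h; apply/mapP/idP => [[k kl ->]|h']; first by rewrite /gdist mulgK -lE.
  by exists (h * g^-1); rewrite ?lE// mulgVK.
Qed.

Lemma bsize_superlinear : superlinear_growth S -> forall C, exists n0, forall n, (n0 <= n)%N -> (C * n < bsize n)%N.
Proof.
move=> sup C; have [N _ HN] := sup C.+1; exists N.+1 => n Nn.
have := HN n (ltnW Nn) => /= h.
have : (`I_(C.+1 * n) #<= `I_(bsize n))%card by rewrite -(card_le_eqr (bsize_card n)).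
rewrite card_le_II; lia.
Qed.

Lemma bsize_polynomial : polynomial_growth S -> exists C d, forall n, (0 < n)%N -> (bsize n <= C * n ^ d)%N.
Proof.
move=> [C [d H]]; exists C, d => n n0; have := H n n0.
by rewrite (card_le_eql (bsize_card n)) card_le_II.
Qed.

Lemma bsize_gt0 n : (0 < bsize n)%N.
Proof. by have [l [ul <- lE]] := gball 1 n; have := lE 1; rewrite (gdist0 _ _).2//; case: l {ul lE}. Qed.

End WordMetric.

Section Action.
Variables (X : ptopologicalType) (c : X -> nat -> nat).
Hypothesis Hc : std c.
Variables (G : groupType) (S : set G) (a : G -> X -> X).
Hypotheses (fS : finite_set S) (gS : generates S).
Hypotheses (act : is_action a) (free : free_action a) (bor : borel_action a).
Local Open Scope group_scope.
Implicit Types (g h : G) (x y z : X).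

Notation len := (len gS).

Lemma mX_act g : mX (a g).
Proof. by move=> A /borelP BA; apply/borelP; exact: bor. Qed.

Lemma act_inj x g h : a g x = a h x -> g = h.
Proof.
case: act => a1 aM e; have : a (h^-1 * g) x = x by rewrite aM e -aM mulVg a1.
by move=> /free e'; rewrite -[g](mulVKg h) e' mulg1.
Qed.

Lemma actV g x : a g^-1 (a g x) = x.
Proof. by case: act => a1 aM; rewrite -aM mulVg a1. Qed.

Lemma enum_group : exists e : seq nat -> G, [/\ e [::] = 1, forall v w, e (v ++ w) = e v * e w & forall g, exists w, e w = g].
Proof.
have /finite_seqP[l lE] : finite_set (S `|` [set t^-1 | t in S]).
  by rewrite finite_setU; split=> //; exact: finite_image.
pose e := foldr (fun j g => nth 1 l j * g) 1.
have eM v w : e (v ++ w) = e v * e w by elim: v => [|j v IH] /=; rewrite ?mul1g// IH mulgA.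
exists e; split=> // g.
have : (\bigcup_n word_ball S n) g by rewrite gS.
move=> [n _]; elim: n g => [|n IH] g /=; first by move=> ->; exists [::].
case=> [/IH//|[s sS [h /IH[w <-] <-]]].
have sl : s \in l by have : (S `|` [set t^-1 | t in S]) s := sS; rewrite lE.
by exists (index s l :: w) => /=; rewrite nth_index.
Qed.

Lemma act_moves : exists f : seq nat -> X -> X, [/\ moves f, forall g, exists w, f w = a g & forall w, exists g, f w = a g].
Proof.
have [a1 aM] := act; have [e [e1 eM es]] := enum_group; exists (fun w => a (e w)); split.
- split; first by move=> w; exact: mX_act.
    by exists [::] => x; rewrite e1 a1.
  by move=> v w; exists (v ++ w) => x; rewrite eM aM.
- by move=> g; have [w <-] := es g; exists w.
- by move=> w; exists (e w).
Qed.

Definition near n x y := exists g, (len g <= n)%N /\ a g x = y.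

Lemma near_act n x g : near n x (a g x) <-> (len g <= n)%N.
Proof. by split=> [[h [hn /act_inj <-]]//|h]; exists g. Qed.

Lemma near_refl n x : near n x x.
Proof. by case: act => a1 _; exists 1; rewrite a1; split=> //; rewrite (len0 gS 1).2. Qed.

Lemma near_sym n x y : near n x y -> near n y x.
Proof. by move=> [g [gn <-]]; exists g^-1; rewrite lenV actV. Qed.

Lemma near_trans m n y x z : near m x y -> near n y z -> near (m + n) x z.
Proof.
move=> [g [gm <-]] [h [hn <-]]; exists (h * g); split; last by case: act => _ ->.
by apply: leq_trans (lenM _ _ _) _; lia.
Qed.

Lemma near_mono m n x y : (m <= n)%N -> near m x y -> near n x y.
Proof. by move=> mn [g [gm <-]]; exists g; split=> //; exact: leq_trans mn. Qed.

Lemma near_covers (f : seq nat -> X -> X) n : (forall g, exists w, f w = a g) -> covers f (near n).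
Proof. by move=> fa x y [g [_ <-]]; have [w fw] := fa g; exists w; rewrite fw. Qed.

Lemma BR_near n : BR (near n).
Proof.
have [f [[mf _ _] fa af]] := act_moves.
apply: (@Bor_ext _ _ (fun p => exists w, (exists g, (len g <= n)%N /\ f w = a g) /\ f w p.1 = p.2)).
  move=> p; split=> [[w [[g [gn ->]] e]]|[g [gn e]]]; first by exists g.
  by have [w fw] := fa g; exists w; rewrite fw; split=> //; exists g.
apply: BorEx => w; apply: BorAc => _.
by apply: (BX_eq Hc); [exact: mea_comp (mfst Hc) (mf w)|exact: (msnd Hc)].
Qed.

Lemma BX_near n (W : X -> Prop) : BX W -> BX (fun x => exists y, W y /\ near n x y).
Proof.
move=> BW; have [f [[mf _ _] fa af]] := act_moves.
apply: (@Bor_ext _ _ (fun x => exists w, (exists g, (len g <= n)%N /\ f w = a g) /\ W (f w x))).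
  move=> x; split=> [[w [[g [gn e]] Ww]]|[y [Wy [g [gn gy]]]]].
    by exists (f w x); split=> //; exists g; rewrite e.
  by have [w fw] := fa g; exists w; rewrite fw gy; split=> //; exists g.
by apply: BorEx => w; apply: BorAc => _; exact: mf.
Qed.

Lemma near_list n x : exists l : seq X, uniq l /\ forall y, y \in l <-> near n x y.
Proof.
have [l [ul lE]] := wb_list fS gS n; exists (map (a^~ x) l); split.
  by rewrite map_inj_uniq// => g h; exact: act_inj.
move=> y; split=> [/mapP[g gl ->]|[g [gn <-]]]; first by apply/near_act; rewrite -lE.
by apply: (map_f (a^~ x)); rewrite lE.
Qed.

Lemma near_finite n x : finite_set (near n x).
Proof.
have [l [_ lE]] := near_list n x; apply: (@sub_finite_set _ _ [set` l]) => // y.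
by move=> /lE.
Qed.

Let E x y := schreier_graph a S (x, y).

Lemma schreier_near x y : E x y <-> x <> y /\ near 1 x y.
Proof.
split=> [[/= xy [s sS H]]|[xy [g [g1 e]]]]; split=> //=.
  have s1 : (len s <= 1)%N by apply/lenP; apply: wb_gen; left.
  by case: H => ->; [exists s|apply: near_sym; exists s].
have : word_ball S 1 g by exact/lenP.
case=> [g1'|[s sS [h h1 gE]]].
  by case: xy; rewrite -e (g1' : g = 1); case: act => ->.
have h1' : h = 1 by []; rewrite h1' mulg1 in gE; subst g.
by case: sS => [sS|[t tS ts]]; [exists s => //; left|exists t => //; right; rewrite -e -ts -{1}[t]invgK actV].
Qed.

End Action.

(** * Separated Borel sets *)

Section Separated.
Variables (X : ptopologicalType) (c : X -> nat -> nat).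
Hypothesis Hc : std c.
Variables (G : groupType) (S : set G) (a : G -> X -> X).
Hypotheses (fS : finite_set S) (gS : generates S).
Hypotheses (act : is_action a) (free : free_action a) (bor : borel_action a).
Notation near := (near a gS).
Notation len := (len gS).

Lemma BX_all_near n (Q : X -> X -> Prop) : (forall g, BX (fun x => Q x (a g x))) ->
  BX (fun x => forall y, near n x y -> Q x y).
Proof.
move=> BQ; have [f [_ fa af]] := act_moves fS gS act bor.
apply: (@Bor_ext _ _ (fun x => forall w, (exists g, (len g <= n)%N /\ f w = a g) -> Q x (f w x))).
  move=> x; split=> [H y [g [gn <-]]|H w [g [gn ->]]]; last by apply: H; exists g.
  by have [w fw] := fa g; rewrite -fw; apply: H; exists g; rewrite fw.
by apply: BorAll => w; apply: BorIc => -[g [_ ->]]; exact: BQ.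
Qed.

Definition isolating n w x := prefix c w x /\ forall y, near n x y -> prefix c w y -> y = x.

Lemma BX_isolating n w : BX (isolating n w).
Proof.
apply: BorA; first exact: BX_prefix.
apply: (@BX_all_near n (fun x y => prefix c w y -> y = x)) => g.
by apply: BorI; [exact: (mX_act bor g (BX_prefix Hc w))|apply: (BX_eq Hc); [exact: mX_act|exact: mea_id]].
Qed.

Lemma isolating_ex n x : exists w, isolating n w x.
Proof. exact: (prefix_sep Hc x (near_finite fS gS act free n x)). Qed.

(** Points isolated by the same prefix at distance [M] are automatically separated, so all eligible
    points of one prefix can be added at once; countably many prefixes exhaust the space. *)
Lemma maximal_separated M (W : X -> Prop) : BX W -> exists Z : X -> Prop,
  [/\ BX Z, forall z, Z z -> W z, forall z z', Z z -> Z z' -> near M z z' -> z = z'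
    & forall x, W x -> exists z, Z z /\ near M z x].
Proof.
move=> BW.
pose U := fix U (k : nat) : X -> Prop := if k is m.+1 then fun x => U m x \/
  exists w, @choice.pickle (seq nat) w = m /\ (isolating M w x /\ (W x /\ ~ exists y, U m y /\ near M x y)) else fun=> False.
have BU k : BX (U k).
  elim: k => [|k IH] /=; first exact: Bor_cst.
  apply: BorO => //; apply: BorEx => w; apply: BorAc => _; apply: BorA; first exact: BX_isolating.
  by apply: BorA => //; apply: BorN; exact: BX_near.
have Umono k m x : (k <= m)%N -> U k x -> U m x.
  by move=> /subnK <-; elim: (m - k)%N => // i IH h; left; exact: IH.
have Usep k z z' : U k z -> U k z' -> near M z z' -> z = z'.
  elim: k z z' => // k IH z z' [Uz|[w [wk [vz [Wz nz]]]]] [Uz'|[w' [w'k [vz' [Wz' nz']]]]] zz'.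
  - exact: IH.
  - by case: nz'; exists z; split=> //; apply: near_sym.
  - by case: nz; exists z'.
  - have ww' : w = w' by apply: (pcan_inj (@choice.pickleK (seq nat))); rewrite wk w'k.
    by subst w'; apply/esym; apply: vz.2 => //; exact: vz'.1.
exists (fun x => exists k, U k x); split.
- exact: BorEx.
- by move=> z [k]; elim: k => // k IH /= [/IH//|[w [_ [_ []]]]].
- move=> z z' [k Uz] [k' Uz']; apply: (Usep (maxn k k')); [apply: Umono Uz|apply: Umono Uz']; lia.
- move=> x Wx; have [w wx] := isolating_ex M x.
  have [[y [Uy xy]]|ny] := pselect (exists y, U (@choice.pickle (seq nat) w) y /\ near M x y).
    by exists y; split; [exists (pickle w)|exact: near_sym].
  exists x; split; last exact: near_refl.
  by exists (@choice.pickle (seq nat) w).+1 => /=; right; exists w.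
Qed.

(* Successive maximal separated sets: in a doubling graph finitely many of them
   come close to every point. *)
Lemma schemes M h : exists Z : nat -> X -> Prop,
  [/\ forall j, BX (Z j), forall j z z', Z j z -> Z j z' -> near M z z' -> z = z'
    & forall t N, 2 * t <= h -> bsize fS gS (M + t) < N * bsize fS gS t ->
      forall x, exists j, j < N /\ exists z, Z j z /\ near h x z].
Proof.
have /choice[Mx HMx] : forall W : X -> Prop, exists Z : X -> Prop, BX W ->
    [/\ BX Z, forall z, Z z -> W z, forall z z', Z z -> Z z' -> near M z z' -> z = z'
    & forall x, W x -> exists z, Z z /\ near M z x].
  move=> W; have [BW|nB] := pselect (BX W); last by exists (fun=> False).
  by have [Z HZ] := maximal_separated M BW; exists Z.
pose C := fix C (j : nat) : X -> Prop := if j is i.+1 then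
  fun x => C i x \/ exists z, Mx (fun y => ~ C i y) z /\ near h x z else fun=> False.
pose Z j := Mx (fun y => ~ C j y).
have BC j : BX (C j).
  elim: j => [|j IH] /=; first exact: Bor_cst.
  apply: BorO => //; have [BZ _ _ _] := HMx _ (BorN IH).
  exact: BX_near.
have HZ j := HMx _ (BorN (BC j)).
exists Z; split.
- by move=> j; have [] := HZ j.
- by move=> j; have [_ _ h' _] := HZ j.
move=> t N th small x; apply: contrapT => nx.
have nC j : j <= N -> ~ C j x.
  elim: j => [|j IH] jN //= [|[z [Zz xz]]]; first by apply: IH; exact: ltnW.
  by apply: nx; exists j; split=> //; exists z.
have /choice[g Hg] : forall j, exists g, j < N -> len g <= M /\ Z j (a g x).
  move=> j; have [jN|] := ltnP j N; last by exists 1%g.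
  have [_ _ _ mx] := HZ j; have [z [Zz /near_sym[//|g [gM gz]]]] := mx x (nC j (ltnW jN)).
  by exists g; rewrite gz.
have Zin i j : i < j -> forall z y, Z i z -> near h y z -> C j y.
  move=> ij z y Zz yz; have Ci : C i.+1 y by right; exists z.
  by rewrite -(subnKC ij); elim: (j - i.+1) => [|k IH]; rewrite ?addn0// addnS; left.
(* If [x] were missed in [N] rounds, the net points found near it in these rounds would be more than
   [h], hence more than [2 * t], apart, and [N] disjoint balls of radius [t] do not fit into one of
   radius [M + t]. *)
have := packing (gdistC gS) (gdistT gS) (gball fS gS) (U := [seq g j | j <- iota 0 N]) (x := 1%g) (r := M) (t := t).
rewrite size_map size_iota leqNgt small => H; suff : ~~ true by []; apply: H.
  rewrite pairwise_map; have := sorted_pairwise ltn_trans (iota 0 N); rewrite iota_ltn_sorted => /esym.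
  have : {subset iota 0 N <= fun j => j < N} by move=> j; rewrite mem_iota.
  elim: (iota 0 N) => [//|i s IH] sN /= /andP[al pw]; apply/andP; split; last first.
    by apply: IH => // j js; apply: sN; rewrite inE js orbT.
  apply/allP => j js; have ij := allP al j js.
  have iN : i < N by exact: (sN i (mem_head _ _)).
  have jN : j < N by apply: sN; rewrite inE js orbT.
  rewrite /= ltnNge; apply/negP => hh.
  have [_ Zi] := Hg i iN; have [_ Zj] := Hg j jN.
  have [_ ZW _ _] := HZ j; apply: (ZW _ Zj); apply: (Zin i j ij _ _ Zi).
  exists (g i * (g j)^-1)%g; split; last by case: act => _ aM; rewrite aM actV.
  by have : gdist gS (g j) (g i) <= h by rewrite gdistC; lia.
by move=> u /mapP[j]; rewrite mem_iota => /andP[_ jN] ->; rewrite gdist1; exact: (Hg j jN).1.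
Qed.

End Separated.

(** * Groups of polynomial growth *)

(** Serves to choose the depth [k] of the tree, since the ratio between the radii is itself a
    polynomial in [k]. *)
Lemma poly_lt_exp C e : exists k, C * k.+2 ^ e <= 2 ^ k.
Proof.
have le1 j : j < 2 ^ j by exact: ltn_expl.
pose j := 2 * e + C + 1; exists (2 ^ (2 * j) - 2).
have h4 : 2 <= 2 ^ (2 * j) by have := le1 (2 * j); rewrite /j; lia.
have -> : (2 ^ (2 * j) - 2).+2 = 2 ^ (2 * j) by lia.
apply: (@leq_trans (2 ^ (C + 2 * j * e))).
  by rewrite expnD [2 ^ (2 * j * e)]expnM leq_mul2r (ltnW (le1 C)) orbT.
rewrite leq_exp2l//.
have : j.+1 * j.+1 <= 2 ^ (2 * j) by rewrite mul2n -addnn expnD leq_mul.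
have : 2 * j * e + C + 2 <= j.+1 * j.+1 by rewrite /j; nia.
by lia.
Qed.

(** If doubling failed at all scales from [n0] on, the ball of radius [L ^ i * n0.+1] would have at
    least [q ^ i] elements; as [q >= 2 * L ^ d], this exceeds the polynomial bound at
    [i = C * n0.+1 ^ d]. *)
Lemma doubling_scale (bs : nat -> nat) C d L q : (forall n, 0 < bs n) -> (forall n, 0 < n -> bs n <= C * n ^ d) ->
  0 < L -> 2 * L ^ d <= q -> forall n0, exists v, [/\ n0 <= v, 0 < v & bs (L * v) < q * bs v].
Proof.
move=> bs0 bsC L0 Lq n0; apply: contrapT => H.
have grow i : q ^ i <= bs (L ^ i * n0.+1).
  elim: i => [|i IH]; first by rewrite !expn0 mul1n.
  rewrite !expnS -mulnA; apply: leq_trans (_ : q * bs (L ^ i * n0.+1) <= _); first by rewrite leq_mul2l IH orbT.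
  rewrite leqNgt; apply/negP => lt; apply: H; exists (L ^ i * n0.+1).
  have Li : 0 < L ^ i by rewrite expn_gt0 L0.
  by split=> //; [apply: leq_trans (leqnSn n0) (leq_pmull _ Li)|rewrite muln_gt0 Li].
pose i := C * n0.+1 ^ d.
have h1 := grow i; have Li : 0 < L ^ i * n0.+1 by rewrite muln_gt0 expn_gt0 L0.
have h2 := bsC _ Li; have : (2 * L ^ d) ^ i <= q ^ i by case: (i) => // i'; rewrite leq_exp2r.
rewrite expnMn => h3; have := leq_trans h3 (leq_trans h1 h2).
rewrite expnMn -!expnM [d * i]mulnC [C * _]mulnCA [2 ^ i * _]mulnC leq_pmul2l ?expn_gt0 ?L0//.
by rewrite -/i leqNgt ltn_expl.
Qed.

Section Polynomial.
Variables (X : ptopologicalType) (c : X -> nat -> nat).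
Hypothesis Hc : std c.
Variables (G : groupType) (S : set G) (a : G -> X -> X).
Hypotheses (fS : finite_set S) (gS : generates S).
Hypotheses (act : is_action a) (free : free_action a) (bor : borel_action a).
Notation near := (near a gS).
Notation len := (len gS).
Notation bs := (bsize fS gS).
Let E x y := schreier_graph a S (x, y).

Lemma near0 x y : near 0 x y -> x = y.
Proof. by move=> [g []]; rewrite leqn0 => /eqP/(len0 gS) -> <-; case: act => ->. Qed.

Lemma annulus_conn s R : (forall x p q, gdist gS x p = 5 * s -> gdist gS x q = 5 * s -> conn (gdist gS) s R x p q) ->
  forall z p q, near (5 * s) z p -> ~ near (5 * s).-1 z p -> near (5 * s) z q -> ~ near (5 * s).-1 z q ->
  rtc (within E (fun u => ~ near s z u /\ near R z u)) p q.
Proof.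
move=> nb z _ _ [g [gs <-]] ng [h [hs <-]] nh.
have ex k : len k <= 5 * s -> ~ near (5 * s).-1 z (a k z) -> gdist gS 1%g k = 5 * s.
  by rewrite gdist1 => k1 k2; apply/eqP; rewrite eqn_leq k1 leqNgt; apply/negP => lt; apply: k2; apply/near_act => //; lia.
have : conn (gdist gS) s R 1%g g h by apply: nb; exact: ex.
elim=> [u v [uv [[u1 u2] [v1 v2]]]|u|u v w _ h1 _ h2]; [|exact: rtc_refl|exact: rtc_trans h2].
rewrite !gdist1 in u1 u2 v1 v2.
have ann k : s < len k -> len k <= R -> ~ near s z (a k z) /\ near R z (a k z).
  by move=> k1 k2; split; [move=> /(near_act gS act free); rewrite leqNgt k1|apply/near_act].
apply: rtc_step; split; last by split; exact: ann.
apply/(schreier_near gS act); split.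
  by move=> /(act_inj act free) e; move: uv; rewrite /adj e (gdist0 gS v v).2.
by exists (v * u^-1)%g; split; [rewrite -/(gdist gS u v) uv|case: act => _ aM; rewrite aM actV].
Qed.

(** The quantitative counterpart of [endlike]: a path of the full graph can be replaced by a
    surviving path displaced by at most [rho]. *)
Definition rerouting rho (E' : X -> X -> Prop) := forall A u v, rtc (within E A) u v ->
  ~ isolated E' u -> ~ isolated E' v -> rtc (within E' (fun x => exists b, A b /\ near rho b x)) u v.

Variables (f : seq nat -> X -> X).
Hypotheses (mf : moves f) (fa : forall g, exists w, f w = a g).

Variable kap : nat.
Hypothesis kap5 : 5 <= kap.
(** Radii of two nested annuli around a core of radius [4 * v]. The inner annulus has scale [8 * v],
    so that paths displaced by at most [v] still avoid the core; the outer one has scale [rad2 v],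
    beyond the inner one, and [rad3 v] encloses everything. *)
Definition rad2 v := kap * (8 * v) + 8 * v.
Definition rad3 v := kap * rad2 v + 4 * v.

Lemma ball_tile E' rho v z : egraph f E' -> (forall x y, E' x y -> E x y) -> rerouting rho E' ->
  rho <= v -> 0 < v ->
  (forall s, s = 8 * v \/ s = rad2 v -> forall x p q, gdist gS x p = 5 * s -> gdist gS x q = 5 * s ->
     conn (gdist gS) s (kap * s) x p q) ->
  exists Kx Px, [/\ forall u, near (rad3 v) z u <-> u \in Kx, valid E' true Kx Px
    & forall u y, near (4 * v) z u -> E' u y -> Px u y].
Proof.
move=> [_ sE iE fE evE] E'E rr rv v0 nb.
have /choice[l Hl] : forall n, exists l : seq X, uniq l /\ forall y, y \in l <-> near n z y.
  by move=> n; exact: near_list.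
have lP n y : y \in l n <-> near n z y by case: (Hl n).
have E1 x y : E' x y -> near 1 x y by move=> /E'E/(schreier_near gS act)[].
have lsub m n : m <= n -> {subset l m <= l n} by move=> mn y /lP h; apply/lP; exact: near_mono h.
pose s1 := 8 * v; pose s2 := rad2 v.
have k5 : 5 * s1 <= kap * s1 by rewrite leq_mul2r kap5 orbT.
have k5' : 5 * s2 <= kap * s2 by rewrite leq_mul2r kap5 orbT.
have s2E : s2 = kap * s1 + s1 by [].
have push m n A u w : (forall b, A b -> ~ near m z b /\ near n z b) ->
    rtc (within E A) u w -> ~ isolated E' u -> ~ isolated E' w ->
    rtc (within E' (fun x => ~ near (m - rho) z x /\ near (n + rho) z x)) u w \/ m < rho.
  move=> HA uw nu nw; have [rm|] := leqP rho m; last by right.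
  left; apply: rtc_mono (rr A u w uw nu nw) => x y [Exy [[b [/HA[b1 b2] bx]] [b' [/HA[b1' b2'] b'y]]]].
  have near_m q q' : ~ near m z q -> near rho q q' -> ~ near (m - rho) z q'.
    by move=> nq qq' h; apply: nq; rewrite -(subnK rm); apply: near_trans h (near_sym act qq').
  by split=> //; split; split; [exact: near_m bx|exact: near_trans bx|exact: near_m b'y|exact: near_trans b'y].
(* All five sets are balls about [z], and [Out] meets [M] in the sphere of radius [5 * s2]. Both
   connectivity conditions come from joining points of a sphere of radius [5 * s] in an annulus and
   displacing the path by [rho]. *)
have [||||||||P [VP cP]] := @plan X E' sE iE fE evE (l (5 * s1).-1) (l (4 * v)) (l (kap * s1 + 4 * v))
    (l (5 * s2)) (l (kap * s2 + 4 * v)) (fun u => ~ near (5 * s2).-1 z u).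
- by apply: lsub; rewrite /s1; lia.
- by apply: lsub; lia.
- by apply: lsub; rewrite s2E /s1; lia.
- by apply: lsub; lia.
- move=> u w /lP zu /E1 uw; apply/lP; apply: near_mono (near_trans act zu uw); lia.
- move=> w w' nw nw' [b /lP zb Ewb] [b' /lP zb' Ewb'].
  have nr y q : near (5 * s1).-1 z q -> E' y q -> near (5 * s1) z y.
    move=> zq /sE/E1 qy; apply: near_mono (near_trans act zq qy); rewrite /s1; lia.
  have nn y : y \notin l (5 * s1).-1 -> ~ near (5 * s1).-1 z y by move=> /negP h /lP.
  have H := annulus_conn (nb s1 (or_introl erefl)) (nr _ _ zb Ewb) (nn _ nw) (nr _ _ zb' Ewb') (nn _ nw').
  have [//|||h|] := push s1 (kap * s1) _ w w' _ H.
  + by move=> /(_ b).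
  + by move=> /(_ b').
  + apply: rtc_mono h => x y [Exy [[x1 x2] [y1 y2]]].
    have aux q : ~ near (s1 - rho) z q -> near (kap * s1 + rho) z q -> q \notin l (4 * v) /\ q \in l (kap * s1 + 4 * v).
      move=> q1 q2; split; last by apply/lP; apply: near_mono q2; lia.
      by apply/negP => /lP h'; apply: q1; apply: near_mono h'; rewrite /s1; lia.
    by split=> //; split; exact: aux.
  + by rewrite /s1; lia.
- move=> u w /lP zu /contrapT zu' /E1 uw; apply/lP; apply: near_mono (near_trans act zu' uw); rewrite s2E /s1; lia.
- move=> w w' nw nw' /lP zw /lP zw' iw iw'.
  have H := annulus_conn (nb s2 (or_intror erefl)) zw nw zw' nw'.
  have [//|h|] := push s2 (kap * s2) _ w w' _ H iw iw'.
  + apply: rtc_mono h => x y [Exy [[x1 x2] [y1 y2]]].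
    have aux q : ~ near (s2 - rho) z q -> near (kap * s2 + rho) z q ->
        q \notin l (kap * s1 + 4 * v) /\ q \in l (kap * s2 + 4 * v).
      move=> q1 q2; split; last by apply/lP; apply: near_mono q2; lia.
      by apply/negP => /lP h'; apply: q1; apply: near_mono h'; rewrite s2E /s1; lia.
    by split=> //; split; exact: aux.
  + by rewrite s2E /s1; lia.
exists (l (rad3 v)), P; split=> // [u|u y zu]; first by split=> /lP.
by apply: cP; exact/lP.
Qed.

(** Balls of radius [rad3 v] about separated centers are disjoint and serve as tiles. A detour stays
    in the tile where it starts, so the displacement grows by at most the diameter bound
    [2 * rad3 v]. *)
Lemma ball_stage E' rho v (Z : X -> Prop) : egraph f E' -> (forall x y, E' x y -> E x y) -> rerouting rho E' ->
  rho <= v -> 0 < v ->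
  (forall s, s = 8 * v \/ s = rad2 v -> forall x p q, gdist gS x p = 5 * s -> gdist gS x q = 5 * s ->
     conn (gdist gS) s (kap * s) x p q) ->
  BX Z -> (forall z z', Z z -> Z z' -> near (2 * rad3 v) z z' -> z = z') ->
  exists F, [/\ even_part E' F, rerouting (rho + 2 * rad3 v) (remove E' F)
    & forall z x, Z z -> near (4 * v) z x -> isolated (remove E' F) x].
Proof.
move=> gE' E'E rr rv v0 nb BZ sepZ; have [[BE cE] sE iE fE evE] := gE'.
pose R x y := exists z, Z z /\ (near (rad3 v) z x /\ near (rad3 v) z y).
pose core x := exists z, Z z /\ near (4 * v) x z.
have same z z' x : Z z -> Z z' -> near (rad3 v) z x -> near (rad3 v) z' x -> z = z'.
  move=> Zz Zz' zx z'x; apply: sepZ => //; rewrite mul2n -addnn; exact: near_trans zx (near_sym act z'x).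
have RE z x y : Z z -> near (rad3 v) z x -> R x y <-> near (rad3 v) z y.
  move=> Zz zx; split=> [[z' [Zz' [z'x z'y]]]|zy]; last by exists z.
  by rewrite (same z z' x).
have cR : covers f R.
  move=> x y [z [Zz [zx zy]]]; apply: (near_covers (gS := gS) (n := rad3 v + rad3 v) fa).
  exact: near_trans (near_sym act zx) zy.
have BR_R : BR R.
  have [mfi _ _] := mf; apply: (BR_covers Hc mfi cR) => w.
  apply: (@Bor_ext _ _ (fun x => exists z, (Z z /\ near (rad3 v) z (f w x)) /\ near (rad3 v) x z)).
    move=> x; split=> [[z [[Zz zy] xz]]|[z [Zz [zx zy]]]]; exists z; split=> //; last exact: near_sym.
    by split=> //; exact: near_sym.
  apply: (@Bor_ext _ _ (fun x => exists u, (exists g, len g <= rad3 v /\ f u = a g) /\ (Z (f u x) /\ near (rad3 v) (f u x) (f w x)))).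
    move=> x; split=> [[u [[g [gn fu]] [Zu nu]]]|[z [[Zz zy] [g [gn gz]]]]].
      by exists (f u x); split=> //; exists g; rewrite fu.
    by have [u fu] := fa g; exists u; rewrite fu gz; split=> //; exists g.
  apply: BorEx => u; apply: BorAc => _; apply: BorA; first exact: mfi.
  exact: (BR_mX Hc (BR_near Hc fS gS act bor (rad3 v))).
have [||||L [K [P [PV Kd KR BF cov]]]] := @stage X c Hc _ f mf E' R core true BE cE iE fE BR_R cR.
- by move=> x y [z [Zz [zx zy]]]; exists z.
- move=> x y w [z [Zz [zx zy]]] [z' [Zz' [z'y z'w]]]; exists z; split=> //; split=> //.
  by rewrite (same z z' y).
- move=> x; have [[z [Zz [zx _]]]|nx] := pselect (R x x); last first.
    by apply: (@sub_finite_set _ _ set0) => // y [z [Zz [zx zy]]]; apply: nx; exists z.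
  by apply: sub_finite_set (near_finite fS gS act free (rad3 v) z) => y /(RE z x y Zz zx).
- exact: BX_near.
exists (fun u w => exists l, P l u w); split.
- split=> //; [exact: (stage_sub PV)|exact: (stage_sym PV)|exact: (stage_even PV)|exact: (stage_fin PV)].
- move=> A u w uw nu nw.
  have nis x : ~ isolated (remove E' (fun u w => exists l, P l u w)) x -> ~ isolated E' x.
    by move=> h i; apply: h => y [/i].
  have iu := nis _ nu; have iw := nis _ nw.
  apply: (@reroute _ true E' L K P sE PV Kd isT (fun x => exists b, A b /\ near rho b x)) nu nw.
  + by move=> x [b [Ab bx]]; exists b; split=> //; apply: near_mono bx; lia.
  + move=> l x y [b [Ab bx]] xl yl; exists b; split=> //; apply: near_trans bx _ => //.
    have [z [Zz [zx zy]]] : R x y by apply/(KR l).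
    rewrite mul2n -addnn; exact: near_trans (near_sym act zx) zy.
  + exact: (rr A u w uw iu iw).
- move=> z x Zz zx y [Exy]; apply; apply: cov => //.
  + by exists z; split=> //; exact: near_sym.
  + have zx3 : near (rad3 v) z x by apply: near_mono zx; rewrite /rad3; lia.
    by exists z.
  have [Kx [Px [HK VP cP]]] := ball_tile z gE' E'E rr rv v0 nb.
  have zx3 : near (rad3 v) z x by apply: near_mono zx; rewrite /rad3; lia.
  exists Kx, Px; split=> // [u|u w uK [z' [Zz' uz']] Euw]; first by rewrite -HK; exact: RE.
  apply: cP => //; have /HK zu := uK.
  have -> : z = z'; last exact: near_sym.
  by apply: (same z z' u) => //; apply: near_mono (near_sym act uz'); rewrite /rad3; lia.
Qed.

End Polynomial.

Lemma rad3E q v : 2 * rad3 q v + v = (2 * (q * (q * 8 + 8) + 4) + 1) * v.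
Proof. rewrite /rad3 /rad2; nia. Qed.

Lemma schreier_egraph (X : ptopologicalType) (c : X -> nat -> nat) (G : groupType) (S : set G) (a : G -> X -> X)
    (f : seq nat -> X -> X) :
  std c -> finite_set S -> generates S -> is_action a -> free_action a -> borel_action a ->
  (forall g, exists w, f w = a g) -> even_degrees (schreier_graph a S) ->
  egraph f (fun x y => schreier_graph a S (x, y)).
Proof.
move=> Hc fS gS act free bor fa eE.
have cE : covers f (fun x y => schreier_graph a S (x, y)).
  by move=> x y /(schreier_near gS act)[_]; exact: near_covers.
apply: egraph_of => //; split; last first.
  apply/borel_BR; apply: (@Bor_ext _ _ (fun p => p.1 <> p.2 /\ near a gS 1 p.1 p.2)).
    by move=> [x y]; rewrite (schreier_near gS act).
  apply: BorA; last exact: (BR_near Hc fS gS act bor 1).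
  by apply: BorN; apply: (BX_eq Hc); [exact: mfst Hc|exact: msnd Hc].
split=> [x y|x]; last by case.
move=> /(schreier_near gS act)[xy h]; apply/(schreier_near gS act); split; first exact: nesym.
exact: near_sym.
Qed.

Theorem polynomial_orientation (R : realType) (X : ptopologicalType) (polishX : polish R X)
    (G : groupType) (S : set G) (a : G -> X -> X) :
  finite_set S -> generates S -> polynomial_growth S -> superlinear_growth S ->
  is_action a -> free_action a -> borel_action a -> even_degrees (schreier_graph a S) ->
  admits_borel_balanced_orientation (schreier_graph a S).
Proof.
move=> fS gS poly sup act free bor eE; have [c Hc] := polish_code polishX.
have [f [mf fa af]] := act_moves fS gS act bor.
pose E x y := schreier_graph a S (x, y).
have gE : egraph f E by exact: (schreier_egraph Hc fS gS act free bor fa eE).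
have [mfi [i0 fi0] fc] := mf; have [a1 aM] := act.
pose bs := bsize fS gS; pose nr := near a gS.
have [C [d bsC]] := bsize_polynomial fS gS poly.
have bs_le := bs_mono (gball fS gS) 1%g.
(* [L] below is the ratio of the packing radius [2 * rad3 kap v + v] to [v]. It is at most
   [41 * (640 * 640) * k.+2 ^ 2], and [k] is such that [2 ^ k] is at least [2 * L ^ d]. *)
have [k Hk] := poly_lt_exp (2 * (41 * (640 * 640)) ^ d) (2 * d).
pose kap := 640 * k.+2.
have kap5 : 5 <= kap by rewrite /kap; lia.
pose L := 2 * (kap * (kap * 8 + 8) + 4) + 1.
have radL v : 2 * rad3 kap v + v = L * v.
  exact: rad3E.
have Lq : 2 * L ^ d <= 2 ^ k.
  apply: leq_trans Hk; rewrite -mulnA leq_mul2l /= expnM -expnMn.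
  have LL : L <= 41 * (640 * 640) * k.+2 ^ 2.
    have -> : 41 * (640 * 640) * k.+2 ^ 2 = 41 * (kap * kap) by rewrite /kap expnS expn1; lia.
    by rewrite /L; nia.
  by case: (d) => // d'; rewrite leq_exp2r.
have /choice[vf Hvf] : forall n0, exists v, [/\ n0 <= v, 0 < v & bs (L * v) < 2 ^ k * bs v].
  by have L0 : 0 < L; [rewrite /L addn1|exact: (doubling_scale (bsize_gt0 fS gS) bsC L0 Lq)].
(* Each scale is chosen once the displacement caused by the earlier stages is known; the summand [m]
   makes the scales unbounded. *)
pose rho := fix rho m := if m is m'.+1 then rho m' + 2 * rad3 kap (vf (rho m' + m)) else 0.
pose v m := vf (rho m + m.+1).
have rhov m : rho m + m.+1 <= v m by case: (Hvf (rho m + m.+1)).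
have v0 m : 0 < v m by case: (Hvf (rho m + m.+1)).
have small m : bs (L * v m) < 2 ^ k * bs (v m) by case: (Hvf (rho m + m.+1)).
have nb m s : s = 8 * v m \/ s = rad2 kap (v m) -> forall x p q, gdist gS x p = 5 * s -> gdist gS x q = 5 * s ->
    conn (gdist gS) s (kap * s) x p q.
  move=> Hs; have vs : v m <= s by case: Hs => ->; rewrite /rad2; lia.
  have sL : s <= 8 * (kap + 1) * v m by case: Hs => ->; rewrite /rad2; nia.
  apply: (no_bottleneck (gdist0 gS) (gdistC gS) (gdistT gS) (@gdistS _ _ gS) (gdist_hom gS) (gball fS gS) 1%g).
  - exact: leq_trans (v0 m) vs.
  - exact: bsize_superlinear.
  apply: leq_ltn_trans (leq_trans (small m) _); last by rewrite leq_mul2l bs_le ?orbT.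
  apply: bs_le; apply: leq_trans (_ : 160 * k.+2 * (8 * (kap + 1) * v m) <= _); first by rewrite leq_mul2l sL orbT.
  rewrite mulnA leq_mul2r; apply/orP; right.
  have -> : 160 * k.+2 * (8 * (kap + 1)) = 2 * kap * (kap + 1) by rewrite /kap; lia.
  by rewrite /L; nia.
have /choice[Z HZ] : forall m, exists Z : nat -> X -> Prop,
    [/\ forall j, BX (Z j), forall j z z', Z j z -> Z j z' -> nr (2 * rad3 kap (v m)) z z' -> z = z'
    & forall x, exists j, j < 2 ^ k /\ exists z, Z j z /\ nr (2 * v m) x z].
  move=> m; have [Z [BZ sZ cZ]] := schemes Hc fS gS act free bor (2 * rad3 kap (v m)) (2 * v m).
  by exists Z; split=> //; apply: (cZ (v m)) => //; rewrite radL.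
have BZ m j : BX (Z m j) by case: (HZ m).
(* At scale [v m] one of [2 ^ k] nets comes close to a given point, but the tiles of a stage must be
   disjoint, so an orbit may use only one net. By the pigeonhole principle some index [j] recurs at
   infinitely many scales, and the quantifier over [g] makes this condition invariant under the
   action. *)
pose good j x := exists g, forall m0, exists m, m0 <= m /\ exists z, Z m j z /\ nr (2 * v m) (a g x) z.
have good_act j x g : good j (a g x) -> good j x by move=> [h H]; exists (h * g)%g; rewrite aM.
have good_inv j x y n : nr n x y -> good j x <-> good j y.
  move=> [g [_ <-]]; split; last exact: good_act.
  by move=> h; apply: (good_act j _ g^-1%g); rewrite (actV act).
have Bgood j : BX (good j).
  apply: (@Bor_ext _ _ (fun x => exists w, forall m0, exists m, m0 <= m /\ exists z, Z m j z /\ nr (2 * v m) (f w x) z)).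
    move=> x; split=> [[w H]|[g H]]; first by have [g e] := af w; exists g; rewrite -e.
    by have [w e] := fa g; exists w; rewrite e.
  apply: BorEx => w; apply: BorAll => m0; apply: BorEx => m; apply: BorAc => _.
  exact: (mfi w _ (BX_near fS gS act bor (2 * v m) (BZ m j))).
pose least j x := good j x /\ forall i, i < j -> ~ good i x.
have Bleast j : BX (least j).
  by apply: BorA => //; apply: BorAll => i; apply: BorIc => _; exact: BorN.
have least_inv j x y n : nr n x y -> least j x <-> least j y.
  move=> xy; split=> -[h1 h2]; (split; first exact/(good_inv j _ _ _ xy)) => i ij /(good_inv i _ _ _ xy); exact: h2.
have least_uniq i j x : least i x -> least j x -> i = j.
  by move=> [g1 n1] [g2 n2]; case: (ltngtP i j) => // h; [case: (n2 _ h)|case: (n1 _ h)].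
have least_ex x : exists j, least j x.
  have ex : exists j, `[< good j x >].
    apply: contrapT => nx.
    have /choice[m0 Hm0] : forall j, exists m0, forall m, m0 <= m -> ~ exists z, Z m j z /\ nr (2 * v m) x z.
      move=> j; apply: contrapT => H; apply: nx; exists j; apply/asboolP; exists 1%g => m0.
      apply: contrapT => H'; apply: H; exists m0 => m mm h; apply: H'; exists m; split=> //.
      by rewrite a1.
    pose m := \max_(j < 2 ^ k) m0 j.
    have [_ _ /(_ x)[j [jk h]]] := HZ m; apply: (Hm0 j m) h.
    exact: (leq_bigmax_cond (F := fun j : 'I__ => m0 j) (Ordinal jk)).
  case: (ex_minnP ex) => j /asboolP gj jmin; exists j; split=> // i ij gi.
  by have : j <= i by [apply: jmin; exact/asboolP]; rewrite leqNgt ij.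
pose Zs m z := exists j, least j z /\ Z m j z.
have BZs m : BX (Zs m) by apply: BorEx => j; apply: BorA.
have sepZs m z z' : Zs m z -> Zs m z' -> nr (2 * rad3 kap (v m)) z z' -> z = z'.
  move=> [j [lj Zj]] [j' [lj' Zj']] zz'; have [_ sep _] := HZ m.
  have e : j = j' by apply: (least_uniq _ _ z') => //; exact/(least_inv j _ _ _ zz').
  by subst j'; exact: (sep j z z' Zj Zj' zz').
(* At a scale beyond the length of [g], the net point close to [a g x] is also close to [x]; this is
   why the core has radius [4 * v m] rather than [2 * v m]. *)
have cover x : exists m z, Zs m z /\ nr (4 * v m) z x.
  have [j lj] := least_ex x; have [[g H] _] := lj.
  have [m [gm [z [Zz gz]]]] := H (len gS g).
  have xz : nr (len gS g + 2 * v m) x z by apply: near_trans gz => //; apply/near_act.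
  exists m, z; split; first by exists j; split=> //; exact/(least_inv j _ _ _ xz).
  by apply: near_sym => //; apply: near_mono xz; have := rhov m; lia.
pose Inv m (E' : X -> X -> Prop) := [/\ forall x y, E' x y -> E x y, rerouting a gS (rho m) E'
  & forall i z x, i < m -> Zs i z -> nr (4 * v i) z x -> isolated E' x].
have [||Es [Es0 gEs IEs sEs]] := @tower X _ f Inv _ gE.
- split=> // A u w uw _ _; apply: rtc_mono uw => x y [Exy [Ax Ay]].
  by split=> //; split; [exists x|exists y]; split=> //; exact: near_refl.
- move=> m E' gE' [E'E rr iE'].
  have rv : rho m <= v m by have := rhov m; lia.
  have [F [eF rrF cF]] := ball_stage Hc fS act free bor mf fa kap5 gE' E'E rr rv (v0 m) (nb m) (BZs m) (sepZs m).
  exists F; split=> //; split=> //; first by move=> x y [/E'E].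
  move=> i z x; rewrite ltnS leq_eqVlt => /predU1P[->|im] Zz zx; first exact: cF zx.
  by move=> y [Exy _]; exact: (iE' i z x im Zz zx y Exy).
have [||O [BO oO bO]] := @tower_orientation X c Hc _ f mf Es (fun=> True) gEs sEs (Bor_cst _ _).
- by [].
- move=> x _; apply: (@sub_finite_set _ _ [set x]) => // y /clos_rt_rt1n_iff H; case: H => // u w Huv _.
  have [m [z [Zz zx]]] := cover x; have [_ _ iE] := IEs m.+1.
  by case: (iE m z x (ltnSn m) Zz zx u).
by apply: orientation_of_rel BO oO bO => x y; rewrite Es0; split=> [[]|].
Qed.

(** * Følner sets *)

Section Hall.
Local Open Scope fset_scope.
Variables (L V : choiceType) (N : L -> {fset V}).

Definition nbh (U : {fset V}) (A : {fset L}) : {fset V} := (\bigcup_(l <- A) N l) `\` U.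

Lemma nbhP U A r : reflect (r \notin U /\ exists l, l \in A /\ r \in N l) (r \in nbh U A).
Proof.
rewrite /nbh in_fsetD; apply: (iffP andP) => [[-> /bigfcupP[l /andP[lA _] rl]]|[-> [l [lA rl]]]].
  by split=> //; exists l.
by split=> //; apply/bigfcupP; exists l => //; rewrite lA.
Qed.

(** The marriage condition for the vertices outside [D] when the values in [U] are already taken. *)
Definition hall (D : {fset L}) U := forall A : {fset L}, [disjoint A & D]%fset -> (#|` A| <= #|` nbh U A|)%N.

(** If every choice [r] violated the condition, each would lie in the neighbourhood of a tight set.
    Tight sets are closed under union by submodularity, and adding [l] to the union of them all
    would leave too few neighbours. *)
Lemma hall_step D U l : hall D U -> l \notin D ->
  exists r, [/\ r \in N l, r \notin U & hall (l |` D) (r |` U)].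
Proof.
move=> H lD; apply: contrapT => no.
have bad r : r \in N l -> r \notin U -> exists A : {fset L}, [/\ [disjoint A & (l |` D)]%fset,
    (#|` nbh U A| <= #|` A|)%N & r \in nbh U A].
  move=> rl rU; apply: contrapT => nA; apply: no; exists r; split=> // A dA; rewrite leqNgt; apply/negP => lt.
  have dA' : [disjoint A & D]%fset by move: dA; rewrite fdisjointXU => /andP[].
  have sub : nbh U A `<=` r |` nbh (r |` U) A.
    apply/fsubsetP => s /nbhP[sU sA]; rewrite in_fset1U; case: eqVneq => //= sr.
    by apply/nbhP; split=> //; rewrite in_fset1U negb_or sr.
  apply: nA; exists A; split=> //.
    apply: leq_trans (fsubset_leq_card sub) _; apply: leq_trans lt.
    by rewrite cardfsU1; case: (_ \notin _) => //; lia.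
  apply: contraT => rA; have : (#|` A| <= #|` nbh U A|)%N by exact: H.
  have sub' : nbh U A `<=` nbh (r |` U) A.
    apply/fsubsetP => s sA; have := fsubsetP sub s sA; rewrite in_fset1U => /predU1P[sr|//].
    by move: rA; rewrite -sr sA.
  by move=> h; have := leq_trans h (fsubset_leq_card sub'); rewrite leqNgt lt.
have [A [dA tA cA]] : exists A : {fset L}, [/\ [disjoint A & (l |` D)]%fset, (#|` nbh U A| <= #|` A|)%N
    & forall r, r \in enum_fset (N l) -> r \notin U -> r \in nbh U A].
  have : forall r, r \in enum_fset (N l) -> r \in N l by [].
  elim: (enum_fset (N l)) => [|r q IH] qN.
    exists fset0; split=> //; first exact: fdisjoint0X.
    rewrite cardfs0 leqn0 cardfs_eq0; apply/eqP/fsetP => r; rewrite in_fset0.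
    by apply/negbTE/negP => /nbhP[_ [l' []]]; rewrite in_fset0.
  have [|A [dA tA cA]] := IH; first by move=> r' r'q; apply: qN; rewrite inE r'q orbT.
  case: (boolP (r \in U)) => rU.
    by exists A; split=> // r'; rewrite inE => /predU1P[->|/cA//]; rewrite rU.
  have [B [dB tB rB]] := bad r (qN _ (mem_head _ _)) rU.
  have dAB : [disjoint (A `|` B) & (l |` D)]%fset by rewrite fdisjointUX dA dB.
  have nU : nbh U (A `|` B) = nbh U A `|` nbh U B.
    apply/fsetP => s; rewrite in_fsetU; apply/nbhP/orP.
      move=> [sU [l' [+ sl']]]; rewrite in_fsetU => /orP[h|h]; [left|right]; apply/nbhP; split=> //; by exists l'.
    by case=> /nbhP[sU [l' [h sl']]]; split=> //; exists l'; rewrite in_fsetU h ?orbT.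
  exists (A `|` B); split=> //.
    have nI : (nbh U (A `&` B) `<=` nbh U A `&` nbh U B).
      apply/fsubsetP => s /nbhP[sU [l' []]]; rewrite !in_fsetI => /andP[lA lB] sl'.
      by apply/andP; split; apply/nbhP; split=> //; exists l'.
    have dI : [disjoint (A `&` B) & D]%fset.
      move: dA; rewrite fdisjointXU => /andP[_ dA]; apply: fdisjointWl dA; exact: fsubsetIl.
    have h1 := H _ dI; have h2 := fsubset_leq_card nI.
    have e1 := cardfsUI A B; have e2 := cardfsUI (nbh U A) (nbh U B).
    rewrite nU; lia.
  move=> r'; rewrite inE nU in_fsetU => /predU1P[->|h r'U]; first by rewrite rB orbT.
  by rewrite cA.
have lA : l \notin A by apply: contraL dA => lA; apply/negP => /fdisjointP/(_ l lA); rewrite in_fset1U eqxx.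
have dlA : [disjoint (l |` A) & D]%fset.
  rewrite fdisjointUX; apply/andP; split; first by rewrite fdisjoint1X.
  by move: dA; rewrite fdisjointXU => /andP[].
have := H _ dlA; rewrite cardfsU1 lA /= add1n ltnNge => /negP; apply.
apply: leq_trans tA; apply: fsubset_leq_card; apply/fsubsetP => r /nbhP[rU [l' []]].
rewrite in_fset1U => /predU1P[->|l'A] rl'; first exact: cA.
by apply/nbhP; split=> //; exists l'.
Qed.

Theorem hall_matching (en : nat -> L) : (forall l, exists n, en n = l) -> hall fset0 fset0 ->
  exists phi : L -> V, injective phi /\ forall l, phi l \in N l.
Proof.
move=> enS H.
have /choice[nx Hnx] : forall p : L * ({fset L} * {fset V}), exists r, hall p.2.1 p.2.2 -> p.1 \notin p.2.1 ->
    [/\ r \in N p.1, r \notin p.2.2 & hall (p.1 |` p.2.1) (r |` p.2.2)].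
  move=> [l [D U]] /=; have [[HD lD]|n] := pselect (hall D U /\ l \notin D).
    by have [r hr] := hall_step HD lD; exists r.
  have [[r _]|nV] := pselect (exists r : V, True); first by exists r => h1 h2; case: n.
  have : #|` [fset l]|%fset <= #|` nbh fset0 [fset l]|%fset by apply: H; exact: fdisjointX0.
  rewrite cardfs1 cardfs_gt0 => /fset0Pn[r _]; by case: nV; exists r.
pose st := fix st n : {fset L} * {fset V} := if n is m.+1 then
  if en m \in (st m).1 then st m else (en m |` (st m).1, nx (en m, st m) |` (st m).2) else (fset0, fset0).
have Hst n : hall (st n).1 (st n).2.
  elim: n => [//|n IH] /=; case: ifPn => // nD; by have [] := Hnx (en n, st n) IH nD.
have mono n m : (n <= m)%N -> (st n).1 `<=` (st m).1 /\ (st n).2 `<=` (st m).2.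
  move=> /subnK <-; elim: (m - n)%N => [|k [IH1 IH2]]; first by rewrite add0n !fsubset_refl.
  rewrite addSn /=; case: ifP => _ //=; split.
    by apply: fsubset_trans IH1 _; exact: fsubsetUr.
  by apply: fsubset_trans IH2 _; exact: fsubsetUr.
have ex l : exists n, en n = l /\ en n \notin (st n).1.
  have [n0 en0] := enS l.
  have : exists n, l \in (st n).1 by exists n0.+1 => /=; case: ifPn; rewrite en0// => _; rewrite in_fset1U eqxx.
  move=> /ex_minnP[[|n] ln nmin] //; exists n; move: ln => /=; case: ifPn => nD.
    by move=> /nmin; rewrite ltnn.
  rewrite in_fset1U => /predU1P[->//|/nmin]; by rewrite ltnn.
have /choice[t Ht] := ex.
exists (fun l => nx (l, st (t l))); split; last first.
  by move=> l; have [e nD] := Ht l; have [] := Hnx (l, st (t l)) (Hst _); rewrite //= -{1}e.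
move=> l l' e; apply: contrapT => ll'.
wlog lt : l l' e ll' / (t l < t l')%N.
  move=> W; case: (ltngtP (t l) (t l')) => h; [exact: (W l l')|by apply: (W l' l) => //; exact: nesym|].
  by apply: ll'; rewrite -(Ht l).1 -(Ht l').1 h.
have [el nl] := Ht l; have [el' nl'] := Ht l'.
have [_ /= nU _] := Hnx (l', st (t l')) (Hst _) ltac:(by rewrite /= -{1}el').
move/negP: nU; apply; rewrite -e.
have : nx (l, st (t l)) \in (st (t l).+1).2.
  by rewrite /= (negbTE nl) /= el in_fset1U eqxx.
exact: (fsubsetP (mono _ _ lt).2).
Qed.

End Hall.

(** * Almost invariant finite sets from an invariant mean *)

Section Folner.
Variables (R : realType) (G : groupType) (S : set G).
Hypotheses (fS : finite_set S) (gS : generates S).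
Local Open Scope group_scope.
Notation gdist := (gdist gS).
Notation len := (len gS).

Definition bd (F : seq G) := [seq x <- F | `[< exists y, (gdist x y <= 1)%N /\ y \notin F >]].

Let ball_list n : seq G := sval (cid (wb_list fS gS n)).
Let ball_listP n g : (g \in ball_list n) = (len g <= n)%N.
Proof. by rewrite /ball_list; case: cid => l /= []. Qed.

Let thick (F : seq G) := undup [seq s * x | s <- ball_list 1, x <- F].

Let thickP F y : y \in thick F <-> exists x, x \in F /\ (gdist x y <= 1)%N.
Proof.
rewrite mem_undup; split=> [/allpairsP[[s x] /= [+ xF ->]]|[x [xF xy]]].
  by rewrite ball_listP => s1; exists x; split=> //; rewrite /gdist mulgK.
apply/allpairsP; exists (y * x^-1, x) => /=; split=> //; first by rewrite ball_listP.
by rewrite mulgVK.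
Qed.

(** The inner boundary of [thick F] is disjoint from [F]. If it always exceeds the proportion [1/q],
    thickening adds at least [size F / q] points. *)
Lemma thick_grow q F : uniq F -> F <> [::] ->
  (forall F, uniq F -> F <> [::] -> (size F < q * size (bd F))%N) ->
  (size F + q * size F <= q * size (thick F))%N.
Proof.
move=> uF F0 H.
have FT : {subset F <= thick F} by move=> x xF; apply/thickP; exists x; split=> //; rewrite (gdist0 gS x x).2.
have T0 : thick F <> [::] by move=> e; move: FT; rewrite e; case: (F) F0 => // x F' _ /(_ x (mem_head _ _)).
have := H _ (undup_uniq _ : uniq (thick F)) T0.
have bF : (size (bd (thick F)) + size F <= size (thick F))%N.
  have -> : size F = size [seq x <- thick F | x \in F].
    apply: perm_size; apply: uniq_perm => //; first by rewrite filter_uniq// undup_uniq.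
    by move=> x; rewrite mem_filter; case xF: (x \in F) => //=; rewrite FT.
  rewrite /bd !size_filter -count_predUI.
  have -> : count (predI (fun x => `[< exists y, (gdist x y <= 1)%N /\ y \notin thick F >]) (fun x => x \in F)) (thick F) = 0%N.
    apply/eqP; rewrite -leqn0 leqNgt -has_count; apply/hasPn => x xT /=; apply/negP => /andP[/asboolP[y [xy yT]] xF].
    by move/negP: yT; apply; apply/thickP; exists x.
  by rewrite addn0; exact: count_size.
have : (size F <= size (thick F))%N by apply: uniq_leq_size.
have := leq_mul (leqnn q) bF; rewrite mulnDr; lia.
Qed.

Lemma thick_double q F : (0 < q)%N -> uniq F -> F <> [::] ->
  (forall F, uniq F -> F <> [::] -> (size F < q * size (bd F))%N) ->
  (2 * size F <= size (iter q thick F))%N.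
Proof.
move=> q0 uF F0 H.
suff h n : [/\ uniq (iter n thick F), iter n thick F <> [::] & (n * size F + q * size F <= q * size (iter n thick F))%N].
  by have [_ _ h'] := h q; rewrite -mulnDr leq_pmul2l// in h'; lia.
elim: n => [|n [un n0 IH]]; first by rewrite mul0n.
have FT : (size F <= size (iter n thick F))%N by have := leq_mul (leqnn q) (leqnn 0); nia.
have g := thick_grow un n0 H; rewrite iterS; split; first exact: undup_uniq.
  by move=> e; move: g; rewrite e /= muln0; case: (iter n thick F) n0.
by rewrite mulSn -addnA; apply: leq_trans (leq_add FT IH) g.
Qed.

Lemma mean_bigcup (m : set G -> R) (I : eqType) (s : seq I) (A : I -> set G) :
  (forall A B, A `&` B = set0 -> m (A `|` B) = (m A + m B)%R) -> m set0 = 0%R ->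
  uniq s -> (forall i j, i \in s -> j \in s -> i <> j -> A i `&` A j = set0) ->
  m [set g | exists i, i \in s /\ A i g] = (\sum_(i <- s) m (A i))%R.
Proof.
move=> mD m0; elim: s => [|i s IH] /=.
  by move=> _ _; rewrite big_nil -m0; congr m; apply/seteqP; split=> g // -[i []].
move=> /andP[is_ us] dA; rewrite big_cons -IH//; last first.
  by move=> j k js ks; apply: dA; rewrite inE ?js ?ks orbT.
rewrite -mD; last first.
  apply/seteqP; split=> g // [Ai [j [js Aj]]].
  have : (A i `&` A j) g by [].
  by rewrite dA// ?inE ?eqxx ?js ?orbT// => e; move: is_; rewrite e js.
congr m; apply/seteqP; split=> g.
  by move=> [j []]; rewrite inE => /predU1P[->|js] Aj; [left|right; exists j].
by case=> [Ai|[j [js Aj]]]; [exists i; rewrite mem_head|exists j; rewrite inE js orbT].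
Qed.

(* A growing group has an injection of two copies of itself into itself moving
   points a bounded distance, which no invariant mean allows. *)
Theorem folner q : amenable R G -> (0 < q)%N -> exists F, [/\ uniq F, F <> [::] & (q * size (bd F) <= size F)%N].
Proof.
move=> [m [m0 m1 mD mI]] q0; apply: contrapT => no.
have H F : uniq F -> F <> [::] -> (size F < q * size (bd F))%N.
  by move=> uF F0; rewrite ltnNge; apply/negP => h; apply: no; exists F.
pose N (p : G * bool) : {fset G} := [fset x in [seq t * p.1 | t <- ball_list q]]%fset.
have NP p x : x \in N p <-> (gdist p.1 x <= q)%N.
  rewrite /N in_fset; split=> [/mapP[t + ->]|h]; first by rewrite ball_listP /gdist mulgK.
  by apply/mapP; exists (x * p.1^-1); rewrite ?ball_listP// mulgVK.
have iterP n F y : y \in iter n thick F -> exists x, x \in F /\ (gdist x y <= n)%N.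
  elim: n y => [|n IH] y /=; first by move=> yF; exists y; rewrite (gdist0 gS y y).2.
  move=> /thickP[z [/IH[x [xF xz]] zy]]; exists x; split=> //.
  by apply: leq_trans (gdistT gS x z y) _; lia.
have [e [_ _ es]] := enum_group fS gS.
pose en n : G * bool := if @choice.unpickle (seq nat * bool)%type n is Some p then (e p.1, p.2) else (1, true).
have [|A _|phi [phiI phiN]] := @hall_matching _ _ N en.
- by move=> [g b]; have [w <-] := es g; exists (@choice.pickle (seq nat * bool)%type (w, b)); rewrite /en pickleK.
(* [A] has at most twice as many elements as its projection [F], and thickening [q] times at least
   doubles [F]. *)
- pose F := undup [seq p.1 | p <- enum_fset A].
  have [Fe|F0] := eqVneq F [::]; last first.
    have := thick_double q0 (undup_uniq _ : uniq F) ltac:(exact/eqP) H.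
    have h1 : (#|` A|%fset <= 2 * size F)%N.
      have -> : (2 * size F = size [seq (g, b) | g <- F, b <- [:: true; false]])%N by rewrite size_allpairs mulnC.
      apply: uniq_leq_size; first exact: fset_uniq.
      move=> [g b] gA; apply/allpairsP; exists (g, b); split=> //=; last by case: b gA.
      by rewrite mem_undup; apply/mapP; exists (g, b).
    have uT : uniq (iter q thick F) by case: (q) => [|n]; rewrite ?iterS undup_uniq.
    have h2 : (size (iter q thick F) <= #|` nbh N fset0 A|%fset)%N.
      apply: uniq_leq_size => // y /iterP[x [+ xy]]; rewrite mem_undup => /mapP[p pA xp].
      by apply/nbhP; rewrite in_fset0; split=> //; exists p; split=> //; apply/NP; rewrite -xp.
    by move=> h3; apply: leq_trans h1 (leq_trans h3 h2).
  have : A = fset0.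
    apply/fsetP => p; rewrite in_fset0; apply/negbTE/negP => pA.
    have : p.1 \in F by rewrite mem_undup; apply: map_f.
    by rewrite Fe.
  by move=> ->; rewrite cardfs0.
(* [Ab b t] is where copy [b] of a point is moved by [t]. For fixed [b] these sets partition the
   group, and their translates for both [b] are disjoint by injectivity of [phi], so they would have
   total mean [2]. *)
pose Ab b t : set G := [set g | phi (g, b) = t * g].
have ms0 : m set0 = 0%R.
  by apply: (@addrI _ (m set0)); rewrite addr0 -mD ?setU0// setI0.
have part b : (\sum_(t <- ball_list q) m (Ab b t) = 1)%R.
  rewrite -mean_bigcup//.
  - rewrite -m1; congr m; apply/seteqP; split=> g // _.
    exists (phi (g, b) * g^-1); rewrite ball_listP; split; first by have /NP := phiN (g, b).
    by rewrite /Ab /= mulgVK.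
  - by rewrite /ball_list; case: cid => l /= [].
  - by move=> t t' _ _ tt'; apply/seteqP; split=> g //; rewrite /Ab /= => -[-> /mulIg].
pose s := [seq (b, t) | b <- [:: true; false], t <- ball_list q].
have us : uniq s.
  by apply: allpairs_uniq => //; [rewrite /ball_list; case: cid => l /= []|case=> [? ?] [? ?]].
have := @mean_bigcup m _ s (fun p => [set p.2 * g | g in Ab p.1 p.2]) mD ms0 us.
rewrite big_allpairs /= !big_cons big_nil.
under eq_bigr do rewrite mI. 
under [X in (_ + (X + _))%R]eq_bigr do rewrite mI.
rewrite !part addr0 => W.
have : (m [set g | exists i, i \in s /\ [set i.2 * h | h in Ab i.1 i.2]%g g]%g <= 1)%R.
  set B := [set g | _]; have := mD B (~` B) (setICr _); rewrite setUCr m1 => ->.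
  by rewrite lerDl.
rewrite W; first by rewrite gerDl ler10.
move=> [b t] [b' t'] _ _ ne; apply/seteqP; split=> g // -[/= [x xA <-] [y yA]].
rewrite -xA -yA => /phiI[e1 e2]; subst y b'; case: ne; congr (_, _).
by apply: (@mulIg _ x); rewrite -xA yA.
Qed.

End Folner.

(** * Følner sets with thin connected walls *)

Lemma maximal_list (T : eqType) (r : rel T) (s : seq T) : reflexive r -> symmetric r ->
  exists Z, [/\ {subset Z <= s}, pairwise (fun x y => ~~ r x y) Z & forall x, x \in s -> exists2 z, z \in Z & r z x].
Proof.
move=> rr rs; elim: s => [|x s [Z [Zs pZ HZ]]]; first by exists [::].
have [/hasP[z zZ rz]|/hasPn nZ] := boolP (has (fun z => r z x) Z).
  exists Z; split=> // [y /Zs|y]; first by rewrite inE => ->; rewrite orbT.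
  by rewrite inE => /predU1P[->|/HZ//]; exists z.
exists (x :: Z); split=> [y||y].
- by rewrite !inE => /predU1P[->|/Zs ->]; rewrite ?eqxx ?orbT.
- by rewrite /= pZ andbT; apply/allP => z zZ; rewrite rs; exact: nZ.
- rewrite inE => /predU1P[->|/HZ[z zZ rz]]; first by exists x; rewrite ?mem_head.
  by exists z; rewrite // inE zZ orbT.
Qed.

Section Walls.
Variables (R : realType) (G : groupType) (S : set G).
Hypotheses (fS : finite_set S) (gS : generates S).
Notation gdist := (gdist gS).
Notation bs := (bsize fS gS).
Notation bd := (bd gS).
Notation adj := (adj gdist).

Definition conn_list (F : seq G) := forall x y, x \in F -> y \in F -> rtc (within adj (fun a => a \in F)) x y.

(** A Følner set of least cardinality is connected: no edge joins a component to the rest, so the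
    boundaries of these two parts add up and one part has a ratio at least as good. *)
Lemma minimal_folner q : amenable R G -> 0 < q -> exists F,
  [/\ uniq F, F <> [::], q * size (bd F) <= size F & conn_list F].
Proof.
move=> am q0; have [F0 [uF0 F00 hF0]] := folner fS gS am q0.
pose Q n := `[< exists F, [/\ uniq F, F <> [::], q * size (bd F) <= size F & size F = n] >].
have ex : exists n, Q n by exists (size F0); apply/asboolP; exists F0.
case: (ex_minnP ex) => n /asboolP[F [uF F1 hF sF]] nmin; exists F; split=> // x y xF yF; apply: contrapT => nxy.
pose C a := `[< rtc (within adj (fun a => a \in F)) x a >].
pose F1' := [seq a <- F | C a]; pose F2' := [seq a <- F | ~~ C a].
have sub (p : pred G) : (forall a b, a \in F -> b \in F -> adj a b -> p a = p b) ->
    size (bd [seq a <- F | p a]) <= count p (bd F).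
  move=> Hp; rewrite -size_filter; apply: uniq_leq_size; first by rewrite !filter_uniq.
  move=> a; rewrite !mem_filter => /andP[/asboolP[b [ab nb]] /andP[pa aF]].
  rewrite pa aF andbT /=; apply/asboolP; exists b; split=> //; apply: contra nb => bF.
  rewrite mem_filter bF andbT; have [ab0|ab1] := eqVneq (gdist a b) 0.
    by move: ab0 => /(gdist0 gS) <-.
  by rewrite -(Hp a b) // /adj; lia.
have CE a b : a \in F -> b \in F -> adj a b -> C a = C b.
  have asym u v : adj u v -> adj v u by rewrite /adj gdistC.
  have st u v : u \in F -> v \in F -> adj u v -> C u -> C v.
    by move=> uF' vF uv /asboolP h; apply/asboolP; apply: rtc_trans h (rtc_step _).
  by move=> aF bF ab; apply/idP/idP; apply: st => //; exact: asym.
have h1 := sub C CE; have h2 := sub (fun a => ~~ C a) (fun a b h h' h'' => congr1 negb (CE a b h h' h'')).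
have Cx : C x by apply/asboolP; exact: rtc_refl.
have nCy : ~~ C y by apply/negP => /asboolP.
have s12 : size F1' + size F2' = size F by rewrite !size_filter count_predC.
have s12b : count C (bd F) + count (fun a => ~~ C a) (bd F) = size (bd F) by rewrite count_predC.
have ne1 : F1' <> [::].
  by move=> e; have : x \in F1' by [rewrite mem_filter Cx]; rewrite e.
have ne2 : F2' <> [::].
  by move=> e; have : y \in F2' by [rewrite mem_filter nCy]; rewrite e.
have pos (l : seq G) : l <> [::] -> 0 < size l by case: l.
have big (l : seq G) : uniq l -> l <> [::] -> size l < n -> size l < q * size (bd l).
  move=> ul l0 ln; rewrite ltnNge; apply/negP => h; have : n <= size l by apply: nmin; apply/asboolP; exists l.
  by rewrite leqNgt ln.
have b1 := big F1' (filter_uniq _ uF) ne1 ltac:(by rewrite -sF -s12 -[X in X < _]addn0 ltn_add2l; exact: pos).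
have b2 := big F2' (filter_uniq _ uF) ne2 ltac:(by rewrite -sF -s12 -[X in X < _]add0n ltn_add2r; exact: pos).
have := leq_mul (leqnn q) (leq_add h1 h2); rewrite s12b mulnDr => h.
have := leq_trans (leq_add b1 b2) (leq_trans h hF).
by rewrite -s12 addSn addnS ltnNge leqnSn.
Qed.

Section Network.
Variables (K D : seq G) (r : nat).
Hypothesis cK : conn_list K.
Let e x y := [&& gdist x y == 1, x \in K & y \in K].
Hypothesis Dnear : forall x, x \in K -> exists d p, [/\ d \in D, path e x p, last x p = d & size p <= r].
Hypothesis DK : {subset D <= K}.

Lemma path_conn x p : path e x p -> forall v, v \in x :: p -> rtc (within adj (fun a => a \in x :: p)) x v.
Proof.
elim: p x => [|y p IH] x /=; first by move=> _ v; rewrite inE => /eqP ->; exact: rtc_refl.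
move=> /andP[/and3P[/eqP xy xK yK] /IH H] v; rewrite inE => /predU1P[->|/H h]; first exact: rtc_refl.
apply: rtc_trans (rtc_step _) _; first by split; [exact: xy|rewrite !inE !eqxx orbT].
by apply: rtc_mono h => a b [ab [ha hb]]; split=> //; rewrite inE ha inE hb !orbT.
Qed.

Lemma path_sub x p : x \in K -> path e x p -> {subset x :: p <= K}.
Proof.
elim: p x => [|y p IH] x xK /=; first by move=> _ v; rewrite inE => /eqP ->.
by move=> /andP[/and3P[_ _ yK] /(IH _ yK) h] v; rewrite inE => /predU1P[->//|/h].
Qed.

Lemma rsym (F : seq G) x y : rtc (within adj (fun a => a \in F)) x y -> rtc (within adj (fun a => a \in F)) y x.
Proof. by apply: rtc_sym => a b; apply: within_sym => u v; rewrite /adj gdistC. Qed.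

(** Each point of [K] is assigned an element of [D] at the end of a short path, elements of [D]
    being assigned to themselves. On a path of [K] from an element of [D] in [Y] to one outside,
    some edge leads from a point assigned to [Y] to a point assigned elsewhere; this edge and the
    two short paths attach a new element of [D] at a cost of [2 * r + 2]. *)
Lemma network n Y : conn_list Y -> {subset Y <= K} -> (exists2 d, d \in D & d \in Y) ->
  size [seq d <- undup D | d \notin Y] <= n ->
  exists Y', [/\ conn_list Y', {subset Y' <= K}, {subset D <= Y'} & size Y' <= size Y + (2 * r + 2) * n].
Proof.
elim: n Y => [|n IH] Y cY YK [d0 d0D d0Y] sD.
  exists Y; split=> //; last by rewrite muln0 addn0.
  move=> d dD; apply: contraT => nd; move: sD; rewrite leqNgt -has_predT; case/negP; apply/hasP; exists d => //.
  by rewrite mem_filter nd mem_undup.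
have [[d dD dY]|nd] := pselect (exists2 d, d \in D & d \notin Y); last first.
  exists Y; split=> //; last exact: leq_addr.
  by move=> d dD; apply: contraT => dY; case: nd; exists d.
have /choice[h Hh] : forall x, exists q : G * seq G, x \in K -> [/\ q.1 \in D, path e x q.2, last x q.2 = q.1, size q.2 <= r & x \in D -> q.1 = x].
  move=> x; have [xD|nD] := boolP (x \in D); first by exists (x, [::]).
  have [xK|nK] := boolP (x \in K); last by exists (x, [::]).
  by have [d' [p [? ? ? ?]]] := Dnear xK; exists (d', p) => _; split=> // h; rewrite h in nD.
have [v [v' [vv' vK v'K vY v'Y]]] : exists v v', [/\ adj v v', v \in K, v' \in K, (h v).1 \in Y & (h v').1 \notin Y].
  have := cK (DK d0D) (DK dD); have := (Hh d (DK dD)); have := (Hh d0 (DK d0D)).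
  move=> [_ _ _ _ /(_ d0D) e0] [_ _ _ _ /(_ dD) ed]; rewrite -{}e0 in d0Y; rewrite -{}ed in dY.
  move=> /clos_rt_rt1n_iff H; elim: H d0Y dY => [u hu|u w z [uw [uK wK]] _ IHp hu hz]; first by rewrite hu.
  by have [hw|nw] := boolP ((h w).1 \in Y); [exact: IHp|exists u, w].
have [hD hp hl hs _] := Hh v vK; have [hD' hp' hl' hs' _] := Hh v' v'K.
pose Y1 := (v :: (h v).2) ++ (v' :: (h v').2) ++ Y.
have inY1 a : a \in Y1 = [|| a \in v :: (h v).2, a \in v' :: (h v').2 | a \in Y] by rewrite /Y1 !mem_cat.
have lm x p : last x p \in x :: p by exact: mem_last.
have cv : forall a, a \in Y1 -> rtc (within adj (fun a => a \in Y1)) v a.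
  have m1 u w : rtc (within adj (fun a => a \in v :: (h v).2)) u w -> rtc (within adj (fun a => a \in Y1)) u w.
    by apply: rtc_mono => a b [ab [ha hb]]; split=> //; rewrite !inY1 ha hb.
  have m2 u w : rtc (within adj (fun a => a \in v' :: (h v').2)) u w -> rtc (within adj (fun a => a \in Y1)) u w.
    by apply: rtc_mono => a b [ab [ha hb]]; split=> //; rewrite !inY1 ha hb !orbT.
  have m3 u w : rtc (within adj (fun a => a \in Y)) u w -> rtc (within adj (fun a => a \in Y1)) u w.
    by apply: rtc_mono => a b [ab [ha hb]]; split=> //; rewrite !inY1 ha hb !orbT.
  move=> a; rewrite inY1 => /or3P[ha|ha|ha].
  - by apply: m1; exact: path_conn.
  - apply: rtc_trans (rtc_step _) (m2 _ _ (path_conn hp' ha)).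
    by split=> //; rewrite !inY1 !mem_head !orbT.
  - apply: (rtc_trans (y := last v (h v).2)); first by apply: m1; refine (path_conn hp _); exact: mem_last.
    by rewrite hl; apply: m3; exact: cY.
have cY1 : conn_list Y1 by move=> a b /cv ha /cv hb; apply: rtc_trans hb; exact: rsym.
have [|||Y' [cY' Y'K DY' sY']] := IH Y1 cY1.
- move=> a; rewrite inY1 => /or3P[]; [exact: path_sub|exact: path_sub|exact: YK].
- by exists d0; rewrite // inY1 d0Y !orbT.
- rewrite -ltnS; apply: leq_trans sD; apply: (@leq_trans (size ((h v').1 :: [seq d <- undup D | d \notin Y1]))).
    by [].
  apply: uniq_leq_size.
    rewrite /= filter_uniq ?undup_uniq// andbT mem_filter negb_and negbK; apply/orP; left.
    by rewrite inY1 -hl' lm orbT.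
  move=> a; rewrite inE => /predU1P[->|]; first by rewrite mem_filter v'Y mem_undup.
  by rewrite !mem_filter inY1 !negb_or => /andP[/and3P[_ _ ->] ->].
exists Y'; split=> //; apply: leq_trans sY' _; rewrite !size_cat /= mulnS; lia.
Qed.

End Network.

Theorem walls q : amenable R G -> superlinear_growth S -> 0 < q -> exists K Y : seq G,
  [/\ uniq K, K <> [::], conn_list K & [/\ uniq Y, {subset Y <= K}, {subset bd K <= Y}, conn_list Y & q * size Y <= size K]].
Proof.
(* [C] is the cost per element of [D] in [network] with paths of length [2 * r], plus one for the
   starting point. The factor [14 * q] comes from [C <= 7 * r], which makes [bs r] at least
   [2 * q * C]. *)
move=> am sup q0; have [n0 Hn0] := bsize_superlinear fS gS sup (14 * q).
pose r := n0.+1; have rb : 14 * q * r < bs r by apply: Hn0.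
pose C := 4 * r + 3.
have Cb : 2 * q * C <= bs r.
  apply: leq_trans (ltnW rb); have -> : 14 * q * r = 2 * q * (7 * r) by lia.
  by rewrite leq_mul2l; apply/orP; right; rewrite /C /r; lia.
have [|K [uK K0 hK cK]] := @minimal_folner (2 * q * C) am.
  by rewrite /C !muln_gt0 q0 addn3.
pose e x y := [&& gdist x y == 1, x \in K & y \in K].
have walk n x y : x \in K -> gdist x y = n ->
    (exists p, [/\ y \in K, path e x p, last x p = y & size p <= n]) \/
    (exists p, [/\ last x p \in bd K, path e x p & size p <= n]).
  move=> xK; elim: n y => [|n IH] y em.
    by left; exists [::]; move: em => /(gdist0 gS) <-.
  have [z [xz zy]] := gdistS em.
  have [[p [zK xp lp sp]]|[p [lp xp sp]]] := IH z xz; last first.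
    by right; exists p; split=> //; exact: leq_trans sp (leqnSn n).
  have [yK|nK] := boolP (y \in K).
    left; exists (rcons p y); rewrite rcons_path xp lp last_rcons size_rcons; split=> //.
    by rewrite /e zy zK yK eqxx.
  right; exists p; rewrite lp; split=> //; last exact: leq_trans sp (leqnSn n).
  by rewrite /bd mem_filter zK andbT; apply/asboolP; exists y; rewrite zy.
(* [Z] will be a maximal separated set of points whose balls of radius [r] lie in [K]. These balls
   are disjoint, so [Z] is a small part of [K]; the points that are not deep are close to the
   boundary. *)
pose deep x := `[< forall y, gdist x y <= r -> y \in K >].
have [|x y|Z [ZK pZ HZ]] := @maximal_list G (fun x y => gdist x y <= 2 * r) [seq x <- K | deep x].
- by move=> x; rewrite (gdist0 gS x x).2.
- by rewrite gdistC.
pose D := bd K ++ Z.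
have DK : {subset D <= K}.
  by move=> d; rewrite mem_cat => /orP[|/ZK]; rewrite mem_filter => /andP[].
have Dnear x : x \in K -> exists d p, [/\ d \in D, path e x p, last x p = d & size p <= 2 * r].
  move=> xK; have [dx|/asboolPn/existsNP[y /not_implyP[xy yK]]] := boolP (deep x).
    have [|z zZ zx] := HZ x; first by rewrite mem_filter dx.
    have zD : z \in D by rewrite mem_cat zZ orbT.
    have [[p [_ xp lp sp]]|[p [lp xp sp]]] := walk _ x z xK erefl; rewrite gdistC in zx.
      by exists z, p; split=> //; exact: leq_trans sp zx.
    by exists (last x p), p; split=> //; [rewrite mem_cat lp|exact: leq_trans sp zx].
  have [[p [yK' _ _ _]]|[p [lp xp sp]]] := walk _ x y xK erefl; first by rewrite yK' in yK.
  exists (last x p), p; split=> //; first by rewrite mem_cat lp.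
  by apply: leq_trans sp (leq_trans xy _); rewrite leq_pmull.
have [x0 x0K] : exists x, x \in K by case: (K) K0 => // x l _; exists x; rewrite mem_head.
have [d0 [_ [d0D _ _ _]]] := Dnear x0 x0K.
have [||||Y [cY YK DY sY]] := @network K D (2 * r) cK Dnear DK (size D) [:: d0].
- by move=> x y; rewrite !inE => /eqP -> /eqP ->; exact: rtc_refl.
- by move=> x; rewrite inE => /eqP ->; exact: DK.
- by exists d0; rewrite ?mem_head.
- by rewrite size_filter; apply: leq_trans (count_size _ _) (size_undup _).
exists K, (undup Y); split=> //; split.
- exact: undup_uniq.
- by move=> x; rewrite mem_undup; exact: YK.
- by move=> x xb; rewrite mem_undup; apply: DY; rewrite mem_cat xb.
- move=> x y; rewrite !mem_undup => xY yY; apply: rtc_mono (cY x y xY yY) => a b [ab [ha hb]].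
  by split=> //; rewrite !mem_undup.
have ZbK : size Z * bs r <= size K.
  have [|W [uW <- HW]] := @disjoint_balls G gdist (gdistC gS) (gdistT gS) bs (gball fS gS) Z r.
    by apply: sub_pairwise pZ => x y; rewrite ltnNge.
  apply: uniq_leq_size => // y /HW[z /ZK]; rewrite mem_filter => /andP[/asboolP dz _]; exact: dz.
have D0 : 0 < size D by case: (D) d0D.
have sYD : size (undup Y) <= C * size D.
  by apply: leq_trans (size_undup _) (leq_trans sY _); rewrite /C /=; nia.
have h1 : 2 * q * C * size Z <= size K.
  by apply: leq_trans ZbK; rewrite mulnC leq_mul2l Cb orbT.
have h2 : 2 * (q * size (undup Y)) <= 2 * q * C * size D.
  by rewrite mulnA -[_ * C * _]mulnA leq_mul2l sYD orbT.
have h3 : 2 * q * C * size D <= 2 * size K by rewrite size_cat mulnDr [2 * size K]mul2n -addnn leq_add.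
by have := leq_trans h2 h3; rewrite leq_pmul2l.
Qed.

End Walls.

(** * Overlapping tiles with connected walls *)

Lemma rtc_cross (X : Type) (E : X -> X -> Prop) (C : X -> Prop) x y : rtc E x y -> ~ C x -> C y ->
  exists u v, [/\ E u v, ~ C u, C v & rtc E x u].
Proof.
move=> /clos_rt_rtn1_iff; elim=> [//|u v Euv xu IH nx Cv].
have [Cu|nu] := pselect (C u); first exact: IH.
by exists u, v; split=> //; apply/clos_rt_rtn1_iff.
Qed.

(** Equal sets share the start of an exit edge, and equal sizes exclude proper inclusion. Otherwise
    suppose the walls disjoint. A path in [A] enters [B] through [YB], and [YB], being connected and
    disjoint from [YA], cannot leave [A]; likewise [YA] stays in [B]. An edge leaving the union of
    [A] and [B] then starts on both walls. *)
Lemma walls_meet (X : choiceType) (E : X -> X -> Prop) (A B YA YB : seq X) x :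
  (forall u v, E u v -> E v u) -> uniq A -> uniq B -> size A = size B ->
  (forall u v, u \in A -> v \in A -> rtc (within E (fun a => a \in A)) u v) ->
  (forall u v, u \in B -> v \in B -> rtc (within E (fun a => a \in B)) u v) ->
  (forall u v, u \in YA -> v \in YA -> rtc (within E (fun a => a \in YA)) u v) ->
  (forall u v, u \in YB -> v \in YB -> rtc (within E (fun a => a \in YB)) u v) ->
  {subset YA <= A} -> {subset YB <= B} ->
  (forall u v, u \in A -> v \notin A -> E u v -> u \in YA) ->
  (forall u v, u \in B -> v \notin B -> E u v -> u \in YB) ->
  x \in A -> x \in B ->
  (forall F : seq X, x \in F -> exists u v, [/\ u \in F, v \notin F & E u v]) ->
  exists q, q \in YA /\ q \in YB.
Proof.
move=> sE; wlog: A B YA YB / exists2 a, a \in A & a \notin B.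
  move=> W uA uB sAB cA cB cYA cYB YAA YBB bA bB xA xB ex.
  have [AB|] := pselect (exists2 a, a \in A & a \notin B).
    exact: (W A B YA YB AB uA uB sAB cA cB cYA cYB YAA YBB bA bB xA xB ex).
  move=> nAB; have AB : {subset A <= B} by move=> a aA; apply: contraT => aB; case: nAB; exists a.
  have [_ eAB] := uniq_min_size uA AB ltac:(by rewrite sAB).
  have [u [v [uF vF uv]]] := ex A xA; exists u; split; first exact: bA uv.
  by apply: (bB u v) => //; rewrite -eAB.
move=> [a aA aB] uA uB sAB cA cB cYA cYB YAA YBB bA bB xA xB ex.
have [b bB' bA'] : exists2 b, b \in B & b \notin A.
  apply: contrapT => nBA; have BA : {subset B <= A} by move=> b bB'; apply: contraT => bA'; case: nBA; exists b.
  have [_ eAB] := uniq_min_size uB BA ltac:(by rewrite sAB).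
  by move: aB; rewrite eAB aA.
apply: contrapT => dis.
have YBA : {subset YB <= A}.
  have [u [w [[uw [uA' wA]] uB' wB _]]] := rtc_cross (C := fun z => z \in B) (cA _ _ aA xA) ltac:(exact/negP) xB.
  have wYB : w \in YB by apply: (bB w u) => //; [exact/negP|exact: sE].
  move=> y yB; apply: (rtc_closed (C := fun z => z \in A) _ wA (cYB _ _ wYB yB)) => p p' pA [pp' [pY p'Y]].
  by apply: contraT => p'A; case: dis; exists p; split=> //; exact: bA pp'.
have YAB : {subset YA <= B}.
  have [u [w [[uw [uB' wB]] uA' wA _]]] := rtc_cross (C := fun z => z \in A) (cB _ _ bB' xB) ltac:(exact/negP) xA.
  have wYA : w \in YA by apply: (bA w u) => //; [exact/negP|exact: sE].
  move=> y yA; apply: (rtc_closed (C := fun z => z \in B) _ wB (cYA _ _ wYA yA)) => p p' pB [pp' [pY p'Y]].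
  by apply: contraT => p'B; case: dis; exists p; split=> //; exact: bB pp'.
have [u [v [+ + uv]]] := ex (A ++ B) ltac:(by rewrite mem_cat xA).
rewrite !mem_cat negb_or => + /andP[vA vB] => /orP[uA'|uB'].
  have uYA := bA u v uA' vA uv.
  by apply: dis; exists u; split=> //; apply: (bB u v) => //; exact: YAB.
have uYB := bB u v uB' vB uv.
by apply: dis; exists u; split=> //; apply: (bA u v) => //; exact: YBA.
Qed.

(** * Connectedness of the wall when earlier tiles hide later ones *)

Section FirstTile.
Variables (X : Type) (E : X -> X -> Prop) (L : Type) (tau : L -> nat) (Kt Yt : L -> X -> Prop).
Hypothesis sE : forall x y, E x y -> E y x.
Hypotheses (YK : forall l x, Yt l x -> Kt l x) (intK : forall l x y, Kt l x -> ~ Yt l x -> E x y -> Kt l y)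
  (cY : forall l x y, Yt l x -> Yt l y -> rtc (within E (Yt l)) x y)
  (meet : forall l l' x, Kt l x -> Kt l' x -> exists q, Yt l q /\ Yt l' q)
  (same : forall l l' x, tau l = tau l' -> Kt l x -> Kt l' x -> l = l').

Definition first l x := Kt l x /\ forall l', Kt l' x -> tau l <= tau l'.

(** Tiles are laid in the order of [tau], and inside an earlier tile nothing of a later one shows.
    Points in no tile belong to the wall vacuously. *)
Definition wall x := forall l, first l x -> Yt l x.

Lemma first_ex l x : Kt l x -> exists l', first l' x /\ tau l' <= tau l.
Proof.
move=> lx; pose Q n := `[< exists2 l', Kt l' x & tau l' = n >].
have ex : exists n, Q n by exists (tau l); apply/asboolP; exists l.
case: (ex_minnP ex) => n /asboolP[l' l'x l'n] nmin; exists l'; split; last first.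
  by rewrite l'n; apply: nmin; apply/asboolP; exists l.
by split=> // l'' l''x; rewrite l'n; apply: nmin; apply/asboolP; exists l''.
Qed.

Lemma first_uniq l l' x : first l x -> first l' x -> l = l'.
Proof.
move=> [lx lm] [l'x l'm]; apply: (same _ lx l'x).
by apply/eqP; rewrite eqn_leq lm// l'm.
Qed.

Let gone l x := first l x /\ ~ Yt l x.

Lemma not_wall x : ~ wall x -> exists l, gone l x.
Proof. by move=> /existsNP[l /not_implyP[? ?]]; exists l. Qed.

(** The inside of a tile contains its neighbours, so both tiles contain both points and each comes
    first; being laid at the same time and sharing a point, they coincide. *)
Lemma gone_adj l l' x y : gone l x -> gone l' y -> E x y -> l = l'.
Proof.
move=> [[lx lm] nx] [[l'y l'm] ny] xy.
have ly := intK lx nx xy; have l'x := intK l'y ny (sE xy).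
by apply: (same _ ly l'y); apply/eqP; rewrite eqn_leq lm// l'm.
Qed.

Let joined l := forall x y, wall x -> wall y -> Kt l x -> Kt l y -> rtc (within E wall) x y.

Lemma walk (A : X -> Prop) x y : (forall l z, A z -> gone l z -> joined l) -> A x ->
  wall x -> rtc (within E A) x y ->
  (wall y /\ rtc (within E wall) x y) \/
  exists l p, [/\ gone l y, wall p, Kt l p & rtc (within E wall) x p].
Proof.
move=> HA Ax wx /clos_rt_rtn1_iff; elim=> [|u v [uv [Au Av]] _ IH].
  by left; split=> //; exact: rtc_refl.
have [wv|/not_wall[l gv]] := pselect (wall v).
  left; split=> //; case: IH => [[wu xu]|[l [p [gu wp lp xp]]]].
    by apply: rtc_trans xu (rtc_step _).
  apply: rtc_trans xp _; apply: (HA l u) => //; case: gu => -[lu _] nu; exact: intK nu uv.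
right; case: IH => [[wu xu]|[l' [p [gu wp lp xp]]]].
  exists l, u; split=> //; case: gv => -[lv _] nv; exact: intK nv (sE uv).
by exists l, p; split=> //; rewrite (gone_adj gv gu (sE uv)).
Qed.

(** Induction on the order of laying. [Yt l] is hidden in places, but only by earlier tiles, and
    these are bridged by the induction hypothesis; what remains is to reach [Yt l] from the other
    wall points of the tile. *)
Lemma tile_joined l : joined l.
Proof.
move: {2}(tau l) (leqnn (tau l)) => n; elim: n l => [|n IH] l ln x y.
  move: x y; suff H : joined l by exact: H.
  have fl z : Kt l z -> first l z by move=> lz; split=> // l' _; move: ln; rewrite leqn0 => /eqP ->.
  move=> x y wx wy lx ly; apply: rtc_mono (cY (wx _ (fl _ lx)) (wy _ (fl _ ly))) => u v [uv [Yu Yv]].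
  have w z : Yt l z -> wall z.
    by move=> Yz l' fl'; rewrite -(first_uniq (fl z (YK Yz)) fl').
  by split=> //; split; exact: w.
have IHl l' z : gone l' z -> tau l' < tau l -> joined l' by move=> _ h; apply: IH; rewrite -ltnS; exact: leq_trans ln.
have lt l' z : Yt l z -> gone l' z -> tau l' < tau l.
  move=> Yz [[l'z l'm] nz]; rewrite ltn_neqAle l'm ?andbT; last exact: YK.
  by apply/eqP => e; apply: nz; rewrite (same e l'z (YK Yz)).
have HA l' z : Yt l z -> gone l' z -> joined l' by move=> Yz g; apply: IHl (g) (lt _ _ Yz g).
(* If all of [Yt l] were hidden, a single tile [l1] would hide it because it is connected; but it
   meets the wall of [l1]. *)
have ne z : Kt l z -> exists2 v, wall v & Yt l v.
  move=> lz; have [q [Yq _]] := meet lz lz; apply: contrapT => none.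
  have [l1 g1] : exists l1, gone l1 q by apply: not_wall => wq; apply: none; exists q.
  have all p : rtc (within E (Yt l)) q p -> gone l1 p.
    move=> /clos_rt_rtn1_iff; elim=> [//|u v [uv [Yu Yv]] _ gu].
    have [l2 g2] : exists l2, gone l2 v by apply: not_wall => wv; apply: none; exists v.
    by rewrite (gone_adj gu g2 uv).
  have [p [Yp Y1p]] := meet (YK Yq) g1.1.1.
  by have [_] := all p (cY Yq Yp).
have toY u : wall u -> Kt l u -> exists v, [/\ wall v, Yt l v & rtc (within E wall) u v].
  move=> wu lu; have [Yu|nYu] := pselect (Yt l u); first by exists u; split=> //; exact: rtc_refl.
  have [l' [fu l'l]] := first_ex lu; have Yu := wu _ fu.
  have ll' : tau l' < tau l.
    rewrite ltn_neqAle l'l andbT; apply/eqP => e; apply: nYu.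
    by rewrite -(same e fu.1 lu).
  have [q [Yq Y'q]] := meet lu fu.1.
  have [wq|/not_wall[l'' gq]] := pselect (wall q).
    exists q; split=> //; apply: (IH l') => //; [by rewrite -ltnS; exact: leq_trans ln|exact: fu.1|exact: YK].
  (* The common point [q] of the two walls is itself hidden. Walking towards it along [Yt l] and
     along [Yt l'] ends at the same hiding tile, whose wall points are joined by induction. *)
  have [v wv Yv] := ne u lu; exists v; split=> //.
  have lt' l3 z : Yt l' z -> gone l3 z -> tau l3 < tau l'.
    move=> Yz [[l3z l3m] nz]; rewrite ltn_neqAle l3m ?andbT; last exact: YK.
    by apply/eqP => e; apply: nz; rewrite (same e l3z (YK Yz)).
  have HA' l3 z : Yt l' z -> gone l3 z -> joined l3.
    by move=> Yz g; apply: IHl (g) (ltn_trans (lt' _ _ Yz g) ll').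
  have [[wq _]|[l3 [p [g3 wp lp vp]]]] := walk HA Yv wv (cY Yv Yq).
    by case: gq => fq nq; case: nq; exact: wq.
  have [[wq _]|[l4 [p' [g4 wp' lp' up']]]] := walk HA' Yu wu (cY Yu Y'q).
    by case: gq => fq nq; case: nq; exact: wq.
  have e34 : l3 = l4 by exact: first_uniq g3.1 g4.1.
  subst l4; apply: rtc_trans up' (rtc_trans (HA l3 q Yq g3 _ _ wp' wp lp' lp) _).
  by apply: rtc_sym vp => a b; exact: within_sym.
move=> wx wy lx ly.
have [v [wv Yv xv]] := toY x wx lx; have [v' [wv' Yv' yv']] := toY y wy ly.
apply: rtc_trans xv _; apply: (rtc_trans (y := v')); last by apply: rtc_sym yv' => a b; exact: within_sym.
have [[_ //]|[l' [p [g _ _ _]]]] := walk HA Yv wv (cY Yv Yv').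
by case: g => f nf; case: nf; exact: wv'.
Qed.

Theorem wall_connected x y : wall x -> wall y -> rtc E x y -> rtc (within E wall) x y.
Proof.
move=> wx wy xy; have xy' : rtc (within E (fun=> True)) x y by apply: rtc_mono xy.
have [[_ //]|[l [p [[fl nl] _ _ _]]]] := walk (fun l z _ _ => tile_joined (l := l)) I wx xy'.
by case: nl; exact: wy.
Qed.

Lemma gone_component x : ~ wall x -> exists l, forall y, rtc (within E (fun z => ~ wall z)) x y -> Kt l y.
Proof.
move=> /not_wall[l gl]; exists l => y xy; suff : gone l y by case=> -[].
move: xy => /clos_rt_rtn1_iff; elim=> // u v [uv [_ /not_wall[l' gv]]] _ gu.
by rewrite (gone_adj gu gv uv).
Qed.

End FirstTile.

(** * Small connected Borel sets with finite complementary pieces *)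

(** A finite Borel measure with real values, countable additivity being expressed by continuity at
    the empty set. Finite sums of pullbacks of a probability measure are of this kind. *)
Definition content (R : realType) (X : topologicalType) (nu : (X -> Prop) -> R) :=
  [/\ forall B, BX B -> (0 <= nu B)%R,
      forall B C, BX B -> BX C -> (forall x, B x -> C x -> False) -> nu (fun x => B x \/ C x) = (nu B + nu C)%R
    & forall B : nat -> X -> Prop, (forall n, BX (B n)) -> (forall n x, B n.+1 x -> B n x) ->
        (forall x, exists n, ~ B n x) -> forall eps : R, (0 < eps)%R -> exists n, (nu (B n) < eps)%R].

Section Content.
Variables (R : realType) (X : ptopologicalType) (nu : (X -> Prop) -> R).
Hypothesis Hnu : content nu.

Lemma content_sub B C : BX B -> BX C -> (forall x, B x -> C x) ->
  nu C = (nu B + nu (fun x => C x /\ ~ B x))%R.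
Proof.
move=> BB BC BsC; have [_ add _] := Hnu; rewrite -add//; last by move=> x Bx [].
  congr nu; apply: funext => x; apply: propext; split=> [Cx|[/BsC//|[]//]].
  by have [?|?] := pselect (B x); [left|right].
by apply: BorA => //; exact: BorN.
Qed.

Lemma content_le B C : BX B -> BX C -> (forall x, B x -> C x) -> (nu B <= nu C)%R.
Proof.
move=> BB BC BsC; rewrite (content_sub BB BC BsC) lerDl; have [pos _ _] := Hnu; apply: pos.
by apply: BorA => //; exact: BorN.
Qed.

Lemma content_or B C : BX B -> BX C -> (nu (fun x => B x \/ C x) <= nu B + nu C)%R.
Proof.
move=> BB BC; have BD : BX (fun x => C x /\ ~ B x) by apply: BorA => //; exact: BorN.
have [_ add _] := Hnu.
have -> : (fun x => B x \/ C x) = (fun x => B x \/ (C x /\ ~ B x)).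
  apply: funext => x; apply: propext; split=> [[?|Cx]|[?|[]]]; [by left| |by left|by right].
  by have [?|?] := pselect (B x); [left|right].
rewrite add//; last by move=> x Bx [].
by rewrite lerD2l; apply: content_le => // x [].
Qed.

Lemma content0 : nu (fun=> False) = 0%R.
Proof.
have [_ add _] := Hnu; apply: (@addrI _ (nu (fun=> False))); rewrite addr0 -add//; try exact: Bor_cst.
by congr nu; apply: funext => x; apply: propext; split=> [[]|].
Qed.

Lemma content_sum (I : eqType) (s : seq I) (P : I -> X -> Prop) : (forall i, BX (P i)) -> uniq s ->
  (forall i j x, i \in s -> j \in s -> P i x -> P j x -> i = j) ->
  nu (fun x => exists i, i \in s /\ P i x) = (\sum_(i <- s) nu (P i))%R.
Proof.
move=> BP; have [_ add _] := Hnu; elim: s => [|i s IH] /=.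
  by move=> _ _; rewrite big_nil -content0; congr nu; apply: funext => x; apply: propext; split=> // -[i []].
move=> /andP[is_ us] dP; rewrite big_cons -IH//; last first.
  by move=> j k x js ks; apply: dP; rewrite inE ?js ?ks orbT.
have Bs (s' : seq I) : BX (fun x => exists j, j \in s' /\ P j x).
  elim: s' => [|j s' IHs].
    by apply: (@Bor_ext _ _ (fun=> False)); [move=> x; split=> // -[j []]|exact: Bor_cst].
  apply: (@Bor_ext _ _ (fun x => P j x \/ exists k, k \in s' /\ P k x)); last exact: BorO.
  move=> x; split=> [[h|[k [ks h]]]|[k []]]; [by exists j; rewrite mem_head|by exists k; rewrite inE ks orbT|].
  by rewrite inE => /predU1P[->|ks] h; [left|right; exists k].
rewrite -add//; last first.
  move=> x Pi [j [js Pj]]; move: is_; rewrite (dP i j x)// ?js// ?inE ?eqxx ?js ?orbT//.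
congr nu; apply: funext => x; apply: propext; split.
  by move=> [j []]; rewrite inE => /predU1P[->|js] h; [left|right; exists j].
by case=> [h|[j [js h]]]; [exists i; rewrite mem_head|exists j; rewrite inE js orbT].
Qed.

End Content.

(** * Walls of small measure *)

Section SmallWall.
Variables (R : realType) (X : ptopologicalType) (c : X -> nat -> nat).
Hypothesis Hc : std c.
Variables (G : groupType) (S : set G) (a : G -> X -> X).
Hypotheses (fS : finite_set S) (gS : generates S) (amen : amenable R G) (sup : superlinear_growth S).
Hypotheses (act : is_action a) (free : free_action a) (bor : borel_action a).
Notation near := (near a gS).
Notation len := (len gS).
Notation gdist := (gdist gS).
Notation adj := (adj gdist).
Let E x y := schreier_graph a S (x, y).

Lemma adj_act g h z : adj g h -> E (a g z) (a h z).
Proof.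
move=> gh; apply/(schreier_near gS act); split.
  by move=> /(act_inj act free) e; move: gh; rewrite /adj e (gdist0 gS h h).2.
by exists (h * g^-1)%g; split; [rewrite -/(gdist g h) gh|case: act => _ aM; rewrite aM (actV act)].
Qed.

Lemma rtc_act F g h z : rtc (within adj (fun k => k \in F)) g h ->
  rtc (within E (fun x => x \in [seq a k z | k <- F])) (a g z) (a h z).
Proof.
elim=> [u v [uv [uF vF]]|u|u v w _ h1 _ h2]; [|exact: rtc_refl|exact: rtc_trans h2].
by apply: rtc_step; split; [exact: adj_act|split; exact: (map_f (fun k => a k z))].
Qed.

Lemma rtc_orbit g z : rtc E z (a g z).
Proof.
have := geodesic (gdist0 gS) (gdistT gS) (@gdistS _ _ gS) 1%g g.
move=> h; rewrite -{1}[z](act.1 z); elim: h => [u v [uv _]|u|u v w _ h1 _ h2]; [|exact: rtc_refl|exact: rtc_trans h2].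
by apply: rtc_step; exact: adj_act.
Qed.

Lemma orbit_exit x (F : seq X) : x \in F -> exists u v, [/\ u \in F, v \notin F & E u v].
Proof.
move=> xF; have [g gF] : exists g, a g x \notin F.
  apply: contrapT => H; have [n0 Hn0] := bsize_superlinear fS gS sup (size F).
  have [l [ul sl _]] := gball fS gS 1%g n0.+1.
  have := Hn0 n0.+1 (leqnSn _); rewrite -sl ltnNge => /negP; apply.
  rewrite -(size_map (a^~ x)); apply: leq_trans (_ : size F <= _); last by rewrite leq_pmulr.
  apply: uniq_leq_size; first by rewrite map_inj_uniq// => u v; exact: act_inj.
  by move=> _ /mapP[k _ ->]; apply: contraT => kF; case: H; exists k.
have nx : ~ x \notin F by rewrite xF.
have [u [v [uv nuF vF _]]] := rtc_cross (C := fun y => y \notin F) (rtc_orbit g x) nx gF.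
by exists u, v; split=> //; apply: contraT => h; case: nuF.
Qed.

(** [schemes] with [h = 0]: being close to a net then means belonging to it, so finitely many
    separated sets cover the space; taking the least index makes them disjoint. *)
Lemma finite_coloring M : exists N (V : nat -> X -> Prop), [/\ forall j, BX (V j),
  forall j z z', V j z -> V j z' -> near M z z' -> z = z', forall x, exists j, j < N /\ V j x
  & forall i j x, V i x -> V j x -> i = j].
Proof.
have [Z [BZ sZ cZ]] := schemes Hc fS gS act free bor M 0.
exists (bsize fS gS (M + 0)).+1, (fun j x => Z j x /\ forall i, i < j -> ~ Z i x); split.
- by move=> j; apply: BorA => //; apply: BorAll => i; apply: BorIc => _; exact: BorN.
- by move=> j z z' [Zz _] [Zz' _] zz'; exact: (sZ j z z' Zz Zz' zz').
- move=> x; have small : bsize fS gS (M + 0) < (bsize fS gS (M + 0)).+1 * bsize fS gS 0.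
    by rewrite mulSn; have := bsize_gt0 fS gS 0; nia.
  have [j0 [j0N [z [Zz xz]]]] := cZ 0 _ (leqnn _) small x.
  have xz' := near0 act xz; subst z.
  have ex : exists j, `[< Z j x >] by exists j0; exact/asboolP.
  case: (ex_minnP ex) => j /asboolP Zj jmin; exists j; split; first by apply: leq_ltn_trans j0N; apply: jmin; exact/asboolP.
  split=> // i ij Zi; have : j <= i by apply: jmin; exact/asboolP.
  by rewrite leqNgt ij.
- by move=> i j x [Zi ni] [Zj nj]; case: (ltngtP i j) => // h; [case: (nj _ h)|case: (ni _ h)].
Qed.

Variable nu : (X -> Prop) -> R.
Hypothesis Hnu : content nu.

Let T (V : nat -> X -> Prop) (F : seq G) w x := exists k, k \in F /\ V w (a k^-1%g x).

Lemma BX_T V F w : (forall j, BX (V j)) -> BX (T V F w).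
Proof.
move=> BV; rewrite /T; elim: F => [|k F IH].
  by apply: (@Bor_ext _ _ (fun=> False)); [move=> x; split=> // -[j []]|exact: Bor_cst].
apply: (@Bor_ext _ _ (fun x => V w (a k^-1%g x) \/ exists k, k \in F /\ V w (a k^-1%g x))).
  move=> x; split=> [[h|[k' [ks h]]]|[k' []]]; [by exists k; rewrite mem_head|by exists k'; rewrite inE ks orbT|].
  by rewrite inE => /predU1P[->|ks] h; [left|right; exists k'].
by apply: BorO => //; exact: (mX_act bor _ (BV w)).
Qed.

(** For each [k] in [F] the translates of the colours by [k] partition the space, and for each
    colour its translates by different [k] are disjoint. Summing over the colours thus replaces
    invariance, which [nu] may lack. *)
Lemma average V N F M (U : X -> Prop) : (forall j, BX (V j)) ->
  (forall j z z', V j z -> V j z' -> near M z z' -> z = z') -> (forall x, exists j, j < N /\ V j x) ->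
  (forall i j x, V i x -> V j x -> i = j) -> BX U -> uniq F ->
  (forall k k', k \in F -> k' \in F -> len (k'^-1 * k)%g <= M) ->
  (\sum_(w <- iota 0 N) nu (fun x => U x /\ T V F w x) = (size F)%:R * nu U)%R.
Proof.
move=> BV sV cV uV BU uF HM.
have BUk w k : BX (fun x => U x /\ V w (a k^-1%g x)) by apply: BorA => //; exact: (mX_act bor _ (BV w)).
have e1 w : nu (fun x => U x /\ T V F w x) = (\sum_(k <- F) nu (fun x => U x /\ V w (a k^-1%g x)))%R.
  rewrite -(content_sum Hnu)//.
    by congr nu; apply: funext => x; apply: propext; split=> [[Ux [k [kF h]]]|[k [kF [Ux h]]]]; [exists k|split=> //; exists k].
  move=> k k' x kF k'F [_ Vk] [_ Vk'].
  have : a k^-1%g x = a k'^-1%g x.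
    apply: (sV w) => //; exists (k'^-1 * k)%g; split; first exact: HM.
    by case: act => a1 aM; rewrite -aM -mulgA mulgV mulg1.
  by move=> /(act_inj act free)/invg_inj.
under eq_bigr do rewrite e1.
rewrite exchange_big /= (eq_bigr (fun=> nu U)); first by rewrite big_const_seq count_predT iter_addr_0 mulr_natl.
move=> k _; rewrite -(content_sum Hnu) ?iota_uniq//; last by move=> i j x _ _ [_ Vi] [_ Vj]; exact: uV Vi Vj.
congr nu; apply: funext => x; apply: propext; split=> [[j [_ []//]]|Ux].
by have [j [jN Vj]] := cV (a k^-1%g x); exists j; rewrite mem_iota.
Qed.

Theorem small_wall (eps : R) : (0 < eps)%R -> exists Y : X -> Prop, [/\ BX Y, (nu Y < eps)%R,
  forall x, finite_set (rtc (within E (fun z => ~ Y z)) x)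
  & forall x y, Y x -> Y y -> rtc E x y -> rtc (within E Y) x y].
Proof.
move=> eps0; pose tot := nu (fun=> True).
have BT : BX (fun _ : X => True) by exact: Bor_cst.
have [pos add _] := Hnu; have tot0 : (0 <= tot)%R by exact: pos.
(* The walls of all tiles together will cost at most [tot / q], which is below [eps / 2]. *)
have [q q0 qeps] : exists2 q : nat, 0 < q & (2 * tot < q%:R * eps)%R.
  pose x := (2 * tot / eps)%R.
  have x0 : (0 <= x)%R by rewrite divr_ge0// ?mulr_ge0// ltW.
  exists (Num.Def.archi_bound x); last by rewrite -ltr_pdivrMr//; exact: archi_boundP.
  by rewrite -(ltr_nat R); apply: le_lt_trans x0 (archi_boundP x0).
have [K [Y0 [uK K0 cK [uY YK bY cY sY]]]] := walls fS gS amen sup (q := 2 * q) ltac:(by rewrite muln_gt0).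
pose M := \max_(p <- [seq (k, k') | k <- K, k' <- K]) len (p.2^-1 * p.1)%g.
have HM k k' : k \in K -> k' \in K -> len (k'^-1 * k)%g <= M.
  move=> kK k'K; apply: (@leq_bigmax_seq _ _ xpredT (fun p : G * G => len (p.2^-1 * p.1)%g) (k, k')) => //.
  by apply/allpairsP; exists (k, k').
have [N [V [BV sV cV uV]]] := finite_coloring M.
have N0 : 0 < N by have [j [jN _]] := cV point; exact: leq_ltn_trans jN.
(* Summed over the colours this is [average] with [2 * q * size Y0 <= size K]. Some colour therefore
   covers a part of [U] of measure at least [nu U / (2 * N)] and pays for its wall at most [1/q] of
   what it covers. *)
have step U : BX U -> exists w, (nu U / (2 * N%:R) + q%:R * nu (fun x => U x /\ T V Y0 w x) <= nu (fun x => U x /\ T V K w x))%R.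
  move=> BU; apply: contrapT => H.
  have aK := average BV sV cV uV BU uK HM.
  have aY := average BV sV cV uV BU uY (fun k k' kY k'Y => HM k k' (YK _ kY) (YK _ k'Y)).
  have : (\sum_(w <- iota 0 N) nu (fun x => U x /\ T V K w x) <
     \sum_(w <- iota 0 N) (nu U / (2 * N%:R) + q%:R * nu (fun x => U x /\ T V Y0 w x)))%R.
    case: N N0 {cV aK aY} H => // N _ H /=; rewrite !big_cons; apply: ltr_leD.
      by rewrite ltNge; apply/negP => h; apply: H; exists 0.
    by apply: ler_sum => w _; rewrite leNgt; apply/negP => h; apply: H; exists w; exact: ltW.
  rewrite big_split /= aK [X in (_ < _ + X)%R](_ : _ = (q%:R * ((size Y0)%:R * nu U))%R); last by rewrite -mulr_sumr aY.
  rewrite big_const_seq count_predT size_iota iter_addr_0 ltNge => /negP; apply.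
  have -> : ((nu U / (2 * N%:R)) *+ N = nu U / 2)%R.
    by rewrite -mulr_natr invfM mulrA -[LHS]mulrA mulVf ?mulr1// pnatr_eq0 -lt0n.
  have U0 := pos _ BU; have k1 : (1 <= (size K)%:R :> R)%R by rewrite ler1n; case: (K) K0.
  have k2 : (2 * q%:R * (size Y0)%:R <= (size K)%:R :> R)%R by rewrite -!natrM ler_nat.
  have h1 : (nu U <= (size K)%:R * nu U)%R by rewrite ler_peMl.
  have h2 : (2 * q%:R * (size Y0)%:R * nu U <= (size K)%:R * nu U)%R by rewrite ler_wpM2r.
  by lra.
have /choice[cf Hcf] : forall U, exists w, BX U -> (nu U / (2 * N%:R) + q%:R * nu (fun x => U x /\ T V Y0 w x) <= nu (fun x => U x /\ T V K w x))%R.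
  by move=> U; have [BU|n] := pselect (BX U); [have [w] := step U BU; exists w|exists 0].
pose U := fix U i : X -> Prop := if i is j.+1 then fun x => U j x /\ ~ T V K (cf (U j)) x else fun=> True.
pose w i := cf (U i).
have BU i : BX (U i) by elim: i => [//|i IH]; apply: BorA => //; apply: BorN; exact: BX_T.
have BUT i F : BX (fun x => U i x /\ T V F (w i) x) by apply: BorA => //; exact: BX_T.
pose Wl := fix Wl i : X -> Prop := if i is j.+1 then fun x => Wl j x \/ (U j x /\ T V Y0 (w j) x) else fun=> False.
have BW i : BX (Wl i) by elim: i => [|i IH]; [exact: Bor_cst|apply: BorO].
have US i : (nu (U i) = nu (U i.+1) + nu (fun x => U i x /\ T V K (w i) x))%R.
  rewrite (content_sub Hnu (BUT i K) (BU i)); last by move=> x [].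
  rewrite addrC; congr (nu _ + _)%R; apply: funext => x; apply: propext.
  by split=> -[Ux n]; split=> // h; apply: n; [split|case: h].
have Winv i : (q%:R * nu (Wl i) <= tot - nu (U i))%R.
  elim: i => [|i IH]; first by rewrite /= (content0 Hnu) mulr0 subrr.
  have h1 := content_or Hnu (BW i) (BUT i Y0); have h2 := Hcf _ (BU i); have h3 := US i.
  have h4 : (0 <= nu (U i) / (2 * N%:R))%R by rewrite divr_ge0// ?mulr_ge0//; exact: pos.
  have h5 : (q%:R * nu (Wl i.+1) <= q%:R * nu (Wl i) + q%:R * nu (fun x => U i x /\ T V Y0 (w i) x))%R.
    by rewrite -mulrDr ler_wpM2l.
  by rewrite -/(w i) in h2; lra.
have [n Un] : exists n, (nu (U n) < eps / 2)%R.
  apply: contrapT => H.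
  have big n : (eps / 2 <= nu (U n))%R by rewrite leNgt; apply/negP => h; apply: H; exists n.
  pose dl : R := (eps / 2 / (2 * N%:R))%R.
  have dl0 : (0 < dl)%R by rewrite !divr_gt0// ?mulr_gt0// ltr0n.
  have dec n : (nu (U n) <= tot - n%:R * dl)%R.
    elim: n => [|n IH]; first by rewrite mul0r subr0.
    have h2 := Hcf _ (BU n); have h3 := US n.
    have h4 : (dl <= nu (U n) / (2 * N%:R))%R by rewrite ler_pM2r ?invr_gt0 ?mulr_gt0 ?ltr0n.
    have h5 : (0 <= q%:R * nu (fun x => U n x /\ T V Y0 (w n) x))%R by rewrite mulr_ge0//; exact: pos.
    by rewrite -/(w n) in h2; rewrite -natr1 mulrDl mul1r; lra.
  have t0 : (0 <= tot / dl)%R by rewrite divr_ge0// ltW.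
  have := archi_boundP t0; rewrite ltr_pdivrMr// => h.
  by have := dec (Num.Def.archi_bound (tot / dl)%R); have := pos _ (BU (Num.Def.archi_bound (tot / dl)%R)); lra.
pose L := {p : nat * X | p.1 < n /\ V (w p.1) p.2}.
pose tau (l : L) := (sval l).1.
pose Kt (l : L) x := x \in [seq a k (sval l).2 | k <- K].
pose Yt (l : L) x := x \in [seq a k (sval l).2 | k <- Y0].
have sE x y : E x y -> E y x.
  by move=> /(schreier_near gS act)[xy h]; apply/(schreier_near gS act); split; [exact: nesym|exact: near_sym].
have YtK l x : Yt l x -> Kt l x by move=> /mapP[k /YK kK ->]; exact: (map_f (fun k => a k (sval l).2)).
have bdry z u v : u \in [seq a k z | k <- K] -> v \notin [seq a k z | k <- K] -> E u v -> u \in [seq a k z | k <- Y0].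
  move=> /mapP[k kK ->] nv /(schreier_near gS act)[_ [g [g1 gv]]].
  apply: (map_f (fun k => a k z)); apply: bY; rewrite /bd mem_filter kK andbT; apply/asboolP; exists (g * k)%g.
  split; first by rewrite /gdist mulgK.
  apply: contra nv => gk; rewrite -gv; have -> : a g (a k z) = a (g * k)%g z by case: act => _ ->.
  exact: (map_f (fun k => a k z)).
have intK l x y : Kt l x -> ~ Yt l x -> E x y -> Kt l y.
  by move=> lx nx xy; apply: contraT => ny; case: nx; exact: bdry lx ny xy.
have cYt l x y : Yt l x -> Yt l y -> rtc (within E (Yt l)) x y.
  by move=> /mapP[k kY ->] /mapP[k' k'Y ->]; apply: rtc_act; exact: cY.
have injz z : {in K &, injective (fun k => a k z)} by move=> k k' _ _; exact: act_inj.
have meet l l' x : Kt l x -> Kt l' x -> exists q, Yt l q /\ Yt l' q.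
  move=> lx l'x; apply: (walls_meet sE _ _ _ _ _ _ _ _ _ (bdry _) (bdry _) lx l'x).
  - by rewrite map_inj_in_uniq.
  - by rewrite map_inj_in_uniq.
  - by rewrite !size_map.
  - by move=> _ _ /mapP[k kK ->] /mapP[k' k'K ->]; apply: rtc_act; exact: cK.
  - by move=> _ _ /mapP[k kK ->] /mapP[k' k'K ->]; apply: rtc_act; exact: cK.
  - exact: cYt.
  - exact: cYt.
  - exact: YtK.
  - exact: YtK.
  - by move=> F; exact: orbit_exit.
have same l l' x : tau l = tau l' -> Kt l x -> Kt l' x -> l = l'.
  move: l l' => [[i z] /= [ln Vz]] [[j z'] /= [l'n Vz']]; rewrite /tau /Kt /= => ij; subst j.
  move=> /mapP[k kK xk] /mapP[k' k'K xk'].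
  have zz' : z = z'.
    apply: (sV (w i)) => //; exists (k'^-1 * k)%g; split; first exact: HM.
    by case: act => _ aM; rewrite aM -xk xk' actV.
  by subst z'; congr (exist _ _ _); exact: Prop_irrelevance.
have UP i x : U i x <-> forall j, j < i -> ~ T V K (w j) x.
  elim: i => [|i IH] /=; first by split.
  rewrite IH; split=> [[h1 h2] j|h]; last by split=> [j ji|]; apply: h; [exact: leqW|].
  by rewrite ltnS leq_eqVlt => /predU1P[->//|]; exact: h1.
have WP i x : Wl i x <-> exists j, j < i /\ (U j x /\ T V Y0 (w j) x).
  elim: i => [|i IH] /=; first by split=> // -[j []].
  rewrite IH; split=> [[[j [ji h]]|h]|[j []]]; [by exists j; split=> //; exact: leqW|by exists i|].
  by rewrite ltnS leq_eqVlt => /predU1P[->|ji] h; [right|left; exists j].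
have wallE x : wall tau Kt Yt x <-> U n x \/ Wl n x.
  have tileT (F : seq G) i : T V F (w i) x <-> exists z, V (w i) z /\ x \in [seq a k z | k <- F].
    split=> [[k [kF Vk]]|[z [Vz /mapP[k kF xk]]]].
      exists (a k^-1%g x); split=> //; apply/mapP; exists k => //.
      by have := actV act k^-1%g x; rewrite invgK.
    by exists k; split=> //; rewrite xk actV.
  split=> [wx|[Ux|/WP[i [iN [Ux /tileT[z [Vz zx]]]]]] l [lx lm]].
  - have [?|nU] := pselect (U n x); first by left.
    right; have ex : exists i, `[< i < n /\ T V K (w i) x >].
      apply: contrapT => H; apply: nU; apply/UP => j jn Tj; apply: H; exists j; exact/asboolP.
    case: (ex_minnP ex) => i /asboolP[iN Ti] imin.
    apply/WP; exists i; split=> //; split.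
      apply/UP => j ji Tj; have : i <= j by apply: imin; apply/asboolP; split=> //; exact: ltn_trans ji iN.
      by rewrite leqNgt ji.
    have [z [Vz zx]] := (tileT K i).1 Ti; apply/tileT; exists z; split=> //.
    have : Yt (exist _ (i, z) (conj iN Vz)) x.
      apply: wx; split=> // -[[j z'] /= [jn Vz']] jx; apply: imin; apply/asboolP; split=> //.
      by apply/tileT; exists z'.
    by [].
  - case: l lx lm => [[i z] /= [iN Vz]] lx _; have /UP/(_ i iN) := Ux; case.
    by apply/tileT; exists z.
  - pose l0 : L := exist _ (i, z) (conj iN Vz).
    have l0x : Kt l0 x by apply: YtK.
    have e : tau l = tau l0.
      apply/eqP; rewrite eqn_leq lm//=; rewrite leqNgt; apply/negP => lt.
      case: l lx lm lt => [[j z'] /= [jn Vz']] lx _ lt; have /UP/(_ j lt) := Ux; case.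
      by apply/tileT; exists z'.
    by rewrite (same _ _ _ e lx l0x).
have wE : (fun x => U n x \/ Wl n x) = wall tau Kt Yt by apply: funext => x; apply: propext; rewrite wallE.
exists (wall tau Kt Yt); split.
- by rewrite -wE; exact: BorO.
- rewrite -wE; apply: le_lt_trans (content_or Hnu (BU n) (BW n)) _.
  have h1 := Winv n; have h2 := pos _ (BU n).
  have q0' : (0 < q%:R :> R)%R by rewrite ltr0n.
  have h3 : (q%:R * nu (Wl n) <= tot)%R by lra.
  have h4 : (nu (Wl n) < eps / 2)%R by rewrite -(ltr_pM2l q0'); lra.
  by lra.
- move=> x; have [wx|nx] := pselect (wall tau Kt Yt x).
    apply: (@sub_finite_set _ _ [set x]) => // y /clos_rt_rt1n_iff H; case: H wx => // u v [_ [nx _]] _ wx.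
    by case: nx.
  have [l Hl] := gone_component sE intK same nx.
  by apply: (@sub_finite_set _ _ [set` [seq a k (sval l).2 | k <- K]]) => // y /Hl.
- by move=> x y wx wy xy; exact: (wall_connected sE YtK intK cYt meet same).
Qed.

End SmallWall.

(** * Amenable groups *)

Section Stages.
Variables (X : ptopologicalType) (c : X -> nat -> nat).
Hypothesis Hc : std c.
Variables (I : countType) (f : I -> X -> X) (E : X -> X -> Prop).
Hypotheses (mf : moves f) (gE : egraph f E).
Hypothesis exit : forall x (F : seq X), x \in F -> exists u v, [/\ u \in F, v \notin F & E u v].

Let sE x y : E x y -> E y x.
Proof. by case: gE => _ h _ _ _; exact: h. Qed.
Let cE : covers f E.
Proof. by case: gE => -[]. Qed.
Let BE : BR E.
Proof. by case: gE => -[]. Qed.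

Definition wall_set (Y : X -> Prop) := [/\ BX Y, forall x, finite_set (rtc (within E (fun z => ~ Y z)) x)
  & forall x y, Y x -> Y y -> rtc E x y -> rtc (within E Y) x y].

(** If the walls did not meet in this component, [Y'] would lie in one finite piece of the
    complement of [Y], and [Y] in one of the complement of [Y']. No edge could leave the union of
    these two pieces, against [exit]. *)
Lemma walls_join Y Y' x y : wall_set Y -> wall_set Y' -> Y x -> Y' y -> rtc E x y ->
  rtc (within E (fun z => Y z \/ Y' z)) x y.
Proof.
move=> [_ fY cY] [_ fY' cY'] Yx Y'y xy.
have [[z [Yz [Y'z xz]]]|none] := pselect (exists z, Y z /\ (Y' z /\ rtc E x z)).
  have zy : rtc E z y by apply: rtc_trans (rtc_sym sE xz) xy.
  apply: (rtc_trans (y := z)).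
    by apply: rtc_mono (cY _ _ Yx Yz xz) => a b [ab [? ?]]; split=> //; split; left.
  by apply: rtc_mono (cY' _ _ Y'z Y'y zy) => a b [ab [? ?]]; split=> //; split; right.
exfalso.
have /finite_seqP[l lE] := fY y; have /finite_seqP[l' l'E] := fY' x.
have lP z : z \in l <-> rtc (within E (fun z => ~ Y z)) y z.
  by have -> : rtc (within E (fun z => ~ Y z)) y z = [set` l] z by rewrite -lE.
have l'P z : z \in l' <-> rtc (within E (fun z => ~ Y' z)) x z.
  by have -> : rtc (within E (fun z => ~ Y' z)) x z = [set` l'] z by rewrite -l'E.
have inY' z : Y' z -> rtc E y z -> z \in l.
  move=> Y'z yz; apply/lP.
  have := cY' _ _ Y'y Y'z yz => /clos_rt_rtn1_iff; elim=> [|u v [uv [Yu Yv]] yu IH]; first exact: rtc_refl.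
  have yu' : rtc E y u by move/clos_rt_rtn1_iff: yu; apply: rtc_mono => a b [].
  apply: rtc_trans IH (rtc_step _); split=> //; split=> h; apply: none.
    by exists u; split=> //; split=> //; exact: rtc_trans yu'.
  by exists v; split=> //; split=> //; apply: rtc_trans (rtc_trans xy yu') (rtc_step _).
have inY z : Y z -> rtc E x z -> z \in l'.
  move=> Yz xz; apply/l'P.
  have := cY _ _ Yx Yz xz => /clos_rt_rtn1_iff; elim=> [|u v [uv [Yu Yv]] xu IH]; first exact: rtc_refl.
  have xu' : rtc E x u by move/clos_rt_rtn1_iff: xu; apply: rtc_mono => a b [].
  apply: rtc_trans IH (rtc_step _); split=> //; split=> h; apply: none.
    by exists u.
  by exists v; split=> //; split=> //; apply: rtc_trans xu' (rtc_step _).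
have [u [v [+ + uv]]] := exit (x := x) (F := l ++ l') ltac:(by rewrite mem_cat (l'P x).2 ?orbT//; exact: rtc_refl).
rewrite !mem_cat negb_or => uF /andP[vl vl'].
have xl z : z \in l -> rtc E x z by move=> /lP h; apply: rtc_trans xy _; apply: rtc_mono h => a b [].
have xl' z : z \in l' -> rtc E x z by move=> /l'P; apply: rtc_mono => a b [].
have xu : rtc E x u by case/orP: uF => [/xl|/xl'].
have xv : rtc E x v by apply: rtc_trans xu (rtc_step _).
have yv : rtc E y v by apply: rtc_trans (rtc_sym sE xy) xv.
have nYv : ~ Y v by move=> h; move: vl'; rewrite inY.
have nY'v : ~ Y' v by move=> h; move: vl; rewrite inY'.
have cl (D : X -> Prop) z t : rtc (within E (fun z => ~ D z)) z t -> ~ D z -> ~ D t.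
  by move=> /clos_rt_rtn1_iff; elim=> // a b [_ [_ nb]].
case/orP: uF => [/lP yu|/l'P xu'].
  have nYy : ~ Y y by move=> h; apply: none; exists y.
  by move/negP: vl; apply; apply/lP; apply: (rtc_trans yu (rtc_step _)); split=> //; split=> //; exact: cl yu nYy.
have nY'x : ~ Y' x by move=> h; apply: none; exists x; split=> //; split=> //; exact: rtc_refl.
by move/negP: vl'; apply; apply/l'P; apply: (rtc_trans xu' (rtc_step _)); split=> //; split=> //; exact: cl xu' nY'x.
Qed.

Variable Y : nat -> X -> Prop.
Hypothesis wY : forall m, wall_set (Y m).

Definition stage_set n x := forall m, n <= m -> ~ Y m x.
Notation A := stage_set.

Lemma BX_stage_set n : BX (A n).
Proof. by apply: BorAll => m; apply: BorIc => _; apply: BorN; case: (wY m). Qed.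

Lemma stage_set_mono n n' x : n <= n' -> A n x -> A n' x.
Proof. by move=> nn Ax m nm; apply: Ax; exact: leq_trans nm. Qed.

Lemma stage_set_finite n x : finite_set (rtc (within E (A n)) x).
Proof.
have [_ fY _] := wY n; apply: sub_finite_set (fY x) => y; apply: rtc_mono => u v [uv [Au Av]].
by split=> //; split; [exact: Au|exact: Av].
Qed.

Lemma stage_set_conn n x y : ~ A n x -> ~ A n y -> rtc E x y -> rtc (within E (fun z => ~ A n z)) x y.
Proof.
have nA z : ~ A n z -> exists m, n <= m /\ Y m z.
  by move=> /existsNP[m /not_implyP[nm /contrapT Yz]]; exists m.
move=> /nA[m [nm Ymx]] /nA[m' [nm' Ym'y]] xy.
apply: rtc_mono (walls_join (wY m) (wY m') Ymx Ym'y xy) => u v [uv [hu hv]].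
have H z : Y m z \/ Y m' z -> ~ A n z by case=> h Az; [exact: (Az m)|exact: (Az m')].
by split=> //; split; exact: H.
Qed.

(* The outer boundary of the component of [x] in [A n] is joined inside [A n']. *)
Definition sat n n' x := forall y w y' w',
  rtc (within E (A n)) x y -> E y w -> ~ A n w -> rtc (within E (A n)) x y' -> E y' w' -> ~ A n w' ->
  A n' w /\ rtc (within E (fun z => A n' z /\ ~ A n z)) w w'.

Lemma BR_rtc_within (D : X -> Prop) : BX D -> BR (rtc (within E D)).
Proof.
move=> BD; apply: (BR_rtc Hc mf); first by move=> x y [/cE].
by apply: (BorA BE); apply: BorA; [exact: (mfst Hc BD)|exact: (msnd Hc BD)].
Qed.

Lemma covers_rtc_within (D : X -> Prop) : covers f (rtc (within E D)).
Proof. by apply: covers_rtc => // x y [/cE]. Qed.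

Lemma BX_sat n n' : BX (sat n n').
Proof.
have [mfi [i0 fi0] fc] := mf.
have BA := BX_stage_set.
have BD : BX (fun z => A n' z /\ ~ A n z) by apply: BorA; [exact: BA|apply: BorN; exact: BA].
apply: (@Bor_ext _ _ (fun x => forall y w y' w',
  rtc (within E (A n)) x (f y x) -> E (f y x) (f w x) -> ~ A n (f w x) ->
  rtc (within E (A n)) x (f y' x) -> E (f y' x) (f w' x) -> ~ A n (f w' x) ->
  A n' (f w x) /\ rtc (within E (fun z => A n' z /\ ~ A n z)) (f w x) (f w' x))).
  move=> x; split=> [H y w y' w' xy yw nw xy' yw' nw'|H y w y' w']; last exact: H.
  have [i iy] := covers_rtc_within xy; have [i' iy'] := covers_rtc_within xy'.
  have [j jw] := cE yw; have [j' jw'] := cE yw'.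
  have [k fk] := fc j i; have [k' fk'] := fc j' i'.
  by have := H i k i' k'; rewrite fk fk' iy iy' jw jw'; apply.
have BRA := BR_rtc_within (BA n); have BRD := BR_rtc_within BD.
do 4 (apply: BorAll => ?); do 3 (apply: BorI; [first [exact: (BR_mX Hc BRA)|exact: (BR_mX Hc BE)|apply: BorN; exact: (mfi _ _ (BA n))]|]).
do 3 (apply: BorI; [first [exact: (BR_mX Hc BRA)|exact: (BR_mX Hc BE)|apply: BorN; exact: (mfi _ _ (BA n))]|]).
by apply: BorA; [exact: (mfi _ _ (BA n'))|exact: (BR_mX Hc BRD)].
Qed.

(** A finite component has a finite outer boundary, joined by finitely many paths outside [A n]; all
    their points lie in [A n'] once [n'] is large. *)
Lemma sat_eventually n x : (forall y, rtc E x y -> exists m, A m y) -> exists n', forall n'', n' <= n'' -> sat n n'' x.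
Proof.
move=> ev; have [_ _ _ fE _] := gE.
have /finite_seqP[l lE] := stage_set_finite n x.
have [N HN] := nbrs_list_all l fE.
pose C z := rtc E x z.
have xl y : rtc (within E (A n)) x y -> y \in l /\ C y.
  move=> xy; split; last by apply: rtc_mono xy => a b [].
  suff -> : y \in l = rtc (within E (A n)) x y :> Prop by [].
  by rewrite lE.
pose T := [seq w <- N | `[< ~ A n w /\ C w >]].
have TP w : w \in T -> ~ A n w /\ C w by rewrite mem_filter => /andP[/asboolP].
have [|||P [PC HP]] := @path_supports X (fun _ _ => True) (within E (fun z => ~ A n z)) C T.
- by move=> a b Ca [ab _]; apply: rtc_trans Ca (rtc_step _).
- by move=> w /TP[].
- move=> w w' /TP[nw Cw] /TP[nw' Cw'] _; apply: stage_set_conn => //.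
  exact: rtc_trans (rtc_sym sE Cw) Cw'.
have /choice[m Hm] : forall z, exists m, C z -> A m z.
  by move=> z; have [Cz|nC] := pselect (C z); [have [m h] := ev z Cz; exists m|exists 0].
pose n' := \max_(z <- T ++ P) m z.
exists n' => n'' nn y w y' w' xy yw nw xy' yw' nw'.
have Alarge z : z \in T ++ P -> C z -> A n'' z.
  by move=> zl Cz; apply: stage_set_mono (Hm z Cz); apply: leq_trans nn; exact: (leq_bigmax_seq (F := m)).
have inT y0 w0 : rtc (within E (A n)) x y0 -> E y0 w0 -> ~ A n w0 -> w0 \in T.
  move=> /xl[yl Cy] h nA; rewrite mem_filter (HN _ _ yl h) andbT; apply/asboolP; split=> //.
  by apply: rtc_trans Cy (rtc_step _).
have wT := inT _ _ xy yw nw; have w'T := inT _ _ xy' yw' nw'.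
split; first by apply: Alarge; [rewrite mem_cat wT|case: (TP _ wT)].
apply: rtc_mono (HP w w' wT w'T Logic.I) => a b [[ab [na nb]] [aP bP]].
by split=> //; split; split=> //; apply: Alarge; rewrite ?mem_cat ?aP ?bP ?orbT//; exact: PC.
Qed.

Lemma sat_comp n n' x y : rtc (within E (A n)) x y -> sat n n' x -> sat n n' y.
Proof. by move=> xy H u w u' w' yu uw nw yu' uw' nw'; apply: (H u w u' w') => //; exact: rtc_trans xy _. Qed.

Variable k : nat -> nat.
Hypothesis kS : forall i, k i <= k i.+1.

(** The tiles are the components of [W i]: unsaturated components of [A (k i)] are left out, as
    their outer boundary may not be joined inside [A (k i.+1)]. By hypothesis every point of [X'] is
    in a saturated component at some stage. *)
Theorem staged_orientation (X' : X -> Prop) : BX X' -> (forall x y, E x y -> X' x -> X' y) ->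
  (forall x, X' x -> exists i, A (k i) x /\ sat (k i) (k i.+1) x) ->
  exists O, [/\ BR O, orients (fun x y => E x y /\ (X' x /\ X' y)) O & balanced_rel O].
Proof.
move=> BX' invX cov.
pose W i x := A (k i.+1) x /\ (A (k i) x -> sat (k i) (k i.+1) x).
pose core i x := A (k i) x /\ sat (k i) (k i.+1) x.
pose R i x y := (W i x /\ W i y) /\ rtc (within E (W i)) x y.
have BW i : BX (W i) by apply: BorA; [exact: BX_stage_set|apply: BorI; [exact: BX_stage_set|exact: BX_sat]].
have Bcore i : BX (core i) by apply: BorA; [exact: BX_stage_set|exact: BX_sat].
have coreW i x : core i x -> W i x by move=> [h1 h2]; split=> //; exact: stage_set_mono h1.
have coreE i x y : core i x -> E x y -> R i x y.
  move=> cx Exy; have [Ax sx] := cx.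
  suff Wy : W i y by split; [split=> //; exact: coreW|apply: rtc_step; split=> //; split=> //; exact: coreW].
  have [Ay|nAy] := pselect (A (k i) y).
    by apply: coreW; split=> //; apply: sat_comp sx; apply: rtc_step.
  split=> //; have [h _] := sx x y x y (rtc_refl _ x) Exy nAy (rtc_refl _ x) Exy nAy.
  exact: h.
(* Edges removed before stage [i] lie inside [A (k i)], so paths outside that set survive. *)
pose Inv i (E' : X -> X -> Prop) := [/\ forall x y, E' x y -> E x y,
  forall x y, E x y -> ~ E' x y -> A (k i) x /\ A (k i) y & forall j x, j < i -> core j x -> isolated E' x].
have [||Es [Es0 gEs IEs sEs]] := @tower X _ f Inv _ gE.
- by split=> // x y h; case.
- move=> i E' gE' [E'E unused iso].
  have [||||||||F [eF FR cF]] := @core_stage X c Hc _ f mf E' (R i) (core i) gE'.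
  + apply: BorA; last exact: BR_rtc_within.
    by apply: BorA; [exact: (mfst Hc (BW i))|exact: (msnd Hc (BW i))].
  + by move=> x y [_]; exact: covers_rtc_within.
  + move=> x y [[Wx Wy] xy]; split=> //; apply: rtc_sym xy => a b; exact: within_sym.
  + by move=> x y z [[Wx Wy] xy] [[_ Wz] yz]; split=> //; exact: rtc_trans yz.
  + move=> x; apply: sub_finite_set (stage_set_finite (k i.+1) x) => y [_].
    by apply: rtc_mono => a b [ab [[Aa _] [Ab _]]].
  + exact: Bcore.
  + by move=> x y cx /E'E; exact: coreE.
  + move=> w w' s s' nw nw' [[Ww Ww'] ww'] _ _ _ _.
    have nA z : W i z -> ~ core i z -> ~ A (k i) z by move=> [_ h] nc Az; apply: nc; split=> //; exact: h.
    pose D z := A (k i.+1) z /\ ~ A (k i) z.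
    have DW z : D z -> W i z by move=> [h1 h2]; split.
    have nAw := nA _ Ww nw; have nAw' := nA _ Ww' nw'.
    (* A passage through a saturated component of [A (k i)] is replaced by a path joining points of
       its outer boundary; [q] remembers where the component was entered and [y] is its neighbour
       inside. *)
    have step p : rtc (within E (W i)) w p -> (~ A (k i) p /\ rtc (within E D) w p) \/
        (A (k i) p /\ exists q y, [/\ ~ A (k i) q, rtc (within E D) w q, rtc (within E (A (k i))) p y & E y q]).
      move=> /clos_rt_rtn1_iff; elim=> [|u v [uv [Wu Wv]] _ IH]; first by left; split=> //; exact: rtc_refl.
      have [Av|nAv] := pselect (A (k i) v).
        right; split=> //; case: IH => [[nu wu]|[Au [q [y [nq wq uy yq]]]]].
          by exists u, v; split=> //; [exact: rtc_refl|exact: sE].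
        by exists q, y; split=> //; apply: rtc_trans (rtc_step _) uy; split; [exact: sE|].
      left; split=> //; case: IH => [[nu wu]|[Au [q [y [nq wq uy yq]]]]].
        by apply: rtc_trans wu (rtc_step _); split=> //; split; [case: Wu|case: Wv].
      have [_ su] := Wu; have [_ h] := su Au y q u v uy yq nq (rtc_refl _ u) uv nAv.
      exact: rtc_trans wq h.
    have [[_ wD]|[Aw' _]] := step w' ww'; last by case: nAw'.
    have WD z : rtc (within E D) w z -> rtc (within E (W i)) w z.
      by apply: rtc_mono => a b [ab [Da Db]]; split=> //; split; exact: DW.
    move: wD => /clos_rt_rtn1_iff; elim=> [|u v [uv [Du Dv]] /clos_rt_rtn1_iff wu IH]; first exact: rtc_refl.
    apply: rtc_trans IH (rtc_step _).
    have inR z : D z -> rtc (within E D) w z -> R i w z /\ ~ core i z.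
      by move=> Dz wz; split; [split; [split=> //; exact: DW|exact: WD]|case=> Az _; case: Dz].
    split; last by split; apply: inR => //; apply: rtc_trans wu (rtc_step _).
    by apply: contrapT => nE'; have [Au _] := unused _ _ uv nE'; case: Du.
  exists F; split=> //; split; first by move=> x y [/E'E].
    move=> x y Exy nr; have [E'xy|nE'] := pselect (E' x y).
      have Fxy : F x y by apply: contrapT => nF; exact: nr.
      by have [[[? _] [? _]] _] := FR _ _ Fxy.
    by have [h1 h2] := unused _ _ Exy nE'; split; apply: stage_set_mono (kS i) _.
  move=> j x; rewrite ltnS leq_eqVlt => /predU1P[->|ji] cx y [E'xy nF]; last exact: (iso j x ji cx y).
  by apply: nF; exact: cF.
have [||O HO] := @tower_orientation X c Hc _ f mf Es X' gEs sEs BX'.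
- by rewrite Es0.
- move=> x Xx; apply: (@sub_finite_set _ _ [set x]) => // y /clos_rt_rt1n_iff H; case: H Xx => // u v Huv _ Xx.
  have [i cx] := cov x Xx; have [_ _ h] := IEs i.+1.
  by case: (h i x (ltnSn i) cx u).
by exists O; move: HO; rewrite Es0.
Qed.

End Stages.

(** * Amenable groups: discarding a null set *)

Section Measure.
Variables (R : realType) (X : ptopologicalType) (mu : probability (g_sigma_algebraType (@open X)) R).

Lemma mBX (B : X -> Prop) : BX B -> measurable ([set x | B x] : set (g_sigma_algebraType (@open X))).
Proof. by move/BorP. Qed.

Lemma fin_mu (B : X -> Prop) : BX B -> mu [set x | B x] \is a fin_num.
Proof.
move=> BB; rewrite ge0_fin_numE; last exact: measure_ge0.
by apply: (le_lt_trans (probability_le1 mu (mBX BB))); rewrite ltry.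
Qed.

Lemma content_pullback (g : X -> X) : mX g -> content (fun B => fine (mu [set x | B (g x)])).
Proof.
move=> mg; split.
- by move=> B BB; exact/fine_ge0/measure_ge0.
- move=> B C BB BC dBC; rewrite -fineD; try exact: (fin_mu (mg _ _)).
  rewrite -measureU; [|exact: (mBX (mg _ BB))|exact: (mBX (mg _ BC))|]; first by congr (fine (mu _)).
  by apply/seteqP; split=> // x [/= Bx Cx]; exact: dBC Bx Cx.
- move=> B BB dec none eps eps0.
  have := @nonincreasing_cvg_mu _ _ _ mu (fun n => [set x | B n (g x)]).
  have cap0 : \bigcap_n [set x | B n (g x)] = set0.
    by apply/seteqP; split=> // x H; have [n nB] := none (g x); exact/nB/H.
  rewrite cap0 measure0 => /(_ _ _ _ _) H.
  have {}H : mu \o (fun n => [set x | B n (g x)]) @ \oo --> 0%E.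
    apply: H => //.
    - by rewrite -ge0_fin_numE ?measure_ge0//; exact: (fin_mu (mg _ (BB 0))).
    - by move=> n; exact: (mBX (mg _ (BB n))).
    apply/nonincreasing_seqP => n; apply/subsetPset => x; exact: dec.
  have /fine_cvgP[_ /cvgrPdist_lt /(_ _ eps0)[N _ HN]] := H.
  exists N; have := HN N (leqnn N); rewrite sub0r normrN => h.
  exact: le_lt_trans (ler_norm _) h.
Qed.

Lemma content_sum_of (m : nat -> (X -> Prop) -> R) n : (forall j, content (m j)) ->
  content (fun B => \sum_(j < n) m j B)%R.
Proof.
move=> Hm; elim: n => [|n IH].
  split=> [B BB|B C BB BC _|B BB _ _ eps eps0]; rewrite ?big_ord0 ?addr0//.
  by exists 0; rewrite big_ord0.
have [pos add ct] := IH; have [pos' add' ct'] := Hm n; split.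
- by move=> B BB; rewrite big_ord_recr addr_ge0//; [exact: pos|exact: pos'].
- by move=> B C BB BC dBC; rewrite !big_ord_recr /= add// add'// addrACA.
move=> B BB dec none eps eps0; have e20 : (0 < eps / 2)%R by rewrite divr_gt0.
have [p Hp] := ct B BB dec none _ e20; have [q Hq] := ct' B BB dec none _ e20.
have mono i j x : i <= j -> B j x -> B i x.
  by move=> /subnK <-; elim: (j - i) => // d IHd; rewrite addSn => /dec.
exists (maxn p q); rewrite big_ord_recr /= [ltRHS]splitr.
apply: ltrD; [apply: le_lt_trans Hp|apply: le_lt_trans Hq].
  by apply: (content_le IH) => // x; apply: mono; exact: leq_maxl.
by apply: (content_le (Hm n)) => // x; apply: mono; exact: leq_maxr.
Qed.

Lemma borel_cantelli (B : nat -> X -> Prop) n0 : (forall n, BX (B n)) ->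
  (forall n, n0 <= n -> (fine (mu [set x | B n x]) < 1 / (2 ^ n.+1)%:R)%R) ->
  mu.-negligible [set x | forall n, exists m, n <= m /\ B m x].
Proof.
move=> BB small; pose F n : set (g_sigma_algebraType (@open X)) := [set x | n0 <= n /\ B n x].
have BF n : BX (fun x => n0 <= n /\ B n x) by apply: BorAc.
have FE : [set x | forall n, exists m, n <= m /\ B m x] = lim_sup_set F.
  apply/seteqP; split=> x /=.
    move=> H n _; have [m [nm Bm]] := H (maxn n n0); exists m => /=.
      by apply: leq_trans nm; exact: leq_maxl.
    by split=> //; apply: leq_trans nm; exact: leq_maxr.
  by move=> H n; have [m /= nm [_ Bm]] := H n Logic.I; exists m.
have mF n : measurable (F n) by exact: (mBX (BF n)).
rewrite FE; apply/negligibleP; last apply: lim_sup_set_cvg0 => //.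
  by apply: bigcap_measurable => // n _; exact: bigcup_measurable.
apply: (le_lt_trans (y := 1%:E)); last by rewrite ltry.
apply: le_trans (@epsilon_trick0 R 1 xpredT ler01).
apply: lee_nneseries => n; first by move=> _ _; exact: measure_ge0.
move=> _; suff : ((fine (mu (F n)))%:E <= (1 / (2 ^ n.+1)%:R)%:E)%E by rewrite fineK; [exact|exact: (fin_mu (BF n))].
rewrite lee_fin; have [nn|nn] := leqP n0 n.
  apply: le_trans (ltW (small n nn)); rewrite le_eqVlt; apply/orP; left; apply/eqP.
  by congr (fine (mu _)); apply/seteqP; split=> // x [].
have -> : F n = set0 by apply/seteqP; split=> // x []; rewrite leqNgt nn.
by rewrite measure0 divr_ge0.
Qed.

Variables (c : X -> nat -> nat) (f : seq nat -> X -> X).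
Hypotheses (Hc : std c) (mf : moves f).

(* Sets that are summably small for these growing sums of translates of [mu] are
   eventually avoided along almost every orbit. *)
Definition translates n (B : X -> Prop) : R :=
  (\sum_(j < n) fine (mu [set x | B (f (odflt [::] (unpickle j)) x)]))%R.

Lemma content_translates n : content (translates n).
Proof.
apply: (@content_sum_of (fun j B => fine (mu [set x | B (f (odflt [::] (unpickle j)) x)]))) => j.
by apply: content_pullback; case: mf.
Qed.

Definition avoided (D : nat -> X -> Prop) x := forall w, exists n, forall m, n <= m -> ~ D m (f w x).

Lemma BX_avoided D : (forall n, BX (D n)) -> BX (avoided D).
Proof.
move=> BD; have [mfi _ _] := mf; apply: BorAll => w; apply: BorEx => n; apply: BorAll => m.
by apply: BorIc => _; apply: BorN; exact: (mfi _ _ (BD m)).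
Qed.

Lemma avoided_move D w x : avoided D x -> avoided D (f w x).
Proof.
have [_ _ fc] := mf => H w'; have [k fk] := fc w' w; have [n Hn] := H k.
by exists n => m; rewrite -fk; exact: Hn.
Qed.

Lemma avoided_conull D : (forall n, BX (D n)) ->
  (forall n, (translates n (D n) < 1 / (2 ^ n.+1)%:R)%R) -> mu.-negligible [set x | ~ avoided D x].
Proof.
move=> BD small; have [mfi _ _] := mf.
pose F j := f (odflt [::] (unpickle j)).
apply: (@negligibleS _ _ _ mu (\bigcup_j [set x | forall n, exists m, n <= m /\ D m (F j x)])).
  move=> x /existsNP[w Hw]; exists (pickle w) => // n.
  have /existsNP[m /not_implyP[nm /contrapT Dm]] : ~ forall m, n <= m -> ~ D m (f w x) by move=> h; apply: Hw; exists n.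
  by exists m; rewrite /F pickleK.
apply: negligible_bigcup => j; apply: (@borel_cantelli _ j.+1).
  by move=> n; exact: (mfi _ _ (BD n)).
move=> n jn; apply: le_lt_trans (small n).
rewrite /translates (bigD1 (Ordinal jn))//= lerDl sumr_ge0// => i _.
exact/fine_ge0/measure_ge0.
Qed.

End Measure.

Theorem amenable_orientation (R : realType) (X : ptopologicalType) (polishX : polish R X)
    (mu : probability (g_sigma_algebraType (@open X)) R)
    (G : groupType) (S : set G) (a : G -> X -> X) :
  finite_set S -> generates S -> amenable R G -> superlinear_growth S ->
  is_action a -> free_action a -> borel_action a -> even_degrees (schreier_graph a S) ->
  exists X' : set X, [/\ graph_invariant (schreier_graph a S) X', borel X', mu (~` X') = 0%E
    & admits_borel_balanced_orientation (induced_graph (schreier_graph a S) X')].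
Proof.
move=> fS gS amen sup act free bor eE; have [c Hc] := polish_code polishX.
have [f [mf fa af]] := act_moves fS gS act bor.
pose E x y := schreier_graph a S (x, y).
have gE : egraph f E by exact: (schreier_egraph Hc fS gS act free bor fa eE).
have [mfi [w0 fw0] fc] := mf.
have cE : covers f E by case: gE => -[].
have oex x (F : seq X) : x \in F -> exists u v, [/\ u \in F, v \notin F & E u v].
  exact: (orbit_exit fS gS sup act free).
have cont n := content_translates mu mf n.
have /choice[Y HY] : forall n, exists Y, wall_set E Y /\ (translates mu f n Y < 1 / (2 ^ n.+1)%:R)%R.
  move=> n; have e0 : (0 < 1 / (2 ^ n.+1)%:R :> R)%R by rewrite divr_gt0// ltr0n expn_gt0.
  by have [Y [BY sY fY cY]] := small_wall Hc fS gS amen sup act free bor (cont n) e0; exists Y.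
have wY n : wall_set E (Y n) by case: (HY n).
pose X1 := avoided f Y.
have BX1 : BX X1 by apply: BX_avoided => // n; case: (wY n).
have X1E x y : rtc E x y -> X1 x -> X1 y.
  by move=> /(covers_rtc mf cE)[w <-]; exact: avoided_move.
have X1A x : X1 x -> exists m, stage_set Y m x.
  by move=> /(_ w0)[m]; rewrite fw0; exists m.
have Bsat n n' : BX (sat E Y n n') by exact: (BX_sat Hc mf gE).
(* For fixed [n] these sets decrease to the empty set as [n'] grows, by [sat_eventually]. So [nxt]
   can space the sequence [k] widely enough for the failures of saturation to be summably small. *)
pose bad n n' x := X1 x /\ exists m, n' <= m /\ ~ sat E Y n m x.
have Bbad n n' : BX (bad n n').
  by apply: BorA => //; apply: BorEx => m; apply: BorAc => _; apply: BorN.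
have /choice[nxt Hnxt] : forall p : nat * nat, exists d,
    (translates mu f p.1 (bad p.2 (p.2.+1 + d)) < 1 / (2 ^ p.1.+1)%:R)%R.
  move=> p; have [_ _ ct] := cont p.1; apply: ct.
  - by move=> d; exact: Bbad.
  - by move=> d x [Xx [m [dm ns]]]; split=> //; exists m; split=> //; apply: leq_trans dm; rewrite leq_add2l.
  - move=> x; have [Xx|nX] := pselect (X1 x); last by exists 0 => -[].
    have [n' Hn'] : exists n', forall n'', n' <= n'' -> sat E Y p.2 n'' x.
      by apply: (sat_eventually gE oex wY) => y xy; apply: X1A; exact: X1E xy Xx.
    by exists n' => -[_ [m [nm]]]; apply; apply: Hn'; apply: leq_trans nm; exact: leq_addl.
  - by rewrite divr_gt0// ltr0n expn_gt0.
pose k := fix k i := if i is j.+1 then (k j).+1 + nxt (j, k j) else 0.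
have kS i : k i < k i.+1 by rewrite /= leq_addr.
have ki i : i <= k i by elim: i => // i IH; exact: leq_ltn_trans IH (kS i).
pose Q i x := X1 x /\ ~ sat E Y (k i) (k i.+1) x.
have BQ i : BX (Q i) by apply: BorA => //; apply: BorN.
pose X2 x := X1 x /\ avoided f Q x.
have BX2 : BX X2 by apply: BorA => //; exact: BX_avoided.
have X2E x y : E x y -> X2 x -> X2 y.
  move=> xy [X1x Qx]; split; first exact: X1E (rtc_step xy) X1x.
  by have [w <-] := cE _ _ xy; exact: avoided_move.
have [|||O [BO oO bO]] := @staged_orientation X c Hc _ f E mf gE Y wY k _ X2 BX2.
- by move=> i; exact: ltnW.
- by [].
- move=> x [X1x Qx]; have [m Am] := X1A x X1x; have [i0 Hi0] := Qx w0.
  exists (maxn m i0); split.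
    by apply: stage_set_mono Am; apply: leq_trans (ki _); exact: leq_maxl.
  apply: contrapT => ns; apply: (Hi0 (maxn m i0)); rewrite ?leq_maxr// fw0.
  by split.
exists X2; split.
- exists X2; apply/seteqP; split=> [x Xx|y [x Xx]]; first by exists x => //; exact: rtc_refl.
  by apply: (rtc_closed (C := X2)) Xx => u v Cu Euv; exact: X2E Euv Cu.
- exact/borelP.
- apply/negligibleP; first exact: (mBX (BorN BX2)).
  apply: (@negligibleS _ _ _ mu ([set x | ~ X1 x] `|` [set x | ~ avoided f Q x])).
    by move=> x nX; apply: contrapT => /not_orP[/contrapT h1 /contrapT h2]; exact: nX.
  apply: negligibleU; apply: avoided_conull => //.
  + by move=> n; case: (wY n).
  + by move=> n; case: (HY n).
  move=> i; apply: le_lt_trans (Hnxt (i, k i)); apply: (content_le (cont i)) => // x [X1x ns].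
  by split=> //; exists (k i.+1).
by apply: orientation_of_rel BO oO bO => x y; split.
Qed.

Unset Implicit Arguments.
Local Open Scope ring_scope.

Theorem theorem1p3 (R : realType) (X : ptopologicalType) (polishX : polish R X)
    (mu : probability (g_sigma_algebraType (@open X)) R) :
  [/\ (* (a) *)
      forall E : set (X * X),
        borel_graph E -> even_degrees E -> admits_connected_toast E ->
        admits_borel_balanced_orientation E,
      (* (b) *)
      forall E : set (X * X),
        borel_graph E -> one_ended E -> even_degrees E ->
        exists X' : set X,
          [/\ graph_invariant E X', comeagre X', borel X'
            & admits_borel_balanced_orientation (induced_graph E X')],
      (* (c) *)
      forall (Gam : groupType) (S : set Gam) (a : Gam -> X -> X),
        finite_set S -> generates S ->
        amenable R Gam -> superlinear_growth S ->
        is_action a -> free_action a -> borel_action a ->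
        even_degrees (schreier_graph a S) ->
        exists X' : set X,
          [/\ graph_invariant (schreier_graph a S) X',
              borel X', mu (~` X') = 0%E
            & admits_borel_balanced_orientation
                (induced_graph (schreier_graph a S) X')]
    & (* (d) *)
      forall (Gam : groupType) (S : set Gam) (a : Gam -> X -> X),
        finite_set S -> generates S ->
        polynomial_growth S -> superlinear_growth S ->
        is_action a -> free_action a -> borel_action a ->
        even_degrees (schreier_graph a S) ->
        admits_borel_balanced_orientation (schreier_graph a S)].
Proof.
have [c Hc] := polish_code polishX.
split.
- by move=> E bE eE [T cT]; exact: (toast_orientation Hc bE eE cT).
- by move=> E; exact: (one_ended_orientation polishX).
- by move=> G S a; exact: (amenable_orientation polishX mu).
- by move=> G S a; exact: (polynomial_orientation polishX).
Qed.
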